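(* Let $\lambda\in\mathfrak{h}_{so(7,\mathbb{C})}^*$ satisfy $\lambda(H_{\varepsilon_2-\varepsilon_3})\in\mathbb{N}$. For $\delta\in\mathfrak{h}_{\mathfrak{g}_2}^*$ put $\sigma=\lambda|_{\mathfrak{h}_{\mathfrak{g}_2}}+\delta$, $\mu=\lambda|_{\mathfrak{h}_{\mathfrak{g}_2}}-\delta$ and $A=\min\{\mu(H_{2\alpha_1+\alpha_2}),\sigma(H_{\alpha_2})\}$. Then, in the Grothendieck group of $\mathcal{O}^{\mathfrak{p}_{\{\alpha_2\}}}$, $$M_{\mathfrak{p}_{\{\varepsilon_2-\varepsilon_3\}}}^{so(7,\mathbb{C})}(\lambda)\big|_{\mathfrak{g}_2}=\bigoplus_{\substack{\delta\in\mathfrak{h}_{\mathfrak{g}_2}^*\\ \delta(H_{\alpha_2})\in\mathbb{N}\\ \mu(H_{3\alpha_1+\alpha_2})\in\mathbb{N}\\ \mu(H_{3\alpha_1+2\alpha_2})\in\mathbb{N}}}\Bigl(1+\frac{A-|\mu(H_{\alpha_2})|}{2}\Bigr)\,M_{\mathfrak{p}_{\{\alpha_2\}}}^{\mathfrak{g}_2}(\delta).$$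
   Context: $\mathbb{N}$ denotes the nonnegative integers. $\mathcal{O}^{\mathfrak{p}_{\{\alpha_2\}}}$ is the parabolic BGG category of $\mathfrak{g}_2$ attached to $\mathfrak{p}_{\{\alpha_2\}}$. The restricted module is a union of $\mathfrak{g}_2$-submodules lying in this category; the identity in the Grothendieck group is between formal (possibly infinite) sums, i.e. every simple object has the same, finite, composition multiplicity on both sides. Setting for $so(7,\mathbb{C})$: it is realized as the Lie algebra of $7\times7$ complex matrices skew-adjoint relative to the quadratic form $2(z_1z_4+z_2z_5+z_3z_6)+z_7^2$. Its Cartan subalgebra $\mathfrak{h}_{so(7,\mathbb{C})}$ has basis $H_i=E_{ii}-E_{i+3,i+3}$ ($i=1,2,3$), with dual basis $\varepsilon_1,\varepsilon_2,\varepsilon_3$. Roots: $\pm\varepsilon_i\pm\varepsilon_j$ ($i<j$) and $\pm\varepsilon_k$; simple roots: $\varepsilon_1-\varepsilon_2,\varepsilon_2-\varepsilon_3,\varepsilon_3$. Coroots: $H_{\varepsilon_i\pm\varepsilon_j}=H_i\pm H_j$, $H_{\varepsilon_k}=2H_k$. Embedding of $\mathfrak{g}_2$: $\mathfrak{g}_2\subset so(7,\mathbb{C})$ has Cartan subalgebra $\mathfrak{h}_{\mathfrak{g}_2}\subset\mathfrak{h}_{so(7,\mathbb{C})}$ spanned by $H_{\alpha_1}=H_1-H_2+2H_3$ and $H_{\alpha_2}=H_2-H_3$, and root vectors $X_{\alpha_2}=X_{\varepsilon_2-\varepsilon_3}$, $X_{3\alpha_1+\alpha_2}=-X_{\varepsilon_1+\varepsilon_3}$,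 $X_{3\alpha_1+2\alpha_2}=-X_{\varepsilon_1+\varepsilon_2}$, $X_{\alpha_1}=X_{\varepsilon_3}+X_{\varepsilon_1-\varepsilon_2}$, $X_{\alpha_1+\alpha_2}=X_{\varepsilon_2}-X_{\varepsilon_1-\varepsilon_3}$, $X_{2\alpha_1+\alpha_2}=-X_{\varepsilon_1}-X_{\varepsilon_2+\varepsilon_3}$, $X_{-\alpha_2}=X_{\varepsilon_3-\varepsilon_2}$, $X_{-3\alpha_1-\alpha_2}=X_{-\varepsilon_1-\varepsilon_3}$, $X_{-3\alpha_1-2\alpha_2}=X_{-\varepsilon_1-\varepsilon_2}$, $X_{-\alpha_1}=X_{-\varepsilon_3}+X_{\varepsilon_2-\varepsilon_1}$, $X_{-\alpha_1-\alpha_2}=X_{-\varepsilon_2}-X_{\varepsilon_3-\varepsilon_1}$, $X_{-2\alpha_1-\alpha_2}=-X_{-\varepsilon_1}-X_{-\varepsilon_2-\varepsilon_3}$, where $X_\gamma$ denotes a nonzero root vector of $so(7,\mathbb{C})$ for $\gamma$, normalized (as in the Levasseur–Smith Chevalley basis) so that these elements and $\mathfrak{h}_{\mathfrak{g}_2}$ span a Lie subalgebra isomorphic to $\mathfrak{g}_2$. The simple roots of $\mathfrak{g}_2$ are $\alpha_1=(\varepsilon_1-\varepsilon_2)|_{\mathfrak{h}_{\mathfrak{g}_2}}=\varepsilon_3|_{\mathfrak{h}_{\mathfrak{g}_2}}$ (short) and $\alpha_2=(\varepsilon_2-\varepsilon_3)|_{\mathfrak{h}_{\mathfrak{g}_2}}$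 (long). For a root $\beta$ of $\mathfrak{g}_2$, $H_\beta$ is its coroot; thus $H_{3\alpha_1+\alpha_2}=H_1+H_3$, $H_{3\alpha_1+2\alpha_2}=H_1+H_2$, $H_{2\alpha_1+\alpha_2}=2H_1+H_2+H_3$. For a set $\Pi$ of simple roots of $\mathfrak{g}$, the standard parabolic subalgebra is $\mathfrak{p}_\Pi=\mathfrak{h}_{\mathfrak{g}}+\sum_{\alpha\in\Phi^+(\mathfrak{g})}\mathfrak{g}_\alpha+\sum_{\alpha\in\mathbb{N}\Pi\cap\Phi^+(\mathfrak{g})}\mathfrak{g}_{-\alpha}=\mathfrak{l}+\mathfrak{u}_+$ (Levi factor containing $\mathfrak{h}_\mathfrak{g}$ plus nilradical). For $\lambda\in\mathfrak{h}_\mathfrak{g}^*$ with $\lambda(H_\alpha)\in\mathbb{N}$ for all $\alpha\in\Pi$, let $F_\lambda$ be the finite-dimensional simple $\mathfrak{l}$-module of highest weight $\lambda$, with $\mathfrak{u}_+$ acting by $0$; the generalized Verma module is $M_{\mathfrak{p}_\Pi}^{\mathfrak{g}}(\lambda)=U(\mathfrak{g})\otimes_{U(\mathfrak{p}_\Pi)}F_\lambda$. *)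

(* Defs.v *)
From HB Require Import structures.
From mathcomp Require Import all_boot all_order all_algebra.
From mathcomp Require Import finmap boolp classical_sets reals ereal esum.
From mathcomp Require Import complex ring.
(* The notations of monalg and of the analysis library cannot be parsed together. *)
From mathcomp Require Import -(notations) monalg.

Set Implicit Arguments.
Unset Strict Implicit.
Unset Printing Implicit Defensive.

Import Order.TTheory GRing.Theory Num.Theory.
Local Open Scope classical_set_scope.
Local Open Scope quotient_scope.
Local Open Scope ring_scope.

Section LinearQuotient.
Context (K : fieldType) (V : lmodType K).
Implicit Types (S W : set V).

Definition subspace W :=
  [/\ W 0, forall u v, W u -> W v -> W (u + v) & forall a u, W u -> W (a *: u)].

Definition lspan S : set V :=
  [set v | forall W, subspace W -> S `<=` W -> W v].

Lemma lspan_subspace S : subspace (lspan S).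
Proof.
split=> [W [W0 _ _] _ //|u v Su Sv W Wsub SW|a u Su W Wsub SW].
  by have [_ WD _] := Wsub; apply: WD; [apply: Su | apply: Sv].
by have [_ _ WZ] := Wsub; apply: WZ; apply: Su.
Qed.

Lemma sub_lspan S : S `<=` lspan S.
Proof. by move=> v Sv W _; apply. Qed.

Lemma lspanN S v : lspan S v -> lspan S (- v).
Proof. by rewrite -scaleN1r; have [_ _] := lspan_subspace S; apply. Qed.

Variable S : set V.

Definition lquot_rel : rel V := fun u v => `[< lspan S (u - v) >].

Lemma lquot_rel_equiv : equiv_class_of lquot_rel.
Proof.
have [S0 SD SZ] := lspan_subspace S.
split=> [u|u v|v u w]; rewrite /lquot_rel.
- by rewrite subrr; apply/asboolP.
- by apply/asbool_equiv_eq; split=> /lspanN; rewrite opprB.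
- by move=> /asboolP uv /asboolP vw; apply/asboolP; rewrite -(subrKA v); apply: SD.
Qed.

Canonical lquot_equiv := EquivRelPack lquot_rel_equiv.

(* The quotient of V by the linear span of S *)
Definition lquot := {eq_quot lquot_equiv}.

HB.instance Definition _ := Choice.on lquot.
HB.instance Definition _ := EqQuotient.on lquot.

Definition lproj (v : V) : lquot := \pi_lquot v.

Lemma lprojP u v : lproj u = lproj v <-> lspan S (u - v).
Proof.
split=> [/eqquotP /asboolP //|uv]; by apply/eqquotP/asboolP.
Qed.

Lemma lproj_repr q : lproj (repr q) = q.
Proof. exact: reprK. Qed.

Lemma lquotP (P : lquot -> Prop) : (forall v, P (lproj v)) -> forall q, P q.
Proof. by move=> h q; rewrite -(lproj_repr q). Qed.

Lemma lreprP v : lspan S (repr (lproj v) - v).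
Proof. by apply/lprojP; rewrite lproj_repr. Qed.

Definition lquot_add := locked (fun p q : lquot => lproj (repr p + repr q)).
Definition lquot_opp := locked (fun p : lquot => lproj (- repr p)).
Definition lquot_scale :=
  locked (fun (a : K) (p : lquot) => lproj (a *: repr p)).

Lemma lquot_addE u v : lquot_add (lproj u) (lproj v) = lproj (u + v).
Proof.
rewrite /lquot_add -lock; apply/lprojP; rewrite opprD addrACA.
have [_ SD _] := lspan_subspace S; apply: SD; exact: lreprP.
Qed.

Lemma lquot_oppE u : lquot_opp (lproj u) = lproj (- u).
Proof.
rewrite /lquot_opp -lock; apply/lprojP; rewrite -opprD; apply: lspanN; exact: lreprP.
Qed.

Lemma lquot_scaleE a u : lquot_scale a (lproj u) = lproj (a *: u).
Proof.
rewrite /lquot_scale -lock; apply/lprojP; rewrite -scalerBr.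
have [_ _ SZ] := lspan_subspace S; apply: SZ; exact: lreprP.
Qed.

Fact lquot_addA : associative lquot_add.
Proof.
by elim/lquotP=> u; elim/lquotP=> v; elim/lquotP=> w; rewrite !lquot_addE addrA.
Qed.
Fact lquot_addC : commutative lquot_add.
Proof. by elim/lquotP=> u; elim/lquotP=> v; rewrite !lquot_addE addrC. Qed.
Fact lquot_add0 : left_id (lproj 0) lquot_add.
Proof. by elim/lquotP=> u; rewrite !lquot_addE add0r. Qed.
Fact lquot_addN : left_inverse (lproj 0) lquot_opp lquot_add.
Proof. by elim/lquotP=> u; rewrite lquot_oppE lquot_addE addNr. Qed.

HB.instance Definition _ :=
  GRing.isZmodule.Build lquot lquot_addA lquot_addC lquot_add0 lquot_addN.

Lemma lprojD u v : lproj (u + v) = lproj u + lproj v.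
Proof. by rewrite -lquot_addE. Qed.

Fact lquot_scaleA a b p : lquot_scale a (lquot_scale b p) = lquot_scale (a * b) p.
Proof. by elim/lquotP: p => u; rewrite !lquot_scaleE scalerA. Qed.
Fact lquot_scale1 : left_id 1 lquot_scale.
Proof. by elim/lquotP=> u; rewrite lquot_scaleE scale1r. Qed.
Fact lquot_scaleDr : right_distributive lquot_scale +%R.
Proof.
move=> a; elim/lquotP=> u; elim/lquotP=> v.
by rewrite -lprojD !lquot_scaleE scalerDr lprojD.
Qed.
Fact lquot_scaleDl p : {morph lquot_scale^~ p : a b / a + b}.
Proof.
by elim/lquotP: p => u a b; rewrite !lquot_scaleE scalerDl lprojD.
Qed.

HB.instance Definition _ := GRing.Zmodule_isLmodule.Build K lquot
  lquot_scaleA lquot_scale1 lquot_scaleDr lquot_scaleDl.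

Fact lproj_linear : linear lproj.
Proof. by move=> a u v; rewrite lprojD -lquot_scaleE. Qed.

HB.instance Definition _ := GRing.isLinear.Build K V lquot *:%R lproj lproj_linear.

Lemma lprojZ a u : lproj (a *: u) = a *: lproj u.
Proof. exact: linearZ. Qed.

End LinearQuotient.
Arguments lproj {K V} S v.


Section AlgebraQuotient.
Context (K : fieldType) (A : algType K) (rel : set A).

Definition ideal_gens : set A :=
  [set t | exists a r b, rel r /\ t = a * r * b].

(* The quotient of A by the two-sided ideal generated by rel. It is not given an
   algType structure, because the library asks algebras to satisfy 1 != 0. *)
Definition algquot := lquot ideal_gens.
HB.instance Definition _ := GRing.Lmodule.on algquot.

Local Notation I := (lspan ideal_gens).

Lemma ideal_mull t u : I u -> I (t * u).
Proof.
have [S0 SD SZ] := lspan_subspace ideal_gens.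
move=> Iu; apply: (Iu [set u | I (t * u)]).
  split=> [|v w|c v] /=; first by rewrite mulr0.
    by rewrite mulrDr; apply: SD.
  by rewrite -scalerAr; apply: SZ.
move=> _ [a [r [b [rr ->]]]]; apply: sub_lspan.
by exists (t * a), r, b; rewrite !mulrA.
Qed.

Lemma ideal_mulr t u : I u -> I (u * t).
Proof.
have [S0 SD SZ] := lspan_subspace ideal_gens.
move=> Iu; apply: (Iu [set u | I (u * t)]).
  split=> [|v w|c v] /=; first by rewrite mul0r.
    by rewrite mulrDl; apply: SD.
  by rewrite -scalerAl; apply: SZ.
move=> _ [a [r [b [rr ->]]]]; apply: sub_lspan.
by exists a, r, (b * t); rewrite !mulrA.
Qed.

Definition aproj (t : A) : algquot := lproj ideal_gens t.

Fact aproj_linear : linear aproj.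
Proof. exact: lproj_linear. Qed.
HB.instance Definition _ :=
  GRing.isLinear.Build K A algquot *:%R aproj aproj_linear.

Lemma aprojD u v : aproj (u + v) = aproj u + aproj v.
Proof. exact: linearD. Qed.

Lemma aprojB u v : aproj (u - v) = aproj u - aproj v.
Proof. exact: linearB. Qed.

Lemma aprojZ a u : aproj (a *: u) = a *: aproj u.
Proof. exact: linearZ. Qed.

Lemma algquotP (P : algquot -> Prop) : (forall t, P (aproj t)) -> forall u, P u.
Proof. exact: lquotP. Qed.

Definition algquot_mul :=
  locked (fun p q : algquot => aproj (repr p * repr q)).

Lemma algquot_mulE u v : algquot_mul (aproj u) (aproj v) = aproj (u * v).
Proof.
rewrite /algquot_mul -lock; apply/lprojP; set u' := repr _; set v' := repr _.
have [_ SD _] := lspan_subspace ideal_gens.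
have -> : u' * v' - u * v = u' * (v' - v) + (u' - u) * v.
  by rewrite mulrBr mulrBl addrA subrK.
by apply: SD; [apply: ideal_mull | apply: ideal_mulr]; apply: lreprP.
Qed.

Fact algquot_mulA : associative algquot_mul.
Proof.
elim/algquotP=> u; elim/algquotP=> v; elim/algquotP=> w.
by rewrite !algquot_mulE mulrA.
Qed.
Fact algquot_mul1l : left_id (aproj 1) algquot_mul.
Proof. by elim/algquotP=> u; rewrite algquot_mulE mul1r. Qed.
Fact algquot_mul1r : right_id (aproj 1) algquot_mul.
Proof. by elim/algquotP=> u; rewrite algquot_mulE mulr1. Qed.
Fact algquot_mulDl : left_distributive algquot_mul +%R.
Proof.
elim/algquotP=> u; elim/algquotP=> v; elim/algquotP=> w.
by rewrite -aprojD !algquot_mulE mulrDl aprojD.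
Qed.
Fact algquot_mulDr : right_distributive algquot_mul +%R.
Proof.
elim/algquotP=> u; elim/algquotP=> v; elim/algquotP=> w.
by rewrite -aprojD !algquot_mulE mulrDr aprojD.
Qed.

HB.instance Definition _ := GRing.Zmodule_isPzRing.Build algquot
  algquot_mulA algquot_mul1l algquot_mul1r algquot_mulDl algquot_mulDr.

Lemma aprojM u v : aproj (u * v) = aproj u * aproj v.
Proof. by rewrite -algquot_mulE. Qed.

Lemma algquot_scaleAl a (u v : algquot) : a *: (u * v) = (a *: u) * v.
Proof.
elim/algquotP: u => u; elim/algquotP: v => v.
by rewrite -aprojM -!aprojZ -aprojM scalerAl.
Qed.

Lemma algquot_scaleAr a (u v : algquot) : a *: (u * v) = u * (a *: v).
Proof.
elim/algquotP: u => u; elim/algquotP: v => v.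
by rewrite -aprojM -!aprojZ -aprojM scalerAr.
Qed.

Lemma aproj_rel r : rel r -> aproj r = 0.
Proof.
move=> rr; rewrite -[RHS](linear0 aproj); apply/lprojP; rewrite subr0.
by apply: sub_lspan; exists 1, r, 1; rewrite mul1r mulr1.
Qed.

End AlgebraQuotient.
Arguments aproj {K A} rel t.

Section FreeAlgebra.
Context (K : fieldType) (T : choiceType).

(* The free associative K-algebra on T *)
Definition free_alg := malg (fmonom T) K.
HB.instance Definition _ := GRing.Lalgebra.on free_alg.

Fact free_scaleAr a (u v : free_alg) : a *: (u * v) = u * (a *: v).
Proof.
apply/malgP=> k; rewrite mcoeffZ.
rewrite [RHS](mcoeffMlw k (fsubset_refl (msupp u)) (msuppZ_le a v)).
rewrite mcoeffMl mulr_sumr; apply: eq_bigr => i _.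
rewrite mulr_sumr; apply: eq_bigr => j _.
by rewrite mcoeffZ mulrnAr mulrCA.
Qed.

HB.instance Definition _ := GRing.Lalgebra_isAlgebra.Build K free_alg free_scaleAr.

Definition free_gen (x : T) : free_alg := mkmalgU (fmu x) 1.

End FreeAlgebra.

Section EnvelopingAlgebra.
Context (K : fieldType) (n : nat).
Implicit Types (g : {vspace 'M[K]_n}) (x y : 'M[K]_n).

Definition lie x y : 'M[K]_n := x *m y - y *m x.

Definition is_liealg g : Prop := forall x y, x \in g -> y \in g -> lie x y \in g.

Variable g : {vspace 'M[K]_n}.

Local Notation gen x := (@free_gen K (subvs_of g) x).

Definition uea_rel : set (free_alg K (subvs_of g)) :=
  [set r | (exists a (x y : subvs_of g),
              r = gen (a *: x + y) - (a *: gen x + gen y)) \/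
           (exists x y : subvs_of g,
              r = gen x * gen y - gen y * gen x
                  - gen (vsproj g (lie (vsval x) (vsval y))))].

(* The universal enveloping algebra of the Lie algebra g *)
Definition uea := algquot uea_rel.
HB.instance Definition _ := GRing.Lmodule.on uea.
HB.instance Definition _ := GRing.PzRing.on uea.

(* The canonical map g -> U(g), with meaningless values outside g *)
Definition uea_in x : uea := aproj uea_rel (gen (vsproj g x)).

Lemma uea_in_linear a x y : uea_in (a *: x + y) = a *: uea_in x + uea_in y.
Proof.
rewrite /uea_in linearP -aproj_linear; apply/eqP.
rewrite -subr_eq0 -aprojB; apply/eqP/aproj_rel.
by left; exists a, (vsproj g x), (vsproj g y).
Qed.

Lemma uea_in_lie x y : x \in g -> y \in g ->
  uea_in (lie x y) = uea_in x * uea_in y - uea_in y * uea_in x.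
Proof.
move=> gx gy; apply/esym/eqP; rewrite -subr_eq0 /uea_in.
rewrite -!aprojM -!aprojB; apply/eqP/aproj_rel; right.
exists (vsproj g x), (vsproj g y).
by rewrite (vsprojK gx) (vsprojK gy).
Qed.

End EnvelopingAlgebra.

Section Modules.
Context (K : fieldType) (n : nat).
Implicit Types (g p : {vspace 'M[K]_n}) (x y : 'M[K]_n).

(* A representation of g is a function on all matrices constrained on g only;
   restricting it to a smaller Lie algebra leaves the function unchanged. *)
Definition is_rep g (V : lmodType K) (act : 'M[K]_n -> V -> V) : Prop :=
  [/\ forall x a u v, x \in g -> act x (a *: u + v) = a *: act x u + act x v,
      forall a x y v, x \in g -> y \in g ->
        act (a *: x + y) v = a *: act x v + act y v
    & forall x y v, x \in g -> y \in g ->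
        act (lie x y) v = act x (act y v) - act y (act x v)].

Definition submod g (V : lmodType K) (act : 'M[K]_n -> V -> V) (N : set V) :=
  subspace N /\ forall x v, x \in g -> N v -> N (act x v).

Definition gen_submod g (V : lmodType K) (act : 'M[K]_n -> V -> V)
    (S : set V) : set V :=
  [set v | forall N, submod g act N -> S `<=` N -> N v].

Definition simple_submod g (V : lmodType K) (act : 'M[K]_n -> V -> V)
    (N : set V) : Prop :=
  [/\ submod g act N, N != [set 0] &
      forall N', submod g act N' -> N' `<=` N -> N' = [set 0] \/ N' = N].

Definition fin_dim (V : lmodType K) (W : set V) : Prop :=
  exists s : seq V, W `<=` lspan [set` s].

(* N is the internal direct sum of the family of subspaces T. *)
Definition direct_sum (V : lmodType K) (T : set (set V)) (N : set V) : Prop :=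
  N = lspan (\bigcup_(W in T) W) /\
  forall (m : nat) (W : 'I_m -> set V) (w : 'I_m -> V),
    injective W -> (forall i, T (W i)) -> (forall i, W i (w i)) ->
    \sum_(i < m) w i = 0 -> forall i, w i = 0.

(* The subquotient N' / N of V is isomorphic to L; phi is the composite of
   N' -> N' / N with the isomorphism. *)
Definition factor_iso g (V : lmodType K) (act : 'M[K]_n -> V -> V)
    (N N' : set V) (L : lmodType K) (aL : 'M[K]_n -> L -> L) : Prop :=
  exists phi : V -> L,
    [/\ forall a u v, N' u -> N' v -> phi (a *: u + v) = a *: phi u + phi v,
        forall x v, x \in g -> N' v -> phi (act x v) = aL x (phi v),
        forall w, exists2 v, N' v & phi v = w
      & forall v, N' v -> (phi v = 0 <-> N v)].

Definition filtration g (V : lmodType K) (act : 'M[K]_n -> V -> V)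
    (m : nat) (N : nat -> set V) : Prop :=
  [/\ N 0%N = [set 0], N m = setT, forall i, submod g act (N i)
    & forall i, (i < m)%N -> N i `<=` N i.+1].

(* The composition multiplicity [V : L] for a module V that need not have
   finite length: the supremum, over all finite filtrations of V by submodules,
   of the number of factors isomorphic to L. *)
Definition comp_mult (R : realType) g
    (V : lmodType K) (act : 'M[K]_n -> V -> V)
    (L : lmodType K) (aL : 'M[K]_n -> L -> L) : \bar R :=
  ereal_sup
    [set c | exists (m : nat) (N : nat -> set V), filtration g act m N /\
       c = ((\sum_(i < m) `[< factor_iso g act (N i) (N i.+1) aL >])%N%:R)%:E].

End Modules.

Lemma mkmalgU_scale (K : fieldType) (T : choiceType) (k : T) (c : K) :
  mkmalgU k c = c *: mkmalgU k 1 :> malg T K.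
Proof. by apply/malgP=> k'; rewrite mcoeffZ !mcoeffU mulrnAr mulr1. Qed.

Section InducedModule.
Context (K : fieldType) (n : nat) (g p : {vspace 'M[K]_n}).
Context (F : lmodType K) (aF : 'M[K]_n -> F -> F).

Local Notation U := (uea g).
Local Notation free := (malg (U * F)%type K).

Definition pure := locked (fun (u : U) (v : F) => mkmalgU (u, v) 1 : free).

(* Relations of U(g) (x)_{U(p)} F inside the free space on U(g) x F. Balancing
   over elements of p suffices, as they generate U(p) as an algebra. *)
Definition tensor_rel : set free :=
  [set r | [\/ exists a u u' v, r = pure (a *: u + u') v
                                    - (a *: pure u v + pure u' v),
               exists a u v v', r = pure u (a *: v + v')
                                    - (a *: pure u v + pure u v')
             | exists u x v, x \in p /\
                 r = pure (u * uea_in g x) v - pure u (aF x v)]].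

Definition induced := lquot tensor_rel.
HB.instance Definition _ := GRing.Lmodule.on induced.

Definition tens (u : U) (v : F) : induced := lproj tensor_rel (pure u v).

Definition free_lmul (a : U) (t : free) : free :=
  \sum_(k <- msupp t) mcoeff k t *: pure (a * k.1) k.2.

(* Left multiplication by x on the factor U(g) *)
Definition induced_act (x : 'M[K]_n) (m : induced) : induced :=
  lproj tensor_rel (free_lmul (uea_in g x) (repr m)).

Lemma free_lmulw a (d : {fset U * F}) t : (msupp t `<=` d)%fset ->
  free_lmul a t = \sum_(k <- d) mcoeff k t *: pure (a * k.1) k.2.
Proof.
move=> le; rewrite /free_lmul (big_fset_incl _ le) //= => k _ /mcoeff_outdom ->.
by rewrite scale0r.
Qed.

Lemma free_lmul_linear a : linear (free_lmul a).
Proof.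
move=> c s t; set d := (msupp s `|` msupp t)%fset.
have ds : (msupp s `<=` d)%fset by apply: fsubsetUl.
have dt : (msupp t `<=` d)%fset by apply: fsubsetUr.
have dst : (msupp (c *: s + t) `<=` d)%fset.
  apply: fsubset_trans (msuppD_le _ _) _; apply: fsetSU; exact: msuppZ_le.
rewrite (free_lmulw _ ds) (free_lmulw _ dt) (free_lmulw _ dst).
rewrite scaler_sumr -big_split /=; apply: eq_bigr => k _.
by rewrite mcoeffD mcoeffZ scalerDl scalerA.
Qed.

HB.instance Definition _ a :=
  GRing.isLinear.Build K free free *:%R (free_lmul a) (free_lmul_linear a).

Lemma free_lmul_pure a u v : free_lmul a (pure u v) = pure (a * u) v.
Proof.
by rewrite {1}/pure -lock (free_lmulw _ msuppU_le) big_seq_fset1 mcoeffUU scale1r.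
Qed.

Lemma free_lmulB a s t : free_lmul a (s - t) = free_lmul a s - free_lmul a t.
Proof. exact: linearB. Qed.

Lemma free_lmul_rel a t : lspan tensor_rel t -> lspan tensor_rel (free_lmul a t).
Proof.
have [S0 SD SZ] := lspan_subspace tensor_rel.
move=> It; apply: (It [set t | lspan tensor_rel (free_lmul a t)]).
  split=> [|v w|c v] /=; first by rewrite linear0.
    by rewrite linearD; apply: SD.
  by rewrite linearZ; apply: SZ.
move=> _ [[c [u [u' [v ->]]]]|[c [u [v [v' ->]]]]|[u [x [v [px ->]]]]];
  apply: sub_lspan.
- rewrite free_lmulB free_lmul_linear !free_lmul_pure mulrDr -algquot_scaleAr.
  by apply: Or31; exists c, (a * u), (a * u'), v.
- rewrite free_lmulB free_lmul_linear !free_lmul_pure.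
  by apply: Or32; exists c, (a * u), v, v'.
rewrite free_lmulB !free_lmul_pure mulrA.
by apply: Or33; exists (a * u), x, v.
Qed.

Lemma induced_act_proj x t :
  induced_act x (lproj tensor_rel t) = lproj tensor_rel (free_lmul (uea_in g x) t).
Proof. by apply/lprojP; rewrite -free_lmulB; apply: free_lmul_rel; apply: lreprP. Qed.

Lemma induced_actE x u v : induced_act x (tens u v) = tens (uea_in g x * u) v.
Proof. by rewrite induced_act_proj free_lmul_pure. Qed.

Lemma tens_balanced u x v : x \in p -> tens (u * uea_in g x) v = tens u (aF x v).
Proof. by move=> px; apply/lprojP; apply: sub_lspan; apply: Or33; exists u, x, v. Qed.

Lemma tens_linearl a u u' v : tens (a *: u + u') v = a *: tens u v + tens u' v.
Proof.
by rewrite /tens -lproj_linear; apply/lprojP; apply: sub_lspan; apply: Or31; exists a, u, u', v.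
Qed.

Lemma inducedP (P : induced -> Prop) :
  P 0 -> (forall a u v m, P m -> P (a *: tens u v + m)) -> forall m, P m.
Proof.
move=> P0 PS; elim/lquotP=> t.
have E (k : U * F) (c : K) : mkmalgU k c = c *: pure k.1 k.2 :> free.
  by rewrite mkmalgU_scale /pure -lock; case: k.
rewrite [t]monalgE (raddf_sum (lproj tensor_rel)).
elim/big_rec: _ => [//|k m _ Pm].
by rewrite E /= lprojZ; apply: PS.
Qed.

Lemma induced_rep : is_rep g induced_act.
Proof.
have lin x a u v : induced_act x (a *: u + v) = a *: induced_act x u + induced_act x v.
  elim/lquotP: u => u; elim/lquotP: v => v.
  by rewrite -lproj_linear !induced_act_proj linearP lproj_linear.
have act0 x : induced_act x 0 = 0.
  by have := lin x (- 1) 0 0; rewrite scaler0 addr0 scaleN1r addNr.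
split=> [x a u v _|a x y m _ _|x y m gx gy]; first exact: lin.
  elim/inducedP: m => [|c u v m IHm]; first by rewrite !act0 scaler0 addr0.
  rewrite !lin {}IHm !induced_actE uea_in_linear mulrDl -algquot_scaleAl.
  rewrite tens_linearl !scalerDr !scalerA (mulrC c a).
  by rewrite [RHS]addrACA.
elim/inducedP: m => [|c u v m IHm]; first by rewrite !act0 subr0.
rewrite !lin {}IHm !induced_actE uea_in_lie // mulrBl -!mulrA.
have B w w' : tens (w - w') v = tens w v - tens w' v.
  by rewrite addrC -scaleN1r tens_linearl scaleN1r addrC.
by rewrite B scalerBr opprD addrACA.
Qed.

End InducedModule.

Section RootSpaces.
Context (K : fieldType) (n : nat).
Implicit Types (g h : {vspace 'M[K]_n}).

Definition dual h := 'Hom(subvs_of h, K^o).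

(* lam(H), for H in h *)
Definition ev h (lam : dual h) (H : 'M[K]_n) : K := lam (vsproj h H).

Definition restr_fun h h' (lam : dual h) (H : subvs_of h') : K^o :=
  ev lam (vsval H).

(* The restriction of lam to a subspace h' of h *)
Definition restr h h' (lam : dual h) : dual h' := linfun (restr_fun lam).
Arguments restr {h} h' lam.

Definition ad_minus (H : 'M[K]_n) (a : K) (X : 'M[K]_n) : 'M[K]_n :=
  lie H X - a *: X.

Definition rootspace g h (al : dual h) : {vspace 'M[K]_n} :=
  (g :&: \bigcap_(i < \dim h)
     lker (linfun (ad_minus (vbasis h)`_i (ev al (vbasis h)`_i))))%VS.

Fact ad_minus_linear H a : linear (ad_minus H a).
Proof.
move=> c X Y; rewrite /ad_minus /lie mulmxDr mulmxDl -scalemxAr -scalemxAl.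
rewrite opprD addrACA -scalerBr (scalerDr a) scalerA (mulrC a c) -scalerA.
by rewrite opprD addrACA -scalerBr.
Qed.
HB.instance Definition _ H a :=
  GRing.isLinear.Build K _ _ *:%R (ad_minus H a) (ad_minus_linear H a).

Lemma ev_linear h (lam : dual h) a H H' :
  ev lam (a *: H + H') = a * ev lam H + ev lam H'.
Proof. by rewrite /ev !linearP. Qed.

Fact restr_fun_linear h h' (lam : dual h) : linear (@restr_fun h h' lam).
Proof. by move=> a H H'; rewrite /restr_fun linearP ev_linear. Qed.
HB.instance Definition _ h h' (lam : dual h) :=
  GRing.isLinear.Build K (subvs_of h') K^o *:%R (restr_fun lam)
    (restr_fun_linear lam).

Lemma restrE h h' (lam : dual h) H : H \in h' -> ev (restr h' lam) H = ev lam H.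
Proof. by move=> hH; rewrite {1}/ev lfunE /= /restr_fun vsprojK. Qed.

Lemma rootspaceP g h (al : dual h) (X : 'M[K]_n) :
  reflect (X \in g /\ forall H, H \in h -> lie H X = ev al H *: X)
          (X \in rootspace g al).
Proof.
rewrite /rootspace memv_cap; apply: (iffP andP) => -[gX hX]; split=> //.
  have hb (i : 'I_(\dim h)) :
      lie (vbasis h)`_i X = ev al (vbasis h)`_i *: X.
    have : X \in lker (linfun (ad_minus (vbasis h)`_i (ev al (vbasis h)`_i))).
      by move: hX => /subv_bigcapP /(_ i isT).
    by rewrite memv_ker lfunE /= subr_eq0 => /eqP.
  move=> H /coord_vbasis ->; rewrite /lie mulmx_suml mulmx_sumr -sumrB.
  have -> : ev al (\sum_(i < \dim h) coord (vbasis h) i H *: (vbasis h)`_i)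
      = \sum_(i < \dim h) coord (vbasis h) i H * ev al (vbasis h)`_i.
    by rewrite /ev !linear_sum; apply: eq_bigr => i _; rewrite !linearZ.
  rewrite scaler_suml; apply: eq_bigr => i _.
  by rewrite -scalemxAl -scalemxAr -scalerBr -scalerA -hb.
apply/subv_bigcapP => i _; rewrite -memvE.
rewrite memv_ker lfunE /= subr_eq0; apply/eqP/hX.
by rewrite vbasis_mem // mem_nth // size_tuple.
Qed.

Section Parabolic.
Variables (g h : {vspace 'M[K]_n}).
(* The positive roots, and the set Pi of simple roots *)
Variables (Phip Pi : seq (dual h)).

Definition in_nat_span (al : dual h) : Prop :=
  exists c : dual h -> nat, al = \sum_(be <- Pi) be *+ c be.

Definition levi_roots := [seq al <- Phip | `[< in_nat_span al >]].
Definition nil_roots := [seq al <- Phip | ~~ `[< in_nat_span al >]].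

Definition parabolic : {vspace 'M[K]_n} :=
  (h + \sum_(al <- Phip) rootspace g al
     + \sum_(al <- levi_roots) rootspace g (- al))%VS.

Definition levi : {vspace 'M[K]_n} :=
  (h + \sum_(al <- levi_roots) (rootspace g al + rootspace g (- al)))%VS.

Definition nilradical : {vspace 'M[K]_n} :=
  (\sum_(al <- nil_roots) rootspace g al)%VS.

(* F is the simple l-module of highest weight lam, inflated to p. *)
Definition simple_hw_module (lam : dual h) (F : vectType K)
    (aF : 'M[K]_n -> F -> F) : Prop :=
  [/\ is_rep parabolic aF,
      forall x v, x \in nilradical -> aF x v = 0,
      simple_submod levi aF setT
    & exists v, [/\ v != 0,
        forall H, H \in h -> aF H v = ev lam H *: v
      & forall al x, al \in levi_roots -> x \in rootspace g al -> aF x v = 0]].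

(* The generalized Verma module U(g) (x)_{U(p)} F *)
Definition gverma (F : vectType K) (aF : 'M[K]_n -> F -> F) : lmodType K :=
  induced g parabolic aF.

Definition gverma_act (F : vectType K) (aF : 'M[K]_n -> F -> F) :
    'M[K]_n -> gverma aF -> gverma aF :=
  @induced_act K n g parabolic F aF.

(* The submodule N of the g-module V is an object of the category O^p. *)
Definition in_catO (V : lmodType K) (act : 'M[K]_n -> V -> V) (N : set V) :=
  [/\ submod g act N,
      exists s : seq V, N = gen_submod g act [set` s],
      exists2 T : set (set V), direct_sum T N &
        forall W, T W -> fin_dim W /\ simple_submod levi act W
    & forall v, N v -> fin_dim (gen_submod nilradical act [set v])].

End Parabolic.
End RootSpaces.
Arguments restr {K n h} h' lam.
Arguments gverma {K n} g {h} Phip Pi {F} aF.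
Arguments gverma_act {K n} g {h} Phip Pi {F} aF.

Section SO7.
Context (R : realType).
Local Notation C := R[i].

(* E_ij, with indices counted from 1 *)
Definition Eij (i j : nat) : 'M[C]_7 := delta_mx (inord i.-1) (inord j.-1).

Definition gram7 : 'M[C]_7 :=
  \sum_(1 <= i < 4) (Eij i (i + 3) + Eij (i + 3) i) + Eij 7 7.

(* gram7 is the Gram matrix of the quadratic form defining so(7) *)
Lemma gram7E (z : 'cV[C]_7) : let z_ i := z (inord i.-1) 0 in
  z^T *m gram7 *m z
  = (2 * (z_ 1 * z_ 4 + z_ 2 * z_ 5 + z_ 3 * z_ 6) + z_ 7 ^+ 2)%:M.
Proof.
have d (i j : nat) : z^T *m Eij i j *m z
    = (z (inord i.-1) 0 * z (inord j.-1) 0)%:M.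
  apply/matrixP=> a b; rewrite !ord1 !mxE eqxx mulr1n.
  rewrite (bigD1 (inord j.-1)) //= big1 ?addr0 => [|k /negPf kj]; last first.
    rewrite !mxE big1 ?mul0r // => l _; rewrite !mxE kj andbF mulr0 //.
  congr (_ * _); rewrite !mxE (bigD1 (inord i.-1)) //= big1 ?addr0.
    by rewrite !mxE !eqxx mulr1.
  by move=> l /negPf li; rewrite !mxE li mulr0.
rewrite /= /gram7 unlock /= addr0 !mulmxDr !mulmxDl !d -!raddfD /=.
congr (_%:M); ring.
Qed.

Definition skew7 (X : 'M[C]_7) : 'M[C]_7 := X^T *m gram7 + gram7 *m X.

Fact skew7_linear : linear skew7.
Proof.
move=> a X Y; rewrite /skew7 !linearP /= mulmxDl -scalemxAl.
by rewrite addrACA -scalerDr.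
Qed.
HB.instance Definition _ := GRing.isLinear.Build C _ _ *:%R skew7 skew7_linear.

Definition so7 : {vspace 'M[C]_7} := lker (linfun skew7).

Lemma so7P X : (X \in so7) = (X^T *m gram7 + gram7 *m X == 0).
Proof. by rewrite memv_ker lfunE. Qed.

Definition Hs (i : nat) : 'M[C]_7 := Eij i i - Eij (i + 3) (i + 3).

Definition hso7 : {vspace 'M[C]_7} := <<[:: Hs 1; Hs 2; Hs 3]>>%VS.

Definition entry (i : nat) (H : subvs_of hso7) : C^o :=
  vsval H (inord i.-1) (inord i.-1).

Fact entry_linear i : linear (entry i).
Proof. by move=> a H H'; rewrite /entry linearP !mxE. Qed.
HB.instance Definition _ i :=
  GRing.isLinear.Build C (subvs_of hso7) C^o *:%R (entry i) (entry_linear i).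

Definition eps (i : nat) : dual hso7 := linfun (entry i).

Lemma epsE i j : (0 < i < 4)%N -> (0 < j < 4)%N ->
  ev (eps i) (Hs j) = (i == j)%:R.
Proof.
move=> i3 j3; have hj : Hs j \in hso7.
  by apply: memv_span; move: j j3 => [|[|[|[|?]]]] //; rewrite !inE eqxx ?orbT.
rewrite /ev lfunE /= /entry vsprojK // !mxE -!val_eqE /=.
by move: i j i3 j3 {hj} => [|[|[|[|?]]]] // [|[|[|[|?]]]] // _ _;
  rewrite !inordK //= subr0.
Qed.

Definition so7_pos : seq (dual hso7) :=
  [:: eps 1 - eps 2; eps 1 - eps 3; eps 2 - eps 3;
      eps 1 + eps 2; eps 1 + eps 3; eps 2 + eps 3; eps 1; eps 2; eps 3].

(* X assigns to each root of so(7) a nonzero root vector. *)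
Definition root_vectors (X : dual hso7 -> 'M[C]_7) : Prop :=
  forall ga, ga \in so7_pos ++ [seq - be | be <- so7_pos] ->
    X ga != 0 /\ X ga \in rootspace so7 ga.

(* The coroots of g_2 *)
Definition Ha1 : 'M[C]_7 := Hs 1 - Hs 2 + 2 *: Hs 3.
Definition Ha2 : 'M[C]_7 := Hs 2 - Hs 3.
Definition H3a1a2 : 'M[C]_7 := Hs 1 + Hs 3.
Definition H3a12a2 : 'M[C]_7 := Hs 1 + Hs 2.
Definition H2a1a2 : 'M[C]_7 := 2 *: Hs 1 + Hs 2 + Hs 3.

Definition hg2 : {vspace 'M[C]_7} := <<[:: Ha1; Ha2]>>%VS.

(* In order: the root vectors of g_2 for alpha_2, 3 alpha_1 + alpha_2,
   3 alpha_1 + 2 alpha_2, alpha_1, alpha_1 + alpha_2, 2 alpha_1 + alpha_2, and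
   then for the opposite roots *)
Definition g2_root_vectors (X : dual hso7 -> 'M[C]_7) : seq 'M[C]_7 :=
  [:: X (eps 2 - eps 3);
      - X (eps 1 + eps 3);
      - X (eps 1 + eps 2);
      X (eps 3) + X (eps 1 - eps 2);
      X (eps 2) - X (eps 1 - eps 3);
      - X (eps 1) - X (eps 2 + eps 3);
      X (eps 3 - eps 2);
      X (- eps 1 - eps 3);
      X (- eps 1 - eps 2);
      X (- eps 3) + X (eps 2 - eps 1);
      - X (- eps 2) - X (eps 3 - eps 1);
      - X (- eps 1) - X (- eps 2 - eps 3)].

(* The root vectors X are to be normalized so that this span is a Lie subalgebra
   of so(7); it is then isomorphic to g_2. *)
Definition g2 (X : dual hso7 -> 'M[C]_7) : {vspace 'M[C]_7} :=
  (hg2 + <<g2_root_vectors X>>)%VS.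

Definition alpha1 : dual hg2 := restr hg2 (eps 3).
Definition alpha2 : dual hg2 := restr hg2 (eps 2 - eps 3).

Definition g2_pos : seq (dual hg2) :=
  [:: alpha1; alpha2; alpha1 + alpha2; alpha1 *+ 2 + alpha2;
      alpha1 *+ 3 + alpha2; alpha1 *+ 3 + alpha2 *+ 2].

Definition is_nat (z : C) : Prop := exists k : nat, z = k%:R.

Definition sigma (lam : dual hso7) (del : dual hg2) : dual hg2 :=
  restr hg2 lam + del.
Definition mu (lam : dual hso7) (del : dual hg2) : dual hg2 :=
  restr hg2 lam - del.

Definition summation_set (lam : dual hso7) : set (dual hg2) :=
  [set del | [/\ is_nat (ev del Ha2), is_nat (ev (mu lam del) H3a1a2)
             & is_nat (ev (mu lam del) H3a12a2)]].

(* For del in summation_set lam both arguments of Num.min are natural numbers, so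
   that C being only partially ordered does not matter, and coef is real. *)
Definition coef (lam : dual hso7) (del : dual hg2) : C :=
  let A := Num.min (ev (mu lam del) H2a1a2) (ev (sigma lam del) Ha2) in
  1 + (A - `|ev (mu lam del) Ha2|) / 2.

End SO7.

(* Main.v *)
From HB Require Import structures.
Require Import Defs.
From mathcomp Require Import all_boot all_order all_algebra.
From mathcomp Require Import finmap boolp classical_sets functions reals ereal esum.
From mathcomp Require Import cardinality fsbigop.
From mathcomp Require Import complex ring lra zify.
From mathcomp Require Import -(notations) monalg.
Import Defs.

Set Implicit Arguments.
Unset Strict Implicit.
Unset Printing Implicit Defensive.

Import Order.TTheory GRing.Theory Num.Theory.
Local Open Scope classical_set_scope.
Local Open Scope ring_scope.

(** The proof compares the two module structures of M, the generalized Verma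
    module of so(7), through the grading by H0 = H_(2 alpha1 + alpha2). As H0
    is 2 H_1 + H_2 + H_3, the parabolic subalgebras of so(7) and of g2 are the
    parts of these two algebras where H0 has nonnegative eigenvalues. They
    share the sl2 of the Levi factor, with root vectors for +/- (eps 2 - eps 3)
    and Cartan element Ha = H_(alpha2).

    The opposite nilradical of so(7) has dimension 8. It is spanned by that of g2,
    which has dimension 5, and by the root vectors of -eps 3, -eps 2 and -eps 1,
    which lower H0 by 1, 1 and 2 and have the Ha-weights 1, -1 and 0. By the
    theorem of Poincare, Birkhoff and Witt ([pbw_indep], [pbw_span]) M is free
    over the ordered monomials in all eight vectors. Hence M is free over the
    ordered monomials in the five vectors of g2, on the generators X_(-eps 3)^a
    X_(-eps 2)^b X_(-eps 1)^j f_s, where the f_s form the weight basis of F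
    ([gens_span], [gens_indep]). On such a generator H0 has the eigenvalue
    lambda(H0) - c, where c = a + b + 2 j will be called its degree.

    Let V_c be the g2-submodule generated by the generators of degree less than c.
    The nilradical of the parabolic subalgebra of g2 raises H0, so that it kills
    the generators of degree c modulo V_c, and these form a module of the Levi
    factor inside V_(c+1) / V_c. This module splits into strings of sl2
    ([sl2_string_basis]). By Frobenius reciprocity and the freeness of M, a string
    of highest weight k contributes to V_(c+1) / V_c a generalized Verma module of
    g2 ([block_cmult]), whose highest weight delta = [hw c k] is the one with
    delta(H0) = lambda(H0) - c and delta(Ha) = k. As composition multiplicities
    are additive ([cmult_add]) and compatible with increasing unions
    ([cmult_union]), the multiplicity of a simple module in M is the sum of its
    multiplicities in these generalized Verma modules ([graded_comp_mult]). It is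
    finite because the eigenspaces of H0 are ([graded_fin]).

    What remains is to count the strings of highest weight k in degree c. Their
    number is the dimension of the weight space k minus that of the weight space
    k + 2 ([strings_count]). Let E(z) be the number of exponents (a, b, j) of
    degree c and weight a - b = z, and let n = lambda(Ha) be the highest weight of
    F; then the weight space k has dimension E(k - n) + ... + E(k + n), in steps
    of 2, and the difference telescopes to E(k - n) - E(k + n + 2)
    ([strings_expos]). Now E(z) is 1 + (c - |z|) / 2 if c - z is even and
    |z| <= c, and 0 otherwise ([expos_count]). As c = mu(H0), k - n = - mu(Ha) and
    k + n = sigma(Ha), this yields the coefficient 1 + (A - |mu(Ha)|) / 2
    ([expo_num_diff], [coef_hw]), and there are such strings exactly when the
    conditions of the index set hold ([summation_setP]).

    The V_c, whose union is M, lie in category O. They are finitely generated; the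
    nilradical lowers the degree, so that each vector generates a
    finite-dimensional module over it ([nil_fin]); and over the Levi factor they
    are sums of simple modules, since each weight vector is a combination of
    vectors in strings ([hw_span], [Vlt_semisimple]). *)

(** * Subspaces and representations *)
Section Subspaces.
Context (K : fieldType) (V : lmodType K).
Implicit Types (W S : set V).

Lemma subspace0 W : subspace W -> W 0.
Proof. by move=> [+ _ _]. Qed.
Lemma subspaceD W u v : subspace W -> W u -> W v -> W (u + v).
Proof. by move=> [_ + _]; apply. Qed.
Lemma subspaceZ W a u : subspace W -> W u -> W (a *: u).
Proof. by move=> [_ _]; apply. Qed.
Lemma subspaceN W u : subspace W -> W u -> W (- u).
Proof. by move=> sW; rewrite -scaleN1r; apply: subspaceZ. Qed.
Lemma subspaceB W u v : subspace W -> W u -> W v -> W (u - v).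
Proof. by move=> sW Wu Wv; apply: subspaceD (subspaceN _ _). Qed.
Lemma subspace_sum W (I : Type) (r : seq I) (P : pred I) (f : I -> V) :
  subspace W -> (forall i, P i -> W (f i)) -> W (\sum_(i <- r | P i) f i).
Proof.
move=> sW Wf; elim/big_rec: _ => [|i x Pi Wx]; first exact: subspace0.
by apply: subspaceD => //; apply: Wf.
Qed.
Lemma subspace_eq0 : subspace [set (0 : V)].
Proof.
by split=> [//|u v /= -> ->|a u /= ->]; rewrite ?addr0 ?scaler0.
Qed.
Lemma subspaceI W W' : subspace W -> subspace W' -> subspace (W `&` W').
Proof.
move=> [W0 WD WZ] [W0' WD' WZ']; split=> [//|u v [a b] [c d]|a u [b c]].
  by split; [apply: WD | apply: WD'].
by split; [apply: WZ | apply: WZ'].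
Qed.

Definition addset W W' : set V := [set v | exists a b, [/\ W a, W' b & v = a + b]].

Lemma subspace_add W W' : subspace W -> subspace W' -> subspace (addset W W').
Proof.
move=> sW sW'; split.
- by exists 0, 0; split; rewrite ?addr0 //; apply: subspace0.
- move=> _ _ [a [b [Wa Wb ->]]] [c [d [Wc Wd ->]]].
  exists (a + c), (b + d); split; [exact: subspaceD|exact: subspaceD|].
  by rewrite addrACA.
move=> k _ [a [b [Wa Wb ->]]].
by exists (k *: a), (k *: b); split; rewrite ?scalerDr //; apply: subspaceZ.
Qed.
Lemma addset_subl W W' : subspace W' -> W `<=` addset W W'.
Proof. by move=> sW' v Wv; exists v, 0; split; rewrite ?addr0 //; apply: subspace0. Qed.
Lemma addset_subr W W' : subspace W -> W' `<=` addset W W'.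
Proof. by move=> sW v Wv; exists 0, v; split; rewrite ?add0r //; apply: subspace0. Qed.
Lemma addset_sub W W' X : subspace X -> W `<=` X -> W' `<=` X -> addset W W' `<=` X.
Proof.
by move=> sX a b _ [x [y [/a Wx /b Wy ->]]]; apply: subspaceD.
Qed.

Lemma lspan_sub S W : subspace W -> S `<=` W -> lspan S `<=` W.
Proof. by move=> sW SW v; apply. Qed.
Lemma lspanS S S' : S `<=` S' -> lspan S `<=` lspan S'.
Proof.
move=> h; apply: lspan_sub; first exact: lspan_subspace.
by move=> v /h; apply: sub_lspan.
Qed.
Lemma lspan_id W : subspace W -> lspan W = W.
Proof.
move=> sW; apply/seteqP; split; last exact: sub_lspan.
exact: lspan_sub.
Qed.

Lemma lspan_seqP (s : seq V) v :
  lspan [set` s] v -> exists c : nat -> K, v = \sum_(i < size s) c i *: s`_i.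
Proof.
pose W : set V := [set v | exists c : nat -> K, v = \sum_(i < size s) c i *: s`_i].
have sW : subspace W.
  split.
  - by exists (fun=> 0); rewrite big1 // => i _; rewrite scale0r.
  - move=> _ _ [c ->] [d ->]; exists (fun i => c i + d i).
    by rewrite -big_split; apply: eq_bigr => i _; rewrite scalerDl.
  - move=> a _ [c ->]; exists (fun i => a * c i).
    by rewrite scaler_sumr; apply: eq_bigr => i _; rewrite scalerA.
apply: (lspan_sub sW) => {v} v /= vs.
have iv : (index v s < size s)%N by rewrite index_mem.
exists (fun i => (i == index v s)%:R).
rewrite (bigD1 (Ordinal iv)) //= eqxx scale1r nth_index // big1 ?addr0 // => j.
by rewrite -val_eqE /= => /negPf ->; rewrite scale0r.
Qed.

End Subspaces.

Section LinearExtension.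
Context (K : fieldType) (T : choiceType) (V : lmodType K) (h : T -> V).

Definition lext (t : malg T K) : V := \sum_(k <- msupp t) mcoeff k t *: h k.

Lemma lextw (d : {fset T}) t : (msupp t `<=` d)%fset ->
  lext t = \sum_(k <- d) mcoeff k t *: h k.
Proof.
move=> le; rewrite /lext (big_fset_incl _ le) //= => k _ /mcoeff_outdom ->.
by rewrite scale0r.
Qed.

Lemma lext_linear : linear lext.
Proof.
move=> c s t; set d := (msupp s `|` msupp t)%fset.
have ds : (msupp s `<=` d)%fset by apply: fsubsetUl.
have dt : (msupp t `<=` d)%fset by apply: fsubsetUr.
have dst : (msupp (c *: s + t) `<=` d)%fset.
  apply: fsubset_trans (msuppD_le _ _) _; apply: fsetSU; exact: msuppZ_le.
rewrite (lextw ds) (lextw dt) (lextw dst).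
rewrite scaler_sumr -big_split /=; apply: eq_bigr => k _.
by rewrite mcoeffD mcoeffZ scalerDl scalerA.
Qed.
HB.instance Definition _ :=
  GRing.isLinear.Build K (malg T K) V *:%R lext lext_linear.

Lemma lextU k c : lext (mkmalgU k c) = c *: h k.
Proof. by rewrite (lextw msuppU_le) big_seq_fset1 mcoeffUU. Qed.

End LinearExtension.

Lemma malg_ind (K : fieldType) (T : choiceType) (P : malg T K -> Prop) :
  P 0 -> (forall a k t, P t -> P (a *: mkmalgU k 1 + t)) -> forall t, P t.
Proof.
move=> P0 PS t; rewrite [t]monalgE; elim/big_rec: _ => [//|k m _ Pm].
by rewrite mkmalgU_scale; apply: PS.
Qed.

Section RepTheory.
Context (K : fieldType) (n : nat) (g : {vspace 'M[K]_n}).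
Context (V : lmodType K) (act : 'M[K]_n -> V -> V) (r : is_rep g act).

Lemma act_lin x a u v : x \in g -> act x (a *: u + v) = a *: act x u + act x v.
Proof. by case: r => + _ _; apply. Qed.
Lemma act_linl a x y v : x \in g -> y \in g ->
  act (a *: x + y) v = a *: act x v + act y v.
Proof. by case: r => _ + _; apply. Qed.
Lemma act_lie x y v : x \in g -> y \in g ->
  act (lie x y) v = act x (act y v) - act y (act x v).
Proof. by case: r => _ _; apply. Qed.
Lemma actD x u v : x \in g -> act x (u + v) = act x u + act x v.
Proof. by move=> gx; have := act_lin 1 u v gx; rewrite !scale1r. Qed.
Lemma act0 x : x \in g -> act x 0 = 0.
Proof. by move=> gx; apply: (addrI (act x 0)); rewrite -actD // !addr0. Qed.
Lemma actZ x a u : x \in g -> act x (a *: u) = a *: act x u.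
Proof. by move=> gx; have := act_lin a u 0 gx; rewrite act0 // !addr0. Qed.
Lemma actN x u : x \in g -> act x (- u) = - act x u.
Proof. by move=> gx; rewrite -scaleN1r actZ // scaleN1r. Qed.
Lemma actB x u v : x \in g -> act x (u - v) = act x u - act x v.
Proof. by move=> gx; rewrite actD // actN. Qed.
Lemma act_sum x (I : Type) (s : seq I) (P : pred I) (f : I -> V) : x \in g ->
  act x (\sum_(i <- s | P i) f i) = \sum_(i <- s | P i) act x (f i).
Proof. by move=> gx; apply: (big_morph (act x)) => [u v|]; [apply: actD | apply: act0]. Qed.
Lemma actDl x y v : x \in g -> y \in g -> act (x + y) v = act x v + act y v.
Proof. by move=> gx gy; have := act_linl 1 v gx gy; rewrite !scale1r. Qed.
Lemma act0l v : act 0 v = 0.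
Proof. by apply: (addrI (act 0 v)); rewrite -actDl ?mem0v // !addr0. Qed.
Lemma actZl x a v : x \in g -> act (a *: x) v = a *: act x v.
Proof. by move=> gx; have := act_linl a v gx (mem0v _); rewrite act0l !addr0. Qed.
Lemma act_suml (I : eqType) (s : seq I) (f : I -> 'M[K]_n) v :
  (forall i, i \in s -> f i \in g) ->
  act (\sum_(i <- s) f i) v = \sum_(i <- s) act (f i) v.
Proof.
elim: s => [|i s IH] h; first by rewrite !big_nil act0l.
rewrite !big_cons actDl ?IH ?h ?inE ?eqxx // => [j js|]; first by rewrite h ?inE ?js ?orbT.
by rewrite big_seq; apply: memv_suml => j js; rewrite h // inE js orbT.
Qed.
Lemma act_swap x y v : x \in g -> y \in g ->
  act x (act y v) = act y (act x v) + act (lie x y) v.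
Proof. by move=> gx gy; rewrite act_lie // addrC subrK. Qed.

Lemma sub_rep (g' : {vspace 'M[K]_n}) : (g' <= g)%VS -> is_rep g' act.
Proof.
move=> /subvP le; case: r => a b c.
by split=> *; [apply: a | apply: b | apply: c]; apply: le.
Qed.

Lemma submod0 : submod g act [set 0].
Proof. by split=> [|x v gx /= ->]; [apply: subspace_eq0 | apply: act0]. Qed.
Lemma submodI N N' : submod g act N -> submod g act N' -> submod g act (N `&` N').
Proof.
move=> [a b] [c d]; split; first exact: subspaceI.
by move=> x v gx [Nv N'v]; split; [apply: b | apply: d].
Qed.
Lemma submod_add N N' : submod g act N -> submod g act N' ->
  submod g act (addset N N').
Proof.
move=> [a b] [c d]; split; first exact: subspace_add.
move=> x _ gx [u [v [Nu Nv ->]]]; exists (act x u), (act x v).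
by rewrite actD //; split=> //; [apply: b | apply: d].
Qed.

End RepTheory.

(** * The universal properties of U(g) and of induced modules *)
Section Frobenius.
Context (K : fieldType) (n : nat) (g : {vspace 'M[K]_n}).
Context (V : lmodType K) (act : 'M[K]_n -> V -> V) (r : is_rep g act).

Local Notation T := (subvs_of g).

Definition word_act (w : fmonom T) (v : V) : V :=
  foldr (fun x => act (vsval x)) v (w : seq T).

Definition free_act (t : free_alg K T) (v : V) : V := lext (word_act^~ v) t.

Lemma word_actM w w' v : word_act (mul w w') v = word_act w (word_act w' v).
Proof. by rewrite /word_act fmM foldr_cat. Qed.

Lemma word_act_linear w a u v :
  word_act w (a *: u + v) = a *: word_act w u + word_act w v.
Proof.
rewrite /word_act; elim: (w : seq T) => [//|x s IH] /=.
by rewrite IH (act_lin r) // subvsP.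
Qed.

Lemma free_act_linearl v : linear (free_act^~ v).
Proof. by move=> a s t; rewrite /free_act lext_linear. Qed.

Lemma free_actU k v : free_act (mkmalgU k 1) v = word_act k v.
Proof. by rewrite /free_act lextU scale1r. Qed.

Lemma free_act_linear t a u v :
  free_act t (a *: u + v) = a *: free_act t u + free_act t v.
Proof.
rewrite /free_act /lext scaler_sumr -big_split; apply: eq_bigr => k _ /=.
by rewrite word_act_linear scalerDr !scalerA mulrC.
Qed.

Lemma free_act0 v : free_act 0 v = 0.
Proof. by rewrite /free_act linear0. Qed.

Lemma free_actD s t v : free_act (s + t) v = free_act s v + free_act t v.
Proof. by have := free_act_linearl v 1 s t; rewrite !scale1r. Qed.

Lemma free_actM s t v : free_act (s * t) v = free_act s (free_act t v).
Proof.
elim/malg_ind: s => [|a k s IH]; first by rewrite mul0r !free_act0.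
rewrite mulrDl free_act_linearl -IH -scalerAl free_actU free_actD; congr (_ + _).
have -> : free_act (a *: ((mkmalgU k 1 : free_alg K T) * t)) v
    = a *: free_act ((mkmalgU k 1 : free_alg K T) * t) v.
  by have := free_act_linearl v a (mkmalgU k 1 * t) 0; rewrite !free_act0 !addr0.
congr (_ *: _); elim/malg_ind: t {s IH} => [|b l t IH].
  rewrite mulr0 !free_act0; have := word_act_linear k (-1) 0 0.
  by rewrite scaler0 addr0 scaleN1r addNr.
rewrite mulrDr free_actD IH free_act_linearl word_act_linear free_actU; congr (_ + _).
rewrite -(@free_scaleAr K T).
have -> : (mkmalgU k 1 : free_alg K T) * mkmalgU l 1 = mkmalgU (mul k l) 1.
  by rewrite malgM_def fgmulUU mulr1.
have := free_act_linearl v b (mkmalgU (mul k l) 1) 0.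
by rewrite !free_act0 !addr0 => ->; rewrite free_actU word_actM.
Qed.

End Frobenius.

Section Induction.
Context (K : fieldType) (n : nat) (g p : {vspace 'M[K]_n}) (gL : is_liealg g).
Context (F : lmodType K) (aF : 'M[K]_n -> F -> F).
Context (V : lmodType K) (act : 'M[K]_n -> V -> V) (r : is_rep g act).

Local Notation T := (subvs_of g).

Lemma free_act_gen x v : x \in g -> free_act act (free_gen K (vsproj g x)) v = act x v.
Proof. by move=> gx; rewrite free_actU /word_act fmU /= vsprojK. Qed.

Lemma free_actZ a (t : free_alg K T) v : free_act act (a *: t) v = a *: free_act act t v.
Proof.
by have := free_act_linearl act v a t 0; rewrite !free_act0 !addr0.
Qed.
Lemma free_actN (t : free_alg K T) v : free_act act (- t) v = - free_act act t v.
Proof. by apply/eqP; rewrite -addr_eq0 -free_actD addNr free_act0. Qed.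

Lemma free_actBB (s t u : free_alg K T) v :
  free_act act (s - t - u) v = free_act act s v - free_act act t v - free_act act u v.
Proof. by rewrite (free_actD act (s - t)) (free_actD act s) !free_actN. Qed.
Lemma free_act_lin_rel (s t u : free_alg K T) a v :
  free_act act (u - (a *: s + t)) v
  = free_act act u v - (a *: free_act act s v + free_act act t v).
Proof. by rewrite (free_actD act u) free_actN (free_actD act (a *: s)) free_actZ. Qed.

Lemma free_act_0 (t : free_alg K T) : free_act act t 0 = 0.
Proof.
have := free_act_linear r t (-1) 0 0.
by rewrite scaler0 addr0 scaleN1r addNr.
Qed.

Lemma free_act_ideal t v : lspan (ideal_gens (@uea_rel K n g)) t -> free_act act t v = 0.
Proof.
pose W : set (free_alg K T) := [set t | forall v, free_act act t v = 0].
have sW : subspace W.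
  split=> [w|s t' Ws Wt w|a s Ws w]; first by rewrite free_act0.
    by rewrite free_actD Ws Wt addr0.
  by apply: (etrans (free_actZ a s w)); rewrite Ws scaler0.
move=> It; apply: (lspan_sub sW _ It) => {It t v} _ [a [s [b [rs ->]]]] v.
rewrite !(free_actM r).
suff -> : free_act act s (free_act act b v) = 0 by rewrite free_act_0.
move: (free_act act b v) => {}v.
have fg (x : T) w : free_act act (free_gen K x) w = act (vsval x) w.
  by rewrite -{1}[x]vsvalK free_act_gen // subvsP.
case: rs => [[c [x [y ->]]]|[x [y ->]]].
  apply: etrans (free_act_lin_rel _ _ _ _ _) _.
  apply: etrans (congr2 (fun s t => s - t) (fg _ v)
    (congr2 (fun s t => c *: s + t) (fg x v) (fg y v))) _.
  rewrite linearP /=.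
  by rewrite (act_linl r) ?subvsP // subrr.
apply: etrans (free_actBB _ _ _ _) _.
have M (a' b' : T) w : free_act act (free_gen K a' * free_gen K b') w
    = act (vsval a') (act (vsval b') w).
  by apply: etrans (free_actM r _ _ _) _; rewrite fg fg.
apply: etrans (congr2 (fun s t => s - t)
  (congr2 (fun s t => s - t) (M x y v) (M y x v)) (fg _ v)) _.
rewrite -(act_lie r) ?subvsP //.
by rewrite vsprojK ?subrr //; apply: gL; apply: subvsP.
Qed.

(** Any representative may be taken, because the relations of U(g) act by zero
    ([free_act_ideal]). *)
Definition uea_act (u : uea g) (v : V) : V := free_act act (repr u) v.

Lemma uea_act_proj t v : uea_act (aproj (@uea_rel K n g) t) v = free_act act t v.
Proof.
apply/eqP; rewrite -subr_eq0 /uea_act -free_actN -free_actD; apply/eqP.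
by apply: free_act_ideal; apply: lreprP.
Qed.

Lemma uea_actD a u u' v :
  uea_act (a *: u + u') v = a *: uea_act u v + uea_act u' v.
Proof.
elim/algquotP: u => u; elim/algquotP: u' => u'.
by rewrite -aprojZ -aprojD !uea_act_proj free_actD free_actZ.
Qed.
Lemma uea_act_linear u a v v' :
  uea_act u (a *: v + v') = a *: uea_act u v + uea_act u v'.
Proof. exact: free_act_linear. Qed.
Lemma uea_actM u u' v : uea_act (u * u') v = uea_act u (uea_act u' v).
Proof.
elim/algquotP: u => u; elim/algquotP: u' => u'.
by rewrite -aprojM !uea_act_proj free_actM.
Qed.
Lemma uea_act_in x v : x \in g -> uea_act (uea_in g x) v = act x v.
Proof. by move=> gx; rewrite uea_act_proj free_act_gen. Qed.
Lemma uea_act1 v : uea_act 1 v = v.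
Proof.
rewrite [1]/(aproj _ 1) uea_act_proj.
by have := free_actU act (monalg.one : fmonom T) v; rewrite /word_act fm1.
Qed.

Context (pg : (p <= g)%VS) (phi : F -> V).
Hypothesis phi_lin : forall a u v, phi (a *: u + v) = a *: phi u + phi v.
Hypothesis phi_p : forall x v, x \in p -> phi (aF x v) = act x (phi v).

Definition ind_lift0 : malg (uea g * F)%type K -> V :=
  lext (fun k => uea_act k.1 (phi k.2)).

Lemma ind_lift0_pure u v : ind_lift0 (pure u v) = uea_act u (phi v).
Proof. by rewrite /pure -lock /ind_lift0 lextU scale1r. Qed.

Lemma ind_lift0_rel t : lspan (tensor_rel p aF) t -> ind_lift0 t = 0.
Proof.
pose W : set (malg (uea g * F)%type K) := [set t | ind_lift0 t = 0].
have sW : subspace W.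
  split=> [|s t' Ws Wt|a s Ws]; rewrite /W /=; first exact: linear0.
    by rewrite /ind_lift0 linearD /= -!/(ind_lift0 _) Ws Wt addr0.
  by rewrite /ind_lift0 linearZ /= -!/(ind_lift0 _) Ws scaler0.
apply: (lspan_sub sW) => {}t.
have lin a u v : ind_lift0 (a *: u + v) = a *: ind_lift0 u + ind_lift0 v.
  exact: lext_linear.
have linB u v : ind_lift0 (u - v) = ind_lift0 u - ind_lift0 v.
  by rewrite /ind_lift0 linearB.
case=> [[a [u [u' [v ->]]]]|[a [u [v [v' ->]]]]|[u [x [v [px ->]]]]];
  rewrite /W /= linB ?lin !ind_lift0_pure.
- by rewrite uea_actD subrr.
- by rewrite phi_lin uea_act_linear subrr.
by rewrite uea_actM uea_act_in ?(subvP pg) // phi_p // subrr.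
Qed.

Definition ind_lift (m : induced g p aF) : V := ind_lift0 (repr m).

Lemma ind_lift_proj t : ind_lift (lproj _ t) = ind_lift0 t.
Proof.
apply/eqP; rewrite -subr_eq0 /ind_lift /ind_lift0 -linearB /=; apply/eqP.
by apply: ind_lift0_rel; apply: lreprP.
Qed.

Lemma ind_lift_linear : linear ind_lift.
Proof.
move=> a; elim/lquotP=> s; elim/lquotP=> t.
by rewrite -lproj_linear !ind_lift_proj /ind_lift0 lext_linear.
Qed.

Lemma ind_lift_tens u v : ind_lift (tens p aF u v) = uea_act u (phi v).
Proof. by rewrite ind_lift_proj ind_lift0_pure. Qed.
Lemma ind_lift_tens1 v : ind_lift (tens p aF 1 v) = phi v.
Proof. by rewrite ind_lift_tens uea_act1. Qed.

Lemma ind_lift_act x m : x \in g -> ind_lift (induced_act x m) = act x (ind_lift m).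
Proof.
move=> gx; have ir := @induced_rep K n g p F aF.
elim/inducedP: m => [|c u v m IH].
  have L0 : ind_lift 0 = 0.
    by have := ind_lift_linear (-1) 0 0; rewrite scaler0 addr0 scaleN1r addNr.
  by rewrite (act0 ir) // L0 (act0 r).
apply: etrans (congr1 ind_lift (act_lin ir c _ _ gx)) _.
apply: etrans (ind_lift_linear _ _ _) _.
apply: etrans _ (congr1 (act x) (esym (ind_lift_linear _ _ _))).
apply: etrans _ (esym (act_lin r c _ _ gx)).
apply: (congr2 (fun s t => c *: s + t) _ IH).
apply: etrans (congr1 ind_lift (induced_actE _ _ _ _ _)) _.
apply: etrans (ind_lift_tens _ _) _.
apply: etrans _ (congr1 (act x) (esym (ind_lift_tens _ _))).
apply: etrans (uea_actM _ _ _) _.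
exact: uea_act_in.
Qed.

(** Frobenius reciprocity, in the direction that maps an induced module
    somewhere: u (x) v |-> u phi(v) respects the balancing relations because phi
    commutes with p. *)
Lemma frobenius : exists Phi : {linear induced g p aF -> V},
  (forall v, Phi (tens p aF 1 v) = phi v) /\
  (forall x m, x \in g -> Phi (induced_act x m) = act x (Phi m)).
Proof.
pose Phi : {linear induced g p aF -> V} :=
  HB.pack ind_lift (GRing.isLinear.Build _ _ _ _ _ ind_lift_linear).
exists Phi.
by split; [apply: ind_lift_tens1 | apply: ind_lift_act].
Qed.

End Induction.

Section InducedGenerated.
Context (K : fieldType) (n : nat) (g p : {vspace 'M[K]_n}) (gL : is_liealg g).
Context (F : lmodType K) (aF : 'M[K]_n -> F -> F).
Local Notation act := (@induced_act K n g p F aF).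

Lemma tens1_linear a v v' :
  tens p aF (1 : uea g) (a *: v + v') = a *: tens p aF 1 v + tens p aF 1 v'.
Proof.
by rewrite /tens -lproj_linear; apply/lprojP; apply: sub_lspan; apply: Or32; exists a, 1, v, v'.
Qed.

(** Every pure tensor u (x) v is reached from 1 (x) v, because U(g) is spanned by
    words in g. *)
Lemma induced_gen (N : set (induced g p aF)) :
  submod g act N -> (forall v, N (tens p aF 1 v)) -> N = setT.
Proof.
move=> [sN aN] N1; apply/seteqP; split=> // m _.
elim/inducedP: m => [|c u v m IH]; first exact: subspace0.
apply: subspaceD => //; apply: subspaceZ => //.
elim/algquotP: u => t; elim/malg_ind: t v => [|a k t IHt] v.
  rewrite linear0.
  have := tens_linearl p aF (-1) (0 : uea g) 0 v.
  by rewrite scaler0 addr0 scaleN1r addNr => ->; exact: subspace0 sN.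
rewrite aproj_linear tens_linearl.
have [S0 SD SZ] := sN; apply: SD; last exact: IHt.
apply: SZ.
case: k => w; elim: w {IHt} => [|x w IHw]; first by rewrite -fmoneE; exact: N1.
have -> : aproj (@uea_rel K n g) (mkmalgU (FMonom (x :: w)) 1)
    = uea_in g (vsval x) * aproj (@uea_rel K n g) (mkmalgU (FMonom w) 1).
  rewrite /uea_in -aprojM vsvalK; congr (aproj _ _).
  rewrite /free_gen malgM_def fgmulUU mulr1; congr (mkmalgU _ _).
  by apply: (@val_inj _ _ (fmonom (subvs_of g))); apply: etrans _ (esym (fmM _ _)); rewrite fmU.
by rewrite -induced_actE; apply: aN => //; apply: subvsP.
Qed.

End InducedGenerated.

(** * Linear independence of ordered monomials *)
Section PBW.
Context (K : fieldType) (n : nat) (g p : {vspace 'M[K]_n}).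
Hypotheses (gL : is_liealg g) (pL : is_liealg p) (pg : (p <= g)%VS).
Context (m : nat) (y : m.-tuple 'M[K]_n).
Hypotheses (yfree : free y) (yp : (<<y>> + p)%VS = g) (ydir : (<<y>> :&: p)%VS = 0%VS).
Context (F : vectType K) (aF : 'M[K]_n -> F -> F) (rF : is_rep p aF).

Local Notation d := (\dim {:F}).
(** N has the basis that the induced module should have: pairs of a sorted list of
    indices, read as a monomial in the y_i, and a basis vector of F. Once g acts
    on N so that monomials act as their names say, independence of the monomials
    is visible on N. Basis vectors named by lists that are not sorted are sent to
    zero. Only the basis and the extension by linearity [ext] enter. *)
Context (N : lmodType K) (nbas : seq nat * 'I_d -> N).
Context (ext : (seq nat * 'I_d -> N) -> {linear N -> N}).
Hypothesis extE : forall h q, ext h (nbas q) = h q.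
Hypothesis nspan : lspan [set nbas q | q in setT] = setT.
Local Notation e := (fun k : 'I_d => (vbasis {:F})`_k).

Definition pbw_coord (x : 'M[K]_n) (i : 'I_m) : K := coord y i (daddv_pi <<y>>%VS p x).
Definition pbw_rest (x : 'M[K]_n) : 'M[K]_n := daddv_pi p <<y>>%VS x.
Local Notation c := pbw_coord.
Local Notation pp := pbw_rest.

Lemma c_lin a x x' i : c (a *: x + x') i = a * c x i + c x' i.
Proof. by rewrite /c !linearP. Qed.
Lemma pp_lin a x x' : pp (a *: x + x') = a *: pp x + pp x'.
Proof. by rewrite /pp linearP. Qed.
Lemma c0 i : c 0 i = 0. Proof. by rewrite /c !linear0. Qed.
Lemma cD x x' i : c (x + x') i = c x i + c x' i.
Proof. by rewrite /c !linearD. Qed.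
Lemma cZ a x i : c (a *: x) i = a * c x i.
Proof. by rewrite /c !linearZ. Qed.
Lemma c_sum I (r : seq I) P (f : I -> 'M[K]_n) i :
  c (\sum_(j <- r | P j) f j) i = \sum_(j <- r | P j) c (f j) i.
Proof. by rewrite /c !linear_sum. Qed.
Lemma pp_p x : pp x \in p. Proof. exact: memv_pi. Qed.
Lemma y_in i : y`_(i : 'I_m) \in <<y>>%VS.
Proof. by apply/memv_span/mem_nth; rewrite size_tuple. Qed.
Lemma yg i : y`_(i : 'I_m) \in g.
Proof. by rewrite -yp; apply: (subvP (addvSl _ _)); apply: y_in. Qed.
Lemma pg' x : x \in p -> x \in g. Proof. exact: (subvP pg). Qed.
Lemma pp_g x : pp x \in g. Proof. by apply/pg'/pp_p. Qed.
Lemma x_decomp x : x \in g -> x = \sum_(i < m) c x i *: y`_i + pp x.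
Proof.
rewrite -yp => gx; rewrite -[LHS](daddv_pi_add ydir gx); congr (_ + _).
by rewrite -coord_span // memv_pi.
Qed.
Lemma c_y i j : c y`_(j : 'I_m) i = (i == j)%:R.
Proof. by rewrite /c daddv_pi_id ?y_in // coord_free // eq_sym. Qed.
Lemma pp_y j : pp y`_(j : 'I_m) = 0.
Proof. 
have ydir' : (p :&: <<y>> = 0)%VS by rewrite capvC.
have gy := yg j; rewrite -yp in gy.
have := daddv_pi_add ydir gy; rewrite daddv_pi_id ?y_in // => /eqP.
by rewrite -subr_eq0 addrAC subrr add0r => /eqP.
Qed.
Lemma pp_id x : x \in p -> pp x = x.
Proof. by move=> px; rewrite /pp daddv_pi_id // capvC. Qed.
Lemma c_p x i : x \in p -> c x i = 0.
Proof.
move=> px; have gx := pg' px; rewrite -yp in gx.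
have := daddv_pi_add ydir gx; rewrite -/(pp x) pp_id // => /eqP.
by rewrite -subr_eq0 addrK => /eqP h; rewrite /c h linear0.
Qed.

(** The part of x that cannot be written in front of a monomial starting with y_j
    and has to be commuted past y_j. *)
Definition above (j : nat) (x : 'M[K]_n) : 'M[K]_n :=
  \sum_(i < m | (j < i)%N) c x i *: y`_i + pp x.

Lemma above_lin j a x x' : above j (a *: x + x') = a *: above j x + above j x'.
Proof.
rewrite /above pp_lin scalerDr scaler_sumr addrACA -big_split; congr (_ + _).
by apply: eq_bigr => i _; rewrite c_lin scalerDl scalerA.
Qed.
Lemma above_g j x : above j x \in g.
Proof. by rewrite rpredD ?pp_g // rpred_sum // => i _; rewrite rpredZ // yg. Qed.

Local Notation bs M k := (nbas (M, k)).
Definition bvec (M : seq nat) (f : F) : N := \sum_(k < d) coord (vbasis {:F}) k f *: bs M k.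
Lemma bvec_lin M a f f' : bvec M (a *: f + f') = a *: bvec M f + bvec M f'.
Proof.
rewrite /bvec scaler_sumr -big_split; apply: eq_bigr => k _ /=.
by rewrite linearP scalerDl scalerA.
Qed.
Lemma bvec0 M : bvec M 0 = 0.
Proof. by rewrite /bvec big1 // => k _; rewrite linear0 scale0r. Qed.
Lemma bvec_e M k : bvec M (e k) = bs M k.
Proof.
have bf : free (vbasis {:F}) by apply: (basis_free (vbasisP _)).
rewrite /bvec (bigD1 k) //= coord_free // eqxx scale1r big1 ?addr0 // => j /negPf jk.
by rewrite coord_free // eq_sym jk scale0r.
Qed.

Definition insn (i : nat) (M : seq nat) := sort leq (i :: M).
(** The leading term: the y-components of x are inserted at their sorted places,
    as in the symmetric algebra. *)
Definition topt x M k : N := \sum_(i < m) c x i *: bs (insn i M) k.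
Definition good M := sorted leq M && all (fun i => i < m)%N M.

(** The terms of lower degree. On y_j M', only the part z of x above j moves
    past y_j, and z y_j M' = y_j z M' + [z, y_j] M'. Applying y_j to the leading
    term of z M' gives leading terms only; what remains is y_j applied to the
    lower terms of z M', and the bracket. The recursive calls concern shorter
    monomials, which need not be subterms of y_j M', so that the recursion is on
    a number D, large enough when it bounds the length ([rem_act_fuel]). *)
Fixpoint rem_act (D : nat) (x : 'M[K]_n) (M : seq nat) (k : 'I_d) : N :=
  if M is j :: M' then
    if D is D'.+1 then
      let z := above j x in
      ext (fun q => topt y`_j q.1 q.2 + rem_act D' y`_j q.1 q.2) (rem_act D' z M' k)
      + (topt (lie z y`_j) M' k + rem_act D' (lie z y`_j) M' k)
    else 0
  else bvec [::] (aF (pp x) (e k)).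

Definition mon_act D x (q : seq nat * 'I_d) : N := topt x q.1 q.2 + rem_act D x q.1 q.2.

Lemma rem_actS D x j M' k : rem_act D.+1 x (j :: M') k
  = ext (mon_act D y`_j) (rem_act D (above j x) M' k)
    + mon_act D (lie (above j x) y`_j) (M', k).
Proof. by []. Qed.

Lemma topt_lin a x x' M k : topt (a *: x + x') M k = a *: topt x M k + topt x' M k.
Proof.
rewrite /topt scaler_sumr -big_split; apply: eq_bigr => i _ /=.
by rewrite c_lin scalerDl scalerA.
Qed.

Lemma lie_linl a (x x' z : 'M[K]_n) : lie (a *: x + x') z = a *: lie x z + lie x' z.
Proof.
rewrite /lie mulmxDl mulmxDr -scalemxAl -scalemxAr opprD addrACA.
by rewrite -scalerBr.
Qed.

Lemma rem_act_lin D a x x' M k :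
  rem_act D (a *: x + x') M k = a *: rem_act D x M k + rem_act D x' M k.
Proof.
have E0 u u' : bvec [::] (aF (pp (a *: u + u')) (e k)) =
    a *: bvec [::] (aF (pp u) (e k)) + bvec [::] (aF (pp u') (e k)).
  by rewrite pp_lin (act_linl rF) ?pp_p // bvec_lin.
elim: D M x x' => [|D IH] [|j M'] x x'; try exact: E0.
  by rewrite /= scaler0 addr0.
rewrite !rem_actS /mon_act /=.
rewrite above_lin lie_linl topt_lin !IH linearP.
by rewrite [X in _ + X = _]addrACA -scalerDr addrACA -scalerDr.
Qed.

Lemma mon_act_lin D a x x' q : mon_act D (a *: x + x') q = a *: mon_act D x q + mon_act D x' q.
Proof. by rewrite /mon_act topt_lin rem_act_lin scalerDr addrACA. Qed.

Definition lowdeg (D : nat) : set N :=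
  lspan [set t | exists M k, [/\ good M, (size M <= D)%N & t = bs M k]].

Lemma lowdeg_sub D : subspace (lowdeg D). Proof. exact: lspan_subspace. Qed.
Lemma lowdeg_bs D M k : good M -> (size M <= D)%N -> lowdeg D (bs M k).
Proof. by move=> gM sM; apply: sub_lspan; exists M, k. Qed.
Lemma good_ins i M : (i < m)%N -> good M -> good (insn i M).
Proof.
move=> im /andP[sM aM]; rewrite /good /insn sort_sorted ?all_sort /= ?im //.
Qed.
Lemma size_ins i M : size (insn i M) = (size M).+1.
Proof. by rewrite size_sort. Qed.
Lemma good_cons i M : good (i :: M) = [&& path leq i M, (i < m)%N & all (fun i => i < m)%N M].
Proof. by []. Qed.
Lemma good_tl i M : good (i :: M) -> good M.
Proof. by rewrite good_cons => /and3P[/path_sorted a _ b]; apply/andP. Qed.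
Lemma ins_id i M : path leq i M -> insn i M = i :: M.
Proof.
move=> h; rewrite /insn; apply: sorted_sort => //; exact: leq_trans.
Qed.

Lemma path_ins i j M : (j <= i)%N -> path leq j M -> path leq j (insn i M).
Proof.
move=> ji; rewrite !(path_sortedE leq_trans) => /andP[aM sM].
rewrite /insn all_sort /= ji aM /=; apply: sort_sorted; exact: leq_total.
Qed.

Lemma topt_deg D x M k : good M -> (size M < D)%N -> lowdeg D (topt x M k).
Proof.
move=> gM sM; apply: subspace_sum => [|i _]; first exact: lowdeg_sub.
apply: (subspaceZ _ (lowdeg_sub _)).
by apply: lowdeg_bs; rewrite ?good_ins // size_ins.
Qed.

Lemma rem_act_deg D0 D x M k : good M -> (size M <= D)%N -> lowdeg D (rem_act D0 x M k).
Proof.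
elim: D0 D x M k => [|D0 IH] D x [|j M'] k gM sM.
- apply: subspace_sum => [|i _]; first exact: lowdeg_sub.
  by apply: (subspaceZ _ (lowdeg_sub _)); apply: lowdeg_bs.
- exact: subspace0 (lowdeg_sub _).
- apply: subspace_sum => [|i _]; first exact: lowdeg_sub.
  by apply: (subspaceZ _ (lowdeg_sub _)); apply: lowdeg_bs.
case: D sM => // D sM; rewrite rem_actS; have gM' := good_tl gM.
have E x' M k' : good M -> (size M <= D)%N -> lowdeg D.+1 (mon_act D0 x' (M, k')).
  move=> gM1 sM1; apply: subspaceD (lowdeg_sub _) _ _ => /=.
    exact: topt_deg.
  by apply: IH => //; apply: leqW.
apply: subspaceD (lowdeg_sub _) _ _; last exact: E.
have := IH D (above j x) M' k gM' sM; move: (rem_act _ _ _ _).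
apply: lspan_sub => [|_ [M1 [k1 [gM1 sM1 ->]]]]; last first.
  by rewrite extE; apply: E.
split=> [|u v /= a b|a u /= b]; rewrite /= ?linear0 ?linearD ?linearZ.
- exact: subspace0 (lowdeg_sub _).
- exact: subspaceD (lowdeg_sub _) _ _.
- exact: subspaceZ (lowdeg_sub _) _.
Qed.

Lemma ext_lowdeg D (h h' : seq nat * 'I_d -> N) t :
  (forall M k, good M -> (size M <= D)%N -> h (M, k) = h' (M, k)) ->
  lowdeg D t -> ext h t = ext h' t.
Proof.
move=> hh; apply: (@lspan_sub _ _ _ [set t | ext h t = ext h' t]).
  split=> [|u v a b|a u b]; rewrite /mkset ?linear0 //.
    by rewrite !linearD; congr (_ + _).
  by rewrite !linearZ; congr (_ *: _).
by move=> _ [M [k [gM sM ->]]] /=; rewrite !extE hh.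
Qed.

Lemma rem_act_fuelS D x M k : good M -> (size M <= D)%N ->
  rem_act D.+1 x M k = rem_act D x M k.
Proof.
elim: D x M k => [|D IH] x [|j M'] k gM sM //; have gM' := good_tl gM.
rewrite (rem_actS D.+1) (rem_actS D) (IH _ _ _ gM' sM); congr (_ + _).
  apply: (@ext_lowdeg D) => [M1 k1 gM1 sM1|]; last exact: rem_act_deg.
  by congr (_ + _); apply: IH.
by congr (_ + _); apply: IH.
Qed.

Lemma rem_act_fuel D x M k : good M -> (size M <= D)%N ->
  rem_act D x M k = rem_act (size M) x M k.
Proof.
move=> gM; elim: D => [|D IH]; first by rewrite leqn0 => /eqP ->.
rewrite leq_eqVlt => /orP[/eqP <- //|]; rewrite ltnS => sM.
by rewrite rem_act_fuelS // IH.
Qed.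

Definition pbw_mon x q : N := if good q.1 then mon_act (size q.1) x q else 0.
Definition pbw_act x : N -> N := ext (pbw_mon x).
Local Notation act := pbw_act.

Lemma pact_lin x a u v : act x (a *: u + v) = a *: act x u + act x v.
Proof. exact: linearP. Qed.
Lemma pact0 x : act x 0 = 0. Proof. exact: linear0. Qed.
Lemma pactD x u v : act x (u + v) = act x u + act x v. Proof. exact: linearD. Qed.
Lemma pactB x u v : act x (u - v) = act x u - act x v. Proof. exact: linearB. Qed.
Lemma pactZ x a u : act x (a *: u) = a *: act x u. Proof. exact: linearZ. Qed.
Lemma pact_sum x I (r : seq I) P (f : I -> N) :
  act x (\sum_(i <- r | P i) f i) = \sum_(i <- r | P i) act x (f i).
Proof. exact: linear_sum. Qed.
Lemma pact_ind (P : set N) : subspace P -> (forall q, P (nbas q)) -> forall t, P t.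
Proof.
move=> sP Pb t; have : lspan [set nbas q | q in setT] t by rewrite nspan.
by apply: lspan_sub => // _ [q _ <-].
Qed.
Lemma pact_linl a x x' t : act (a *: x + x') t = a *: act x t + act x' t.
Proof.
move: t; apply: pact_ind => [|q].
  split=> [|u v /= IHu IHv|b u /= IHu]; rewrite /mkset ?linear0 ?pact0 ?scaler0 ?addr0 //.
    by rewrite !pactD IHu IHv scalerDr addrACA.
  by rewrite !pactZ IHu scalerDr !scalerA mulrC.
rewrite /act !extE /pbw_mon.
by case: ifP => _; [rewrite mon_act_lin | rewrite scaler0 addr0].
Qed.
Lemma pact0l t : act 0 t = 0.
Proof. by have := pact_linl (-1) 0 0 t; rewrite scaler0 addr0 scaleN1r addNr. Qed.
Lemma pactZl a x t : act (a *: x) t = a *: act x t.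
Proof. by have := pact_linl a x 0 t; rewrite pact0l !addr0. Qed.

Lemma pact_bs x M k : good M -> act x (bs M k) = topt x M k + rem_act (size M) x M k.
Proof. by move=> gM; rewrite /act extE /pbw_mon /= gM. Qed.

Lemma ext_mon_act D x t : lowdeg D t -> ext (mon_act D x) t = act x t.
Proof.
apply: ext_lowdeg => M k gM sM.
by rewrite /pbw_mon /mon_act /= gM rem_act_fuel.
Qed.

Lemma rem_act0 D M k : rem_act D 0 M k = 0.
Proof.
have := rem_act_lin D (-1) 0 0 M k.
by rewrite scaler0 addr0 scaleN1r addNr.
Qed.

Lemma topt_y (i : 'I_m) M k : topt y`_i M k = bs (insn i M) k.
Proof.
rewrite /topt (bigD1 i) //= c_y eqxx scale1r big1 ?addr0 // => j /negPf ji.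
by rewrite c_y ji scale0r.
Qed.

(** Inserting y_i in front of a list that stays sorted leaves no correction: no
    component of y_i lies above the first index of the list. *)
Lemma pact_y (i : 'I_m) M k : good (val i :: M) -> act y`_i (bs M k) = bs (val i :: M) k.
Proof.
move=> giM; have gM := good_tl giM; move: (giM); rewrite good_cons => /and3P[piM _ _].
rewrite pact_bs // topt_y ins_id //.
suff -> : rem_act (size M) y`_i M k = 0 by rewrite addr0.
case: M piM {giM gM} => [|j M] /=.
  by move=> _; rewrite pp_y (act0l rF) bvec0.
move=> /andP[ij _]; have -> : above j y`_i = 0.
  rewrite /above pp_y addr0 big1 // => k' jk'; rewrite c_y.
  by case: eqP jk' => [->|_]; [rewrite ltnNge ij|rewrite scale0r].
rewrite rem_act0 linear0 add0r.
have -> : lie 0 y`_j = 0 by rewrite /lie mul0mx mulmx0 subrr.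
rewrite rem_act0 addr0 /topt big1 // => k' _.
by rewrite c0 scale0r.
Qed.

(** The recursion that defines the action, free of the bound D. *)
Lemma pact_above (j : 'I_m) z M k : good (val j :: M) -> above j z = z ->
  act z (bs (val j :: M) k) = act y`_j (act z (bs M k)) + act (lie z y`_j) (bs M k).
Proof.
move=> gjM az; have gM := good_tl gjM; move: (gjM); rewrite good_cons => /and3P[pjM jm _].
rewrite pact_bs // rem_actS az ext_mon_act; last exact: rem_act_deg.
rewrite addrA -[X in _ = _ + X]/(act _ (bs M k)).
rewrite [X in _ = _ + X]pact_bs // -/(mon_act _ _ (M, k)); congr (_ + _).
rewrite [act z _]pact_bs // pactD; congr (_ + _).
rewrite pact_sum /topt; apply: eq_bigr => i _; rewrite pactZ.
case: (ltnP j i) => ji; last first.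
  suff -> : c z i = 0 by rewrite !scale0r.
  rewrite -az /above cD (c_p _ (pp_p _)) addr0 c_sum big1 // => i0 ji0.
  rewrite cZ c_y; case: eqP ji0 => [<-|_]; last by rewrite mulr0.
  by rewrite ltnNge ji.
have e1 : insn i (val j :: M) = val j :: insn i M.
  apply: (sorted_eq leq_trans anti_leq).
  - by apply: sort_sorted; apply: leq_total.
- by apply: path_ins (ltnW ji) pjM.
  - rewrite /insn perm_sort; apply: (@perm_trans _ [:: val j, (i : nat) & M]).
      exact: (permEl (perm_catCA [:: i : nat] [:: val j] M)).
    by rewrite perm_cons perm_sym perm_sort.
rewrite e1 pact_y //; rewrite good_cons jm.
have /andP[_ ->] := good_ins (ltn_ord i) gM; rewrite andbT.
by rewrite andbT; apply: path_ins (ltnW ji) pjM.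
Qed.

Local Notation Br t x x' :=
  (act x (act x' t) - act x' (act x t) = act (lie x x') t).

Lemma lie_anti (x x' : 'M[K]_n) : lie x x' = - lie x' x.
Proof. by rewrite /lie opprB. Qed.
Lemma lie_self (x : 'M[K]_n) : lie x x = 0. Proof. by rewrite /lie subrr. Qed.
Lemma lie_jacobi (x x' z : 'M[K]_n) :
  lie (lie x x') z = lie x (lie x' z) - lie x' (lie x z).
Proof.
rewrite /lie !mulmxBr !mulmxBl !mulmxA !opprB.
rewrite !addrA; apply/eqP; rewrite -subr_eq0; apply/eqP.
set A := x *m x' *m z; set B := x' *m x *m z; set C := z *m x *m x'.
set D := z *m x' *m x; set E := x *m z *m x'; set G := x' *m z *m x.
by apply/matrixP => a b; rewrite !mxE; ring.
Qed.

Lemma Br_sym t x x' : Br t x x' -> Br t x' x.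
Proof.
move=> h; have -> : lie x' x = (-1) *: lie x x' by rewrite lie_anti scaleN1r.
by rewrite pactZl -h scaleN1r opprB.
Qed.
Lemma Br_self t x : Br t x x.
Proof. by rewrite lie_self pact0l subrr. Qed.
Lemma Br_lin t x' a x z : Br t x x' -> Br t z x' -> Br t (a *: x + z) x'.
Proof.
move=> h h'; rewrite lie_linl !pact_linl pact_lin -h -h' scalerBr opprD.
by rewrite addrACA.
Qed.
Lemma Br_sum t x' (I : Type) (r : seq I) (P : pred I) (f : I -> 'M[K]_n) (a : I -> K) z :
  (forall i, P i -> Br t (f i) x') -> Br t z x' ->
  Br t (\sum_(i <- r | P i) a i *: f i + z) x'.
Proof.
move=> h h'; elim/big_rec: _ => [|i s Pi IH]; first by rewrite add0r.
by rewrite -addrA; apply: Br_lin => //; apply: h.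
Qed.

Lemma Br_vec x x' t u a : Br t x x' -> Br u x x' -> Br (a *: t + u) x x'.
Proof.
move=> h h'; rewrite !pact_lin -h -h' scalerBr opprD.
by rewrite addrACA.
Qed.
Lemma Br_subspace x x' : subspace [set t | Br t x x'].
Proof.
split=> [|u v h h'|a u h]; rewrite /mkset; first by rewrite !pact0 subrr.
  by have := Br_vec 1 h h'; rewrite scale1r.
have z0 : Br 0 x x' by rewrite !pact0 subrr.
by have := Br_vec a h z0; rewrite addr0.
Qed.

Lemma above_above j x : above j (above j x) = above j x.
Proof.
rewrite {1}/above; congr (_ + _); last first.
  rewrite /above /pp linearD /= linear_sum big1 ?add0r => [|i _].
    exact: pp_id (pp_p _).
  by rewrite linearZ /= -/(pp _) pp_y scaler0.
apply: eq_bigr => i ji; congr (_ *: _).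
rewrite cD (c_p _ (pp_p _)) addr0 c_sum (bigD1 i) //= cZ c_y eqxx mulr1.
rewrite big1 ?addr0 // => i0 /andP[_ /negPf i0i].
by rewrite cZ c_y eq_sym i0i mulr0.
Qed.
Lemma above_y (i j : 'I_m) : (j < i)%N -> above j y`_i = y`_i.
Proof.
move=> ji; rewrite /above pp_y addr0 (bigD1 i) //= c_y eqxx scale1r big1 ?addr0 //.
by move=> k /andP[_ /negPf ki]; rewrite c_y ki scale0r.
Qed.
Lemma above_split j x : x \in g ->
  x = \sum_(i < m | (i <= j)%N) c x i *: y`_i + above j x.
Proof.
move=> gx; rewrite {1}(x_decomp gx) /above addrA; congr (_ + _).
rewrite (bigID (fun i : 'I_m => (i <= j)%N)) /=; congr (_ + _).
by apply: eq_bigl => i; rewrite ltnNge.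
Qed.

(** This is the recursion [pact_above], read as a bracket relation. *)
Lemma Br_above (i : 'I_m) M k x : good (val i :: M) -> above i x = x ->
  Br (bs M k) x y`_i.
Proof.
move=> gi ax; rewrite (pact_y _ gi) (pact_above _ gi ax).
by rewrite addrAC subrr add0r.
Qed.

(** The part of x above i is covered by [Br_above]. A component y_j of x with
    j < i may itself be put in front of M, so that the roles of x and y_i can be
    exchanged. *)
Lemma Br_low (i : 'I_m) M k x : good (val i :: M) -> x \in g -> Br (bs M k) x y`_i.
Proof.
move=> gi gx; rewrite (above_split i gx); apply: Br_sum => [j ji|]; last first.
  by apply: Br_above => //; apply: above_above.
case: (ltngtP j i) ji => // [ji _|/val_inj -> _]; last exact: Br_self.
apply: Br_sym; apply: Br_above; last exact: above_y.
move: gi; rewrite !good_cons ltn_ord /= => /andP[].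
case: M => [|l M] /=; first by rewrite ltn_ord.
by move=> /andP[il ->] ->; rewrite ltn_ord (leq_trans (ltnW ji) il).
Qed.

Lemma pbw_bvec_p u f : u \in p -> act u (bvec [::] f) = bvec [::] (aF u f).
Proof.
move=> pu; rewrite /bvec pact_sum.
transitivity (\sum_(k0 < d) coord (vbasis fullv) k0 f *: bvec [::] (aF u (e k0))).
  apply: eq_bigr => k0 _; rewrite pactZ pact_bs //= (pp_id pu) /topt.
  by rewrite big1 ?add0r // => i _; rewrite c_p // scale0r.
have bv_lin : linear (bvec [::]) by move=> a' v v'; apply: bvec_lin.
pose bl : {linear F -> N} := HB.pack (bvec [::]) (GRing.isLinear.Build _ _ _ _ _ bv_lin).
rewrite -[LHS]/(\sum_(k0 < d) coord (vbasis fullv) k0 f *: bl (aF u (e k0))).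
rewrite -[RHS]/(bl (aF u f)) [in RHS](coord_vbasis (memvf f)).
rewrite (act_sum rF) // linear_sum; apply: eq_bigr => i _.
by rewrite (actZ rF) // linearZ.
Qed.

(** Induction on the length. By [Br_low] it suffices to treat two elements above
    the first index j. Both are moved past y_j, and the terms that arise cancel
    by the induction hypothesis and the Jacobi identity. On the empty monomial
    this is the bracket relation of F. *)
Lemma Br_monomial M k x x' : good M -> x \in g -> x' \in g -> Br (bs M k) x x'.
Proof.
have [D] := ubnP (size M); elim: D M k x x' => // D IH M k x x' sM gM gx gx'.
case: M gM sM => [|j M] gM sM.
  have low x'' (i : 'I_m) : x'' \in g -> Br (bs [::] k) x'' y`_i.
    by move=> gx''; apply: Br_low => //; rewrite /good /= ltn_ord.
  rewrite (x_decomp gx); apply: Br_sum => [i _|].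
    by apply: Br_sym; apply: low.
  apply: Br_sym; rewrite (x_decomp gx'); apply: Br_sum => [i _|].
    by apply: Br_sym; apply: low; apply: pp_g.
  rewrite -bvec_e !pbw_bvec_p ?pp_p //; last by apply: pL; apply: pp_p.
  rewrite (act_lie rF) ?pp_p // -scaleN1r addrC -bvec_lin.
  by rewrite scaleN1r addrC.
have jm : (j < m)%N by move: gM; rewrite good_cons => /and3P[].
pose jo := Ordinal jm; have gM' := good_tl gM.
have low x'' (i : 'I_m) : (i <= j)%N -> x'' \in g -> Br (bs (j :: M) k) x'' y`_i.
  move=> ij gx''; apply: Br_low => //; move: gM; rewrite !good_cons => /and3P[a b c'].
  by rewrite /= ij a ltn_ord b c'.
suff hi u u' : above j u = u -> above j u' = u' -> u \in g -> u' \in g ->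
    Br (bs (j :: M) k) u u'.
  rewrite (above_split j gx); apply: Br_sum => [i ij|].
    by apply: Br_sym; apply: low.
  apply: Br_sym; rewrite (above_split j gx'); apply: Br_sum => [i ij|].
    by apply: Br_sym; apply: low => //; apply: above_g.
  by apply: hi; rewrite ?above_above ?above_g.
move=> au au' gu gu'.
have IH' t v v' : lowdeg (size M) t -> v \in g -> v' \in g -> Br t v v'.
  move=> ht gv gv'; move: t ht; apply: (@lspan_sub _ _ _ [set t | Br t v v']).
    exact: Br_subspace.
  by move=> _ [M1 [k1 [gM1 sM1 ->]]]; apply: IH => //; apply: leq_ltn_trans sM1 _.
have lM : lowdeg (size M) (bs M k) by apply: lowdeg_bs.
have gj := yg jo.
(* The leading term of v' M consists of monomials as long as y_j M, out of reach
   of the induction hypothesis; but y_j may be put in front of them. *)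
have key v v' : above j v = v -> v \in g -> above j v' = v' -> Br (act v' (bs M k)) v y`_jo.
  move=> av gv av'; rewrite pact_bs //.
  have := subspaceD (Br_subspace v y`_jo); apply; last first.
    by apply: IH' => //; apply: rem_act_deg.
  rewrite /topt; apply: (@subspace_sum _ _ [set t | Br t v y`_jo] _ _ _ _ (Br_subspace _ _)) => i _.
  case: (ltnP j i) => ji; last first.
    suff -> : c v' i = 0 by rewrite scale0r; exact: subspace0 (Br_subspace _ _).
    rewrite -av' /above cD (c_p _ (pp_p _)) addr0 c_sum big1 // => i0 ji0.
    rewrite cZ c_y; case: eqP ji0 => [<-|_]; last by rewrite mulr0.
    by rewrite ltnNge ji.
  apply: subspaceZ (Br_subspace _ _) _; apply: Br_above => //=.
  rewrite good_cons jm; have /andP[_ ->] := good_ins (ltn_ord i) gM'.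
  rewrite !andbT; apply: path_ins (ltnW ji) _.
  by move: gM; rewrite good_cons => /and3P[].
have yM : bs (j :: M) k = act y`_jo (bs M k) by rewrite pact_y.
have sw v v' t : Br t v v' -> act v (act v' t) = act v' (act v t) + act (lie v v') t.
  by move=> <-; rewrite addrC subrK.
have glie v v' : v \in g -> v' \in g -> lie v v' \in g by apply: gL.
(* Both elements are moved past y_j; the first summand is symmetric in v and v'
   and disappears from the commutator. *)
have half v v' : above j v = v -> above j v' = v' -> v \in g -> v' \in g ->
    act v (act v' (bs (j :: M) k)) = (act (lie v y`_jo) (act v' (bs M k))
      + act (lie v' y`_jo) (act v (bs M k)))
      + (act y`_jo (act v (act v' (bs M k))) + act (lie v (lie v' y`_jo)) (bs M k)).
  move=> av av' gv gv'; have glv' := glie _ _ gv' gj.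
  rewrite yM (sw v' y`_jo _ (IH' _ _ _ lM gv' gj)) pactD.
  rewrite (sw v y`_jo _ (key _ _ av gv av')) (sw v _ _ (IH' _ _ _ lM gv glv')).
  by rewrite [X in X + _ = _]addrC addrACA.
have glu := glie _ _ gu gu'.
rewrite (half _ _ au au' gu gu') (half _ _ au' au gu' gu).
rewrite [X in _ - (X + _)]addrC opprD addrACA subrr add0r opprD addrACA -pactB.
rewrite (IH' _ _ _ lM gu gu') yM (sw _ _ _ (IH' _ _ _ lM glu gj)); congr (_ + _).
have := pact_linl (-1) (lie u' (lie u y`_jo)) (lie u (lie u' y`_jo)) (bs M k).
by rewrite !scaleN1r => h; rewrite lie_jacobi [X in _ = act X _]addrC h addrC.
Qed.

Lemma pbw_rep : is_rep g act.
Proof.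
split=> [x a u v _|a x x' v _ _|x x' v gx gx']; first exact: pact_lin.
  exact: pact_linl.
apply/esym; move: v; apply: pact_ind => [|[M k]]; first exact: Br_subspace.
case: (boolP (good M)) => gM; first exact: Br_monomial.
have z u : act u (bs M k) = 0 by rewrite /act extE /pbw_mon /= (negPf gM).
by rewrite !z !pact0 subrr.
Qed.

Lemma pbw_word M f : good M -> foldr (fun i => act y`_i) (bvec [::] f) M = bvec M f.
Proof.
elim: M => [//|i M IH] gM /=; rewrite IH ?(good_tl gM) //.
have im : (i < m)%N by move: gM; rewrite good_cons => /and3P[].
rewrite /bvec pact_sum; apply: eq_bigr => k _; rewrite pactZ; congr (_ *: _).
exact: (pact_y (i := Ordinal im)).
Qed.

End PBW.

Section PBWInduced.
Context (K : fieldType) (n : nat) (g p : {vspace 'M[K]_n}).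
Hypotheses (gL : is_liealg g) (pL : is_liealg p) (pg : (p <= g)%VS).
Context (m : nat) (y : m.-tuple 'M[K]_n).
Hypotheses (yfree : free y) (yp : (<<y>> + p)%VS = g) (ydir : (<<y>> :&: p)%VS = 0%VS).
Context (F : vectType K) (aF : 'M[K]_n -> F -> F) (rF : is_rep p aF).

Local Notation d := (\dim {:F}).
Local Notation N := (malg (seq nat * 'I_d)%type K).
Local Notation ind := (induced g p aF).

Definition ymon (V : lmodType K) (act : 'M[K]_n -> V -> V) (M : seq nat) (v : V) : V :=
  foldr (fun i => act y`_i) v M.

(** The independence half of the Poincare-Birkhoff-Witt theorem for an induced
    module. Frobenius reciprocity maps it to the module built above, on a space
    that has the ordered monomials as a basis. *)
Theorem pbw_indep (s : seq (seq nat)) (f : seq nat -> F) :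
  uniq s -> all (good m) s ->
  \sum_(M <- s) ymon (@induced_act K n g p F aF) M (tens p aF 1 (f M)) = 0 ->
  forall M, M \in s -> f M = 0.
Proof.
move=> us gs s0.
pose nbas (q : seq nat * 'I_d) : N := mkmalgU q 1.
pose ext (h : seq nat * 'I_d -> N) : {linear N -> N} := lext h.
have extE h q : ext h (nbas q) = h q by apply: etrans (lextU _ _ _) (scale1r _).
have nspan : lspan [set nbas q | q in setT] = setT.
  apply/seteqP; split=> // t _; elim/malg_ind: t => [|a q t IH].
    exact: subspace0 (lspan_subspace _).
  apply: (subspaceD (lspan_subspace _)) => //; apply: (subspaceZ _ (lspan_subspace _)).
  by apply: sub_lspan; exists q.
pose bv := @bvec K F N nbas.
pose act := @pbw_act K n p m y F aF N nbas ext.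
have rN : is_rep g act by apply: pbw_rep.
have bv_p x v : x \in p -> bv [::] (aF x v) = act x (bv [::] v).
  by move=> px; apply/esym; apply: (@pbw_bvec_p K n g p) => //.
have bv_lin a u v : bv [::] (a *: u + v) = a *: bv [::] u + bv [::] v by apply: bvec_lin.
have [L [L1 Lact]] := frobenius gL rN pg bv_lin bv_p.
have LE M v : good m M -> L (ymon (@induced_act K n g p F aF) M (tens p aF 1 v)) = bv M v.
  move=> gM; have <- : foldr (fun i => act y`_i) (bv [::] v) M = bv M v.
    exact: (@pbw_word K n g p).
  have : all (fun i => i < m)%N M by case/andP: gM.
  elim: M {gM} => [|i M IH] /=; first by rewrite L1.
  move=> /andP[im aM]; rewrite Lact; first by rewrite IH.
  exact: (yg yp (Ordinal im)).
have : L (\sum_(M <- s) ymon (@induced_act K n g p F aF) M (tens p aF 1 (f M))) = 0.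
  by rewrite s0 linear0.
rewrite linear_sum big_seq => E.
have {}E : \sum_(M <- s) bv M (f M) = 0.
  rewrite -[RHS]E big_seq; apply: eq_bigr => M Ms.
  by rewrite LE //; apply: (allP gs).
move=> M Ms; rewrite (coord_vbasis (memvf (f M))); apply: big1 => k _.
suff -> : coord (vbasis fullv) k (f M) = 0 by rewrite scale0r.
have := congr1 (mcoeff (M, k)) E; rewrite mcoeff0 raddf_sum /=.
have bvE M' : mcoeff (M, k) (bv M' (f M')) = coord (vbasis fullv) k (f M') *+ (M' == M).
  rewrite /bv /bvec raddf_sum /= (bigD1 k) //= big1 ?addr0 => [|k' /negPf kk'].
    by rewrite mcoeffZ mcoeffU xpair_eqE eqxx andbT mulrnAr mulr1.
  by rewrite mcoeffZ mcoeffU xpair_eqE kk' andbF mulr0.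
rewrite (bigD1_seq M) //= bvE eqxx big1 ?addr0 // => M' /negPf MM'.
by rewrite bvE MM'.
Qed.

End PBWInduced.

(** * Spanning by ordered monomials *)
Section PBWSpanning.
Context (K : fieldType) (n : nat) (g q : {vspace 'M[K]_n}).
Hypotheses (gL : is_liealg g) (qg : (q <= g)%VS).
Context (m : nat) (y : m.-tuple 'M[K]_n).
Hypotheses (yg : forall i : 'I_m, y`_i \in g) (gyq : (g <= <<y>> + q)%VS).
Context (V : lmodType K) (act : 'M[K]_n -> V -> V) (r : is_rep g act).
Context (P : set V) (sP : subspace P) (Pq : forall x v, x \in q -> P v -> P (act x v)).

Local Notation ymon := (ymon y act).

Definition ysorted : set V :=
  lspan [set w | exists M v, [/\ good m M, P v & w = ymon M v]].

(** Monomials in arbitrary order, filtered by length: sorting is possible up to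
    shorter ones. *)
Definition ywords (D : nat) : set V :=
  lspan [set w | exists M v,
    [/\ all (fun i => i < m)%N M, (size M <= D)%N, P v & w = ymon M v]].

Lemma ywords_sub D : subspace (ywords D). Proof. exact: lspan_subspace. Qed.
Lemma ywords_le D D' v : (D <= D')%N -> ywords D v -> ywords D' v.
Proof.
move=> le; apply: lspanS => _ [M [w [aM sM Pw ->]]]; exists M, w; split=> //.
exact: leq_trans le.
Qed.
Lemma ywords_mon D M v : all (fun i => i < m)%N M -> (size M <= D)%N -> P v ->
  ywords D (ymon M v).
Proof. by move=> aM sM Pv; apply: sub_lspan; exists M, v. Qed.

Lemma ynat i : (i < m)%N -> y`_i \in g.
Proof. by move=> im; apply: (yg (Ordinal im)). Qed.

Lemma lspan_act x (S W : set V) v : x \in g -> subspace W ->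
  (forall w, S w -> W (act x w)) -> lspan S v -> W (act x v).
Proof.
move=> gx sW SW; apply: (@lspan_sub _ _ _ [set v | W (act x v)]) => //.
split=> [|u w /= Wu Ww|a u /= Wu]; rewrite /mkset.
- by rewrite (act0 r) //; apply: subspace0.
- by rewrite (actD r) //; apply: subspaceD.
- by rewrite (actZ r) //; apply: subspaceZ.
Qed.

Lemma ywords_y D i v : (i < m)%N -> ywords D v -> ywords D.+1 (act y`_i v).
Proof.
move=> im; apply: lspan_act; [exact: ynat|exact: ywords_sub|].
move=> _ [M [w [aM sM Pw ->]]].
by apply: (@ywords_mon _ (i :: M)) => //=; rewrite im.
Qed.

Lemma split_yq x v (W : set V) : x \in g -> subspace W ->
  (forall i, (i < m)%N -> W (act y`_i v)) -> (forall z, z \in q -> W (act z v)) ->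
  W (act x v).
Proof.
move=> gx sW Wy Wq; have /memv_addP[u uy [z zq ->]] := subvP gyq _ gx.
rewrite (coord_span uy) (actDl r); first last.
- exact: (subvP qg).
- by rewrite rpred_sum // => i _; rewrite rpredZ // yg.
apply: (subspaceD sW); last exact: Wq.
rewrite (act_suml r) => [|i _]; last by rewrite rpredZ // yg.
by apply: subspace_sum => // i _; rewrite (actZl r) ?yg //; apply: subspaceZ => //; apply: Wy.
Qed.

(** Moving x towards P past one y_i leaves a bracket applied to a shorter
    monomial. *)
Lemma ywords_act D v : ywords D v ->
  (forall x, x \in q -> ywords D (act x v)) /\ (forall x, x \in g -> ywords D.+1 (act x v)).
Proof.
suff hq : forall x, x \in q -> forall w, ywords D w -> ywords D (act x w).
  move=> Wv; split=> x xq; first exact: hq.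
  apply: split_yq => //; first exact: ywords_sub.
    by move=> i im; apply: ywords_y.
  by move=> z zq; apply: ywords_le (leqnSn _) _; apply: hq.
elim: D {v} => [|D IH] x xq w; apply: lspan_act; rewrite ?(subvP qg) //;
  try exact: ywords_sub.
  move=> _ [[|? ?] [u [aM sM Pu ->]]] //.
  by apply: (@ywords_mon _ [::]) => //; apply: Pq.
move=> _ [[|i M] [u [aM sM Pu ->]]].
  by apply: (@ywords_mon _ [::]) => //; apply: Pq.
move: aM => /= /andP[im aM]; have gx := subvP qg _ xq; have gi := ynat im.
have WM : ywords D (ymon M u) by apply: ywords_mon.
rewrite (act_swap r) //; apply: (subspaceD (ywords_sub _)).
  by apply: ywords_y => //; apply: IH.
apply: split_yq; [exact: gL|exact: ywords_sub|by move=> *; apply: ywords_y|].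
by move=> z zq; apply: ywords_le (leqnSn _) _; apply: IH.
Qed.

Lemma ymon_insn i M v : (i < m)%N -> good m M -> P v ->
  ywords (size M) (ymon (i :: M) v - ymon (insn i M) v).
Proof.
move=> im; elim: M => [|j M IH] gM Pv.
  by rewrite /insn /= subrr; exact: subspace0 (ywords_sub _).
case: (leqP i j) => ij.
  rewrite ins_id /= ?ij ?subrr; first exact: subspace0 (ywords_sub _).
  by case/andP: gM.
have gM' := good_tl gM; move: (gM); rewrite good_cons => /and3P[pjM jm aM].
have -> : insn i (j :: M) = j :: insn i M.
  apply: (sorted_eq leq_trans anti_leq); first by apply: sort_sorted; apply: leq_total.
    exact: path_ins (ltnW ij) pjM.
  rewrite /insn perm_sort; apply: (@perm_trans _ [:: j, i & M]).
    exact: (permEl (perm_catCA [:: i] [:: j] M)).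
  by rewrite perm_cons perm_sym perm_sort.
rewrite /= (act_swap r) ?ynat // addrAC -(actB r) ?ynat //.
apply: (subspaceD (ywords_sub _)); first by apply: ywords_y => //; apply: IH.
have WM : ywords (size M) (ymon M v) by apply: ywords_mon.
by apply: (ywords_act WM).2; apply: gL; apply: ynat.
Qed.

Lemma ywords_sorted D : ywords D `<=` ysorted.
Proof.
suff h : ywords D `<=` lspan [set w | exists M v,
    [/\ good m M, (size M <= D)%N, P v & w = ymon M v]].
  move=> v /h; apply: lspanS => _ [M [w [gM _ Pw ->]]]; by exists M, w.
elim: D => [|D IH]; apply: lspan_sub; try exact: lspan_subspace.
  by move=> _ [[|? ?] [u [aM sM Pu ->]]] //; apply: sub_lspan; exists [::], u.
set W := lspan _ in IH *; set W' := lspan _.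
have sW' : subspace W' by exact: lspan_subspace.
have WW' : W `<=` W'.
  apply: lspanS => _ [M [w [gM sM Pw ->]]]; exists M, w; split=> //.
  exact: leqW.
move=> _ [[|i M] [u [aM sM Pu ->]]].
  by apply: sub_lspan; exists [::], u.
move: aM => /= /andP[im aM].
have /IH : ywords D (ymon M u) by apply: ywords_mon.
apply: lspan_act; rewrite ?ynat // => _ [M1 [v [gM1 sM1 Pv ->]]].
rewrite -[act _ _](subrK (ymon (insn i M1) v)); apply: (subspaceD sW').
  by have h := ymon_insn im gM1 Pv; exact: (WW' _ (IH _ (ywords_le sM1 h))).
apply: sub_lspan; exists (insn i M1), v; split=> //; last by rewrite size_ins.
exact: good_ins.
Qed.

(** The spanning half of the Poincare-Birkhoff-Witt theorem: a monomial can be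
    sorted, because each exchange costs a commutator, which shortens it. *)
Theorem pbw_span : submod g act ysorted.
Proof.
split=> [|x v gx]; first exact: lspan_subspace.
apply: lspan_act => // [|_ [M [w [gM Pw ->]]]]; first exact: lspan_subspace.
apply: (@ywords_sorted (size M).+1); apply: (ywords_act _).2 => //.
by apply: ywords_mon => //; case/andP: gM.
Qed.

Lemma ysorted_sub : P `<=` ysorted.
Proof. by move=> v Pv; apply: sub_lspan; exists [::], v. Qed.

End PBWSpanning.

Section SortedExpansion.
Context (K : fieldType) (n : nat) (g : {vspace 'M[K]_n}).
Context (m : nat) (y : m.-tuple 'M[K]_n) (yg : forall i : 'I_m, y`_i \in g).
Context (V : lmodType K) (act : 'M[K]_n -> V -> V) (r : is_rep g act).
Local Notation ymon := (ymon y act).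

Lemma ymon_lin M a u v : good m M ->
  ymon M (a *: u + v) = a *: ymon M u + ymon M v.
Proof.
case/andP=> _; elim: M => [//|i M IH] /= /andP[im aM].
by rewrite IH // (act_lin r) //; apply: (yg (Ordinal im)).
Qed.
Lemma ymon0 M : good m M -> ymon M 0 = 0.
Proof.
by move=> gM; have := ymon_lin (-1) 0 0 gM; rewrite scaler0 addr0 scaleN1r addNr.
Qed.

(** Collecting the terms with the same monomial gives the form in which
    independence of the monomials can be used. *)
Lemma ysortedP (P : set V) v : subspace P -> ysorted y act P v ->
  exists s (f : seq nat -> V), [/\ uniq s, all (good m) s, forall M, P (f M) &
    v = \sum_(M <- s) ymon M (f M)].
Proof.
move=> sP.
pose W : set V := [set v | exists s (f : seq nat -> V),
  [/\ uniq s, all (good m) s, forall M, P (f M) & v = \sum_(M <- s) ymon M (f M)]].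
suff sW : subspace W.
  apply: (lspan_sub sW) => _ [M [w [gM Pw ->]]].
  exists [:: M], (fun=> w); split=> //; first by rewrite /= gM.
  by rewrite big_seq1.
split.
- by exists [::], (fun=> 0); split=> // [_|]; rewrite ?big_nil //; apply: subspace0.
- move=> _ _ [s [f [us gs Pf ->]]] [t [h [ut gt Ph ->]]].
  pose f' M := if M \in s then f M else 0; pose h' M := if M \in t then h M else 0.
  exists (undup (s ++ t)), (fun M => f' M + h' M); split.
  + exact: undup_uniq.
  + by apply/allP => M; rewrite mem_undup mem_cat => /orP[/(allP gs)|/(allP gt)].
  + move=> M; apply: (subspaceD sP); rewrite /f' /h'; case: ifP => _ //; exact: subspace0.
  have ext (u : seq (seq nat)) (k : seq nat -> V) : uniq u ->
      {subset u <= undup (s ++ t)} -> all (good m) u ->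
      \sum_(M <- u) ymon M (k M) =
      \sum_(M <- undup (s ++ t)) ymon M (if M \in u then k M else 0).
    move=> uu su gu; rewrite [RHS](bigID (mem u)) /= [X in _ = _ + X]big1_seq ?addr0; last first.
      move=> M /andP[/negPf Mu]; rewrite Mu mem_undup mem_cat => Mst; apply: ymon0.
      by case/orP: Mst => [/(allP gs)|/(allP gt)].
    rewrite -[RHS]big_filter.
    have pe : perm_eq u [seq M <- undup (s ++ t) | M \in u].
      apply: uniq_perm => //; first by rewrite filter_uniq ?undup_uniq.
      by move=> M; rewrite mem_filter; case Mu: (M \in u); rewrite //= su.
    rewrite -(perm_big _ pe) /=; apply: eq_big_seq => M ->; by [].
  rewrite (ext s f) ?(ext t h) //; first last.
  + by move=> M Ms; rewrite mem_undup mem_cat Ms.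
  + by move=> M Ms; rewrite mem_undup mem_cat Ms orbT.
  rewrite -big_split /=; apply: eq_big_seq => M; rewrite mem_undup mem_cat => Mst.
  have gM : good m M by case/orP: Mst => [/(allP gs)|/(allP gt)].
  by have := ymon_lin 1 (f' M) (h' M) gM; rewrite !scale1r => ->.
- move=> a _ [s [f [us gs Pf ->]]].
  exists s, (fun M => a *: f M); split=> //; first by move=> M; apply: subspaceZ.
  rewrite scaler_sumr; apply: eq_big_seq => M Ms.
  have gM := allP gs _ Ms.
  by have := ymon_lin a (f M) 0 gM; rewrite ymon0 // !addr0 => ->.
Qed.

End SortedExpansion.

(** * Composition multiplicities *)
Lemma ereal_sup_add_le (R : realType) (S1 S2 : set (\bar R)) (c : \bar R) :
  S1 !=set0 -> S2 !=set0 -> (forall x, S1 x -> x \is a fin_num) ->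
  (forall x, S2 x -> x \is a fin_num) ->
  (forall x y, S1 x -> S2 y -> (x + y <= c)%E) ->
  (ereal_sup S1 + ereal_sup S2 <= c)%E.
Proof.
move=> [x S1x] [y S2y] f1 f2 h.
have [->|cy] := eqVneq c +oo%E; first exact: leey.
have le1 z : S2 z -> (ereal_sup S1 <= c - z)%E.
  by move=> S2z; apply: ge_ereal_sup => u S1u; rewrite leeBrDr ?f2 //; apply: h.
have fs : ereal_sup S1 \is a fin_num.
  rewrite fin_numElt; apply/andP; split.
    apply: lt_le_trans (ereal_sup_ubound S1x).
    by have := f1 _ S1x; rewrite fin_numElt => /andP[].
  apply: le_lt_trans (le1 _ S2y) _.
  have := f2 _ S2y; case: (y) => // t _; move: cy; case: (c) => // u _; by rewrite ltry.
rewrite addeC -leeBrDr //; apply: ge_ereal_sup => z S2z.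
by rewrite leeBrDr // addeC -leeBrDr ?f2 //; apply: le1.
Qed.

Section CompositionMultiplicity.
Context (R : realType) (K : fieldType) (n : nat) (g : {vspace 'M[K]_n}).
Context (L : lmodType K) (aL : 'M[K]_n -> L -> L) (rL : is_rep g aL).
Hypothesis sL : simple_submod g aL setT.

Definition chain (V : lmodType K) (act : 'M[K]_n -> V -> V) (A B : set V)
    (m : nat) (N : nat -> set V) : Prop :=
  [/\ N 0%N = A, N m = B, forall i, submod g act (N i)
    & forall i, (i < m)%N -> N i `<=` N i.+1].

Definition nfactors (V : lmodType K) (act : 'M[K]_n -> V -> V)
    (m : nat) (N : nat -> set V) : nat :=
  (\sum_(i < m) `[< factor_iso g act (N i) (N i.+1) aL >])%N.

(** The multiplicity of L in the subquotient B / A, computed on chains between A and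
    B so that no quotient has to be formed. *)
Definition cmult (V : lmodType K) (act : 'M[K]_n -> V -> V) (A B : set V) : \bar R :=
  ereal_sup [set c | exists m N, chain act A B m N /\ c = ((nfactors act m N)%:R)%:E].

Lemma comp_multE (V : lmodType K) (act : 'M[K]_n -> V -> V) :
  comp_mult R g act aL = cmult act [set 0] setT.
Proof. by []. Qed.

Lemma simple_nonzero : exists w : L, w != 0.
Proof.
apply: contrapT => h; have [_ /eqP T0 _] := sL; apply: T0.
apply/seteqP; split=> // w _ /=; apply: contrapT => w0; apply: h; exists w.
exact/eqP.
Qed.

Section OneModule.
Context (V : lmodType K) (act : 'M[K]_n -> V -> V) (r : is_rep g act).
Local Notation sub := (submod g act).

Lemma submod_eq0 N : sub N -> N 0. Proof. by case=> /subspace0. Qed.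

(** The image in L of the intersection of N' and B is a submodule of a simple
    module. *)
Lemma simple_factor_cases (N' : set V) (phi : V -> L) (B : set V) :
  (forall a u v, N' u -> N' v -> phi (a *: u + v) = a *: phi u + phi v) ->
  (forall x v, x \in g -> N' v -> phi (act x v) = aL x (phi v)) ->
  sub N' -> sub B ->
  (forall v, N' v -> B v -> phi v = 0) \/ (forall w, exists v, [/\ N' v, B v & phi v = w]).
Proof.
move=> plin pact sN' sB.
have [s0 hs] := submodI sN' sB.
pose I : set L := [set w | exists v, [/\ N' v, B v & phi v = w]].
have p0 : phi 0 = 0.
  have := plin (-1) 0 0 (submod_eq0 sN') (submod_eq0 sN').
  by rewrite scaler0 addr0 scaleN1r addNr.
have sI : submod g aL I.
  split; [split|].
  - by exists 0; split=> //; apply: submod_eq0.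
  - move=> _ _ [u [Nu Bu <-]] [v [Nv Bv <-]]; exists (u + v).
    have [] := subspaceD s0 (conj Nu Bu) (conj Nv Bv); split=> //.
    by have := plin 1 u v Nu Nv; rewrite !scale1r.
  - move=> a _ [u [Nu Bu <-]]; exists (a *: u).
    have [] := subspaceZ a s0 (conj Nu Bu); split=> //.
    by have := plin a u 0 Nu (submod_eq0 sN'); rewrite p0 !addr0.
  - move=> x _ gx [u [Nu Bu <-]]; exists (act x u).
    by have [] := hs x u gx (conj Nu Bu); split=> //; apply: pact.
have [_ _ /(_ I sI (fun _ _ => Logic.I))[I0|IT]] := sL.
  by left=> v Nv Bv; have : I (phi v) by [exists v]; rewrite I0.
by right=> w; have : I w by rewrite IT.
Qed.

(** If B meets N' inside N, then adding B does not change the simple factor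
    N' / N; otherwise B covers the factor, which then appears inside B. *)
Lemma factor_cap_add (N N' B : set V) : sub N -> sub N' -> N `<=` N' -> sub B ->
  factor_iso g act N N' aL ->
  factor_iso g act (N `&` B) (N' `&` B) aL \/
  factor_iso g act (addset N B) (addset N' B) aL.
Proof.
move=> sN sN' NN' sB [phi [plin pact psurj pker]].
have [p0|pT] := simple_factor_cases plin pact sN' sB; [right|left]; last first.
  exists phi; split=> [a u v [? _] [? _]|x v gx [? _]|w|v [N'v Bv]].
  - exact: plin.
  - exact: pact.
  - by have [v [? ? ?]] := pT w; exists v.
  - by split=> [/(pker _ N'v)|[/(pker _ N'v)]].
pose dec v u := N' u /\ B (v - u).
pose psi v := phi (xget 0 [set u | dec v u]).
have psiE v u : dec v u -> psi v = phi u.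
  move=> d; have := xgetPex (0 : V) (ex_intro (dec v) u d).
  rewrite /psi -/(dec v); set u' := xget _ _ => -[N'u' Bu']; case: d => N'u Bu.
  have N'd : N' (u' - u) by apply: subspaceB sN'.1 _ _.
  have Bd : B (u' - u).
    have -> : u' - u = (v - u) - (v - u') by rewrite opprB [RHS]addrC addrA subrK.
    by apply: subspaceB sB.1 _ _.
  have := p0 _ N'd Bd; have := plin (-1) u u' N'u N'u'.
  by rewrite !scaleN1r ![- _ + _]addrC => -> /eqP; rewrite subr_eq0 => /eqP.
have decP v : addset N' B v -> exists u, dec v u.
  by move=> [u [b [N'u Bb ->]]]; exists u; split=> //; rewrite addrC addKr.
exists psi; split=> [a u v /decP[u' du] /decP[v' dv]|x v gx /decP[v' dv]|w|v /decP[v' dv]].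
- rewrite (psiE _ _ du) (psiE _ _ dv) (psiE _ (a *: u' + v')) ?plin //; first by case: du.
    by case: dv.
  case: du dv => [N'u Bu] [N'v Bv]; split.
    by apply: subspaceD sN'.1 _ _ => //; apply: subspaceZ sN'.1 _.
  by rewrite opprD addrACA -scalerBr; apply: subspaceD sB.1 _ _ => //; apply: subspaceZ sB.1 _.
- rewrite (psiE _ _ dv) (psiE _ (act x v')) ?pact //; first by case: dv.
  case: dv => N'v Bv; split; first exact: sN'.2.
  by rewrite -(actB r) //; apply: sB.2.
- have [v N'v <-] := psurj w; exists v; first exact: addset_subl sB.1 _ N'v.
  by apply: psiE; split=> //; rewrite subrr; apply: submod_eq0.
- rewrite (psiE _ _ dv); case: dv => N'v' Bv; split=> [/(pker _ N'v') Nv'|].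
    by exists v', (v - v'); split=> //; rewrite addrC subrK.
  move=> [u [b [Nu Bb vE]]]; rewrite -(psiE v v') ?(psiE v u) //.
    by apply/pker => //; apply: NN'.
  by split; [apply: NN' | rewrite vE addrC addKr].
Qed.

Lemma chain_mono A B m N i : chain act A B m N -> (i <= m)%N -> A `<=` N i /\ N i `<=` B.
Proof.
move=> [N0 Nm sN le] im; split.
  by rewrite -N0; elim: i im => [_ v|i IH im v /(IH (ltnW im)) h] //; exact: (le _ im _ h).
rewrite -Nm; have E j : (i + j <= m)%N -> N i `<=` N (i + j)%N.
  elim: j => [|j IH]; first by rewrite addn0 => _ v.
  by rewrite addnS => im' v /(IH (ltnW im')) h; exact: (le _ im' _ h).
by have := E (m - i)%N; rewrite subnKC //; apply.
Qed.

Lemma nfactors_nat m N : nfactors act m N =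
  (\sum_(0 <= i < m) `[< factor_iso g act (N i) (N i.+1) aL >])%N.
Proof. by rewrite big_mkord. Qed.

Lemma chain_cat A B C m1 N1 m2 N2 : chain act A B m1 N1 -> chain act B C m2 N2 ->
  exists N, chain act A C (m1 + m2) N /\
    nfactors act (m1 + m2) N = (nfactors act m1 N1 + nfactors act m2 N2)%N.
Proof.
move=> [a1 b1 c1 d1] [a2 b2 c2 d2].
pose N i := if (i <= m1)%N then N1 i else N2 (i - m1)%N.
have N1E i : (i <= m1)%N -> N i = N1 i by rewrite /N => ->.
have N2E i : N (m1 + i)%N = N2 i.
  rewrite /N; case: leqP => h; last by rewrite addKn.
  have -> : i = 0%N by lia.
  by rewrite addn0 b1 a2.
exists N; split; first split.
- by rewrite N1E.
- by rewrite N2E.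
- by move=> i; rewrite /N; case: ifP.
- move=> i; case: (ltnP i m1) => h h2.
    by rewrite !N1E ?(ltnW h) //; apply: d1.
  have -> : i = (m1 + (i - m1))%N by lia.
  by rewrite -addnS !N2E; apply: d2; lia.
rewrite !nfactors_nat (big_cat_nat (n := m1)) //=; last by lia.
congr (_ + _)%N.
  by apply: eq_big_nat => i /andP[_ im]; rewrite !N1E // ltnW.
rewrite -{1}[m1]add0n big_addn addKn; apply: eq_big_nat => i _.
by rewrite addnC -addnS !N2E.
Qed.

(** Intersect the chain with B and add B to it: by [factor_cap_add] one of the
    two chains sees each factor isomorphic to L. *)
Lemma chain_split A B C m N : sub B -> A `<=` B -> B `<=` C -> chain act A C m N ->
  exists N1 N2, [/\ chain act A B m N1, chain act B C m N2 &
    (nfactors act m N <= nfactors act m N1 + nfactors act m N2)%N].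
Proof.
move=> sB AB BC hN; have [N0 Nm sN le] := hN.
exists (fun i => N i `&` B), (fun i => addset (N i) B); split; first split.
- by rewrite N0; apply: setIidl.
- by rewrite Nm; apply: setIidr.
- by move=> i; apply: submodI.
- by move=> i im v [Nv Bv]; split=> //; apply: le.
- split.
  + have sA : subspace A by rewrite -N0; case: (sN 0%N).
    rewrite N0; apply/seteqP; split; last exact: addset_subr.
    by apply: addset_sub => //; case: sB.
  + rewrite Nm; apply/seteqP; split; last exact: addset_subl sB.1.
    by apply: addset_sub => //; rewrite -Nm; case: (sN m).
  + by move=> i; apply: submod_add.
  + by move=> i im _ [u [b [Nu Bb ->]]]; exists u, b; split=> //; apply: le.
rewrite -big_split /=; apply: leq_sum => i _.
case: asboolP => // f.
by have [h|h] := factor_cap_add (sN i) (sN i.+1) (le _ (ltn_ord i)) sB f;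
  rewrite (asboolT h) ?addn1 ?add1n.
Qed.

Lemma cmult_ge0 A B : sub A -> sub B -> A `<=` B -> (0 <= cmult act A B)%E.
Proof.
move=> sA sB AB; apply: (@le_trans _ _ ((nfactors act 1 (fun i => if i == 0%N then A else B))%:R)%:E).
  by rewrite lee_fin ler0n.
apply: ereal_sup_ubound; exists 1%N, (fun i => if i == 0%N then A else B); split=> //.
split=> //; first by case.
by case.
Qed.

(** Chains can be concatenated, and split at B by [chain_split]. *)
Lemma cmult_add A B C : sub A -> sub B -> sub C -> A `<=` B -> B `<=` C ->
  cmult act A C = (cmult act A B + cmult act B C)%E.
Proof.
move=> sA sB sC AB BC; apply/eqP; rewrite eq_le; apply/andP; split.
  apply: ge_ereal_sup => _ [m [N [hN ->]]].
  have [N1 [N2 [h1 h2 le]]] := chain_split sB AB BC hN.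
  apply: (@le_trans _ _ (((nfactors act m N1)%:R)%:E + ((nfactors act m N2)%:R)%:E)%E).
    by rewrite -EFinD lee_fin -natrD ler_nat.
  by apply: leeD; apply: ereal_sup_ubound; [exists m, N1 | exists m, N2].
apply: ereal_sup_add_le.
- exists ((nfactors act 1 (fun i => if i == 0%N then A else B))%:R)%:E.
  by exists 1%N, (fun i => if i == 0%N then A else B); split=> //; split=> //; case.
- exists ((nfactors act 1 (fun i => if i == 0%N then B else C))%:R)%:E.
  by exists 1%N, (fun i => if i == 0%N then B else C); split=> //; split=> //; case.
- by move=> _ [? [? [_ ->]]].
- by move=> _ [? [? [_ ->]]].
move=> _ _ [m1 [N1 [h1 ->]]] [m2 [N2 [h2 ->]]].
have [N [hN E]] := chain_cat h1 h2.
by apply: ereal_sup_ubound; exists (m1 + m2)%N, N; rewrite E natrD EFinD.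
Qed.

Lemma factor_iso_neq N : factor_iso g act N N aL -> False.
Proof.
move=> [phi [_ _ psurj pker]]; have [w /eqP w0] := simple_nonzero.
by have [v Nv pv] := psurj w; apply: w0; rewrite -pv; apply/pker.
Qed.

Lemma cmult_refl A : sub A -> cmult act A A = 0.
Proof.
move=> sA; apply/eqP; rewrite eq_le cmult_ge0 // andbT.
apply: ge_ereal_sup => _ [m [N [hN ->]]].
rewrite /nfactors big1 // => i _; case: asboolP => //.
have [a b] := chain_mono hN (ltnW (ltn_ord i)); have [c d] := chain_mono hN (ltn_ord i).
have -> : N i = A by apply/seteqP.
have -> : N i.+1 = A by apply/seteqP.
by move=> /factor_iso_neq.
Qed.

(** A factor of a chain isomorphic to L survives the intersection with a submodule
    as soon as this contains one vector of nonzero image in L; hence some term of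
    the union detects all the factors of a finite chain. *)
Lemma cmult_union (W : nat -> set V) :
  (forall c, sub (W c)) -> (forall c, W c `<=` W c.+1) -> (forall v, exists c, W c v) ->
  cmult act [set 0] setT = ereal_sup [set cmult act [set 0] (W c) | c in setT].
Proof.
move=> sW Wle WT; have s0 := submod0 r; have W0 c : [set 0] `<=` W c.
  by move=> _ ->; apply: submod_eq0.
have Wmono c c' : (c <= c')%N -> W c `<=` W c'.
  by move=> /subnKC <-; elim: (c' - c)%N => [|j IH]; rewrite ?addn0 // addnS => v /IH /Wle.
apply/eqP; rewrite eq_le; apply/andP; split; last first.
  apply: ge_ereal_sup => _ [c _ <-].
  rewrite (@cmult_add [set 0] (W c) setT) // leeDl // cmult_ge0 //.
apply: ge_ereal_sup => _ [m [N [hN ->]]].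
have [N0 Nm sN le] := hN.
have [w /eqP w0] := simple_nonzero.
have det (i : 'I_m) : exists c, factor_iso g act (N i) (N i.+1) aL ->
    factor_iso g act (N i `&` W c) (N i.+1 `&` W c) aL.
  have [[phi [plin pact psurj pker]]|nf] := pselect (factor_iso g act (N i) (N i.+1) aL);
    last by exists 0%N.
  have [v Nv pv] := psurj w; have [c Wv] := WT v; exists c => _.
  have [p0|pT] := simple_factor_cases plin pact (sN i.+1) (sW c).
    by case: w0; rewrite -pv; apply: p0.
  exists phi; split=> [a u u' [? _] [? _]|x u gx [? _]|u|u [Nu Wu]].
  - exact: plin.
  - exact: pact.
  - by have [u' [? ? ?]] := pT u; exists u'.
  - by split=> [/(pker _ Nu)|[/(pker _ Nu)]].
have [c cP] := choice det.
pose C := (\max_(i < m) c i)%N.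
apply: (@le_trans _ _ (cmult act [set 0] (W C))); last first.
  by apply: ereal_sup_ubound; exists C.
apply: (@le_trans _ _ ((nfactors act m (fun i => N i `&` W C))%:R)%:E); last first.
  apply: ereal_sup_ubound; exists m, (fun i => N i `&` W C); split=> //; split.
  - by rewrite N0; apply: setIidl.
  - by rewrite Nm setTI.
  - by move=> i; apply: submodI.
  - by move=> i im v [Nv Wv]; split=> //; apply: (le _ im).
rewrite lee_fin ler_nat; apply: leq_sum => i _; case: asboolP => // f.
have cC : (c i <= C)%N by apply: leq_bigmax.
have [phi [plin pact psurj pker]] := f.
have [p0|pT] := simple_factor_cases plin pact (sN i.+1) (sW C).
  have [phi' [_ _ psurj' pker']] := cP i f.
  have [v [Nv Wv] pv] := psurj' w; case: w0; rewrite -pv.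
  apply/(pker' _ (conj Nv Wv)); split=> //; apply/(pker _ Nv).
  by apply: p0 => //; apply: Wmono Wv.
rewrite asboolT //.
exists phi; split=> [a u u' [? _] [? _]|x u gx [? _]|u|u [Nu Wu]].
- exact: plin.
- exact: pact.
- by have [u' [? ? ?]] := pT u; exists u'.
- by split=> [/(pker _ Nu)|[/(pker _ Nu)]].
Qed.

End OneModule.

(** Transport along an isomorphism of V' with a subquotient B / A of V, given as
    a linear relation between V' and V *)
Section Transport.
Context (V V' : lmodType K) (act : 'M[K]_n -> V -> V) (act' : 'M[K]_n -> V' -> V').
Context (r : is_rep g act) (r' : is_rep g act').
Context (A B : set V) (Rr : V' -> V -> Prop).
Hypothesis Rlin : forall a u' u v' v, Rr u' u -> Rr v' v -> Rr (a *: u' + v') (a *: u + v).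
Hypothesis Ract : forall x v' v, x \in g -> Rr v' v -> Rr (act' x v') (act x v).
Hypothesis Rtot : forall v', exists v, Rr v' v.
Hypothesis RB : forall v, B v <-> exists v', Rr v' v.
Hypothesis RA : forall v, Rr 0 v <-> A v.
Hypothesis Rinj : forall v' v, Rr v' v -> A v -> v' = 0.

Local Lemma R00 : Rr 0 0.
Proof.
have [v Rv] := Rtot 0; have := Rlin (-1) Rv Rv.
by rewrite !scaleN1r !addNr.
Qed.
Local Lemma Rsub u' u v' v : Rr u' u -> Rr v' v -> Rr (u' - v') (u - v).
Proof. by move=> h h'; have := Rlin (-1) h' h; rewrite !scaleN1r ![- _ + _]addrC. Qed.
Local Lemma Runique v' v'' v : Rr v' v -> Rr v'' v -> v' = v''.
Proof.
move=> h h'; have := Rsub h h'; rewrite subrr => h0.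
apply/eqP; rewrite -subr_eq0; apply/eqP; apply: (Rinj h0).
by apply/RA; exact: R00.
Qed.

(** Images and preimages under the relation turn chains into chains with the
    same factors. *)
Lemma cmult_transport : cmult act' [set 0] setT = cmult act A B.
Proof.
apply/eqP; rewrite eq_le; apply/andP; split.
  apply: ge_ereal_sup => _ [m [N [hN ->]]]; have [N0 Nm sN le] := hN.
  pose M i : set V := [set v | exists2 v', N i v' & Rr v' v].
  apply: (@le_trans _ _ ((nfactors act m M)%:R)%:E); last first.
    apply: ereal_sup_ubound; exists m, M; split=> //; split.
    - rewrite /M N0; apply/seteqP; split=> [v [_ /= ->] /RA //|v /RA Rv].
      by exists 0.
    - rewrite /M Nm; apply/seteqP; split=> [v [v' _ Rv]|v /RB[v' Rv]].
        by apply/RB; exists v'.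
      by exists v'.
    - move=> i; have [s a] := sN i; split; [split|].
      + by exists 0; [apply: subspace0 | apply: R00].
      + move=> u v [u' Nu Ru] [v' Nv Rv]; exists (u' + v'); first exact: subspaceD.
        by have := Rlin 1 Ru Rv; rewrite !scale1r.
      + move=> b u [u' Nu Ru]; exists (b *: u'); first exact: subspaceZ.
        by have := Rlin b Ru R00; rewrite !addr0.
      + by move=> x v gx [v' Nv Rv]; exists (act' x v'); [apply: a | apply: Ract].
    - by move=> i im v [v' Nv Rv]; exists v' => //; apply: (le _ im).
  rewrite lee_fin ler_nat; apply: leq_sum => i _; case: asboolP => // f.
  rewrite asboolT //; have [phi [plin pact psurj pker]] := f.
  pose psi v := phi (xget 0 [set v' | Rr v' v]).
  have psiE v v' : Rr v' v -> psi v = phi v'.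
    move=> Rv; rewrite /psi; case: xgetP => [v'' -> Rv''|/(_ v')//].
    by rewrite (Runique Rv'' Rv).
  exists psi; split=> [a u v [u' Nu Ru] [v' Nv Rv]|x v gx [v' Nv Rv]|w|v [v' Nv Rv]].
  - by rewrite (psiE _ _ Ru) (psiE _ _ Rv) (psiE _ _ (Rlin a Ru Rv)) plin.
  - by rewrite (psiE _ _ Rv) (psiE _ _ (Ract gx Rv)) pact.
  - have [v' Nv <-] := psurj w; have [v Rv] := Rtot v'; exists v; first by exists v'.
    exact: psiE.
  - rewrite (psiE _ _ Rv); split=> [/(pker _ Nv) Nv'|[v'' Nv'' Rv'']]; first by exists v'.
    by apply/(pker _ Nv); rewrite (Runique Rv Rv'').
apply: ge_ereal_sup => _ [m [N [hN ->]]]; have [N0 Nm sN le] := hN.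
pose M i : set V' := [set v' | exists2 v, N i v & Rr v' v].
apply: (@le_trans _ _ ((nfactors act' m M)%:R)%:E); last first.
  apply: ereal_sup_ubound; exists m, M; split=> //; split.
  - rewrite /M N0; apply/seteqP; split=> [v' [v /Rinj Av /Av]//|_ /= ->].
    by exists 0; [apply/RA|]; exact: R00.
  - rewrite /M Nm; apply/seteqP; split=> // v' _; have [v Rv] := Rtot v'.
    by exists v => //; apply/RB; exists v'.
  - move=> i; have [s a] := sN i; split; [split|].
    + by exists 0; [apply: subspace0 | apply: R00].
    + move=> u v [u' Nu Ru] [v' Nv Rv]; exists (u' + v'); first exact: subspaceD.
      by have := Rlin 1 Ru Rv; rewrite !scale1r.
    + move=> b u [u' Nu Ru]; exists (b *: u'); first exact: subspaceZ.
      by have := Rlin b Ru R00; rewrite !addr0.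
    + by move=> x v gx [v' Nv Rv]; exists (act x v'); [apply: a | apply: Ract].
  - by move=> i im v [v' Nv Rv]; exists v' => //; apply: (le _ im).
rewrite lee_fin ler_nat; apply: leq_sum => i _; case: asboolP => // f.
rewrite asboolT //; have [phi [plin pact psurj pker]] := f.
have [AN _] := chain_mono hN (ltnW (ltn_ord i)).
have phiE v' u v : N i.+1 u -> N i.+1 v -> Rr v' u -> Rr v' v -> phi u = phi v.
  move=> Nu Nv Ru Rv; have := Rsub Ru Rv; rewrite subrr => /RA Auv.
  have Nuv : N i.+1 (u - v) by apply: subspaceB (sN _).1 _ _.
  have /(pker _ Nuv) := AN _ Auv; have := plin (-1) v u Nv Nu.
  by rewrite !scaleN1r ![- _ + _]addrC => -> /eqP; rewrite subr_eq0 => /eqP.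
pose psi v' := phi (xget 0 [set v | N i.+1 v /\ Rr v' v]).
have psiE v v' : N i.+1 v -> Rr v' v -> psi v' = phi v.
  move=> Nv Rv; rewrite /psi; case: xgetP => [u -> [Nu Ru]|/(_ v)[]//].
  exact: phiE Ru Rv.
exists psi; split=> [a u v [u' Nu Ru] [v' Nv Rv]|x v gx [v' Nv Rv]|w|v [v' Nv Rv]].
- rewrite (psiE _ _ Nu Ru) (psiE _ _ Nv Rv) (psiE _ _ _ (Rlin a Ru Rv)) ?plin //.
  by apply: subspaceD (sN _).1 _ _ => //; apply: subspaceZ (sN _).1 _.
- by rewrite (psiE _ _ Nv Rv) (psiE _ _ _ (Ract gx Rv)) ?pact //; apply: (sN _).2.
- have [v Nv <-] := psurj w.
  have [v' Rv] : exists v', Rr v' v.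
    by apply/RB; have [_] := chain_mono hN (ltn_ord i); apply.
  by exists v'; [exists v | apply: psiE].
- rewrite (psiE _ _ Nv Rv); split=> [/(pker _ Nv) Nv'|[v'' Nv'' Rv'']]; first by exists v'.
  have Nw := le _ (ltn_ord i) _ Nv''.
  by rewrite (phiE _ _ _ Nv Nw Rv Rv''); apply/(pker _ Nw).
Qed.

End Transport.

(** Vectors that witness different steps of a flag are linearly independent. *)
Lemma flag_bound (V : lmodType K) (t : seq V) (m : nat) (N : nat -> set V)
    (J : {set 'I_m}) (u : 'I_m -> V) :
  (forall i, subspace (N i)) -> (forall i, (i < m)%N -> N i `<=` N i.+1) ->
  (forall i, i \in J -> [/\ N i.+1 (u i), ~ N i (u i) & lspan [set` t] (u i)]) ->
  (#|J| <= size t)%N.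
Proof.
move=> sN le hu; rewrite leqNgt; apply/negP => lt.
have co (i : 'I_#|J|) : exists c : nat -> K, u (enum_val i) = \sum_(k < size t) c k *: t`_k.
  by have [_ _ /lspan_seqP] := hu _ (enum_valP i).
have [c cE] := choice co.
pose A : 'M[K]_(#|J|, size t) := \matrix_(i, k) c i k.
have nf : kermx A != 0.
  rewrite -mxrank_eq0 mxrank_ker subn_eq0 -ltnNge.
  exact: leq_ltn_trans (rank_leq_col A) lt.
have [x xA x0] : exists2 x : 'rV_#|J|, x *m A = 0 & x != 0.
  have /rowV0Pn[x /sub_kermxP xA x0] := nf; by exists x.
have rel : \sum_i x 0 i *: u (enum_val i) = 0.
  under eq_bigr do rewrite cE scaler_sumr.
  rewrite exchange_big big1 // => k _ /=.
  under eq_bigr do rewrite scalerA.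
  rewrite -scaler_suml; have := congr1 (fun B : 'rV_(size t) => B 0 k) xA.
  by rewrite !mxE => h; under eq_bigr do rewrite -[c _ _](mxE matrix_key (fun i k => c i k)); rewrite h scale0r.
have [i0 xi0] : exists i0, x 0 i0 != 0.
  apply/existsP; apply: contraR x0; rewrite negb_exists => /forallP h.
  by apply/eqP/rowP => i; rewrite mxE; apply/eqP; move: (h i); rewrite negbK.
pose Q := [pred i : 'I_#|J| | x 0 i != 0].
have [j xj jmax] := @arg_maxnP _ i0 Q (fun i => enum_val i : nat) xi0.
have Nmono a b : (a <= b)%N -> (b <= m)%N -> N a `<=` N b.
  move=> /subnKC <-; elim: (b - a)%N => [|k IH]; first by rewrite addn0 => _ v.
  by rewrite addnS => km v /(IH (ltnW km)) h; exact: (le _ km _ h).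
have [_ nuj _] := hu _ (enum_valP j); apply: nuj.
have -> : u (enum_val j) = - (x 0 j)^-1 *: (\sum_(i | i != j) x 0 i *: u (enum_val i)).
  apply: (scalerI xj); rewrite scalerA mulrN mulfV // scaleN1r.
  apply/eqP; rewrite -addr_eq0; apply/eqP; rewrite -[RHS]rel [RHS](bigD1 j) //=.
apply: subspaceZ => //; apply: subspace_sum => // i ij; case: (eqVneq (x 0 i) 0) => [->|xi].
  by rewrite scale0r; apply: subspace0.
apply: subspaceZ => //; have [Nu _ _] := hu _ (enum_valP i).
apply: (Nmono (enum_val i).+1) => //; last exact: ltnW.
have : (enum_val i <= enum_val j)%N := jmax i xi.
rewrite leq_eqVlt => /orP[/eqP/val_inj/enum_val_inj e|//].
by rewrite e eqxx in ij.
Qed.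

Section EigenProjection.
Context (V : lmodType K) (act : 'M[K]_n -> V -> V) (r : is_rep g act).
Context (H : 'M[K]_n) (gH : H \in g) (c0 : K).

(** Lagrange interpolation in the operator H: it kills the eigenvectors with
    eigenvalue in cs and fixes those with eigenvalue c0, when c0 is not in cs. As
    a polynomial in H it preserves submodules and commutes with homomorphisms. *)
Definition eproj (cs : seq K) (v : V) : V :=
  foldr (fun c w => (c0 - c)^-1 *: (act H w - c *: w)) v cs.

Lemma eproj_lin cs a u v : eproj cs (a *: u + v) = a *: eproj cs u + eproj cs v.
Proof.
elim: cs => [//|c cs IH] /=; rewrite IH (act_lin r) //.
set A := act H _; set B := act H _; set C := eproj _ _; set D := eproj _ _.
have -> : a *: A + B - c *: (a *: C + D) = a *: (A - c *: C) + (B - c *: D).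
  by rewrite scalerBr scalerDr !scalerA (mulrC c) opprD addrACA.
by rewrite scalerDr !scalerA mulrC.
Qed.
Lemma eproj0 cs : eproj cs 0 = 0.
Proof. by have := eproj_lin cs (-1) 0 0; rewrite scaler0 addr0 scaleN1r addNr. Qed.
Lemma eproj_sum cs (I : Type) (s : seq I) (P : pred I) (f : I -> V) :
  eproj cs (\sum_(i <- s | P i) f i) = \sum_(i <- s | P i) eproj cs (f i).
Proof.
apply: (big_morph (eproj cs)) => [u v|]; last exact: eproj0.
by have := eproj_lin cs 1 u v; rewrite !scale1r.
Qed.
Lemma eproj_sub cs N v : submod g act N -> N v -> N (eproj cs v).
Proof.
move=> [sN aN] Nv; elim: cs => [//|c cs IH] /=.
by apply: subspaceZ => //; apply: subspaceB => //; [apply: aN | apply: subspaceZ].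
Qed.
Lemma eproj_eig cs c w : act H w = c *: w -> c0 \notin cs ->
  eproj cs w = if c == c0 then w else if c \in cs then 0 else eproj cs w.
Proof.
move=> Hw; elim: cs => [|c' cs IH]; first by case: ifP.
rewrite inE negb_or => /andP[cc' /IH]; rewrite inE /=.
case: eqVneq => [e|ne] => [->|].
  by rewrite Hw -scalerBl e scalerA mulVf ?scale1r // subr_eq0.
case: eqVneq => [<- _|ne'] /=.
  have E : act H (eproj cs w) = c *: eproj cs w.
    clear IH; elim: cs => [//|d cs IH] /=.
    by rewrite IH -scalerBl !(actZ r) // IH !scalerA; congr (_ *: _); ring.
  by rewrite E subrr scaler0.
by case: ifP => // _ ->; rewrite (act0 r) // scaler0 subrr scaler0.
Qed.

End EigenProjection.

Section Bound.
Context (V : lmodType K) (act : 'M[K]_n -> V -> V) (r : is_rep g act).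
Context (H : 'M[K]_n) (gH : H \in g).
Hypothesis eig : forall v, exists s : seq (K * V),
  (forall p, p \in s -> act H p.2 = p.1 *: p.2) /\ v = \sum_(p <- s) p.2.
Hypothesis eig_fd : forall c, fin_dim [set v | act H v = c *: v].

(** Interpolate on the other eigenvalues that occur in v. *)
Lemma eig_component v c0 : exists2 cs, c0 \notin cs &
  act H (eproj act H c0 cs v) = c0 *: eproj act H c0 cs v.
Proof.
have [s [sE ->]] := eig v.
pose cs := [seq c <- [seq p.1 | p <- s] | c != c0].
have c0n : c0 \notin cs by rewrite mem_filter eqxx.
exists cs => //.
rewrite (eproj_sum r) // (act_sum r) // scaler_sumr; apply: eq_big_seq => p ps.
rewrite (eproj_eig r gH (sE _ ps) c0n); case: eqVneq => [<-|ne]; first exact: sE.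
have -> : p.1 \in cs by rewrite mem_filter ne; apply: map_f.
by rewrite (act0 r) // scaler0.
Qed.

Lemma eproj_factor (N : set V) (phi : V -> L) c0 cs v :
  (forall a u v, N u -> N v -> phi (a *: u + v) = a *: phi u + phi v) ->
  (forall x v, x \in g -> N v -> phi (act x v) = aL x (phi v)) ->
  submod g act N -> N v -> phi (eproj act H c0 cs v) = eproj aL H c0 cs (phi v).
Proof.
move=> plin pact sN Nv; elim: cs => [//|c cs IH] /=.
set w := eproj act _ _ _ _ in IH *; have Nw : N w := eproj_sub gH c0 cs sN Nv.
have p0 : phi 0 = 0.
  have N0 := subspace0 sN.1.
  by have := plin (-1) 0 0 N0 N0; rewrite scaler0 addr0 scaleN1r addNr.
have Z a u : N u -> phi (a *: u) = a *: phi u.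
  by move=> Nu; have := plin a u 0 Nu (subspace0 sN.1); rewrite p0 !addr0.
have aw : N (act H w) by apply: sN.2.
rewrite Z; last by apply: subspaceB sN.1 _ _ => //; apply: subspaceZ sN.1 _.
have := plin (- c) w (act H w) Nw aw; rewrite !scaleNr ![- _ + _]addrC => ->.
by rewrite pact // IH.
Qed.

(** If L occurs at all, then H has an eigenvector l0 in L. Each factor
    isomorphic to L contains an image of an eigenvector of V over l0, and these
    vectors are independent in a single eigenspace of V, whose dimension bounds
    their number. *)
Lemma cmult_bounded : exists D : nat, forall m N, chain act [set 0] setT m N ->
  (nfactors act m N <= D)%N.
Proof.
have [[m0 [N0 [i0 [h0 i0m [phi [plin pact psurj pker]]]]]]|none] := pselect
  (exists m N i, [/\ chain act [set 0] setT m N, (i < m)%N & factor_iso g act (N i) (N i.+1) aL]);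
  last first.
  exists 0%N => m N hN; rewrite leqn0 /nfactors big1 // => i _; case: asboolP => // f.
  by case: none; exists m, N, i.
have [_ _ sN0 _] := h0; have sN := sN0 i0.+1.
have [c0 [l0 [l00 Hl0]]] : exists c0 l0, l0 != 0 /\ aL H l0 = c0 *: l0.
  have [w w0] := simple_nonzero; have [v Nv pv] := psurj w.
  have [s [sE vE]] := eig v.
  have comp c : N0 i0.+1 (\sum_(p <- s | p.1 == c) p.2).
    pose cs := [seq c' <- [seq p.1 | p <- s] | c' != c].
    have cn : c \notin cs by rewrite mem_filter eqxx.
    suff <- : eproj act H c cs v = \sum_(p <- s | p.1 == c) p.2 by apply: eproj_sub.
    rewrite vE (eproj_sum r) // [RHS]big_mkcond; apply: eq_big_seq => p ps.
    rewrite (eproj_eig r gH (sE _ ps) cn); case: eqVneq => // ne.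
    by have -> : p.1 \in cs by rewrite mem_filter ne; apply: map_f.
  have Hcomp c : act H (\sum_(p <- s | p.1 == c) p.2) = c *: \sum_(p <- s | p.1 == c) p.2.
    rewrite (act_sum r) // scaler_sumr big_seq_cond [RHS]big_seq_cond.
    by apply: eq_bigr => p /andP[ps /eqP <-]; apply: sE.
  have vE' : v = \sum_(c <- undup [seq p.1 | p <- s]) \sum_(p <- s | p.1 == c) p.2.
    rewrite vE (exchange_big_dep xpredT) //=; apply: eq_big_seq => p ps.
    rewrite big_mkcond (bigD1_seq p.1) ?undup_uniq ?mem_undup ?map_f //=.
    by rewrite eqxx big1 ?addr0 // => c; rewrite eq_sym => /negPf ->.
  have pZ (I : eqType) (l : seq I) (f : I -> V) : (forall i, N0 i0.+1 (f i)) ->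
      phi (\sum_(i <- l) f i) = \sum_(i <- l) phi (f i).
    move=> Nf; have N00 := subspace0 sN.1.
    have p0 : phi 0 = 0.
      by have := plin (-1) 0 0 N00 N00; rewrite scaler0 addr0 scaleN1r addNr.
    elim: l => [|i l IH]; first by rewrite !big_nil.
    rewrite !big_cons -IH; have := plin 1 (f i) (\sum_(j <- l) f j) (Nf i).
    by rewrite !scale1r; apply; apply: subspace_sum sN.1 _.
  have : phi v != 0 by rewrite pv.
  rewrite vE' pZ //; move: (undup _) => l.
  have [[c pc]|nc] := pselect (exists c, phi (\sum_(p <- s | p.1 == c) p.2) != 0).
    move=> _; exists c, (phi (\sum_(p <- s | p.1 == c) p.2)); split=> //.
    have N00 := subspace0 sN.1.
    rewrite -pact // Hcomp; have := plin c _ 0 (comp c) N00.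
    have := plin (-1) 0 0 N00 N00; rewrite scaler0 addr0 scaleN1r addNr => ->.
    by rewrite !addr0.
  move=> /eqP h; case: h; apply: big1 => c _; apply/eqP; apply: contrapT => h.
  by apply: nc; exists c; apply/negP.
have [t tP] := eig_fd c0.
exists (size t) => m N hN; have [_ _ sN' le] := hN.
pose J := [set i : 'I_m | `[< factor_iso g act (N i) (N i.+1) aL >]]%SET.
have -> : nfactors act m N = #|J|.
  by rewrite /nfactors -sum1_card [RHS]big_mkcond; apply: eq_bigr => i _; rewrite inE; case: asboolP.
have uP (i : 'I_m) : exists u, i \in J -> [/\ N i.+1 u, ~ N i u & lspan [set` t] u].
  case iJ: (i \in J); last by exists 0.
  move: iJ; rewrite inE => /asboolP[psi [slin sact ssurj sker]].
  have [v Nv pv] := ssurj l0; have [cs cn Hv] := eig_component v c0.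
  have Nv' : N i.+1 (eproj act H c0 cs v) by apply: eproj_sub.
  exists (eproj act H c0 cs v) => _; split=> //; last exact: tP.
  move/(sker _ Nv'); rewrite (eproj_factor _ _ slin sact) // pv.
  by rewrite (eproj_eig rL gH Hl0 cn) eqxx => /eqP; rewrite (negPf l00).
have [u uJ] := choice uP.
by apply: (@flag_bound _ t m N J u) => // i; case: (sN' i).
Qed.

Lemma cmult_fin : comp_mult R g act aL \is a fin_num.
Proof.
have [D hD] := cmult_bounded; rewrite comp_multE ge0_fin_numE; last first.
  by apply: cmult_ge0 => //; apply: submod0.
apply: (@le_lt_trans _ _ (D%:R)%:E); last exact: ltry.
apply: ge_ereal_sup => _ [m [N [hN ->]]]; rewrite lee_fin ler_nat; exact: hD.
Qed.

End Bound.

End CompositionMultiplicity.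

(** * Representations of sl2 *)
Section Sl2.
Context (K : numFieldType) (V : lmodType K) (e f h : {linear V -> V}).
Hypothesis hef : forall v, e (f v) - f (e v) = h v.
Hypothesis hhe : forall v, h (e v) - e (h v) = 2 *: e v.
Hypothesis hhf : forall v, h (f v) - f (h v) = - 2 *: f v.

Local Notation E := (fun r => iter r e).
Local Notation Fi := (fun r => iter r f).

Lemma iter_lin (t : {linear V -> V}) r a u v :
  iter r t (a *: u + v) = a *: iter r t u + iter r t v.
Proof. by elim: r => //= r ->; rewrite linearP. Qed.
Lemma iter_lin0 (t : {linear V -> V}) r : iter r t 0 = 0.
Proof. by elim: r => //= r ->; rewrite linear0. Qed.
Lemma iter_linZ (t : {linear V -> V}) r a u : iter r t (a *: u) = a *: iter r t u.
Proof. by have := iter_lin t r a u 0; rewrite iter_lin0 !addr0. Qed.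
Lemma iter_linB (t : {linear V -> V}) r u v : iter r t (u - v) = iter r t u - iter r t v.
Proof. by elim: r => //= r ->; rewrite linearB. Qed.

Lemma ef v : e (f v) = f (e v) + h v. Proof. by rewrite -hef addrC subrK. Qed.

Lemma wt_f k v r : h v = k *: v -> h (Fi r v) = (k - 2 * r%:R) *: Fi r v.
Proof.
elim: r => [|r IH] hv; first by rewrite mulr0 subr0.
have := hhf (Fi r v); rewrite IH // linearZ /= => /eqP; rewrite subr_eq => /eqP ->.
by rewrite -scalerDl -natr1; congr (_ *: _); ring.
Qed.
Lemma wt_e k v r : h v = k *: v -> h (E r v) = (k + 2 * r%:R) *: E r v.
Proof.
elim: r => [|r IH] hv; first by rewrite mulr0 addr0.
have := hhe (E r v); rewrite IH // linearZ /= => /eqP; rewrite subr_eq => /eqP ->.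
by rewrite -scalerDl -natr1; congr (_ *: _); ring.
Qed.

Lemma e_fS k v r : h v = k *: v ->
  e (Fi r.+1 v) = Fi r.+1 (e v) + (r.+1%:R * (k - r%:R)) *: Fi r v.
Proof.
move=> hv; elim: r => [|r IH]; first by rewrite /= ef hv subr0 mul1r.
rewrite [Fi r.+2 v]iterS ef IH linearD linearZ -addrA (wt_f _ hv) -iterS.
rewrite -[f (iter r f v)]/(Fi r.+1 v) -scalerDl; congr (_ + _ *: _).
by rewrite -!natr1; ring.
Qed.

Lemma eS_f k v r : h v = k *: v ->
  E r.+1 (f v) = f (E r.+1 v) + (r.+1%:R * (k + r%:R)) *: E r v.
Proof.
move=> hv; elim: r => [|r IH]; first by rewrite /= ef hv addr0 mul1r.
rewrite [E r.+2 (f v)]iterS IH linearD linearZ ef -addrA (wt_e _ hv).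
rewrite -[e (iter r e v)]/(E r.+1 v) -scalerDl; congr (_ + _ *: _).
by rewrite -!natr1; ring.
Qed.

Hypothesis fnil : forall v, exists r, Fi r v = 0.
Hypothesis enil : forall v, exists r, E r v = 0.

Lemma nil_min (t : {linear V -> V}) v : (exists r, iter r t v = 0) -> v != 0 ->
  exists r, iter r t v != 0 /\ iter r.+1 t v = 0.
Proof.
move=> [r]; elim: r => [/= ->|r IH h0 v0]; first by rewrite eqxx.
by case: (eqVneq (iter r t v) 0) => [/IH|ne]; [apply | exists r].
Qed.

(** By induction on j, f e acts on v as a scalar; then e f^(r+1) v is a nonzero
    multiple of f^r v for all r, so that no power of f could kill a nonzero v. *)
Lemma low_weight_eq0 l j v : h v = - l%:R *: v -> (j <= l)%N -> E j v = 0 -> v = 0.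
Proof.
elim: j v => [//|j IH] v hv jl ev.
pose c : K := j%:R * (j.+1%:R - l%:R).
have hev : h (e v) = (2 - l%:R) *: e v.
  by have := wt_e 1 hv; rewrite /= mulr1 [_ + 2]addrC.
have fev : f (e v) = c *: v.
  apply/eqP; rewrite -subr_eq0; apply/eqP; apply: IH (ltnW jl) _.
    rewrite linearB linearZ /= hv; have := hhf (e v).
    rewrite hev linearZ /= => /eqP; rewrite subr_eq => /eqP ->.
    rewrite -scalerDl scalerBr; congr (_ *: _ - _); first by ring.
    by rewrite !scalerA mulrC.
  rewrite iter_linB iter_linZ.
  rewrite /c {c}; case: j jl ev => [|j] jl ev /=.
    by rewrite mul0r scale0r subr0 [e v]ev linear0.
  rewrite -[X in X - _]/(iter j.+1 e (f (e v))) (eS_f j hev).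
  rewrite -iterSr ev linear0 add0r -iterSr -[e (iter j e v)]/(iter j.+1 e v) -scalerBl.
  rewrite (_ : _ - _ = 0) ?scale0r //.
  by rewrite -!natr1; ring.
apply/eqP; apply: contraT => v0.
have [r [r0 r1]] := nil_min (fnil v) v0.
have := e_fS r hv; rewrite r1 linear0 iterSr fev iter_linZ -scalerDl => /esym/eqP.
rewrite scaler_eq0 (negPf r0) orbF => /eqP h0.
have : (j.+1 + r)%:R * (l + r - j)%:R = 0 :> K.
  have lj : (j <= l + r)%N by lia.
  rewrite natrB // !natrD -[RHS]oppr0 -h0 /c -!natr1; ring.
move/eqP; rewrite -natrM pnatr_eq0 muln_eq0 => /orP[|] /eqP; lia.
Qed.

Lemma hw_nat z v : h v = (z : int)%:~R *: v -> e v = 0 -> v != 0 -> exists m : nat, z = m%:Z.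
Proof.
case: z => [m _ _ _|l hv ev]; first by exists m.
by rewrite (@low_weight_eq0 l.+1 1 v) ?eqxx.
Qed.

Lemma hw_string m v : h v = m%:R *: v -> e v = 0 -> Fi m.+1 v = 0.
Proof.
move=> hv ev; apply: (@low_weight_eq0 m.+2 1) => //.
  by rewrite (wt_f _ hv); congr (_ *: _); rewrite -!natr1; ring.
by rewrite /= -iterS (e_fS m hv) ev iter_lin0 subrr mulr0 scale0r addr0.
Qed.

(** The scalar by which e^r f^r acts on a highest weight vector of weight m. *)
Definition ef_coef (m r : nat) : K := \prod_(i < r) (i.+1%:R * (m%:R - i%:R)).
Lemma ef_coef_neq0 m r : (r <= m)%N -> ef_coef m r != 0.
Proof.
move=> rm; apply/prodf_neq0 => i _; have im := leq_trans (ltn_ord i) rm.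
by rewrite -natrB 1?ltnW // -natrM pnatr_eq0 muln_eq0 negb_or /= -lt0n subn_gt0.
Qed.
Lemma e_f_hw m r v : h v = m%:R *: v -> e v = 0 -> E r (Fi r v) = ef_coef m r *: v.
Proof.
move=> hv ev; elim: r => [|r IH]; first by rewrite /ef_coef big_ord0 scale1r.
rewrite iterSr (e_fS r hv) ev iter_lin0 add0r iter_linZ IH scalerA.
by rewrite /ef_coef big_ord_recr /= mulrC.
Qed.

(** Every weight vector is a combination of vectors f^r u with u of highest weight,
    by induction on the power of e that kills it: if e^(j+1) v = 0, then u = e^j v
    has a highest weight at least j by [low_weight_eq0], so that e^j f^j u is a
    nonzero multiple of u, and e^j kills v minus a multiple of f^j u. *)
Lemma hw_span (N S : set V) : subspace N -> (forall v, N v -> N (e v)) ->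
  (forall v, N v -> N (f v)) -> subspace S ->
  (forall u m r, N u -> h u = m%:R *: u -> e u = 0 -> S (Fi r u)) ->
  forall v z, N v -> h v = (z : int)%:~R *: v -> S v.
Proof.
move=> sN Ne Nf sS Shw v z Nv hv.
have NE r w : N w -> N (E r w) by move=> Nw; elim: r => //= r; apply: Ne.
have [j ej] := enil v; elim: j v Nv hv ej => [v _ _ /= ->|j IH v Nv hv ej].
  exact: subspace0.
have [ez|u0] := eqVneq (E j v) 0; first exact: IH.
set u := E j v in u0; have Nu : N u by apply: NE.
have eu : e u = 0 by [].
have hu : h u = (z + 2 * j%:Z)%:~R *: u.
  by rewrite (wt_e _ hv); congr (_ *: _); rewrite rmorphD rmorphM /=.
have [m mE] := hw_nat hu eu u0; rewrite mE -pmulrn in hu.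
have jm : (j <= m)%N.
  rewrite leqNgt; apply/negP => mj; move/eqP: u0; apply.
  suff v0 : v = 0 by rewrite /u v0 iter_lin0.
  apply: (@low_weight_eq0 (2 * j - m) j.+1) => //; last by lia.
  rewrite hv; congr (_ *: _).
  have -> : z = - (2 * j - m)%N%:Z by lia.
  by rewrite mulrNz -pmulrn.
have c0 := ef_coef_neq0 jm.
rewrite -[v](subrK ((ef_coef m j)^-1 *: Fi j u)); apply: subspaceD => //; last first.
  by apply: subspaceZ => //; apply: Shw hu eu.
apply: IH.
- apply: subspaceB => //; apply: subspaceZ => //.
  by elim: (j) => //= r; apply: Nf.
- rewrite linearB linearZ /= hv (wt_f _ hu) !scalerBr; congr (_ - _).
  rewrite !scalerA mulrC; congr (_ * _ *: _).
  have -> : z = m%:Z - 2 * j%:Z by lia.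
  by rewrite rmorphB rmorphM /=.
- by rewrite iter_linB iter_linZ (e_f_hw _ hu eu) scalerA mulVf // scale1r subrr.
Qed.

End Sl2.

(** The product of the operators h - d over the listed eigenvalues d kills the span
    of S and acts on w by a nonzero scalar. *)
Lemma eigen_absent (K : fieldType) (V : lmodType K) (h : {linear V -> V})
    (cs : seq K) (S : set V) c w :
  (forall v, S v -> exists2 d, d \in cs & h v = d *: v) ->
  lspan S w -> h w = c *: w -> c \notin cs -> w = 0.
Proof.
move=> hS Sw hw ncs.
pose P v := foldr (fun d u => h u - d *: u) v cs.
have Plin a u v : P (a *: u + v) = a *: P u + P v.
  rewrite /P; elim: (cs) => [//|d ds IH] /=; rewrite IH linearP scalerBr scalerDr.
  by rewrite !scalerA (mulrC d) opprD addrACA.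
have hP v d : h v = d *: v -> h (P v) = d *: P v.
  move=> hv; rewrite /P; elim: (cs) => [//|a ds IH] /=.
  by rewrite IH -scalerBl linearZ /= IH !scalerA mulrC.
have Pw : P w = (\prod_(d <- cs) (c - d)) *: w.
  rewrite /P; elim: (cs) => [|d ds IH] /=; first by rewrite big_nil scale1r.
  rewrite IH linearZ /= hw big_cons !scalerA -scalerBl; congr (_ *: _); ring.
have : P w = 0.
  apply: (lspan_sub _ _ Sw : [set v | P v = 0] w).
    split=> [|u v Pu Pv|a u Pu]; rewrite /mkset.
    - have := Plin (-1) 0 0; by rewrite scaler0 addr0 scaleN1r addNr.
    - by have := Plin 1 u v; rewrite !scale1r Pu Pv addr0.
    - have P0 : P 0 = 0 by have := Plin (-1) 0 0; rewrite scaler0 addr0 scaleN1r addNr.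
      by have := Plin a u 0; rewrite !addr0 Pu P0 scaler0 addr0.
  move=> v Sv; have [d dcs hv] := hS v Sv; rewrite /mkset /P.
  elim: (cs) dcs => [//|d' ds IH]; rewrite inE => /orP[/eqP <-|/IH /= ->] /=; last first.
    by rewrite linear0 scaler0 subrr.
  have E ds' : h (foldr (fun d u => h u - d *: u) v ds') = d *: foldr (fun d u => h u - d *: u) v ds'.
    elim: ds' => [//|a ds' IH'] /=; by rewrite IH' -scalerBl linearZ /= IH' !scalerA mulrC.
  by rewrite E subrr.
rewrite Pw => /eqP; rewrite scaler_eq0 => /orP[|/eqP //].
rewrite prodf_seq_eq0 => /hasP[d dcs /= /eqP/subr0_eq cd].
by rewrite cd dcs in ncs.
Qed.

Section WeightNilpotent.
Context (K : numFieldType) (V : lmodType K) (h t : {linear V -> V}) (a : int).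
Hypothesis ht : forall v, h (t v) - t (h v) = a%:~R *: t v.
Hypothesis a0 : a != 0.

(** The weights of the vectors t^r v differ by multiples of a, and so leave the
    finite list of weights. *)
Lemma weight_nilpotent (cs : seq int) (N S : set V) :
  (forall v, N v -> N (t v)) -> N `<=` lspan S ->
  (forall v, S v -> exists2 z, z \in cs & h v = z%:~R *: v) ->
  forall v z, N v -> h v = (z : int)%:~R *: v -> exists r, iter r t v = 0.
Proof.
move=> Nt NS Scs v z Nv hv.
have hr r : h (iter r t v) = (z + a * r%:Z)%:~R *: iter r t v.
  elim: r => [|r IH]; first by rewrite mulr0 addr0.
  have := ht (iter r t v); rewrite IH linearZ /= => /eqP; rewrite subr_eq => /eqP ->.
  by rewrite -scalerDl -rmorphD; congr (_%:~R *: _); lia.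
have Nr r : N (iter r t v) by elim: r => //= r; apply: Nt.
have [r rcs] : exists r : nat, z + a * r%:Z \notin cs.
  pose B := (\sum_(c <- cs) absz c + absz z).+1.
  exists B; apply/negP => h1.
  have : (absz (z + a * B%:Z)%R <= \sum_(c <- cs) absz c)%N.
    by rewrite (big_rem _ h1) /= leq_addr.
  have : (B <= absz (a * B%:Z)%R)%N by rewrite abszM absz_nat leq_pmull // absz_gt0.
  by rewrite {2}/B; lia.
exists r; apply: (@eigen_absent K V h [seq c%:~R | c <- cs] S (z + a * r%:Z)%:~R) => //.
- by move=> u /Scs[c ccs hu]; exists c%:~R => //; apply: map_f.
- exact: NS.
- by rewrite mem_map //; apply: intr_inj.
Qed.

End WeightNilpotent.

Section Sl2Vector.
Context (K : numFieldType) (U : vectType K) (e f h : {linear U -> U}).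
Hypothesis hef : forall v, e (f v) - f (e v) = h v.
Hypothesis hhe : forall v, h (e v) - e (h v) = 2 *: e v.
Hypothesis hhf : forall v, h (f v) - f (h v) = - 2 *: f v.
Context (X : seq (U * int)).
Hypothesis Xbasis : basis_of {:U} [seq p.1 | p <- X].
Hypothesis Xwt : forall p, p \in X -> h p.1 = p.2%:~R *: p.1.

Lemma fullv_lspan v : lspan [set` [seq p.1 | p <- X]] v.
Proof.
rewrite [v](coord_basis (X := in_tuple _) Xbasis) ?memvf //.
apply: subspace_sum => [|i _]; first exact: lspan_subspace.
apply: (subspaceZ _ (lspan_subspace _)).
by apply: sub_lspan => /=; apply: mem_nth.
Qed.

Lemma sl2_nil (t : {linear U -> U}) (a : int) : a != 0 ->
  (forall v, h (t v) - t (h v) = a%:~R *: t v) ->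
  forall v, exists r, iter r t v = 0.
Proof.
move=> a0 ht v.
have nilX p : p \in X -> exists r, iter r t p.1 = 0.
  move=> pX; apply: (@weight_nilpotent K U h t a ht a0 [seq p.2 | p <- X] setT [set` [seq p.1 | p <- X]] _ _ _ _ p.2) => //.
  - by move=> u _; apply: fullv_lspan.
  - by move=> _ /mapP[q qX ->]; exists q.2; [apply: map_f | apply: Xwt].
  - exact: Xwt.
apply: (lspan_sub _ _ (fullv_lspan v) : [set v | exists r, iter r t v = 0] v); last first.
  by move=> _ /mapP[p pX ->]; apply: nilX.
have mono r s u : iter r t u = 0 -> iter (s + r) t u = 0.
  by move=> h0; rewrite iterD h0 iter_lin0.
split=> [|u w [r ru] [s sw]|b u [r ru]]; first by exists 0%N.
  exists (r + s)%N; have := iter_lin t (r + s) 1 u w; rewrite !scale1r => ->.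
  have e1 := mono _ s _ ru; rewrite addnC in e1.
  by rewrite e1 (mono _ r _ sw) addr0.
by exists r; rewrite iter_linZ ru scaler0.
Qed.

Fixpoint sl2_string (u : U) (m : nat) : seq U :=
  if m is m'.+1 then iter m f u :: sl2_string u m' else [:: u].
Definition sl2_strings (T : seq (U * nat)) := flatten [seq sl2_string p.1 p.2 | p <- T].
Definition hw_vectors (T : seq (U * nat)) :=
  forall p, p \in T -> [/\ e p.1 = 0, h p.1 = p.2%:R *: p.1 & iter p.2.+1 f p.1 = 0].

Lemma mem_string u m v : v \in sl2_string u m -> exists2 r, (r <= m)%N & v = iter r f u.
Proof.
elim: m => [|m IH] /=; rewrite inE; first by move=> /eqP ->; exists 0%N.
by move=> /orP[/eqP ->|/IH[r rm ->]]; [exists m.+1 | exists r; rewrite // leqW].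
Qed.
Lemma string_mem u m r : (r <= m)%N -> iter r f u \in sl2_string u m.
Proof.
elim: m => [|m IH] /=; first by rewrite leqn0 inE => /eqP ->.
by rewrite leq_eqVlt inE => /orP[/eqP ->|/IH ->]; rewrite ?eqxx ?orbT.
Qed.

Lemma strings_stable T : hw_vectors T ->
  (forall v, v \in <<sl2_strings T>>%VS -> e v \in <<sl2_strings T>>%VS) /\
  (forall v, v \in <<sl2_strings T>>%VS -> f v \in <<sl2_strings T>>%VS).
Proof.
move=> hT; set S := <<_>>%VS.
have memS p r : p \in T -> (r <= p.2)%N -> iter r f p.1 \in S.
  move=> pT rp; apply: memv_span; apply/flatten_mapP; exists p => //.
  exact: string_mem.
have gen (t : {linear U -> U}) : (forall p r, p \in T -> (r <= p.2)%N -> t (iter r f p.1) \in S) ->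
    forall v, v \in S -> t v \in S.
  move=> ht v vS; have := coord_span (X := in_tuple (sl2_strings T)) vS => ->.
  rewrite linear_sum; apply: rpred_sum => i _; rewrite linearZ; apply: rpredZ.
  have /flatten_mapP[p pT /mem_string[r rp ->]] : (sl2_strings T)`_i \in sl2_strings T.
    exact: mem_nth.
  exact: ht.
split; apply: gen => p r pT rp; have [ep hp fp] := hT p pT.
  case: r rp => [|r] rp; first by rewrite /= ep mem0v.
  rewrite (e_fS hef hhf r hp) ep iter_lin0 add0r; apply: rpredZ; apply: memS => //.
  exact: ltnW.
rewrite -iterS; move: rp; rewrite leq_eqVlt => /orP[/eqP ->|rp]; last exact: memS.
by rewrite fp mem0v.
Qed.

(** As long as the strings found do not span, [hw_span] gives a highest weight
    vector u outside their span. The string of u is independent of them: a power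
    of e would bring a relation to one that involves u alone. *)
Theorem sl2_string_basis : exists T, hw_vectors T /\ basis_of {:U} (sl2_strings T).
Proof.
have fnil := @sl2_nil f (-2) isT hhf.
have enil := @sl2_nil e 2 isT hhe.
suff H d : forall T, hw_vectors T -> free (sl2_strings T) ->
    (\dim {:U} - size (sl2_strings T) <= d)%N ->
    exists T, hw_vectors T /\ basis_of {:U} (sl2_strings T).
  by apply: (H (\dim {:U}) [::]) => //=; rewrite ?nil_free // leq_subr.
elim: d => [|d IH] T hT fT.
  rewrite leqn0 subn_eq0 => le; exists T; split=> //.
  by rewrite basisEfree fT subvf.
move=> le; have [full|nfull] := boolP (<<sl2_strings T>> == fullv)%VS.
  exists T; split=> //; by rewrite /basis_of full fT.
have [Se Sf] := strings_stable hT.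
have [u [m [hu eu nuS]]] : exists u m, [/\ h u = (m : nat)%:R *: u, e u = 0 & u \notin <<sl2_strings T>>%VS].
  apply: contrapT => nex; case/negP: nfull; rewrite eqEsubv subvf /=.
  rewrite -(span_basis Xbasis); apply/span_subvP => _ /mapP[p pX ->].
  apply: (hw_span hef hhe hhf fnil enil (N := setT)
    (S := [set v | v \in <<sl2_strings T>>%VS]) _ _ _ _ _ _ (Xwt pX)) => //.
    by split=> [|u v /= ? ?|a u /= ?]; rewrite /mkset; [apply: mem0v | apply: rpredD | apply: rpredZ].
  move=> u m r _ hu eu; rewrite /mkset; apply: contrapT => /negP nS; apply: nex.
  exists u, m; split=> //; apply: contra nS => uS.
  by elim: r => //= r; apply: Sf.
have fu := hw_string hef hhe hhf fnil hu eu.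
set T' := (u, m) :: T.
have TE : sl2_strings T' = sl2_string u m ++ sl2_strings T by [].
have sz r : size (sl2_string u r) = r.+1 by elim: r => //= r ->.
apply: (IH T'); first by move=> p; rewrite inE => /orP[/eqP ->|/hT].
  rewrite TE; have : (m <= m)%N by [].
  elim: {-2}m => [|r IHr] rm; first by rewrite /= free_cons nuS.
  rewrite /= free_cons IHr ?andbT; last exact: ltnW.
  apply/negP; rewrite span_cat => /memv_addP[s1 s1u [s2 s2S E]].
  case/negP: nuS; have c0 := ef_coef_neq0 K rm.
  have Er t v : v \in <<sl2_strings T>>%VS -> iter t e v \in <<sl2_strings T>>%VS.
    by move=> vS; elim: t => //= t; apply: Se.
  have : iter r.+1 e (iter r.+1 f u) \in <<sl2_strings T>>%VS.
    rewrite [iter r.+1 f u]E; have := iter_lin e r.+1 1 s1 s2; rewrite !scale1r => ->.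
    suff -> : iter r.+1 e s1 = 0 by rewrite add0r; apply: Er.
    have := coord_span (X := in_tuple (sl2_string u r)) s1u => ->.
    apply: (big_ind (fun v => iter r.+1 e v = 0)) => [|v w v0 w0|i _].
    - exact: iter_lin0.
    - by have := iter_lin e r.+1 1 v w; rewrite !scale1r v0 w0 addr0.
    rewrite iter_linZ.
    have /mem_string[t tr ->] : (sl2_string u r)`_i \in sl2_string u r by apply: mem_nth.
    have -> : r.+1 = ((r - t).+1 + t)%N by lia.
    rewrite iterD (e_f_hw hef hhf t hu eu) iter_linZ iterSr eu iter_lin0.
    by rewrite !scaler0.
  rewrite (e_f_hw hef hhf _ hu eu) => h1.
  by rewrite -[u](scalerK c0); apply: rpredZ.
by rewrite TE size_cat sz; lia.
Qed.

(** The vectors of eigenvalue c form a basis of the eigenspace, so that their number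
    depends on h only. *)
Lemma eigenbasis_count (P : seq (U * K)) c : basis_of {:U} [seq p.1 | p <- P] ->
  (forall p, p \in P -> h p.1 = p.2 *: p.1) ->
  count (fun p => p.2 == c) P = \dim (lker (linfun (fun v => h v - c *: v))).
Proof.
move=> Pb Pw.
have lin : linear (fun v => h v - c *: v).
  move=> a u v; rewrite linearP scalerBr scalerDr !scalerA (mulrC c) opprD.
  by rewrite addrACA.
have linE v : linfun (fun v => h v - c *: v) v = h v - c *: v.
  pose L : {linear U -> U} := HB.pack (fun v => h v - c *: v) (GRing.isLinear.Build _ _ _ _ _ lin).
  exact: (lfunE L).
pose Q := [seq p <- P | p.2 == c].
have fP := basis_free Pb.
have fQ : free [seq p.1 | p <- Q].
  have pe : perm_eq [seq p.1 | p <- P]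
      ([seq p.1 | p <- Q] ++ [seq p.1 | p <- P & ~~ (p.2 == c)]).
    by rewrite -map_cat; apply: perm_map; rewrite perm_sym; apply/permPl/perm_filterC.
  by rewrite (perm_free pe) in fP; apply: catl_free fP.
have -> : lker (linfun (fun v => h v - c *: v)) = <<[seq p.1 | p <- Q]>>%VS.
  apply/eqP; rewrite eqEsubv; apply/andP; split; last first.
    apply/span_subvP => x /mapP[p]; rewrite mem_filter => /andP[/eqP pc pP] ->.
    by rewrite memv_ker linE Pw // pc subrr.
  apply/subvP => v; rewrite memv_ker linE => /eqP hv.
  have vE := coord_basis (X := in_tuple _) Pb (memvf v).
  have P1 (i : 'I_(size [seq p.1 | p <- P])) : (i < size P)%N by rewrite -(size_map fst) ltn_ord.
  pose w (i : 'I_(size [seq p.1 | p <- P])) := (nth (0, 0) P i).2.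
  have wE (i : 'I_(size [seq p.1 | p <- P])) : h (in_tuple [seq p.1 | p <- P])`_i = w i *: (in_tuple [seq p.1 | p <- P])`_i.
    rewrite /= (nth_map (0, 0)) // Pw // mem_nth //.
  have /freeP fr : free (in_tuple [seq p.1 | p <- P]) by [].
  have a0 (i : 'I_(size [seq p.1 | p <- P])) : coord (in_tuple [seq p.1 | p <- P]) i v * (w i - c) = 0.
    apply: (fr (fun i => coord (in_tuple [seq p.1 | p <- P]) i v * (w i - c))).
    rewrite -[RHS]hv [in RHS]vE linear_sum scaler_sumr -sumrB.
    apply: eq_bigr => k _; rewrite linearZ /= wE !scalerA -scalerBl.
    by congr (_ *: _); ring.
  rewrite vE; apply: rpred_sum => i _; have /eqP := a0 i; rewrite mulf_eq0.
  case/orP => [/eqP ->|]; first by rewrite scale0r mem0v.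
  rewrite subr_eq0 => wc; apply: rpredZ; apply: memv_span.
  rewrite /= (nth_map (0, 0)) //; apply: map_f; rewrite mem_filter mem_nth // andbT.
  exact: wc.
by move/eqP: fQ => ->; rewrite size_map size_filter.
Qed.

Local Lemma count_string (m k : nat) :
  (\sum_(r < m.+1) (m == k + 2 * r)%N = \sum_(r < m.+1) (m == k.+2 + 2 * r)%N + (m == k))%N.
Proof.
rewrite big_ord_recl [X in (_ = X + _)%N]big_ord_recr /=.
have -> : (m == k.+2 + 2 * m) = false by apply/eqP; lia.
rewrite !addn0 addnC; congr (_ + _)%N.
by apply: eq_bigr => r _; congr (nat_of_bool _); rewrite /bump; lia.
Qed.

(** Both X and the strings are eigenbases, and a string has as many vectors of
    weight k as of weight k + 2, unless its highest weight is k. *)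
Theorem strings_count T (k : nat) : hw_vectors T -> basis_of {:U} (sl2_strings T) ->
  (count (fun p => p.2 == k%:Z) X = count (fun p => p.2 == k.+2%:Z) X + count (fun p => p.2 == k) T)%N.
Proof.
move=> hT bT.
pose XK := [seq (p.1, (p.2)%:~R : K) | p <- X].
have XKb : basis_of {:U} [seq p.1 | p <- XK] by rewrite -map_comp.
have XKw p : p \in XK -> h p.1 = p.2 *: p.1 by case/mapP => q qX ->; apply: Xwt.
pose str (p : U * nat) := [seq (iter r f p.1, (p.2%:Z - 2 * r%:Z)%:~R : K) | r <- rev (iota 0 p.2.+1)].
pose TK := flatten [seq str p | p <- T].
have strE u m : sl2_string u m = [seq iter r f u | r <- rev (iota 0 m.+1)].
  elim: m => [//|m IH]; rewrite -[m.+2]addn1 iotaD rev_cat add0n /= IH.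
  by rewrite [in RHS]/= .
have TKE : [seq p.1 | p <- TK] = sl2_strings T.
  rewrite /TK map_flatten -map_comp; congr flatten; apply: eq_map => p /=.
  by rewrite strE /str -map_comp.
have TKb : basis_of {:U} [seq p.1 | p <- TK] by rewrite TKE.
have TKw p : p \in TK -> h p.1 = p.2 *: p.1.
  case/flatten_mapP => q qT /mapP[r _ ->] /=; have [_ hq _] := hT q qT.
  by rewrite (wt_f hhf r hq); congr (_ *: _); rewrite rmorphB rmorphM /=.
have cX (z : int) : count (fun p => p.2 == z) X = count (fun p => p.2 == z%:~R) XK.
  by rewrite count_map; apply: eq_count => p /=; rewrite (inj_eq (@intr_inj _)).
have cT (j : nat) : count (fun p => p.2 == (j%:Z)%:~R) TK
    = (\sum_(p <- T) \sum_(r < p.2.+1) (p.2 == j + 2 * r))%N.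
  rewrite /TK count_flatten -map_comp sumnE big_map; apply: eq_bigr => p _ /=.
  rewrite count_map count_rev -sum1_count big_mkcond -[iota _ _]/(index_iota 0 p.2.+1) big_mkord.
  apply: eq_bigr => r _ /=; rewrite (inj_eq (@intr_inj _)).
  have -> : (p.2%:Z - 2 * r%:Z == j%:Z) = (p.2 == j + 2 * r)%N by lia.
  by case: eqP.
rewrite !cX !(eigenbasis_count _ XKb XKw) -!(eigenbasis_count _ TKb TKw) !cT.
have -> : count (fun p => p.2 == k) T = (\sum_(p <- T) (p.2 == k))%N.
  by rewrite -sum1_count big_mkcond; apply: eq_bigr => p _; case: eqP.
by rewrite -big_split; apply: eq_bigr => p _; apply: count_string.
Qed.

End Sl2Vector.

(** * Quotients and modules spanned by ordered monomials *)
Lemma act_bundle (K : fieldType) (n : nat) (g : {vspace 'M[K]_n}) (V : lmodType K)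
    (act : 'M[K]_n -> V -> V) (r : is_rep g act) x : x \in g ->
  exists t : {linear V -> V}, forall v, t v = act x v.
Proof.
move=> gx; have lin : linear (act x) by move=> a u v; exact: (act_lin r a u v gx).
pose t : {linear V -> V} := HB.pack (act x) (GRing.isLinear.Build _ _ _ _ _ lin).
by exists t.
Qed.

Section QuotientModule.
Context (K : fieldType) (n : nat) (g : {vspace 'M[K]_n}).
Context (V : lmodType K) (act : 'M[K]_n -> V -> V) (r : is_rep g act).
Context (W : set V) (sW : submod g act W).

Definition quot_act (x : 'M[K]_n) (m : lquot W) : lquot W := lproj W (act x (repr m)).

Lemma lproj_eq u v : lproj W u = lproj W v <-> W (u - v).
Proof. by rewrite lprojP lspan_id //; case: sW. Qed.
Lemma lproj_eq0 v : lproj W v = 0 <-> W v.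
Proof. by rewrite -(linear0 (lproj W)) lproj_eq subr0. Qed.

Lemma quot_actE x v : x \in g -> quot_act x (lproj W v) = lproj W (act x v).
Proof.
move=> gx; apply/lproj_eq; rewrite -(actB r) //; apply: sW.2 => //.
by apply/lproj_eq; rewrite lproj_repr.
Qed.

Lemma quot_rep : is_liealg g -> is_rep g quot_act.
Proof.
move=> gL; split=> [x a|a x y|x y].
- elim/lquotP=> u; elim/lquotP=> v gx.
  by rewrite -lproj_linear !quot_actE // (act_lin r) // lproj_linear.
- elim/lquotP=> v gx gy.
  rewrite (quot_actE v gx) (quot_actE v gy) -lproj_linear quot_actE ?(act_linl r) //.
  by rewrite rpredD ?rpredZ.
- elim/lquotP=> v gx gy; rewrite (quot_actE v gy) (quot_actE v gx).
  rewrite (quot_actE _ gx) (quot_actE _ gy) quot_actE; last exact: gL.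
  by rewrite (act_lie r) // linearB.
Qed.

End QuotientModule.

Section StableSorted.
Context (K : fieldType) (n : nat) (g q : {vspace 'M[K]_n}).
Hypotheses (gL : is_liealg g) (qg : (q <= g)%VS).
Context (m : nat) (y : m.-tuple 'M[K]_n).
Hypotheses (yg : forall i : 'I_m, y`_i \in g) (gyq : (g <= <<y>> + q)%VS).
Hypothesis yL : is_liealg <<y>>%VS.
Context (V : lmodType K) (act : 'M[K]_n -> V -> V) (r : is_rep g act).
Context (P : set V).
Local Notation W := (ysorted y act P).

Lemma span_yg : (<<y>> <= g)%VS.
Proof.
by apply/span_subvP => x /tnthP[i ->]; rewrite (tnth_nth 0); apply: yg.
Qed.

(** The case q = 0 of [pbw_span], for the Lie algebra spanned by y. *)
Lemma ysorted_y (sP : subspace P) : submod <<y>>%VS act W.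
Proof.
have y0 : (0 <= <<y>>)%VS by rewrite sub0v.
have ry := sub_rep r span_yg.
apply: (@pbw_span K n <<y>>%VS 0%VS yL y0 m y _ _ V act ry P).
- by move=> i; apply/memv_span/mem_nth; rewrite size_tuple.
- by rewrite addv0.
- by move=> x v; rewrite memv0 => /eqP -> _; rewrite (act0l r); apply: subspace0.
Qed.

Hypothesis sP : subspace P.
Hypothesis qP : forall x v, x \in q -> P v -> W (act x v).

(** In contrast to [pbw_span], q need not preserve P: it may send P into the
    span of the ordered monomials applied to P, since commuting x in q to the
    right past a monomial leads to elements of q and of the span of y, applied
    to shorter monomials. *)
Lemma ysorted_submod : submod g act W.
Proof.
have [sW yW] := ysorted_y sP.
have Wy i v : (i < m)%N -> W v -> W (act y`_i v).
  by move=> im; apply: yW; apply/memv_span/mem_nth; rewrite size_tuple.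
have qW M v x : all (fun i => i < m)%N M -> P v -> x \in q -> W (act x (ymon y act M v)).
  move=> aM Pv; elim: M x aM => [|i M IH] x; first by move=> _ /qP; apply.
  move=> /= /andP[im aM] xq; have gx := subvP qg _ xq; have gi := yg (Ordinal im).
  rewrite (act_swap r) //; apply: (subspaceD sW); first by apply: Wy => //; apply: IH.
  apply: (@split_yq K n g q qg m y yg gyq V act r) => //; first exact: gL.
    have WM : W (ymon y act M v).
      elim: M aM {IH} => [|k M IH] /=; first by move=> _; apply: sub_lspan; exists [::], v.
      by move=> /andP[km /IH]; apply: Wy.
    by move=> j jm; apply: Wy.
  by move=> z zq; apply: IH.
split=> // x v gx Wv.
apply: (@split_yq K n g q qg m y yg gyq V act r) => //.
  by move=> j jm; apply: Wy.
move=> z zq; apply: (lspan_act r (subvP qg _ zq) sW _ Wv).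
by move=> _ [M [w [gM Pw ->]]]; apply: qW => //; case/andP: gM.
Qed.

End StableSorted.

Section Eigen.
Context (K : fieldType) (V : lmodType K) (h : {linear V -> V}).

Lemma lspan_fin (S : set V) v : lspan S v ->
  exists2 s : seq V, (forall u, u \in s -> S u) & lspan [set` s] v.
Proof.
pose W : set V := [set v | exists2 s : seq V, (forall u, u \in s -> S u) & lspan [set` s] v].
apply: (@lspan_sub _ _ _ W); last first.
  move=> u Su; exists [:: u]; first by move=> w; rewrite inE => /eqP ->.
  by apply: sub_lspan; rewrite /= inE.
split.
- by exists [::] => //; apply: subspace0 (lspan_subspace _).
- move=> u w [s sS su] [t tS tw]; exists (s ++ t).
    by move=> z; rewrite mem_cat => /orP[/sS|/tS].
  apply: (subspaceD (lspan_subspace _)).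
    by apply: lspanS su => z /= zs; rewrite mem_cat zs.
  by apply: lspanS tw => z /= zs; rewrite mem_cat zs orbT.
- by move=> a u [s sS su]; exists s => //; apply: subspaceZ (lspan_subspace _) su.
Qed.

(** The other components add up to an eigenvector to which [eigen_absent] applies. *)
Lemma eig_part (S : set V) c v : (forall s, S s -> exists d, h s = d *: s) ->
  lspan S v -> h v = c *: v -> lspan [set s | S s /\ h s = c *: s] v.
Proof.
move=> hS /lspan_fin[s sS sv] hv.
have [a vE] := lspan_seqP sv.
have dP (i : 'I_(size s)) : exists d, h s`_i = d *: s`_i.
  by apply/hS/sS/mem_nth.
have [d dE] := choice dP.
pose v1 := \sum_(i < size s | d i == c) a i *: s`_i.
have v1c : h v1 = c *: v1.
  rewrite linear_sum scaler_sumr; apply: eq_bigr => i /eqP di.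
  by rewrite linearZ /= dE di !scalerA mulrC.
suff -> : v = v1.
  apply: subspace_sum => [|i /eqP di]; first exact: lspan_subspace.
  apply: (subspaceZ _ (lspan_subspace _)); apply: sub_lspan.
  by split; [apply/sS/mem_nth | rewrite dE di].
apply/eqP; rewrite -subr_eq0; apply/eqP.
pose cs := [seq d' <- [seq d i | i <- enum 'I_(size s)] | d' != c].
pose S' : set V := [set u | exists2 e, e \in cs & h u = e *: u].
apply: (@eigen_absent K V h cs S' c) => //.
- rewrite vE (bigID (fun i => d i == c)) /= -/v1 addrAC subrr add0r.
  apply: subspace_sum => [|i di]; first exact: lspan_subspace.
  apply: (subspaceZ _ (lspan_subspace _)); apply: sub_lspan.
  by exists (d i); rewrite // mem_filter di map_f // mem_enum.
- by rewrite linearB v1c hv scalerBr.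
- by rewrite mem_filter eqxx.
Qed.

End Eigen.

Lemma eig_free (K : fieldType) (U : vectType K) (h : {linear U -> U}) (s : seq (U * K)) :
  uniq [seq p.2 | p <- s] ->
  (forall p, p \in s -> p.1 != 0 /\ h p.1 = p.2 *: p.1) -> free [seq p.1 | p <- s].
Proof.
elim: s => [|p s IH] /=; first by rewrite nil_free.
move=> /andP[ps us] hs; rewrite free_cons IH // ?andbT; last first.
  by move=> p' p's; apply: hs; rewrite inE p's orbT.
have [p0 hp] := hs p (mem_head _ _).
apply: contra p0 => pS; apply/eqP.
apply: (@eigen_absent K U h [seq p.2 | p <- s] [set` [seq p.1 | p <- s]] p.2) => //.
  move=> _ /mapP[p' p's ->]; exists p'.2; first exact: map_f.
  by case: (hs p') => //; rewrite inE p's orbT.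
have := coord_span (X := in_tuple [seq p.1 | p <- s]) pS => ->.
apply: subspace_sum => [|i _]; first exact: lspan_subspace.
by apply: (subspaceZ _ (lspan_subspace _)); apply: sub_lspan => /=; apply: mem_nth.
Qed.

(** * Simple highest weight modules of the Levi factor *)
Section HighestWeight.
Context (K : numFieldType) (n : nat) (g hh lv : {vspace 'M[K]_n}).
Context (H : 'M[K]_n) (e f : 'M[K]_n).
Hypotheses (hg : (hh <= g)%VS) (eg : e \in g) (fg : f \in g) (Hh : H \in hh).
Hypothesis lvE : lv = (hh + <[e]> + <[f]>)%VS.
Hypotheses (ef : lie e f = H) (He : lie H e = 2 *: e) (Hf : lie H f = - 2 *: f).
Hypothesis hf : forall x, x \in hh -> exists c, lie x f = c *: f.
Context (F : vectType K) (aF : 'M[K]_n -> F -> F) (rF : is_rep g aF).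
Hypothesis sF : simple_submod lv aF setT.
Context (v0 : F) (k : nat) (wt : 'M[K]_n -> K).
Hypotheses (v0n0 : v0 != 0) (wt0 : forall x, x \in hh -> aF x v0 = wt x *: v0).
Hypotheses (ev0 : aF e v0 = 0) (wtH : wt H = k%:R).

Local Notation st r := (iter r (aF f) v0).

Lemma hw_h x : x \in hh -> forall r, exists c, aF x (st r) = c *: st r.
Proof.
move=> xh; have gx := subvP hg _ xh; have [c cE] := hf xh; elim=> [|r [d dE]].
  by exists (wt x); apply: wt0.
exists (d + c); rewrite /= (act_swap rF) // dE cE (actZ rF) // (actZl rF) //.
by rewrite -scalerDl.
Qed.

(** The vectors f^r v0 have distinct weights, so only finitely many are nonzero.
    Their span is stable under the Levi factor, hence everything, and sl2 theory
    gives the length of the string. *)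
Theorem hw_basis :
  basis_of {:F} [seq st r | r <- iota 0 k.+1] /\ st k.+1 = 0.
Proof.
have gH := subvP hg _ Hh.
have [te teE] := act_bundle rF eg; have [tf tfE] := act_bundle rF fg.
have [th thE] := act_bundle rF gH.
have stE r : st r = iter r tf v0 by elim: r => //= r ->; rewrite tfE.
have hef v : te (tf v) - tf (te v) = th v.
  by rewrite !teE !tfE thE -ef (act_lie rF).
have hhe v : th (te v) - te (th v) = 2 *: te v.
  by rewrite !teE !thE -(act_lie rF) // He (actZl rF).
have hhf v : th (tf v) - tf (th v) = - 2 *: tf v.
  by rewrite !tfE !thE -(act_lie rF) // Hf (actZl rF).
have hv0 : th v0 = k%:R *: v0 by rewrite thE wt0 // wtH.
have ev0' : te v0 = 0 by rewrite teE.
have wr r := wt_f hhf r hv0.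
have inj : injective (fun r : nat => k%:R - 2 * r%:R : K).
  move=> r s /addrI /oppr_inj /eqP; rewrite -!natrM eqr_nat eqn_pmul2l // => /eqP //.
have fr N : (forall r, (r < N)%N -> st r != 0) -> free [seq st r | r <- iota 0 N].
  move=> nz; have -> : [seq st r | r <- iota 0 N]
      = [seq p.1 | p <- [seq (st r, k%:R - 2 * r%:R : K) | r <- iota 0 N]].
    by rewrite -map_comp.
  apply: (@eig_free K F th); first by rewrite -map_comp map_inj_uniq ?iota_uniq.
  move=> p /mapP[r]; rewrite mem_iota => /andP[_ rN] ->; split=> /=; first exact: nz.
  by rewrite stE wr.
have [N0 stN0] : exists N, st N = 0.
  apply: contrapT => nN.
  have /fr : forall r, (r < (\dim {:F}).+1)%N -> st r != 0.
    by move=> r _; apply/eqP => h; apply: nN; exists r.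
  move=> /eqP E; have := dimvS (subvf <<[seq st r | r <- iota 0 (\dim {:F}).+1]>>%VS).
  by rewrite E size_map size_iota ltnn.
pose W : set F := lspan [set v | exists r, v = st r].
have WT : W = setT.
  have sW : submod lv aF W.
    split=> [|x v]; first exact: lspan_subspace.
    rewrite lvE => xl Wv.
    have lg : (lv <= g)%VS by rewrite lvE !subv_add hg -!memvE eg fg.
    have gx : x \in g by apply: (subvP lg); rewrite lvE.
    apply: (lspan_act rF gx (lspan_subspace _) _ Wv) => _ [r ->].
    have /memv_addP[x1 /memv_addP[xh xhh [xe /vlineP[a ->] ->]] [xf /vlineP[b ->] ->]] := xl.
    have gxh := subvP hg _ xhh; have sWs : subspace W := lspan_subspace _.
    rewrite !(actDl rF) ?rpredD ?rpredZ // !(actZl rF) //.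
    have Wst i : W (st i) by apply: sub_lspan; exists i.
    apply: (subspaceD sWs); last by apply: (subspaceZ _ sWs); apply: (Wst r.+1).
    apply: (subspaceD sWs).
      by have [c ->] := hw_h xhh r; apply: (subspaceZ _ sWs).
    apply: (subspaceZ _ sWs); rewrite -teE stE.
    case: r => [|r]; first by rewrite /= ev0'; apply: subspace0.
    rewrite (e_fS hef hhf r hv0) ev0' iter_lin0 add0r -stE.
    by apply: (subspaceZ _ sWs).
  have [_ _ /(_ W sW (fun _ _ => Logic.I))[W0|//]] := sF.
  have : W v0 by apply: sub_lspan; exists 0%N.
  by rewrite W0 /= => /eqP; rewrite (negPf v0n0).
have nil v : exists N, iter N tf v = 0.
  have : W v by rewrite WT.
  apply: (@lspan_sub _ _ _ [set v | exists N, iter N tf v = 0]).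
    have mono r s u : iter r tf u = 0 -> iter (s + r) tf u = 0.
      by move=> h0; rewrite iterD h0 iter_lin0.
    split=> [|u w [r ru] [s sw]|b u [r ru]]; first by exists 0%N.
      exists (r + s)%N; have := iter_lin tf (r + s) 1 u w; rewrite !scale1r => ->.
      have e1 := mono _ s _ ru; rewrite addnC in e1.
      by rewrite e1 (mono _ r _ sw) addr0.
    by exists r; rewrite iter_linZ ru scaler0.
  by move=> _ [r ->]; exists N0; rewrite stE -iterD addnC iterD -stE stN0 iter_lin0.
have stk : st k.+1 = 0 by rewrite stE; apply: (hw_string hef hhe hhf nil hv0 ev0').
have stn0 r : (r <= k)%N -> st r != 0.
  move=> rk; apply: contra v0n0 => /eqP s0; apply/eqP.
  have := e_f_hw hef hhf r hv0 ev0'; rewrite -stE s0 iter_lin0 => /esym/eqP.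
  by rewrite scaler_eq0 (negPf (ef_coef_neq0 K rk)) => /eqP.
split=> //; rewrite /basis_of fr ?andbT; last by move=> r; rewrite ltnS; apply: stn0.
rewrite eqEsubv subvf /=; apply/subvP => v _.
have : W v by rewrite WT.
apply: (@lspan_sub _ _ _ [set v | v \in <<[seq st r | r <- iota 0 k.+1]>>%VS]).
  by split=> [|u w /= ? ?|a u /= ?]; rewrite /mkset; [apply: mem0v | apply: rpredD | apply: rpredZ].
move=> _ [r ->]; rewrite /mkset; case: (leqP r k) => rk.
  by apply: memv_span; apply/mapP; exists r; rewrite // mem_iota.
have -> : r = ((r - k.+1) + k.+1)%N by lia.
by rewrite stE iterD -stE stk iter_lin0 mem0v.
Qed.

End HighestWeight.

(** * Graded modules that are free over the negative part of a subalgebra *)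
Section Lact.
Context (K : fieldType) (n : nat) (g : {vspace 'M[K]_n}).
Context (V : lmodType K) (act : 'M[K]_n -> V -> V) (r : is_rep g act).
Context (x : 'M[K]_n) (gx : x \in g).
Definition lact : {linear V -> V} := projT1 (cid (act_bundle r gx)).
Lemma lactE v : lact v = act x v.
Proof. exact: (projT2 (cid (act_bundle r gx))). Qed.
End Lact.

Lemma addset0 (K : fieldType) (V : lmodType K) (W : set V) :
  addset W [set 0] = W.
Proof.
apply/seteqP; split=> [_ [a [_ [Wa -> ->]]]|v Wv]; first by rewrite addr0.
by exists v, 0; rewrite addr0.
Qed.

Lemma tens1_act (K : fieldType) (n : nat) (g p : {vspace 'M[K]_n}) (F : lmodType K)
    (aF : 'M[K]_n -> F -> F) x v : x \in p ->
  induced_act x (tens (g := g) p aF 1 v) = tens p aF 1 (aF x v).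
Proof.
move=> xp; rewrite -(tens_balanced aF 1 v xp).
apply: etrans (induced_actE _ _ _ _ _) _.
exact: (congr1 (fun u => tens p aF u v) (etrans (mulr1 _) (esym (mul1r _)))).
Qed.

Section DirectSum.
Context (K : fieldType) (n : nat) (l : {vspace 'M[K]_n}).
Context (V : lmodType K) (act : 'M[K]_n -> V -> V) (r : is_rep l act).

Definition independent (T : set (set V)) : Prop :=
  forall (m : nat) (W : 'I_m -> set V) (w : 'I_m -> V),
    injective W -> (forall i, T (W i)) -> (forall i, W i (w i)) ->
    \sum_(i < m) w i = 0 -> forall i, w i = 0.

(** Zorn's lemma for independent families of the given simple modules: one that is
    not contained in the sum of a maximal family meets it in zero and could be
    added. *)
Lemma simple_direct_sum (SS : set (set V)) : (forall W, SS W -> simple_submod l act W) ->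
  exists2 T, T `<=` SS & direct_sum T (lspan (\bigcup_(W in SS) W)).
Proof.
move=> hS; pose P : set (set (set V)) := [set T | T `<=` SS /\ independent T].
have [|T [[TS indT] maxT]] := @Zorn_bigcup _ P.
  move=> F FP tot; split; first by move=> W [T FT TW]; exact: (FP _ FT).1.
  move=> m W w injW TW Ww; have [m0|m0] := posnP m.
    by move=> _ i; move: (ltn_ord i); rewrite {2}m0.
  have [X FX XW] : exists2 X, F X & forall i, X (W i).
    suff h (s : seq 'I_m) : s != [::] -> exists2 X, F X & forall i, i \in s -> X (W i).
      have [|X FX XW] := h (enum 'I_m); last by exists X => // i; apply: XW; rewrite mem_enum.
      by rewrite -size_eq0 size_enum_ord -lt0n.
    elim: s => // i s IH _; have [Y FY Yi] := TW i.
    case: (eqVneq s [::]) => [->|/IH[X FX Xs]]; first by exists Y => // j; rewrite inE => /eqP ->.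
    case: (tot X Y FX FY) => XY.
      by exists Y => // j; rewrite inE => /orP[/eqP -> //|/Xs/XY].
    by exists X => // j; rewrite inE => /orP[/eqP ->|/Xs //]; exact: XY.
  by apply: (FP _ FX).2 => //; exact: injW.
exists T => //; split=> //.
have sL : subspace (lspan (\bigcup_(W in T) W)) by exact: lspan_subspace.
apply/seteqP; split; last by apply: lspanS => w [W TW Ww]; exists W => //; exact: TS.
apply: lspan_sub => // w [W SW Ww].
have [sW _ simW] := hS W SW.
have sLm : submod l act (lspan (\bigcup_(W in T) W)).
  split=> // x v xl; apply: (lspan_act r xl sL) => u [W' TW' W'u].
  apply: sub_lspan; exists W' => //; have [[_ aW'] _ _] := hS _ (TS _ TW').
  exact: aW'.
have [cap0|capW] := simW _ (submodI sW sLm) (@subIsetl _ _ _); last first.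
  by have : W w := Ww; rewrite -capW => -[].
have WT : ~ T W.
  move=> TW; have [_ /eqP W0 _] := hS W SW; apply: W0; rewrite -cap0.
  apply/seteqP; split=> // v Wv; split=> //; apply: sub_lspan; by exists W.
exfalso; apply: (maxT (T `|` [set W])).
  split; first by move=> ? ?; left.
  by move=> /(_ W (or_intror (erefl W))).
split; first by move=> ? [/TS|->].
move=> m; case: m => [|m] Wi wi injW TW Wwi; first by move=> _ [].
have [[i0 Wi0]|none] := pselect (exists i, Wi i = W); last first.
  move=> s0; apply: indT injW _ Wwi s0 => i.
  by case: (TW i) => // Wi0; case: none; exists i.
have TW' j : T (Wi (lift i0 j)).
  case: (TW (lift i0 j)) => // Wj; exfalso.
  have /injW E : Wi i0 = Wi (lift i0 j) by rewrite Wi0.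
  by have := neq_lift i0 j; rewrite -E eqxx.
rewrite (bigD1_ord i0) //= => s0.
have wi0 : wi i0 = 0.
  have : (W `&` lspan (\bigcup_(W in T) W)) (wi i0).
    split; first by rewrite -Wi0.
    move/eqP: s0; rewrite addr_eq0 => /eqP ->; apply: (subspaceN sL).
    apply: subspace_sum => [|j _]; first exact: sL.
     apply: sub_lspan; by exists (Wi (lift i0 j)).
  by rewrite cap0.
rewrite wi0 add0r in s0.
have wj := indT m (fun j => Wi (lift i0 j)) (fun j => wi (lift i0 j))
  (fun a b h => lift_inj (injW _ _ h)) TW' (fun j => Wwi _) s0.
by move=> i; case: (unliftP i0 i) => [j ->|->].
Qed.
End DirectSum.

(** Here q is a parabolic subalgebra of g. Its Levi factor is spanned by H0,
    which is central in it and gives the grading, and by an sl2 with basis e,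
    Ha, f; its nilradical nl lies in the span of vectors us that raise the
    eigenvalue of H0; the vectors y lower it and span the opposite nilradical.
    The module V is free over the ordered monomials in y, on generators listed
    by degree: those of degree c, in [Ec c], have the H0-eigenvalue l0 - c and
    come with their Ha-weight. The span of the generators is not stable under q.
    It is so modulo the g-module generated in lower degrees, and this is why V
    is filtered by the degree of the generators. *)
Section GradedModule.
Context (K : numFieldType) (n : nat) (g q nl : {vspace 'M[K]_n}).
Hypotheses (gL : is_liealg g) (qg : (q <= g)%VS).
Context (m : nat) (y : m.-tuple 'M[K]_n).
Hypotheses (yg : forall i : 'I_m, y`_i \in g) (gyq : (g <= <<y>> + q)%VS).
Hypothesis yL : is_liealg <<y>>%VS.
Context (H0 Ha e f : 'M[K]_n) (us : seq 'M[K]_n).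
Hypotheses (H0q : H0 \in q) (Haq : Ha \in q) (eq : e \in q) (fq : f \in q).
Hypotheses (nlE : (nl <= <<us>>)%VS)
  (usP : forall u, u \in us -> u \in g /\ exists d : nat, lie H0 u = d.+1%:R *: u).
Hypothesis qE : (q <= <<[:: H0; Ha; e; f]>> + nl)%VS.
Hypotheses (ef : lie e f = Ha) (Hae : lie Ha e = 2 *: e) (Haf : lie Ha f = - 2 *: f).
Hypotheses (H0e : lie H0 e = 0) (H0f : lie H0 f = 0) (H0Ha : lie H0 Ha = 0).
Context (dy : nat -> nat) (wy : nat -> int).
Hypotheses (H0y : forall i : 'I_m, lie H0 y`_i = - (dy i).+1%:R *: y`_i)
  (Hay : forall i : 'I_m, lie Ha y`_i = (wy i)%:~R *: y`_i).

Context (V : lmodType K) (act : 'M[K]_n -> V -> V) (r : is_rep g act).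
Context (l0 : K) (Ec : nat -> seq (V * int)).
Hypotheses (EcH0 : forall c p, p \in Ec c -> act H0 p.1 = (l0 - c%:R) *: p.1)
  (EcHa : forall c p, p \in Ec c -> act Ha p.1 = p.2%:~R *: p.1).

Definition gen_all : set V := lspan [set v | exists c p, p \in Ec c /\ v = p.1].
Definition gen_lt (c : nat) : set V :=
  lspan [set v | exists c' p, [/\ (c' < c)%N, p \in Ec c' & v = p.1]].
Definition gen_at (c : nat) : set V := lspan [set v | exists2 p, p \in Ec c & v = p.1].

Hypothesis Espan : forall v, ysorted y act gen_all v.
Hypothesis Efree : forall s (h : seq nat -> V), uniq s -> all (good m) s ->
  (forall b, gen_all (h b)) -> \sum_(b <- s) ymon y act b (h b) = 0 ->
  forall b, b \in s -> h b = 0.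
Hypothesis Ecfree : forall c (a : nat -> K),
  \sum_(i < size (Ec c)) a i *: (nth (0, 0) (Ec c) i).1 = 0 ->
  forall i, (i < size (Ec c))%N -> a i = 0.

Let gq x : x \in q -> x \in g. Proof. exact: (subvP qg). Qed.
Let H0g := gq H0q.
Let Hag := gq Haq.
Let eg := gq eq.
Let fg := gq fq.
Local Notation ym := (ymon y act).

(** Degrees count downwards from the highest eigenvalue l0 of H0. *)
Definition wdeg (c : nat) : set V := [set v | act H0 v = (l0 - c%:R) *: v].

Lemma wdeg_sub c : subspace (wdeg c).
Proof.
split=> [|u v hu hv|a u hu]; rewrite /wdeg /mkset.
- by rewrite (act0 r) // scaler0.
- by rewrite (actD r) // hu hv scalerDr.
- by rewrite (actZ r) // hu !scalerA mulrC.
Qed.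

Definition ydeg (M : seq nat) : nat := sumn [seq (dy i).+1 | i <- M].

Lemma ymon_deg M c v : all (fun i => i < m)%N M -> wdeg c v -> wdeg (c + ydeg M) (ym M v).
Proof.
move=> aM hv; elim: M aM => [_|i M IH /= /andP[im aM]]; first by rewrite addn0.
have gi := yg (Ordinal im); rewrite /wdeg /mkset (act_swap r) // IH //.
rewrite (H0y (Ordinal im)) (actZ r) // (actZl r) // -scalerDl; congr (_ *: _).
by rewrite /ydeg /= !natrD -natr1; ring.
Qed.

Lemma ymon_wt M (z : int) v : all (fun i => i < m)%N M -> act Ha v = z%:~R *: v ->
  act Ha (ym M v) = (z + \sum_(i <- M) wy i)%:~R *: ym M v.
Proof.
move=> aM hv; elim: M aM => [_|i M IH /= /andP[im aM]]; first by rewrite big_nil addr0.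
have gi := yg (Ordinal im); rewrite (act_swap r) // IH //.
rewrite (Hay (Ordinal im)) (actZ r) // (actZl r) // -scalerDl -rmorphD; congr (_%:~R *: _).
by rewrite big_cons -addrA [in LHS](addrC _ (wy _)).
Qed.

Definition mons (c : nat) : set V := [set v | exists M c' p,
  [/\ good m M, p \in Ec c', (c' + ydeg M)%N = c & v = ym M p.1]].

Lemma mons_deg c : mons c `<=` wdeg c.
Proof.
move=> _ [M [c' [p [gM pE <- ->]]]]; apply: ymon_deg; first by case/andP: gM.
exact: EcH0.
Qed.

Lemma ysorted_lspan (S : set V) :
  ysorted y act (lspan S) `<=` lspan [set v | exists M u, [/\ good m M, S u & v = ym M u]].
Proof.
apply: lspan_sub; first exact: lspan_subspace.
move=> _ [M [v [gM Sv ->]]].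
apply: (@lspan_sub _ _ _ [set v | lspan _ (ym M v)] _ _ _ Sv).
  have sS : subspace (lspan [set v | exists M u, [/\ good m M, S u & v = ym M u]]).
    exact: lspan_subspace.
  split=> [|u w hu hw|a u hu]; rewrite /mkset.
  - by rewrite (ymon0 yg r gM); apply: subspace0.
  - have := ymon_lin yg r 1 u w gM; rewrite !scale1r => ->.
    exact: (subspaceD sS).
  - have := ymon_lin yg r a u 0 gM; rewrite (ymon0 yg r gM) !addr0 => ->.
    exact: (subspaceZ _ sS).
by move=> u Su; apply: sub_lspan; exists M, u.
Qed.

Lemma mons_span v : lspan [set v | exists c, mons c v] v.
Proof.
have := Espan v => /ysorted_lspan; apply: lspanS => _ [M [u [gM [c [p [pE ->]]] ->]]].
by exists (c + ydeg M)%N, M, c, p.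
Qed.

Lemma natl0_inj c c' : l0 - c%:R = l0 - c'%:R -> c = c'.
Proof. by move/addrI/oppr_inj/eqP; rewrite eqr_nat => /eqP. Qed.

Lemma wdeg_part c v : wdeg c v -> lspan (mons c) v.
Proof.
move=> hv; have h := lactE r H0g.
have : lspan [set s | (exists c, mons c s) /\ lact r H0g s = (l0 - c%:R) *: s] v.
  apply: eig_part (mons_span v) _; last by rewrite h.
  by move=> s [c' /mons_deg hs]; exists (l0 - c'%:R); rewrite h.
apply: lspan_sub => [|s [[c' ms] hs]]; first exact: lspan_subspace.
have [->|s0] := eqVneq s 0; first exact: subspace0 (lspan_subspace _).
apply: sub_lspan; suff <- : c' = c by [].
rewrite h (mons_deg ms) in hs; apply: natl0_inj.
by move/eqP: hs; rewrite -subr_eq0 -scalerBl scaler_eq0 (negPf s0) orbF subr_eq0 => /eqP.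
Qed.

Lemma deg_absent c v : act H0 v = c *: v -> (forall d : nat, c != l0 - d%:R) -> v = 0.
Proof.
move=> hv nd; have h := lactE r H0g.
have : lspan [set s | (exists c, mons c s) /\ lact r H0g s = c *: s] v.
  apply: eig_part (mons_span v) _; last by rewrite h.
  by move=> s [c' /mons_deg hs]; exists (l0 - c'%:R); rewrite h.
apply: (@lspan_sub _ _ _ [set 0]); first exact: subspace_eq0.
move=> s [[c' ms] hs]; rewrite h (mons_deg ms) in hs; apply/eqP.
move/eqP: hs; rewrite -subr_eq0 -scalerBl scaler_eq0 => /orP[|//].
by rewrite subr_eq0 eq_sym (negPf (nd c')).
Qed.

Lemma gen_lt_mono c c' : (c <= c')%N -> gen_lt c `<=` gen_lt c'.
Proof.
move=> cc'; apply: lspanS => _ [d [p [dc pE ->]]]; exists d, p; split=> //.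
exact: leq_trans dc cc'.
Qed.
Lemma gen_lt_all c : gen_lt c `<=` gen_all.
Proof. by apply: lspanS => _ [d [p [dc pE ->]]]; exists d, p. Qed.
Lemma gen_at_all c : gen_at c `<=` gen_all.
Proof. by apply: lspanS => _ [p pE ->]; exists c, p. Qed.
Lemma gen_at_lt c : gen_at c `<=` gen_lt c.+1.
Proof. by apply: lspanS => _ [p pE ->]; exists c, p. Qed.
Lemma gen_at_deg c : gen_at c `<=` wdeg c.
Proof.
by apply: lspan_sub (wdeg_sub c) _ => _ [p pE ->]; apply: EcH0.
Qed.

(** The definition by ordered monomials keeps the freeness of V at hand; by
    [Vlt_gen] this is the g-module generated in degrees below c. *)
Definition Vlt c := ysorted y act (gen_lt c).
Definition VQ c Q := ysorted y act (addset (gen_lt c) Q).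

Lemma Vlt_sub c : subspace (Vlt c). Proof. exact: lspan_subspace. Qed.
Lemma VQ_sub c Q : subspace (VQ c Q). Proof. exact: lspan_subspace. Qed.
Lemma VQ0 c : VQ c [set 0] = Vlt c. Proof. by rewrite /VQ addset0. Qed.
Lemma ysorted_mono P P' : P `<=` P' -> ysorted y act P `<=` ysorted y act P'.
Proof. by move=> PP; apply: lspanS => _ [M [w [gM Pw ->]]]; exists M, w; split=> //; apply: PP. Qed.
Lemma Vlt_VQ c Q : subspace Q -> Vlt c `<=` VQ c Q.
Proof. by move=> sQ; apply: ysorted_mono; exact: addset_subl. Qed.

Lemma wdeg_lt c c' : (c' < c)%N -> wdeg c' `<=` Vlt c.
Proof.
move=> cc' v /wdeg_part; apply: lspan_sub; first exact: Vlt_sub.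
move=> _ [M [d [p [gM pE dE ->]]]]; apply: sub_lspan; exists M, p.1; split=> //.
by apply: sub_lspan; exists d, p; split=> //; apply: leq_ltn_trans cc'; rewrite -dE leq_addr.
Qed.

Lemma wdeg0_act x c v : x \in g -> lie H0 x = 0 -> wdeg c v -> wdeg c (act x v).
Proof.
move=> gx h hv; rewrite /wdeg /mkset (act_swap r) // h (act0l r) addr0 hv (actZ r) //.
Qed.

(** The nilradical raises the eigenvalue of H0, that is, it lowers the degree. *)
Lemma us_act c x v : x \in us -> wdeg c v -> Vlt c (act x v).
Proof.
move=> /usP[gx [d dE]] hv.
have hx : act H0 (act x v) = (l0 - c%:R + d.+1%:R) *: act x v.
  by rewrite (act_swap r) // hv dE (actZ r) // (actZl r) // -scalerDl.
case: (leqP d.+1 c) => dc.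
  apply: (@wdeg_lt c (c - d.+1)); first by rewrite ltn_subrL (leq_trans _ dc).
  by rewrite /wdeg /mkset hx natrB // opprB addrA addrAC.
suff -> : act x v = 0 by apply: subspace0 (Vlt_sub c).
apply: deg_absent hx _ => d'; apply/negP => /eqP h.
have : (d.+1 + d')%:R = c%:R :> K.
  move/eqP: h; rewrite -addrA => /eqP/addrI h.
  have {}h : d.+1%:R = c%:R - d'%:R :> K by rewrite -h addrA subrr add0r.
  by rewrite natrD h subrK.
by move/eqP; rewrite eqr_nat => /eqP h'; move: dc; rewrite -h' ltnS addSn ltnNge leq_addr.
Qed.

Lemma q_ind (W : set V) v : subspace W -> W (act H0 v) -> W (act Ha v) ->
  W (act e v) -> W (act f v) -> (forall u, u \in us -> W (act u v)) ->
  forall x, x \in q -> W (act x v).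
Proof.
move=> sW w1 w2 w3 w4 wu x xq.
have /memv_addP[a ah [b bn ->]] := subvP qE _ xq.
have lin (s : seq 'M[K]_n) z : (forall u, u \in s -> u \in g /\ W (act u v)) ->
    z \in <<s>>%VS -> z \in g /\ W (act z v).
  move=> sP zs; rewrite (coord_span (X := in_tuple s) zs).
  have P (i : 'I_(size s)) : s`_i \in g /\ W (act s`_i v) by apply/sP/mem_nth.
  elim/big_ind: _ => [|u w [gu Wu] [gw Ww]|i _].
  - by rewrite mem0v (act0l r); split=> //; apply: subspace0.
  - by rewrite rpredD // (actDl r) //; split=> //; apply: subspaceD.
  - by have [gi Wi] := P i; rewrite rpredZ // (actZl r) //; split=> //; apply: subspaceZ.
have [ga Wa] : a \in g /\ W (act a v).
  by apply: lin ah => u; rewrite !inE => /or4P[] /eqP ->.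
have [gb Wb] : b \in g /\ W (act b v).
  by apply: lin (subvP nlE _ bn) => u us'; split; [case: (usP us') | apply: wu].
by rewrite (actDl r) //; apply: subspaceD.
Qed.

(** The nilradical sends Q to lower degrees, so that only the stability of Q under
    the Levi factor has to be asked. *)
Lemma VQ_submod c Q : subspace Q -> Q `<=` gen_at c ->
  (forall v, Q v -> [/\ VQ c Q (act Ha v), VQ c Q (act e v) & VQ c Q (act f v)]) ->
  submod g act (VQ c Q).
Proof.
move=> sQ QE Qst; have sG : subspace (gen_lt c) by exact: lspan_subspace.
apply: (@ysorted_submod K n g q gL qg m y yg gyq yL V act r); first exact: subspace_add.
have sW := VQ_sub c Q; have LW := @Vlt_VQ c Q sQ.
have PW : addset (gen_lt c) Q `<=` VQ c Q by apply: ysorted_sub.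
move=> x v xq [a [b [Ga Qb ->]]]; have gx := gq xq; rewrite (actD r) //.
apply: (subspaceD sW).
  apply: (lspan_act r gx sW _ Ga) => _ [c' [p [cc' pE ->]]].
  have Wp : VQ c Q p.1.
    apply: PW; apply: addset_subl sQ _ _; apply: sub_lspan; by exists c', p.
  have dp : wdeg c' p.1 by apply: EcH0.
  apply: q_ind xq => //.
  - by rewrite (EcH0 pE); apply: (subspaceZ _ sW).
  - by rewrite (EcHa pE); apply: (subspaceZ _ sW).
  - apply: LW; exact: (wdeg_lt cc' (wdeg0_act eg H0e dp)).
  - apply: LW; exact: (wdeg_lt cc' (wdeg0_act fg H0f dp)).
  - move=> u uu; apply: LW; have := us_act uu dp; apply: ysorted_mono.
    by apply: gen_lt_mono; apply: ltnW.
have db : wdeg c b by exact: (gen_at_deg (QE _ Qb)).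
have [h1 h2 h3] := Qst b Qb; apply: q_ind xq => //.
- by rewrite db; apply: (subspaceZ _ sW); apply: PW; apply: addset_subr.
- by move=> u uu; apply: LW; exact: (us_act uu db).
Qed.

Lemma Vlt_submod c : submod g act (Vlt c).
Proof.
rewrite -VQ0; apply: VQ_submod; first exact: subspace_eq0.
  by move=> _ ->; apply: subspace0 (lspan_subspace _).
by move=> _ ->; rewrite !(act0 r) //; split; apply: subspace0 (VQ_sub _ _).
Qed.

(** By freeness the expansion in ordered monomials is unique, so that membership
    in [VQ c Q] can be read off from the coefficients. *)
Lemma VQ_mem c Q s (h : seq nat -> V) : subspace Q -> Q `<=` gen_all ->
  uniq s -> all (good m) s -> (forall b, gen_all (h b)) ->
  VQ c Q (\sum_(b <- s) ym b (h b)) ->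
  forall b, b \in s -> addset (gen_lt c) Q (h b).
Proof.
move=> sQ QE us' gs hE Wh b bs.
have sG : subspace (gen_lt c) by exact: lspan_subspace.
have sP := subspace_add sG sQ.
have sA : subspace gen_all by exact: lspan_subspace.
have PE : addset (gen_lt c) Q `<=` gen_all by apply: addset_sub => //; apply: gen_lt_all.
have [t [k [ut gt Pk E]]] := ysortedP yg r sP Wh.
pose h' b := if b \in s then h b else 0; pose k' b := if b \in t then k b else 0.
have gut : all (good m) (undup (s ++ t)).
  by apply/allP => M; rewrite mem_undup mem_cat => /orP[/(allP gs)|/(allP gt)].
have ext (u : seq (seq nat)) (l : seq nat -> V) : uniq u ->
    {subset u <= undup (s ++ t)} ->
    \sum_(M <- u) ym M (l M) =
    \sum_(M <- undup (s ++ t)) ym M (if M \in u then l M else 0).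
  move=> uu su; rewrite [RHS](bigID (mem u)) /= [X in _ = _ + X]big1_seq ?addr0; last first.
    by move=> M /andP[/negPf Mu] /(allP gut) gM; rewrite Mu; apply: (ymon0 yg r).
  rewrite -[RHS]big_filter.
  have pe : perm_eq u [seq M <- undup (s ++ t) | M \in u].
    apply: uniq_perm => //; first by rewrite filter_uniq ?undup_uniq.
    by move=> M; rewrite mem_filter; case Mu: (M \in u); rewrite //= su.
  rewrite -(perm_big _ pe) /=; apply: eq_big_seq => M ->; by [].
have Z : \sum_(M <- undup (s ++ t)) ym M (- k' M + h' M) = 0.
  have -> : \sum_(M <- undup (s ++ t)) ym M (- k' M + h' M) =
      - \sum_(M <- undup (s ++ t)) ym M (k' M) + \sum_(M <- undup (s ++ t)) ym M (h' M).
    rewrite -sumrN -big_split; apply: eq_big_seq => M /(allP gut) gM.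
    by have := ymon_lin yg r (-1) (k' M) (h' M) gM; rewrite !scaleN1r => ->.
  rewrite -(ext s h) // -?(ext t k) // => [|M Mt|M Ms].
  - by rewrite E addNr.
  - by rewrite mem_undup mem_cat Mt orbT.
  - by rewrite mem_undup mem_cat Ms.
have hb : h b = k' b.
  have bu : b \in undup (s ++ t) by rewrite mem_undup mem_cat bs.
  have : - k' b + h' b = 0.
    apply: (Efree (undup_uniq _) gut _ Z bu) => M.
    apply: (subspaceD sA); first apply: (subspaceN sA).
      by rewrite /k'; case: ifP => _; [apply: PE | apply: subspace0].
    by rewrite /h'; case: ifP => _ //; apply: subspace0.
  by rewrite /h' bs addrC => /subr0_eq.
by rewrite hb /k'; case: ifP => _ //; apply: subspace0.
Qed.

(** ** The generators of degree c, as a module over the Levi factor *)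
Section Degree.
Variable c : nat.
Local Notation N := (size (Ec c)).
(** Row vectors serve as coordinates on the span of the generators of degree c. *)
Definition gen_vec (u : 'rV[K]_N) : V := \sum_(i < N) u 0 i *: (nth (0, 0) (Ec c) i).1.

Lemma gen_vec_linear : linear gen_vec.
Proof.
move=> a u v; rewrite /gen_vec scaler_sumr -big_split; apply: eq_bigr => i _ /=.
by rewrite !mxE scalerDl scalerA.
Qed.
HB.instance Definition _ := GRing.isLinear.Build K _ V *:%R gen_vec gen_vec_linear.

Lemma gen_vec_inj u : gen_vec u = 0 -> u = 0.
Proof.
move=> u0; apply/rowP => i; rewrite mxE.
pose a k := if insub k is Some i then u 0 (i : 'I_N) else 0.
have aE (k : 'I_N) : a k = u 0 k by rewrite /a valK.
rewrite -aE; apply: (@Ecfree c a) => //; rewrite -[RHS]u0 /gen_vec.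
by apply: eq_bigr => k _; rewrite aE.
Qed.

Lemma gen_vec_at u : gen_at c (gen_vec u).
Proof.
apply: subspace_sum => [|i _]; first exact: lspan_subspace.
apply: (subspaceZ _ (lspan_subspace _)); apply: sub_lspan.
by exists (nth (0, 0) (Ec c) i) => //; apply: mem_nth.
Qed.
Lemma gen_vec_deg u : wdeg c (gen_vec u). Proof. exact: (gen_at_deg (gen_vec_at u)). Qed.

Lemma gen_at_vec v : gen_at c v -> exists u, v = gen_vec u.
Proof.
apply: (@lspan_sub _ _ _ [set v | exists u, v = gen_vec u]).
  split=> [|_ _ [u ->] [w ->]|a _ [u ->]].
  - by exists 0; rewrite linear0.
  - by exists (u + w); rewrite linearD.
  - by exists (a *: u); rewrite linearZ.
move=> _ [p pE ->]; have ip : (index p (Ec c) < N)%N by rewrite index_mem.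
exists (delta_mx 0 (Ordinal ip)); rewrite /gen_vec (bigD1 (Ordinal ip)) //= !mxE !eqxx.
rewrite nth_index // scale1r big1 ?addr0 // => i /negPf ii.
by rewrite mxE ii andbF scale0r.
Qed.

Lemma gen_lt_wdeg v : gen_lt c v -> wdeg c v -> v = 0.
Proof.
move=> Gv dv; have h := lactE r H0g.
apply: (@eigen_absent K V (lact r H0g) [seq l0 - d%:R | d <- iota 0 c] _ (l0 - c%:R) v _ Gv).
- move=> _ [c' [p [cc' pE ->]]]; exists (l0 - c'%:R); last by rewrite h (EcH0 pE).
  by apply: (map_f (fun d : nat => l0 - d%:R)); rewrite mem_iota.
- by rewrite h.
- apply/negP => /mapP[d]; rewrite mem_iota => /andP[_ dc] /natl0_inj cd.
  by rewrite -cd add0n ltnn in dc.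
Qed.

(** This is [VQ_mem] for the empty monomial: the generators of degree c are
    independent modulo what is generated in lower degrees. *)
Lemma VQ_gen_vec (S : {vspace 'rV[K]_N}) u :
  VQ c [set gen_vec w | w in [set w | w \in S]] (gen_vec u) -> u \in S.
Proof.
set Q := [set gen_vec w | w in _] => Wu.
have sQ : subspace Q.
  split=> [|_ _ [a aS <-] [b bS <-]|k _ [a aS <-]].
  - by exists 0; rewrite ?linear0 //= mem0v.
  - by exists (a + b); rewrite ?linearD //=; apply: rpredD.
  - by exists (k *: a); rewrite ?linearZ //=; apply: rpredZ.
have QE : Q `<=` gen_all by move=> _ [a _ <-]; exact: (gen_at_all (gen_vec_at a)).
have : addset (gen_lt c) Q (gen_vec u).
  apply: (@VQ_mem c Q [:: [::]] (fun=> gen_vec u)) => //; last by rewrite inE.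
    by move=> _; exact: (gen_at_all (gen_vec_at u)).
  by rewrite big_seq1.
move=> [a [_ [Ga [w wS <-] E]]].
have a0 : a = gen_vec (u - w) by rewrite linearB /= E addrK.
have : a = 0 by apply: gen_lt_wdeg => //; rewrite a0; apply: gen_vec_deg.
by rewrite a0 => /gen_vec_inj/subr0_eq ->.
Qed.

Lemma Vlt_gen_vec u : Vlt c (gen_vec u) -> u = 0.
Proof.
rewrite -VQ0 => h; apply/eqP; rewrite -memv0; apply: VQ_gen_vec.
have -> : [set gen_vec w | w in [set w | w \in 0%VS]] = [set 0].
  apply/seteqP; split=> [_ [w /= + <-]|_ ->].
    by rewrite memv0 => /eqP ->; rewrite linear0.
  by exists 0; rewrite ?linear0 //= mem0v.
exact: h.
Qed.

Lemma wdeg_split v : wdeg c v -> exists u, Vlt c (v - gen_vec u).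
Proof.
move=> /wdeg_part; apply: (@lspan_sub _ _ _ [set v | exists u, Vlt c (v - gen_vec u)]).
  split=> [|a b [u hu] [w hw]|a b [u hu]].
  - by exists 0; rewrite linear0 subrr; apply: subspace0 (Vlt_sub c).
  - exists (u + w); rewrite linearD opprD addrACA.
    exact: subspaceD (Vlt_sub c) _ _.
  - by exists (a *: u); rewrite linearZ -scalerBr; apply: subspaceZ (Vlt_sub c) _.
move=> _ [M [c' [p [gM pE cE ->]]]].
case: M gM cE => [|i M] gM cE.
  have cc : c' = c by rewrite -cE addn0.
  rewrite cc in pE; have [u uE] : exists u, p.1 = gen_vec u.
    by apply: gen_at_vec; apply: sub_lspan; exists p.
  by exists u; rewrite /= uE subrr; apply: subspace0 (Vlt_sub c).
exists 0; rewrite linear0 subr0; apply: sub_lspan; exists (i :: M), p.1; split=> //.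
apply: sub_lspan; exists c', p; split=> //.
by rewrite -cE /ydeg /= addnA addnS addSn ltnS -addnA leq_addr.
Qed.

(** An element of degree zero preserves the degree c part, where everything but the
    generators of degree c lies in [Vlt c] ([wdeg_split]). So it acts on the span
    of these generators, modulo [Vlt c]. *)
Lemma gen_op x : x \in g -> lie H0 x = 0 ->
  exists t : {linear 'rV[K]_N -> 'rV[K]_N}, forall u, Vlt c (act x (gen_vec u) - gen_vec (t u)).
Proof.
move=> gx hx.
have opP i : exists w, Vlt c (act x (gen_vec (delta_mx 0 i)) - gen_vec w).
  by apply: wdeg_split; apply: wdeg0_act => //; apply: gen_vec_deg.
have [w wE] := choice opP.
pose A : 'M[K]_N := \matrix_i w i.
exists (mulmxr A : {linear _ -> _}) => u /=.
have -> : u *m A = \sum_i u 0 i *: w i.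
  rewrite mulmx_sum_row; apply: eq_bigr => i _; congr (_ *: _).
  by apply/rowP => j; rewrite !mxE.
have uE : gen_vec u = \sum_i u 0 i *: gen_vec (delta_mx 0 i).
  rewrite {1}[u]row_sum_delta linear_sum; apply: eq_bigr => i _; exact: linearZ.
have wuE : gen_vec (\sum_i u 0 i *: w i) = \sum_i u 0 i *: gen_vec (w i).
  rewrite linear_sum; apply: eq_bigr => i _; exact: linearZ.
rewrite uE wuE (act_sum r) // -sumrB.
apply: subspace_sum => [|i _]; first exact: Vlt_sub.
rewrite (actZ r) // -scalerBr.
exact: subspaceZ (Vlt_sub c) _.
Qed.

End Degree.

Definition gen_space c (S : {vspace 'rV[K]_(size (Ec c))}) : set V :=
  [set gen_vec w | w in [set w | w \in S]].

Lemma gen_space_sub c S : subspace (@gen_space c S).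
Proof.
split=> [|_ _ [a aS <-] [b bS <-]|k _ [a aS <-]].
- by exists 0; rewrite ?linear0 //= mem0v.
- by exists (a + b); rewrite ?linearD //=; apply: rpredD.
- by exists (k *: a); rewrite ?linearZ //=; apply: rpredZ.
Qed.

Lemma gen_space_at c S : @gen_space c S `<=` gen_at c.
Proof. by move=> _ [a _ <-]; exact: gen_vec_at. Qed.

Lemma VQ_full c : VQ c (gen_space (fullv : {vspace 'rV[K]_(size (Ec c))})) = Vlt c.+1.
Proof.
have s1 : subspace (gen_lt c.+1) by exact: lspan_subspace.
rewrite /VQ /Vlt; congr (ysorted y act _); apply/seteqP; split.
  apply: addset_sub => //; first by apply: gen_lt_mono.
  by move=> v /gen_space_at/gen_at_lt.
have sG : subspace (gen_lt c) by exact: lspan_subspace.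
apply: lspan_sub; first exact: (subspace_add sG (@gen_space_sub c fullv)).
move=> _ [d [p [dc pE ->]]]; move: dc; rewrite ltnS leq_eqVlt => /orP[/eqP dc|dc]; last first.
  by apply: (addset_subl (@gen_space_sub c fullv)); apply: sub_lspan; exists d, p.
rewrite dc in pE; have [u uE] : exists u : 'rV_(size (Ec c)), p.1 = gen_vec u.
  by apply: gen_at_vec; apply: sub_lspan; exists p.
rewrite uE; apply: (addset_subr sG); by exists u => //=; rewrite memvf.
Qed.

Section Operators.
Variable c : nat.
Local Notation U := 'rV[K]_(size (Ec c)).
Definition acts_as (x : 'M[K]_n) (t : U -> U) :=
  forall u, Vlt c (act x (gen_vec u) - gen_vec (t u)).

Lemma acts_as_unique x (u w w' : U) : Vlt c (act x (gen_vec u) - gen_vec w) ->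
  Vlt c (act x (gen_vec u) - gen_vec w') -> w = w'.
Proof.
move=> h h'; apply/eqP; rewrite -subr_eq0; apply/eqP; apply: Vlt_gen_vec.
have := subspaceB (Vlt_sub c) h' h; congr (Vlt c _).
have -> : gen_vec (w - w') = gen_vec w - gen_vec w' by exact: linearB.
by rewrite opprB addrC subrKA.
Qed.

Lemma acts_as_lie x x' (t t' : {linear U -> U}) : x \in g -> x' \in g ->
  acts_as x t -> acts_as x' t' -> acts_as (lie x x') (fun u => t (t' u) - t' (t u)).
Proof.
move=> gx gx' h h' u.
have comp z z' (s s' : {linear U -> U}) : z \in g -> z' \in g -> acts_as z s -> acts_as z' s' ->
    Vlt c (act z (act z' (gen_vec u)) - gen_vec (s (s' u))).
  move=> gz gz' hz hz'; rewrite -(subrK (act z (gen_vec (s' u))) (act z _)) -addrA.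
  apply: (subspaceD (Vlt_sub c)); last exact: hz.
  by rewrite -(actB r) //; apply: (Vlt_submod c).2.
have := subspaceB (Vlt_sub c) (comp _ _ _ _ gx gx' h h') (comp _ _ _ _ gx' gx h' h).
congr (Vlt c _); rewrite (act_lie r) //.
have -> : gen_vec (t (t' u) - t' (t u)) = gen_vec (t (t' u)) - gen_vec (t' (t u)) by exact: linearB.
set a := act x _; set b := act x' _; set a' := gen_vec _; set b' := gen_vec (t' _).
by rewrite !opprD addrACA.
Qed.

Lemma acts_asZ a x (t : {linear U -> U}) : x \in g -> acts_as x t ->
  acts_as (a *: x) (fun u => a *: t u).
Proof.
move=> gx h u; rewrite (actZl r) // linearZ /= -scalerBr.
exact: (subspaceZ _ (Vlt_sub c)).
Qed.

(** The operators induced in coordinates satisfy the sl2 relations, because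
    elements of [Vlt c] of the form [gen_vec u] vanish; then sl2 theory splits
    the coordinate space into strings. *)
Lemma degree_strings : exists (eU fU hU : {linear U -> U}) (T : seq (U * nat)),
  [/\ acts_as e eU, acts_as f fU & acts_as Ha hU] /\
  [/\ forall v, eU (fU v) - fU (eU v) = hU v, forall v, hU (eU v) - eU (hU v) = 2 *: eU v
    & forall v, hU (fU v) - fU (hU v) = - 2 *: fU v] /\
  [/\ hw_vectors eU fU hU T, basis_of {:U} (sl2_strings fU T)
    & forall k : nat, count (fun p => p.2 == k%:Z) (Ec c) =
        (count (fun p => p.2 == k.+2%:Z) (Ec c) + count (fun p => p.2 == k) T)%N].
Proof.
have [eU eP] := @gen_op c e eg H0e; have [fU fP] := @gen_op c f fg H0f.
have [hU hP] := @gen_op c Ha Hag H0Ha; exists eU, fU, hU.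
have hef v : eU (fU v) - fU (eU v) = hU v.
  by apply: acts_as_unique (acts_as_lie eg fg eP fP v) _; rewrite ef; apply: hP.
have hhe v : hU (eU v) - eU (hU v) = 2 *: eU v.
  apply: acts_as_unique (acts_as_lie Hag eg hP eP v) _; rewrite Hae.
  exact: acts_asZ.
have hhf v : hU (fU v) - fU (hU v) = - 2 *: fU v.
  apply: acts_as_unique (acts_as_lie Hag fg hP fP v) _; rewrite Haf.
  exact: acts_asZ.
pose X : seq (U * int) := [seq (delta_mx 0 i, (nth (0, 0) (Ec c) i).2) | i <- enum 'I_(size (Ec c))].
have gdelta (i : 'I_(size (Ec c))) : gen_vec (delta_mx 0 i) = (nth (0, 0) (Ec c) i).1.
  rewrite /gen_vec (bigD1 i) //= !mxE !eqxx scale1r big1 ?addr0 // => k /negPf ki.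
  by rewrite mxE ki andbF scale0r.
have Xwt p : p \in X -> hU p.1 = p.2%:~R *: p.1.
  move=> /mapP[i _ ->] /=; apply: acts_as_unique (hP (delta_mx 0 i)) _.
  have -> : gen_vec ((nth (0, 0) (Ec c) i).2%:~R *: delta_mx 0 i : 'rV_(size (Ec c))) =
      (nth (0, 0) (Ec c) i).2%:~R *: gen_vec (delta_mx 0 i : 'rV_(size (Ec c))) by exact: linearZ.
  rewrite gdelta (@EcHa c) ?mem_nth // subrr; exact: subspace0 (Vlt_sub c).
have Xb : basis_of {:U} [seq p.1 | p <- X].
  rewrite basisEdim; apply/andP; split; last first.
    by rewrite dimvf /dim /= mul1n size_map /X size_map size_enum_ord.
  apply/subvP => u _; rewrite [u]row_sum_delta; apply: memv_suml => i _.
  apply: memvZ; apply: memv_span; rewrite -map_comp; apply/mapP.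
  by exists i; rewrite ?mem_enum.
have [T [hT bT]] := sl2_string_basis hef hhe hhf Xb Xwt; exists T; do !split=> //.
move=> k; have := strings_count hhf Xb Xwt k hT bT.
have cX z : count (fun p => p.2 == z) X = count (fun p => p.2 == z) (Ec c).
  rewrite -[in RHS](mkseq_nth (0, 0) (Ec c)) /mkseq -val_enum_ord !count_map.
  by apply: eq_count => i.
by rewrite !cX.
Qed.

End Operators.

(** What is needed of an inducing module: it is a string of length k for sl2, with H0
    acting by the scalar of degree c and the nilradical by zero. *)
Definition hw_module (c k : nat) (G : vectType K) (aG : 'M[K]_n -> G -> G) (g0 : G) : Prop :=
  [/\ is_rep q aG,
      basis_of {:G} [seq iter s (aG f) g0 | s <- iota 0 k.+1] /\ iter k.+1 (aG f) g0 = 0,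
      aG e g0 = 0 /\ aG Ha g0 = k%:R *: g0,
      (forall v, aG H0 v = (l0 - c%:R) *: v)
    & forall u v, u \in nl -> aG u v = 0].

Lemma span_ind (vT : vectType K) (s : seq vT) (P : set vT) : subspace P ->
  (forall u, u \in s -> P u) -> forall z, z \in <<s>>%VS -> P z.
Proof.
move=> sP sPs z zs; rewrite (coord_span (X := in_tuple s) zs).
apply: subspace_sum => // i _; apply: (subspaceZ _ sP); apply: sPs; exact: mem_nth.
Qed.

Section Block.
Context (c : nat).
Local Notation U := 'rV[K]_(size (Ec c)).
Context (eU fU hU : {linear U -> U}).
Hypotheses (eP : acts_as e eU) (fP : acts_as f fU) (hP : acts_as Ha hU).
Hypotheses (hef : forall v, eU (fU v) - fU (eU v) = hU v)
  (hhe : forall v, hU (eU v) - eU (hU v) = 2 *: eU v)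
  (hhf : forall v, hU (fU v) - fU (hU v) = - 2 *: fU v).

Lemma strings_submod (T : seq (U * nat)) : hw_vectors eU fU hU T ->
  submod g act (VQ c (gen_space <<sl2_strings fU T>>%VS)).
Proof.
move=> hT; have [se sf] := strings_stable hef hhf hT; set S := <<_>>%VS.
have sS := gen_space_sub S; have sW := VQ_sub c (gen_space S).
have memW x t : acts_as x t -> (forall v, v \in S -> t v \in S) ->
    forall v, gen_space S v -> VQ c (gen_space S) (act x v).
  move=> xP st _ [u uS <-]; rewrite -(subrK (gen_vec (t u)) (act x _)).
  apply: (subspaceD sW); first exact: (Vlt_VQ sS (xP u)).
  apply: ysorted_sub; apply: addset_subr; first exact: lspan_subspace.
  by exists (t u) => //; apply: st.
apply: VQ_submod => //; first exact: gen_space_at.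
move=> v Qv; split; [|exact: memW eP se v Qv|exact: memW fP sf v Qv].
apply: memW hP _ v Qv => u uS; rewrite -hef; apply: rpredB; first exact/se/sf.
exact/sf/se.
Qed.

Context (k : nat) (t0 : U) (S : {vspace U}).
Hypotheses (et0 : eU t0 = 0) (ht0 : hU t0 = k%:R *: t0) (ft0 : iter k.+1 fU t0 = 0).
Hypothesis tfree : free (sl2_string fU t0 k).
Hypothesis tS : (<<sl2_string fU t0 k>> :&: S = 0)%VS.
Local Notation S' := (<<sl2_string fU t0 k>> + S)%VS.
Local Notation W := (VQ c (gen_space S)).
Local Notation W' := (VQ c (gen_space S')).
Hypotheses (sW : submod g act W) (sW' : submod g act W').

Context (G : vectType K) (aG : 'M[K]_n -> G -> G) (g0 : G).
Hypothesis hG : hw_module c k aG g0.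

Let Gb : k.+1.-tuple G := [tuple of [seq iter s (aG f) g0 | s <- iota 0 k.+1]].
Definition string_map (v : G) : U := \sum_(i < k.+1) coord Gb i v *: iter i fU t0.

Lemma string_map_linear : linear string_map.
Proof.
move=> a u v; rewrite /string_map scaler_sumr -big_split; apply: eq_bigr => i _ /=.
by rewrite linearP scalerDl scalerA.
Qed.
HB.instance Definition _ := GRing.isLinear.Build K G U *:%R string_map string_map_linear.

Lemma string_map_st s : string_map (iter s (aG f) g0) =
  if (s <= k)%N then iter s fU t0 else 0.
Proof.
have [rG [Gbas Gk] _ _ _] := hG; have [tf tfE] := act_bundle rG fq.
have Gf : free Gb by apply: basis_free Gbas.
case: leqP => sk; last first.
  have iE i : iter i (aG f) g0 = iter i tf g0 by elim: i => //= i ->; rewrite tfE.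
  by rewrite -(subnK sk) iE iterD -(iE k.+1) Gk iter_lin0 linear0.
have ss : (s < k.+1)%N by [].
have nE (i : 'I_k.+1) : Gb`_i = iter i (aG f) g0.
  by rewrite (nth_map 0%N) ?size_iota // nth_iota.
rewrite /string_map (bigD1 (Ordinal ss)) //= big1 => [|i /negPf si].
  by rewrite -(nE (Ordinal ss)) coord_free // eqxx scale1r addr0.
by rewrite -(nE (Ordinal ss)) coord_free // eq_sym si scale0r.
Qed.

Lemma st_ind (P : set G) : subspace P -> (forall s, (s <= k)%N -> P (iter s (aG f) g0)) ->
  forall v, P v.
Proof.
move=> sP h v; have [_ [Gbas _] _ _ _] := hG.
have vS : v \in <<[seq iter s (aG f) g0 | s <- iota 0 k.+1]>>%VS.
  by rewrite (span_basis Gbas) memvf.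
apply: span_ind sP _ _ vS => u /mapP[s sk ->]; apply: h.
by rewrite mem_iota in sk.
Qed.

Lemma string_map_mem v : string_map v \in <<sl2_string fU t0 k>>%VS.
Proof.
apply: memv_suml => i _; apply: memvZ; apply: memv_span; apply: string_mem.
by rewrite -ltnS.
Qed.

Lemma string_map_onto u : u \in <<sl2_string fU t0 k>>%VS -> exists v, u = string_map v.
Proof.
apply: (@span_ind _ _ [set u | exists v, u = string_map v]).
  split=> [|_ _ [a ->] [b ->]|a _ [b ->]].
  - by exists 0; rewrite linear0.
  - by exists (a + b); rewrite linearD.
  - by exists (a *: b); rewrite linearZ.
move=> _ /mem_string[s sk ->]; exists (iter s (aG f) g0).
by rewrite string_map_st sk.
Qed.

Lemma string_map_inj v : string_map v = 0 -> v = 0.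
Proof.
have [_ [Gbas _] _ _ _] := hG.
have sE m' : sl2_string fU t0 m' = rev [seq iter i fU t0 | i <- iota 0 m'.+1].
  elim: m' => // m' IH; rewrite [LHS]/= IH.
  have -> : iota 0 m'.+2 = iota 0 m'.+1 ++ [:: m'.+1] by rewrite -(addn1 m'.+1) iotaD.
  by rewrite map_cat rev_cat.
have fr : free [tuple of [seq iter i fU t0 | i <- iota 0 k.+1]].
  by rewrite -(perm_free (_ : perm_eq (sl2_string fU t0 k) _)) // sE perm_rev.
move=> v0; rewrite (coord_basis (X := Gb) Gbas (memvf v)); apply: big1 => i _.
suff -> : coord Gb i v = 0 by rewrite scale0r.
have /freeP fr' := fr; apply: (fr' (fun i => coord Gb i v)); rewrite -[RHS]v0; apply: eq_bigr => j _.
by rewrite (nth_map 0%N) ?size_iota // nth_iota.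
Qed.

Lemma string_map_hom v : [/\ string_map (aG Ha v) = hU (string_map v),
  string_map (aG e v) = eU (string_map v) & string_map (aG f v) = fU (string_map v)].
Proof.
have [rG [_ Gk] [eg0 hg0] _ _] := hG.
have [te teE] := act_bundle rG eq; have [tf tfE] := act_bundle rG fq.
have [th thE] := act_bundle rG Haq.
have Gef u : te (tf u) - tf (te u) = th u.
  by rewrite !teE !tfE thE -ef (act_lie rG).
have Ghf u : th (tf u) - tf (th u) = - 2 *: tf u.
  by rewrite !tfE !thE -(act_lie rG) // Haf (actZl rG).
have thg0 : th g0 = k%:R *: g0 by rewrite thE.
have iE i : iter i (aG f) g0 = iter i tf g0 by elim: i => //= i ->; rewrite tfE.
rewrite -thE -teE -tfE.
have sub (t : {linear G -> G}) (t' : {linear U -> U}) :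
    subspace [set v | string_map (t v) = t' (string_map v)].
  split=> [|a b ha hb|a b hb]; rewrite /mkset.
  - by rewrite !linear0.
  - have {}ha : string_map (t a) = t' (string_map a) := ha.
    have {}hb : string_map (t b) = t' (string_map b) := hb.
    have smD x z : string_map (x + z) = string_map x + string_map z by exact: linearD.
    by rewrite (linearD t) !smD (linearD t') ha hb.
  - have {}hb : string_map (t b) = t' (string_map b) := hb.
    have smZ x z : string_map (x *: z) = x *: string_map z by exact: linearZ.
    by rewrite (linearZ_LR t) !smZ (linearZ_LR t') hb.
split; apply: (st_ind (sub _ _)) => s sk; rewrite /mkset string_map_st sk iE.
- by rewrite (wt_f Ghf s thg0) (wt_f hhf s ht0) linearZ /= -iE string_map_st sk.
- case: s sk => [|s] sk; first by rewrite /= teE eg0 et0 linear0.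
  rewrite (e_fS Gef Ghf s thg0) (e_fS hef hhf s ht0) teE eg0 et0 !iter_lin0 !add0r.
  by rewrite linearZ /= -iE string_map_st (ltnW sk).
have -> : tf (iter s tf g0) = iter s.+1 (aG f) g0 by rewrite iE.
rewrite string_map_st; case: leqP => // ks.
have -> : s = k by apply/eqP; rewrite eqn_leq sk.
exact: (esym ft0).
Qed.

Let phi (v : G) : lquot W := lproj W (gen_vec (string_map v)).

Lemma phi_lin a u v : phi (a *: u + v) = a *: phi u + phi v.
Proof.
have -> : phi (a *: u + v) = lproj W (gen_vec (a *: string_map u + string_map v)).
  by congr (lproj _ (gen_vec _)); exact: linearP.
have -> : gen_vec (a *: string_map u + string_map v) =
    a *: gen_vec (string_map u) + gen_vec (string_map v) by exact: linearP.
exact: lproj_linear.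
Qed.

Lemma phi_q x v : x \in q -> phi (aG x v) = quot_act act x (phi v).
Proof.
have [rG _ _ GH0 Gnl] := hG; move=> xq; have gx := gq xq.
rewrite (quot_actE r sW) //; apply/(lproj_eq sW).
have LW : Vlt c `<=` W := Vlt_VQ (gen_space_sub S).
have sWs := VQ_sub c (gen_space S).
suff h : W (act x (gen_vec (string_map v)) - gen_vec (string_map (aG x v))).
  by rewrite -opprB; exact: (subspaceN sWs h).
pose P : set 'M[K]_n := [set z | z \in q /\
  W (act z (gen_vec (string_map v)) - gen_vec (string_map (aG z v)))].
pose gs w := gen_vec (string_map w).
have gsD a b : gs (a + b) = gs a + gs b by rewrite /gs [string_map _]linearD [LHS]linearD.
have gsZ a b : gs (a *: b) = a *: gs b by rewrite /gs [string_map _]linearZ [LHS]linearZ.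
have sP : subspace P.
  split=> [|a b [qa Wa] [qb Wb]|a b [qb Wb]]; split; rewrite ?mem0v ?rpredD ?rpredZ //.
  - rewrite (act0l r) (act0l rG) /gs [string_map _]linear0 [gen_vec _]linear0 subrr.
    exact: subspace0.
  - rewrite (actDl r) ?gq // (actDl rG) // -/(gs (_ + _)) gsD opprD addrACA.
    exact: (subspaceD sWs).
  - rewrite (actZl r) ?gq // (actZl rG) // -/(gs (_ *: _)) gsZ -scalerBr.
    exact: (subspaceZ _ sWs).
have /memv_addP[a ah [b bn xE]] := subvP qE _ xq.
have [hHa he hf] := string_map_hom v.
have Pa : P a.
  apply: (span_ind sP _ ah) => z; rewrite !inE => /or4P[] /eqP ->; split=> //.
  - rewrite GH0 -/(gs (_ *: _)) gsZ gen_vec_deg subrr; exact: subspace0.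
  - by rewrite hHa; exact: (LW _ (hP _)).
  - by rewrite he; exact: (LW _ (eP _)).
  - by rewrite hf; exact: (LW _ (fP _)).
have bq : b \in q.
  have -> : b = x - a by rewrite xE addrC addKr.
  by apply: rpredB => //; case: Pa.
suff Pb : P b by rewrite xE; have [] := subspaceD sP Pa Pb.
split=> //; rewrite Gnl // [string_map 0]linear0 [gen_vec 0]linear0 subr0; apply: LW.
have sQ : subspace [set z | z \in g /\ Vlt c (act z (gen_vec (string_map v)))].
  have sV := Vlt_sub c.
  split=> [|z w [gz Vz] [gw Vw]|z w [gw Vw]]; split; rewrite ?mem0v ?rpredD ?rpredZ //.
  - rewrite (act0l r); exact: subspace0.
  - rewrite (actDl r) //; exact: (subspaceD sV).
  - rewrite (actZl r) //; exact: (subspaceZ _ sV).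
apply: (span_ind sQ _ (subvP nlE _ bn)).2 => u uu; split; first by case: (usP uu).
by apply: us_act uu _; exact: gen_vec_deg.
Qed.

Context (R : realType) (L : lmodType K) (aL : 'M[K]_n -> L -> L).

(** Frobenius reciprocity extends the isomorphism of G with the string of t0 to a
    homomorphism from the induced module to V / W, whose image is W' / W. It is
    injective because the induced module is spanned by the ordered monomials on G,
    and these remain independent modulo W by the freeness of V. *)
Theorem block_cmult : cmult R g aL act W W' = comp_mult R g (@induced_act K n g q G aG) aL.
Proof.
have [rG _ _ _ _] := hG.
have LW : Vlt c `<=` W := Vlt_VQ (gen_space_sub S).
have sWs := VQ_sub c (gen_space S); have sWs' := VQ_sub c (gen_space S').
have WW' : W `<=` W'.
  apply: ysorted_mono; apply: addset_sub.
  - apply: subspace_add; [exact: lspan_subspace|exact: gen_space_sub].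
  - apply: addset_subl; exact: gen_space_sub.
  - move=> _ [u uS <-]; apply: addset_subr; first exact: lspan_subspace.
    by exists u => //; apply: (subvP (addvSr _ _)).
have [Phi [Phi1 Phia]] := frobenius gL (quot_rep r sW gL) qg phi_lin phi_q.
rewrite comp_multE; apply/esym.
apply: (@cmult_transport R K n g L aL V _ act _ W W' (fun v' v => Phi v' = lproj W v)).
- by move=> a u' u v' v hu hv; rewrite [LHS]linearP hu hv lproj_linear.
- by move=> x v' v gx hv; rewrite Phia // hv (quot_actE r sW).
- by move=> v'; exists (repr (Phi v')); rewrite lproj_repr.
- move=> v; split.
    apply: (@lspan_sub _ _ _ [set v | exists v', Phi v' = lproj W v]).
      split=> [|a b [a' ha] [b' hb]|a b [b' hb]].
      + by exists 0; rewrite !linear0.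
      + by exists (a' + b'); rewrite [LHS]linearD ha hb lprojD.
      + by exists (a *: b'); rewrite [LHS]linearZ hb lprojZ.
    move=> _ [M [w [/andP[_ aM] [a [_ [Ga [u /memv_addP[u1 u1T [u2 u2S uE]] <-] ->]]] ->]]].
    elim: M aM => [_|i M IH /= /andP[im /IH[v' hv']]]; last first.
      have gi := yg (Ordinal im).
      by exists (induced_act y`_i v'); rewrite Phia // hv' (quot_actE r sW).
    have [x xE] := string_map_onto u1T; exists (tens q aG 1 x); rewrite Phi1 /phi -xE.
    apply/esym/(lproj_eq sW) => /=.
    have -> : gen_vec u = gen_vec u1 + gen_vec u2 by rewrite uE; exact: linearD.
    rewrite [gen_vec u1 + _]addrC addrA addrK; apply: (subspaceD sWs).
      by apply: ysorted_sub; apply: addset_subl => //; exact: gen_space_sub.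
    apply: ysorted_sub; apply: addset_subr; first exact: lspan_subspace.
    by exists u2.
  pose N : set (induced g q aG) := [set v' | exists2 v, W' v & Phi v' = lproj W v].
  have NT : N = setT.
    apply: induced_gen => [|x].
      split=> [|x v' gx [w Ww hw]].
        split=> [|a b [a' Wa ha] [b' Wb hb]|a b [b' Wb hb]].
        + by exists 0; [exact: subspace0 | rewrite !linear0].
        + exists (a' + b'); first exact: (subspaceD sWs').
          by rewrite [LHS]linearD ha hb lprojD.
        + exists (a *: b'); first exact: (subspaceZ _ sWs').
          by rewrite [LHS]linearZ hb lprojZ.
      exists (act x w); first exact: sW'.2.
      by rewrite Phia // hw (quot_actE r sW).
    exists (gen_vec (string_map x)); last by rewrite Phi1.
    apply: ysorted_sub; apply: addset_subr; first exact: lspan_subspace.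
    exists (string_map x) => //; apply: (subvP (addvSl _ _)); exact: string_map_mem.
  move=> [v' hv']; have [w Ww hw] : N v' by rewrite NT.
  rewrite -(subrK w v); apply: (subspaceD sWs') => //; apply: WW'.
  by apply/(lproj_eq sW); rewrite -hv' -hw.
- move=> v; rewrite linear0; split=> [/esym/(lproj_eq0 sW)//|/(lproj_eq0 sW)//].
move=> v' v hv Wv; have {hv} : Phi v' = 0 by rewrite hv; apply/(lproj_eq0 sW).
have t0E : tens q aG 1 0 = 0 :> induced g q aG.
  by have := tens1_linear g q aG (-1) 0 0; rewrite scaler0 addr0 scaleN1r addNr.
pose P : set (induced g q aG) := [set t | exists x, t = tens q aG 1 x].
have sP : subspace P.
  split=> [|_ _ [a ->] [b ->]|a _ [b ->]].
  + by exists 0; rewrite t0E.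
  + by exists (a + b); have := tens1_linear g q aG 1 a b; rewrite !scale1r => ->.
  + by exists (a *: b); have := tens1_linear g q aG a b 0; rewrite t0E !addr0 => ->.
have rI := @induced_rep K n g q G aG.
have v'P : ysorted y (@induced_act K n g q G aG) P v'.
  have -> : ysorted y (@induced_act K n g q G aG) P = setT; last by [].
  apply: induced_gen; last by move=> x; apply: ysorted_sub; exists x.
  apply: (pbw_span gL qg yg gyq rI) => x _ xq [w ->]; exists (aG x w).
  exact: tens1_act.
have [t [k' [ut gt Pk E]]] := ysortedP yg rI sP v'P.
have [h hE] := choice Pk; move: (E) => ->.
rewrite linear_sum => {E} Z.
have Phimon b w : all (fun i => i < m)%N b ->
    Phi (ymon y (@induced_act K n g q G aG) b (tens q aG 1 w)) =
    lproj W (ym b (gen_vec (string_map w))).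
  elim: b => [_|i b IH /= /andP[im ab]]; first exact: Phi1.
  by rewrite Phia ?(yg (Ordinal im)) // IH // (quot_actE r sW) // (yg (Ordinal im)).
have {}Z : W (\sum_(b <- t) ym b (gen_vec (string_map (h b)))).
  apply/(lproj_eq0 sW); rewrite linear_sum -[RHS]Z; apply: eq_big_seq => b bt.
  by rewrite hE Phimon //; have /andP[] := allP gt b bt.
have := VQ_mem (gen_space_sub S) _ ut gt _ Z.
move=> /(_ (fun v Sv => gen_at_all (gen_space_at Sv)) (fun b => gen_at_all (gen_vec_at _))) hb.
apply: big1_seq => b /= bt; rewrite hE; suff -> : h b = 0.
  by rewrite t0E; apply: (ymon0 yg rI); have := allP gt b bt.
apply: string_map_inj; apply/eqP; rewrite -memv0 -tS memv_cap string_map_mem /=.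
have [a [_ [Ga [w wS <-] E]]] := hb b bt.
have a0 : a = gen_vec (string_map (h b) - w).
  by rewrite [RHS]linearB /= E addrK.
have : a = 0 by apply: (gen_lt_wdeg Ga); rewrite a0; apply: gen_vec_deg.
by rewrite a0 => /gen_vec_inj/subr0_eq ->.
Qed.

End Block.
Section Filtration.
Context (R : realType) (L : lmodType K) (aL : 'M[K]_n -> L -> L).
Hypotheses (rL : is_rep g aL) (sL : simple_submod g aL setT).
Context (Gf : nat -> nat -> vectType K) (aGf : forall c k, 'M[K]_n -> Gf c k -> Gf c k).
Context (g0f : forall c k, Gf c k) (hGf : forall c k, hw_module c k (@aGf c k) (g0f c k)).

Definition ind_mult c k : \bar R :=
  comp_mult R g (@induced_act K n g q (Gf c k) (@aGf c k)) aL.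

Lemma gen_space0 c : gen_space (0 : {vspace 'rV[K]_(size (Ec c))})%VS = [set 0].
Proof.
apply/seteqP; split=> [_ [w /= + <-]|_ ->].
  by rewrite memv0 => /eqP ->; rewrite linear0.
by exists 0; rewrite ?linear0 //= mem0v.
Qed.

Lemma gen_space_mono c (S1 S2 : {vspace 'rV[K]_(size (Ec c))}) : (S1 <= S2)%VS ->
  VQ c (gen_space S1) `<=` VQ c (gen_space S2).
Proof.
move=> S12; have sG : subspace (gen_lt c) by exact: lspan_subspace.
apply: ysorted_mono; apply: addset_sub.
- apply: subspace_add; [exact: lspan_subspace|exact: gen_space_sub].
- apply: addset_subl; exact: gen_space_sub.
- move=> _ [u uS <-]; apply: addset_subr; first exact: lspan_subspace.
  by exists u => //; apply: (subvP S12).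
Qed.

(** The strings are added one at a time, and each contributes an induced module
    by [block_cmult]. *)
Lemma strings_cmult c (eU fU hU : {linear 'rV[K]_(size (Ec c)) -> 'rV[K]_(size (Ec c))}) T :
  acts_as e eU -> acts_as f fU -> acts_as Ha hU ->
  (forall v, eU (fU v) - fU (eU v) = hU v) -> (forall v, hU (eU v) - eU (hU v) = 2 *: eU v) ->
  (forall v, hU (fU v) - fU (hU v) = - 2 *: fU v) ->
  hw_vectors eU fU hU T -> free (sl2_strings fU T) ->
  cmult R g aL act (Vlt c) (VQ c (gen_space <<sl2_strings fU T>>%VS)) =
  (\sum_(p <- T) ind_mult c p.2)%E.
Proof.
move=> eP fP hP hef hhe hhf; elim: T => [_ _|[t0 k] T IH hT frT].
  by rewrite /sl2_strings span_nil gen_space0 VQ0 big_nil (cmult_refl R sL) //; exact: Vlt_submod.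
have hT' : hw_vectors eU fU hU T by move=> p pT; apply: hT; rewrite inE pT orbT.
have [et0 ht0 ft0] : [/\ eU t0 = 0, hU t0 = k%:R *: t0 & iter k.+1 fU t0 = 0].
  by apply: (hT (t0, k)); rewrite mem_head.
have stE : sl2_strings fU ((t0, k) :: T) = sl2_string fU t0 k ++ sl2_strings fU T by [].
move: frT; rewrite stE cat_free => /and3P[fr1 fr2 dir].
have sW := strings_submod eP fP hP hef hhf hT'.
have sW' := strings_submod eP fP hP hef hhf hT; rewrite stE span_cat in sW'.
rewrite big_cons span_cat (cmult_add R sL r (Vlt_submod c) sW sW'); last 2 first.
- by apply: Vlt_VQ; exact: gen_space_sub.
- by apply: gen_space_mono; exact: addvSr.
rewrite IH // addeC; congr (_ + _)%E.
apply: (block_cmult eP fP hP hef hhf et0 ht0 ft0 fr1 _ sW sW' (hGf c k)).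
exact/directv_addP.
Qed.

Lemma degree_cmult c : exists s : seq nat,
  (forall k : nat, count (fun p => p.2 == k%:Z) (Ec c) =
        (count (fun p => p.2 == k.+2%:Z) (Ec c) + count_mem k s)%N) /\
  cmult R g aL act (Vlt c) (Vlt c.+1) = (\sum_(k <- s) ind_mult c k)%E.
Proof.
have [eU [fU [hU [T [[eP fP hP] [[hef hhe hhf] [hT bT cT]]]]]]] := degree_strings c.
exists [seq p.2 | p <- T]; split; first by move=> k; rewrite cT count_map.
have := strings_cmult eP fP hP hef hhe hhf hT (basis_free bT).
by rewrite (span_basis bT) VQ_full big_map.
Qed.

Lemma Vlt0 : Vlt 0 = [set 0].
Proof.
apply/seteqP; split; last by move=> _ ->; apply: subspace0 (Vlt_sub 0).
apply: lspan_sub; first exact: subspace_eq0.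
move=> _ [M [v [gM Gv ->]]].
have -> : v = 0; last exact: (ymon0 yg r gM).
by move: Gv; apply: (@lspan_sub _ _ _ [set 0]); [exact: subspace_eq0 | move=> ? [? [? []]]].
Qed.

Lemma Vlt_mono c c' : (c <= c')%N -> Vlt c `<=` Vlt c'.
Proof. by move=> h; apply: ysorted_mono; exact: gen_lt_mono. Qed.

Lemma Vlt_exhaust v : exists c, Vlt c v.
Proof.
have : lspan [set v | exists c, mons c v] v by exact: mons_span.
apply: (@lspan_sub _ _ _ [set v | exists c, Vlt c v]).
  split=> [|a b [c ha] [c' hb]|a b [c hb]].
  - by exists 0%N; apply: subspace0 (Vlt_sub 0).
  - exists (maxn c c'); apply: (subspaceD (Vlt_sub _)).
      exact: (Vlt_mono (leq_maxl c c') ha).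
    exact: (Vlt_mono (leq_maxr c c') hb).
  - by exists c; apply: (subspaceZ _ (Vlt_sub _)).
by move=> w [c /mons_deg wc]; exists c.+1; exact: (wdeg_lt (ltnSn c) wc).
Qed.

(** Multiplicity is additive along the filtration by the degree of generators
    and passes to its union. *)
Theorem graded_comp_mult : exists s : nat -> seq nat,
  (forall c k : nat, count (fun p => p.2 == k%:Z) (Ec c) =
        (count (fun p => p.2 == k.+2%:Z) (Ec c) + count_mem k (s c))%N) /\
  comp_mult R g act aL =
    ereal_sup [set (\sum_(c < N) \sum_(k <- s c) ind_mult c k)%E | N in setT].
Proof.
have [s sE] := choice degree_cmult; exists s; split; first by move=> c; case: (sE c).
rewrite comp_multE (cmult_union R sL r (W := Vlt)); last exact: Vlt_exhaust.
- congr ereal_sup; apply: eq_imagel => N _; elim: N => [|N IH].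
    by rewrite Vlt0 big_ord0 (cmult_refl R sL) //; exact: submod0.
  rewrite big_ord_recr /= -IH -(sE N).2; apply: (cmult_add R sL r).
  + exact: submod0.
  + exact: Vlt_submod.
  + exact: Vlt_submod.
  + by move=> _ ->; apply: subspace0 (Vlt_sub N).
  + exact: Vlt_mono.
- exact: Vlt_submod.
- by move=> c; exact: Vlt_mono.
Qed.

End Filtration.

(** ** Finiteness *)

(** Each y_i raises the degree by at least one, which bounds the length of a
    monomial of given degree. *)
Lemma mons_fin c : exists s : seq V, mons c `<=` [set` s].
Proof.
pose ws := [seq [seq val i | i <- tval t] | j <- iota 0 c.+1, t <- enum {: j.-tuple 'I_m}].
exists [seq ym M p.1 | M <- ws, p <- flatten [seq Ec c' | c' <- iota 0 c.+1]].
move=> _ [M [c' [p [/andP[_ aM] pE cE ->]]]].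
have c'c : (c' <= c)%N by rewrite -cE leq_addr.
have sM : (size M <= c)%N.
  apply: leq_trans (_ : ydeg M <= c)%N; last by rewrite -cE leq_addl.
  by rewrite /ydeg sumnE big_map; elim: (M) => [|i s IH]; rewrite ?big_nil // big_cons addSn ltnS (leq_trans IH) // leq_addl.
apply/allpairsP; exists (M, p); split=> //; rewrite [X in X \in _]/=; last first.
  apply/flattenP; exists (Ec c') => //; apply: map_f.
  by rewrite mem_iota.
apply/flattenP; exists [seq [seq val i | i <- tval t] | t <- enum {: (size M).-tuple 'I_m}].
  by apply/mapP; exists (size M); rewrite // mem_iota.
have sz : size (pmap (insub : nat -> option 'I_m) M) == size M.
  by rewrite size_pmap_sub -all_count.
apply/mapP; exists (Tuple sz); first by rewrite mem_enum.
by rewrite /= pmap_filter; [apply/esym/all_filterP/(sub_all _ aM) => i im; rewrite isSome_insub | exact: insubK].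
Qed.

Lemma wdeg_fin c : fin_dim (wdeg c).
Proof.
have [s sE] := mons_fin c; exists s => v /wdeg_part; exact: lspanS.
Qed.

(** V is the sum of the eigenspaces of H0, which are finite-dimensional. *)
Theorem graded_fin (R : realType) (L : lmodType K) (aL : 'M[K]_n -> L -> L) :
  is_rep g aL -> simple_submod g aL setT -> comp_mult R g act aL \is a fin_num.
Proof.
move=> rL sL; apply: (cmult_fin R rL sL r H0g) => [v|c].
  have := mons_span v; apply: (@lspan_sub _ _ _ [set v | exists s : seq (K * V),
    (forall p, p \in s -> act H0 p.2 = p.1 *: p.2) /\ v = \sum_(p <- s) p.2]).
    split=> [|a b [s [hs ->]] [t [ht ->]]|a b [s [hs ->]]].
    - by exists [::]; rewrite big_nil.
    - exists (s ++ t); rewrite big_cat; split=> // p.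
      by rewrite mem_cat => /orP[/hs|/ht].
    - exists [seq (p.1, a *: p.2) | p <- s]; rewrite big_map scaler_sumr; split=> // p.
      by move=> /mapP[p' /hs h ->] /=; rewrite (actZ r) // h !scalerA mulrC.
  move=> w [c /mons_deg wc]; exists [:: (l0 - c%:R, w)]; rewrite big_seq1; split=> // p.
  by rewrite inE => /eqP ->.
have [[d ->]|nd] := pselect (exists d : nat, c = l0 - d%:R); first exact: wdeg_fin.
exists [::] => v hv; rewrite (deg_absent hv) => [|d]; first exact: subspace0 (lspan_subspace _).
by apply/eqP => cE; apply: nd; exists d.
Qed.

Lemma Vlt_gen c : Vlt c = gen_submod g act
  [set` flatten [seq [seq p.1 | p <- Ec c'] | c' <- iota 0 c]].
Proof.
apply/seteqP; split=> [v Vv N sN hN|v]; last first.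
  apply; first exact: Vlt_submod.
  move=> u /flattenP[t /mapP[c']]; rewrite mem_iota => /andP[_ cc'] -> /mapP[p pE ->].
  by apply: ysorted_sub; apply: sub_lspan; exists c', p.
move: Vv; apply: lspan_sub; first by case: sN.
move=> _ [M [u [/andP[_ aM] Gu ->]]].
elim: M aM => [_|i M IH /= /andP[im /IH Nu]]; last by apply: sN.2 => //; exact: (yg (Ordinal im)).
move: Gu; apply: lspan_sub; first by case: sN.
move=> _ [c' [p [cc' pE ->]]]; apply: hN => /=; apply/flattenP.
exists [seq p.1 | p <- Ec c']; first by apply: map_f; rewrite mem_iota.
exact: map_f.
Qed.

(** The nilradical lowers the degree, and monomials of bounded degree are finite
    in number. *)
Lemma nil_fin v : fin_dim (gen_submod nl act [set v]).
Proof.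
pose W D := lspan [set w | exists2 c, (c <= D)%N & mons c w].
have sW D : subspace (W D) by exact: lspan_subspace.
have Wmono D D' : (D <= D')%N -> W D `<=` W D'.
  by move=> DD; apply: lspanS => w [c cD mc]; exists c => //; exact: leq_trans cD DD.
have [D WD] : exists D, W D v.
  have := mons_span v; apply: (@lspan_sub _ _ _ [set v | exists D, W D v]).
    split=> [|a b [c ha] [c' hb]|a b [c hb]].
    - by exists 0%N; apply: subspace0.
    - exists (maxn c c'); apply: (subspaceD (sW _)).
        exact: (Wmono _ _ (leq_maxl c c') _ ha).
      exact: (Wmono _ _ (leq_maxr c c') _ hb).
    - by exists c; apply: (subspaceZ _ (sW _)).
  by move=> w [c mc]; exists c; apply: sub_lspan; exists c.
have [s sE] : exists s : seq V, forall c, (c <= D)%N -> mons c `<=` [set` s].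
  have [s sE] := choice mons_fin; exists (flatten [seq s c | c <- iota 0 D.+1]) => c cD w /sE ws.
  by apply/flattenP; exists (s c) => //; apply: map_f; rewrite mem_iota.
have Wnl : submod nl act (W D).
  split=> // x w xn Ww.
  have sQ : subspace [set z | z \in g /\ W D (act z w)].
    split=> [|z t [gz Vz] [gw Vw]|z t [gw Vw]]; split; rewrite ?mem0v ?rpredD ?rpredZ //.
    - rewrite (act0l r); exact: subspace0.
    - rewrite (actDl r) //; exact: (subspaceD (sW D)).
    - rewrite (actZl r) //; exact: (subspaceZ _ (sW D)).
  apply: (span_ind sQ _ (subvP nlE _ xn)).2 => u uu.
  have [gu [d dE]] := usP uu; split=> //.
  apply: (lspan_act r gu (sW D) _ Ww) => t [c cD /mons_deg tc].
  have hx : act H0 (act u t) = (l0 - c%:R + d.+1%:R) *: act u t.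
    by rewrite (act_swap r) // tc dE (actZ r) // (actZl r) // -scalerDl.
  case: (leqP d.+1 c) => dc.
    have : wdeg (c - d.+1) (act u t) by rewrite /wdeg /mkset hx natrB // opprB addrA addrAC.
    move=> /wdeg_part; apply: lspanS => z mz; exists (c - d.+1)%N => //.
    exact: leq_trans (leq_subr _ _) cD.
  suff -> : act u t = 0 by apply: subspace0.
  apply: deg_absent hx _ => d'; apply/negP => /eqP h.
  move/eqP: h; rewrite -addrA => /eqP/addrI h.
  have {}h : d.+1%:R = c%:R - d'%:R :> K by rewrite -h addrA subrr add0r.
  have : (d.+1 + d')%:R = c%:R :> K by rewrite natrD h subrK.
  by move/eqP; rewrite eqr_nat => /eqP h'; move: dc; rewrite -h' ltnS addSn ltnNge leq_addr.
exists s => w /(_ (W D) Wnl) Ww; have : W D w by apply: Ww => _ ->.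
by apply: lspanS => t [c cD]; exact: sE.
Qed.


(** ** Semisimplicity over the Levi factor *)
Section Semisimple.
Context (lv : {vspace 'M[K]_n}).
Hypotheses (lvE : (lv <= <<[:: H0; Ha; e; f]>>)%VS) (elv : e \in lv) (flv : f \in lv).

Let eV := lact r eg.
Let fV := lact r fg.
Let hV := lact r Hag.

Lemma sl2_ef v : eV (fV v) - fV (eV v) = hV v.
Proof. by rewrite !lactE -ef (act_lie r). Qed.
Lemma sl2_he v : hV (eV v) - eV (hV v) = 2%:~R *: eV v.
Proof. by rewrite !lactE -(act_lie r) // Hae (actZl r). Qed.
Lemma sl2_hf v : hV (fV v) - fV (hV v) = (-2)%:~R *: fV v.
Proof. by rewrite !lactE -(act_lie r) // Haf (actZl r). Qed.

Lemma mons_wt c w : mons c w -> exists z : int, hV w = z%:~R *: w.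
Proof.
move=> [M [c' [p [/andP[_ aM] pE cE ->]]]]; exists (p.2 + \sum_(i <- M) wy i).
by rewrite lactE; apply: ymon_wt => //; exact: EcHa pE.
Qed.

Lemma Vlt_mons c : Vlt c = lspan [set w | Vlt c w /\ exists d, mons d w].
Proof.
apply/seteqP; split; last by apply: lspan_sub; [exact: Vlt_sub | move=> w []].
move=> v /ysorted_lspan; apply: lspan_sub; first exact: lspan_subspace.
move=> _ [M [u [gM [c' [p [cc' pE ->]]] ->]]]; apply: sub_lspan; split.
  by apply: sub_lspan; exists M, p.1; split=> //; apply: sub_lspan; exists c', p.
by exists (c' + ydeg M)%N, M, c', p.
Qed.

(** The operator preserves the degree, and finitely many Ha-weights occur in a
    given degree. *)
Lemma loc_nil (t : {linear V -> V}) (a : int) : a != 0 ->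
  (forall v, hV (t v) - t (hV v) = a%:~R *: t v) ->
  (forall c v, wdeg c v -> wdeg c (t v)) -> forall v, exists j, iter j t v = 0.
Proof.
move=> a0 ht td v; have := mons_span v.
apply: (@lspan_sub _ _ _ [set v | exists j, iter j t v = 0]).
  have mono j i u : iter j t u = 0 -> iter (i + j) t u = 0.
    by move=> h0; rewrite iterD h0 iter_lin0.
  split=> [|u w [j ru] [i sw]|b u [j ru]]; first by exists 0%N.
    exists (j + i)%N; have := iter_lin t (j + i) 1 u w; rewrite !scale1r => ->.
    have e1 := mono _ i _ ru; rewrite addnC in e1.
    by rewrite e1 (mono _ j _ sw) addr0.
  by exists j; rewrite iter_linZ ru scaler0.
move=> w [c mw]; have [z hz] := mons_wt mw.
have [s sE] := mons_fin c.
pose zs := [seq xget 0 [set z : int | hV u = z%:~R *: u] | u <- s].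
apply: (@weight_nilpotent K V hV t a ht a0 zs (wdeg c) (mons c)) (mons_deg mw) hz.
- exact: td.
- exact: wdeg_part.
move=> u mu; have [z' hz'] := mons_wt mu.
exists (xget 0 [set z : int | hV u = z%:~R *: u]).
  by apply: map_f; exact: sE.
exact: (xgetPex 0 (ex_intro [set z : int | hV u = z%:~R *: u] z' hz')).
Qed.

Lemma fnilV v : exists j, iter j fV v = 0.
Proof.
apply: (loc_nil (a := -2)) => // [|c u hu]; first exact: sl2_hf.
by rewrite lactE; exact: (wdeg0_act fg H0f hu).
Qed.
Lemma enilV v : exists j, iter j eV v = 0.
Proof.
apply: (loc_nil (a := 2)) => // [|c u hu]; first exact: sl2_he.
by rewrite lactE; exact: (wdeg0_act eg H0e hu).
Qed.

Definition string_space (u : V) : set V := lspan [set w | exists j, w = iter j fV u].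

(** For simplicity: a nonzero submodule contains a nonzero sum of a_i f^i u, which
    is mapped to a nonzero multiple of u by e^j, for the largest j with a_j != 0. *)
Lemma string_simple u k d : u != 0 -> wdeg d u -> hV u = k%:R *: u -> eV u = 0 ->
  fin_dim (string_space u) /\ simple_submod lv act (string_space u).
Proof.
move=> u0 du hu eu; set W := string_space u.
have sW : subspace W by exact: lspan_subspace.
have Wst j : W (iter j fV u) by apply: sub_lspan; exists j.
have uk := hw_string sl2_ef sl2_he sl2_hf fnilV hu eu.
have dst j : wdeg d (iter j fV u).
  elim: j => // j IH; rewrite iterS lactE; exact: (wdeg0_act fg H0f IH).
have Wfin w : W w -> lspan [set` [seq iter j fV u | j <- iota 0 k.+1]] w.
  apply: lspan_sub; first exact: lspan_subspace.
  move=> _ [j ->]; case: (leqP j k) => jk.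
    by apply: sub_lspan; apply/mapP; exists j; rewrite // mem_iota.
  rewrite -(subnK jk) iterD uk iter_lin0; exact: subspace0 (lspan_subspace _).
have lg : (lv <= g)%VS.
  apply: subv_trans lvE _; apply/span_subvP => x.
  by rewrite !inE => /or4P[] /eqP ->.
have subW : submod lv act W.
  split=> // x w xl; apply: (lspan_act r (subvP lg _ xl) sW) => _ [j ->].
  have sQ : subspace [set z | z \in g /\ W (act z (iter j fV u))].
    split=> [|z t [gz Vz] [gw Vw]|z t [gw Vw]]; split; rewrite ?mem0v ?rpredD ?rpredZ //.
    - rewrite (act0l r); exact: subspace0.
    - rewrite (actDl r) //; exact: (subspaceD sW).
    - rewrite (actZl r) //; exact: (subspaceZ _ sW).
  apply: (span_ind sQ _ (subvP lvE _ xl)).2 => z; rewrite !inE => /or4P[] /eqP ->; split=> //.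
  - rewrite dst; exact: (subspaceZ _ sW).
  - rewrite -(lactE r Hag) (wt_f sl2_hf j hu); exact: (subspaceZ _ sW).
  - rewrite -(lactE r eg); case: (j) => [|i]; first by rewrite /= eu; exact: subspace0.
    rewrite (e_fS sl2_ef sl2_hf i hu) eu iter_lin0 add0r; exact: (subspaceZ _ sW).
  - by rewrite -(lactE r fg); exact: (Wst j.+1).
split; first by exists [seq iter j fV u | j <- iota 0 k.+1].
split=> //.
  apply/eqP => W0; have : W u by exact: (Wst 0%N).
  by rewrite W0 => /eqP; rewrite (negPf u0).
move=> N' [sN' aN'] N'W; have [h0|h0] := pselect (forall v, N' v -> v = 0).
  by left; apply/seteqP; split=> [v /h0 ->|_ ->] //; exact: subspace0.
right; have [v N'v v0] : exists2 v, N' v & v != 0.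
  apply: contrapT => h; apply: h0 => v N'v; apply: contrapT => v0; apply: h; exists v => //.
  exact/eqP.
have [a vE] := lspan_seqP (Wfin _ (N'W _ N'v)); rewrite size_map size_iota in vE.
have [i0 ai0] : exists i : 'I_k.+1, a i != 0.
  apply: contrapT => h; move/eqP: v0; apply; rewrite vE big1 // => i _.
  by case: (eqVneq (a i) 0) => [->|ai]; [rewrite scale0r | case: h; exists i].
case: (@arg_maxnP _ i0 (fun i : 'I_k.+1 => a i != 0) (fun i => i : nat) ai0) => j aj jmax.
have N'e i w : N' w -> N' (iter i eV w).
  by move=> N'w; elim: i => // i IH; rewrite iterS lactE; exact: aN'.
have N'u : N' u.
  have ne : a j * ef_coef K k j != 0.
    by rewrite mulf_neq0 // ef_coef_neq0 // -ltnS.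
  have := subspaceZ (a j * ef_coef K k j)^-1 sN' (N'e j v N'v); congr (N' _).
  suff -> : iter j eV v = (a j * ef_coef K k j) *: u by rewrite scalerA mulVf // scale1r.
  have eit : iter j eV v = \sum_(i < k.+1) a i *: iter j eV (iter i fV u).
    rewrite vE; elim/big_rec2: _ => [|i y1 y2 _ <-]; first exact: iter_lin0.
    rewrite iter_lin; congr (_ *: iter j eV _ + _).
    by rewrite (nth_map 0%N) ?size_iota // nth_iota.
  rewrite eit (bigD1 j) //= (e_f_hw sl2_ef sl2_hf j hu eu) scalerA big1 ?addr0 // => i ij.
  case: (eqVneq (a i) 0) => [->|ai]; first by rewrite scale0r.
  have lt : (i < j)%N by rewrite ltn_neqAle ij; exact: jmax.
  rewrite -(subnK lt) addnS -addSn iterD (e_f_hw sl2_ef sl2_hf i hu eu) iter_linZ iterSr eu.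
  by rewrite iter_lin0 !scaler0.
apply/seteqP; split=> // w; apply: lspan_sub => // _ [i ->].
by elim: i => // i IH; rewrite iterS lactE; exact: aN'.
Qed.

(** By [hw_span], [Vlt c] is the sum of the simple modules of [string_simple]
    contained in it. *)
Theorem Vlt_semisimple c : exists2 T : set (set V), direct_sum T (Vlt c) &
  forall W, T W -> fin_dim W /\ simple_submod lv act W.
Proof.
pose SS : set (set V) := [set W | exists u k d, [/\ [/\ u != 0, Vlt c u & wdeg d u],
  hV u = k%:R *: u, eV u = 0 & W = string_space u]].
have SSP W : SS W -> fin_dim W /\ simple_submod lv act W.
  by move=> [u [k [d [[u0 Vu du] hu eu ->]]]]; exact: (string_simple u0 du hu eu).
have lg : (lv <= g)%VS.
  apply: subv_trans lvE _; apply/span_subvP => x.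
  by rewrite !inE => /or4P[] /eqP ->.
have [T TS dT] := simple_direct_sum (sub_rep r lg) (fun W SW => (SSP W SW).2).
exists T; last by move=> W /TS/SSP.
suff -> : Vlt c = lspan (\bigcup_(W in SS) W) by [].
have sV := Vlt_sub c; have aV := (Vlt_submod c).2.
apply/seteqP; split; last first.
  apply: lspan_sub => // w [W [u [k [d [[u0 Vu du] hu eu ->]]]]].
  apply: lspan_sub => // _ [j ->].
  by elim: j => // j IH; rewrite iterS lactE; exact: aV.
rewrite {1}Vlt_mons; apply: lspan_sub; first exact: lspan_subspace.
move=> v [Vv [d mv]]; have [z hz] := mons_wt mv.
pose N := Vlt c `&` wdeg d.
apply: (hw_span sl2_ef sl2_he sl2_hf fnilV enilV (N := N)) hz.
- split=> [|a b [Va da] [Vb db]|a b [Vb db]].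
  + split; [exact: subspace0 sV | exact: subspace0 (wdeg_sub d)].
  + split; [exact: subspaceD sV _ _ | exact: subspaceD (wdeg_sub d) _ _].
  + split; [exact: subspaceZ sV _ | exact: subspaceZ (wdeg_sub d) _].
- by move=> w [Vw dw]; rewrite lactE; split; [exact: aV | exact: (wdeg0_act eg H0e dw)].
- by move=> w [Vw dw]; rewrite lactE; split; [exact: aV | exact: (wdeg0_act fg H0f dw)].
- exact: lspan_subspace.
- move=> u k j [Vu du] hu eu; have [->|u0] := eqVneq u 0.
    rewrite iter_lin0; exact: subspace0 (lspan_subspace _).
  apply: sub_lspan; exists (string_space u); last by apply: sub_lspan; exists j.
  by exists u, k, d.
- by split=> //; exact: mons_deg.
Qed.

End Semisimple.
End GradedModule.

(** * The matrices of so(7) *)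
Section VspaceSums.
Context (K : fieldType) (vT : vectType K) (I : eqType).

Lemma subv_sum_seq (s : seq I) (U : I -> {vspace vT}) i : i \in s ->
  (U i <= \sum_(j <- s) U j)%VS.
Proof. by move=> si; rewrite (big_rem i) //= addvSl. Qed.

Lemma sumv_seq_sub (s : seq I) (U : I -> {vspace vT}) W :
  (forall i, i \in s -> (U i <= W)%VS) -> (\sum_(j <- s) U j <= W)%VS.
Proof.
move=> h; rewrite big_seq; apply: (big_ind (fun V => (V <= W)%VS)) => [|U1 U2 h1 h2|i si]; first exact: sub0v.
  by rewrite subv_add h1 h2.
exact: h.
Qed.
End VspaceSums.

Section Evaluation.
Context (K : fieldType) (n : nat) (h : {vspace 'M[K]_n}).
Implicit Types (l m : dual h).
Lemma evDl l m H : ev (l + m) H = ev l H + ev m H.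
Proof. by rewrite /ev !lfunE. Qed.
Lemma evNl l H : ev (- l) H = - ev l H.
Proof. by rewrite /ev !lfunE. Qed.
Lemma evZl a l H : ev (a *: l) H = a * ev l H.
Proof. by rewrite /ev !lfunE. Qed.
Lemma evMnl l k H : ev (l *+ k) H = ev l H *+ k.
Proof. by elim: k => [|k IH]; rewrite ?mulr0n /ev ?lfunE // -/(ev _ _) !mulrS evDl IH. Qed.
Lemma evD l H H' : ev l (H + H') = ev l H + ev l H'.
Proof. by have := ev_linear l 1 H H'; rewrite scale1r mul1r. Qed.
Lemma ev0 l : ev l 0 = 0.
Proof. by rewrite /ev !linear0. Qed.
Lemma evZ l a H : ev l (a *: H) = a * ev l H.
Proof. by have := ev_linear l a H 0; rewrite addr0 ev0 addr0. Qed.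
Lemma evN l H : ev l (- H) = - ev l H.
Proof. by rewrite -scaleN1r evZ mulN1r. Qed.
End Evaluation.

Section SO7.
Context (R : realType).
Local Notation C := R[i].
Local Notation M7 := 'M[C]_7.

(** The quadratic form pairs each of the first three coordinates with the one
    three places further, and the last one with itself. *)
Definition barN (a : nat) : nat := nth 0%N [:: 3; 4; 5; 0; 1; 2; 6]%N a.
Definition bar (a : 'I_7) : 'I_7 := inord (barN a).

Lemma barNK k : (k < 7)%N -> barN (barN k) = k.
Proof. by case: k => [|[|[|[|[|[|[|]]]]]]]. Qed.
Lemma barN_lt k : (k < 7)%N -> (barN k < 7)%N.
Proof. by case: k => [|[|[|[|[|[|[|]]]]]]]. Qed.
Lemma barE (a : 'I_7) : bar a = barN a :> nat.
Proof. by rewrite /bar inordK //; case: a => [[|[|[|[|[|[|[|]]]]]]]]. Qed.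
Lemma barK : involutive bar.
Proof. by move=> a; apply: ord_inj; rewrite !barE; case: a => [[|[|[|[|[|[|[|]]]]]]]]. Qed.

Lemma gramE (a b : 'I_7) : gram7 R a b = (b == bar a)%:R.
Proof.
rewrite /gram7 unlock /= !mxE -!val_eqE /= barE !inordK //.
case: a b => [[|[|[|[|[|[|[|//]]]]]]] ia] [[|[|[|[|[|[|[|//]]]]]]] ib] /=;
  by rewrite ?addr0 ?add0r.
Qed.

Lemma so7E (x : M7) : reflect (forall a b, x a b = - x (bar b) (bar a)) (x \in so7 R).
Proof.
have e1 a b : (x^T *m gram7 R) a b = x (bar b) a.
  rewrite mxE (bigD1 (bar b)) //= big1 ?addr0 => [|k kb].
    by rewrite gramE barK eqxx mulr1 mxE.
  by rewrite gramE -(inj_eq (can_inj barK)) barK eq_sym (negPf kb) mulr0.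
have e2 a b : (gram7 R *m x) a b = x (bar a) b.
  rewrite mxE (bigD1 (bar a)) //= big1 ?addr0 => [|k kb].
    by rewrite gramE eqxx mul1r.
  by rewrite gramE (negPf kb) mul0r.
rewrite so7P; apply: (iffP eqP) => [h a b|h].
  have := congr1 (fun m : M7 => m b (bar a)) h; rewrite !mxE -/(mulmx _ _).
  have := e1 b (bar a); have := e2 b (bar a); rewrite !mxE barK => -> -> /eqP.
  by rewrite addr_eq0 => /eqP.
apply/matrixP => a b; have := e1 a b; have := e2 a b; rewrite !mxE => -> ->.
by rewrite [x (bar b) a]h barK addNr.
Qed.

Lemma so7_lie : is_liealg (so7 R).
Proof.
move=> x y; rewrite !so7P => /eqP hx /eqP hy; apply/eqP.
have ex : x^T *m gram7 R = - (gram7 R *m x) by apply/eqP; rewrite -addr_eq0 hx.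
have ey : y^T *m gram7 R = - (gram7 R *m y) by apply/eqP; rewrite -addr_eq0 hy.
rewrite /lie linearB /= !trmx_mul mulmxBl mulmxBr -!mulmxA ex ey !mulmxN !mulmxA ex ey.
by rewrite !mulNmx !opprK -!mulmxA addrA subrK subrr.
Qed.

Definition H3 (a b c : C) : M7 := a *: Hs R 1 + b *: Hs R 2 + c *: Hs R 3.
Lemma HsE i (a b : 'I_7) : (0 < i < 4)%N ->
  Hs R i a b = ((a == b) && (a == i.-1 :> nat))%:R - ((a == b) && (a == i.+2 :> nat))%:R.
Proof.
move=> i4; rewrite !mxE -!val_eqE /= !inordK; try by case: i i4 => [|[|[|[|]]]].
have -> : (i + 3).-1 = i.+2 by rewrite addn3.
by congr (_%:R - _%:R); case: eqVneq => [->|ab]; rewrite ?andbb ?andbF //=;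
  case: eqVneq => //= ai; case: eqVneq => // bi; move: ab; rewrite ai bi eqxx.
Qed.
Lemma H3E x y z (a b : 'I_7) : H3 x y z a b =
  if a == b then nth 0 [:: x; y; z; - x; - y; - z; 0] a else 0.
Proof.
have E (h1 h2 h3 : M7) : (x *: h1 + y *: h2 + z *: h3) a b = x * h1 a b + y * h2 a b + z * h3 a b.
  by rewrite !mxE.
rewrite /H3 E {E} !HsE //; case: eqVneq => /= [_|_]; last by rewrite !subrr !mulr0 !addr0.
case: a => [[|[|[|[|[|[|[|//]]]]]]] ia] /=;
  by rewrite ?subr0 ?sub0r ?subrr ?mulrN ?mulr1 ?mulr0 ?addr0 ?add0r.
Qed.
Lemma Hs_in i : (0 < i < 4)%N -> Hs R i \in hso7 R.
Proof. by case: i => [|[|[|[|]]]] // _; apply: memv_span; rewrite !inE eqxx ?orbT. Qed.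
Lemma H3_in x y z : H3 x y z \in hso7 R.
Proof. by rewrite !rpredD ?rpredZ ?Hs_in. Qed.
Lemma hso7E H : H \in hso7 R -> exists x y z, H = H3 x y z.
Proof.
apply: (@span_ind _ _ _ [set H | exists x y z, H = H3 x y z]).
  split=> [|_ _ [x [y [z ->]]] [x' [y' [z' ->]]]|a _ [x [y [z ->]]]].
  - by exists 0, 0, 0; rewrite /H3 !scale0r !addr0.
  - exists (x + x'), (y + y'), (z + z'); rewrite /H3 !scalerDl.
    move: (Hs R 1) (Hs R 2) (Hs R 3) => h1 h2 h3; clear.
    by rewrite [LHS]addrACA; congr (_ + _); rewrite addrACA.
  - by exists (a * x), (a * y), (a * z); rewrite /H3 !scalerDr !scalerA.
move=> u; rewrite !inE => /or3P[] /eqP ->.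
- by exists 1, 0, 0; rewrite /H3 !scale0r !addr0 scale1r.
- by exists 0, 1, 0; rewrite /H3 !scale0r !addr0 scale1r add0r.
- by exists 0, 0, 1; rewrite /H3 !scale0r !add0r scale1r.
Qed.

Lemma ev_eps x y z : [/\ ev (eps R 1) (H3 x y z) = x, ev (eps R 2) (H3 x y z) = y
  & ev (eps R 3) (H3 x y z) = z].
Proof.
by split; rewrite /H3 !evD !evZ !epsE //= ?mulr0 ?mulr1 ?addr0 ?add0r.
Qed.

Lemma lie_H3 x y z (u : M7) a b : lie (H3 x y z) u a b =
  (nth 0 [:: x; y; z; - x; - y; - z; 0] a - nth 0 [:: x; y; z; - x; - y; - z; 0] b) * u a b.
Proof.
rewrite /lie !mxE (bigD1 a) //= big1 => [|k ka]; last by rewrite H3E eq_sym (negPf ka) mul0r.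
rewrite (bigD1 b) //= big1 => [|k kb]; last by rewrite H3E (negPf kb) mulr0.
by rewrite !addr0 !H3E !eqxx mulrBl [X in _ - X]mulrC.
Qed.

(** In [so7] the entries at (p, q) and at its mirror position (bar q, bar p) are
    opposite; when all the others vanish this is a root vector, or an element of
    the Cartan subalgebra. *)
Definition B (p q : nat) : M7 := \matrix_(a, b)
  (((a == p :> nat) && (b == q :> nat))%:R - ((a == barN q :> nat) && (b == barN p :> nat))%:R).

Lemma so7_dec (x : M7) : x \in so7 R -> x = \sum_(a < 7) \sum_(b < 7) (x a b / 2) *: B a b.
Proof.
move=> /so7E xE; apply/matrixP => i j; rewrite summxE.
under eq_bigr do rewrite summxE.
have -> : \sum_(a < 7) \sum_(b < 7) ((x a b / 2) *: B a b) i j =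
    \sum_(a < 7) \sum_(b < 7) (x a b / 2 * ((i == a) && (j == b))%:R) -
    \sum_(a < 7) \sum_(b < 7) (x a b / 2 * ((bar i == b) && (bar j == a))%:R).
  rewrite -sumrB; apply: eq_bigr => a _; rewrite -sumrB; apply: eq_bigr => b _.
  rewrite !mxE mulrBr; congr (_ - _ * _%:R); congr (nat_of_bool (_ && _)).
    by rewrite -!val_eqE /= barE; move: i b; do 2 case=> [[|[|[|[|[|[|[|//]]]]]]] ?].
  by rewrite -!val_eqE /= barE; move: j a; do 2 case=> [[|[|[|[|[|[|[|//]]]]]]] ?].
have -> : \sum_(a < 7) \sum_(b < 7) (x a b / 2 * ((i == a) && (j == b))%:R) = x i j / 2.
  rewrite (bigD1 i) //= [X in _ + X]big1 ?addr0; last first.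
    by move=> a ai; rewrite big1 // => b _; rewrite eq_sym (negPf ai) mulr0.
  rewrite (bigD1 j) //= [X in _ + X]big1 ?addr0; last first.
    by move=> a ai; rewrite [j == _]eq_sym (negPf ai) andbF mulr0.
  by rewrite !eqxx mulr1.
have -> : \sum_(a < 7) \sum_(b < 7) (x a b / 2 * ((bar i == b) && (bar j == a))%:R)
    = x (bar j) (bar i) / 2.
  rewrite (bigD1 (bar j)) //= [X in _ + X]big1 ?addr0; last first.
    by move=> a ai; rewrite big1 // => b _; rewrite [bar j == _]eq_sym (negPf ai) andbF mulr0.
  rewrite (bigD1 (bar i)) //= [X in _ + X]big1 ?addr0; last first.
    by move=> a ai; rewrite eq_sym (negPf ai) mulr0.
  by rewrite !eqxx mulr1.
by rewrite {1}(splitr (x i j)) {2}(xE i j) mulNr.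
Qed.

(** The values 1, 5, 25 are such that no two roots agree on [Hst]; a root vector is
    then determined up to a scalar by one eigenvalue. *)
Definition dstN (a : nat) : int := nth 0 [:: 1; 5; 25; -1; -5; -25; 0] a.
Definition Hst : M7 := H3 1 5 25.
(** The diagonals of the coroots of 2 alpha1 + alpha2, which gives the grading,
    and of alpha2, which gives the weight for the Levi factor. *)
Definition degN (a : nat) : int := nth 0 [:: 2; 1; 1; -2; -1; -1; 0] a.
Definition haN (a : nat) : int := nth 0 [:: 0; 1; -1; 0; -1; 1; 0] a.
Definition D0 : M7 := H3 2 1 1.
Definition Da : M7 := H3 0 1 (-1).

Lemma entry_weight (x y z : int) (u : M7) (c : int) (a b : 'I_7) :
  lie (H3 x%:~R y%:~R z%:~R) u = c%:~R *: u ->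
  nth 0 [:: x; y; z; - x; - y; - z; 0] a - nth 0 [:: x; y; z; - x; - y; - z; 0] b != c ->
  u a b = 0.
Proof.
move=> /(congr1 (fun m : M7 => m a b)); rewrite lie_H3 [RHS]mxE => h ne.
have nE (k : 'I_7) : nth 0 [:: x%:~R; y%:~R; z%:~R; - x%:~R; - y%:~R; - z%:~R; 0] k =
    (nth 0 [:: x; y; z; - x; - y; - z; 0] k)%:~R :> C.
  by case: k => [[|[|[|[|[|[|[|//]]]]]]] ?] /=; rewrite ?rmorphN ?rmorph0.
move/eqP: h; rewrite !nE -rmorphB -subr_eq0 -mulrBl mulf_eq0 -rmorphB intr_eq0 subr_eq0 /=.
by rewrite (negPf ne) => /eqP.
Qed.
Lemma so7_entry (u : M7) (a b : 'I_7) : u \in so7 R -> u a b = - u (bar b) (bar a).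
Proof. by move=> /so7E. Qed.

(** The eigenvalue c of [Hst] belongs to the position (p, q) and its mirror position
    only: a condition on integers that computation decides. *)
Definition isolated (c : int) (p q : nat) : bool :=
  [&& (p < 7)%N, (q < 7)%N, (p != barN q) &
  all (fun a => all (fun b => (dstN a - dstN b == c) ==>
    ((a == p) && (b == q) || (a == barN q) && (b == barN p))) (iota 0 7)) (iota 0 7)].

Lemma B_form (u : M7) p q : u \in so7 R -> (p < 7)%N -> (q < 7)%N -> p != barN q ->
  (forall a b : 'I_7, ~~ ((a == p :> nat) && (b == q :> nat) ||
     (a == barN q :> nat) && (b == barN p :> nat)) -> u a b = 0) ->
  u = u (inord p) (inord q) *: B p q.
Proof.
move=> us p7 q7 pq u0; apply/matrixP => a b; rewrite !mxE.
case: (boolP ((a == p :> nat) && (b == q :> nat) || (a == barN q :> nat) && (b == barN p :> nat)));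
  last first.
  by move=> h; rewrite u0 //; move: h; rewrite negb_or => /andP[/negPf -> /negPf ->]; rewrite subrr mulr0.
move=> /orP[] /andP[/eqP ap /eqP bq].
  have -> : (a == barN q :> nat) = false by rewrite ap; apply/negbTE.
  by rewrite ap bq !eqxx subr0 mulr1 -ap -bq !inord_val.
have ap' : (a == p :> nat) = false by rewrite ap eq_sym; apply/negbTE.
rewrite ap bq !eqxx -ap ap' sub0r mulrN1 so7_entry //; congr (- u _ _).
  by apply: ord_inj; rewrite inordK // barE bq barNK.
by apply: ord_inj; rewrite inordK // barE ap barNK.
Qed.

Lemma weight_form (u : M7) c p q : u \in so7 R -> lie Hst u = c%:~R *: u -> isolated c p q ->
  u = u (inord p) (inord q) *: B p q.
Proof.
move=> us hu /and4P[p7 q7 pq /allP iso]; apply: B_form => // a b h.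
apply: (@entry_weight 1 5 25 u c a b) => //; apply: contra h => h.
have aI : (a : nat) \in iota 0 7 by rewrite mem_iota ltn_ord.
have bI : (b : nat) \in iota 0 7 by rewrite mem_iota ltn_ord.
by have := allP (iso a aI) b bI; rewrite [X in X ==> _]h.
Qed.

Lemma Bbar p q : (p < 7)%N -> (q < 7)%N -> B (barN q) (barN p) = - B p q.
Proof.
move=> p7 q7; apply/matrixP => a b; rewrite !mxE opprB; congr ((_ && _)%:R - (_ && _)%:R).
  by case: p p7 => [|[|[|[|[|[|[|]]]]]]].
by case: q q7 => [|[|[|[|[|[|[|]]]]]]].
Qed.

Lemma B_self p : (p < 7)%N -> B p (barN p) = 0.
Proof.
move=> p7; apply/matrixP => a b; rewrite !mxE.
by rewrite barNK // subrr.
Qed.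

Lemma B_diag p : (p < 7)%N -> B p p \in hso7 R.
Proof.
suff h i : (0 < i < 4)%N -> B i.-1 i.-1 = Hs R i.
  case: p => [|[|[|[|[|[|[|//]]]]]]] _.
  - by rewrite (h 1%N) ?Hs_in.
  - by rewrite (h 2%N) ?Hs_in.
  - by rewrite (h 3%N) ?Hs_in.
  - by rewrite (@Bbar 0 0) // (h 1%N) ?rpredN ?Hs_in.
  - by rewrite (@Bbar 1 1) // (h 2%N) ?rpredN ?Hs_in.
  - by rewrite (@Bbar 2 2) // (h 3%N) ?rpredN ?Hs_in.
  - by rewrite (@B_self 6) // mem0v.
move=> i4; apply/matrixP => a b; rewrite HsE // !mxE.
congr (_%:R - _%:R); congr nat_of_bool.
  by rewrite -val_eqE /= [RHS]andbC; case: eqVneq => [->|] //=; rewrite ?andbF // eq_sym.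
have -> : barN i.-1 = i.+2 by case: i i4 => [|[|[|[|]]]].
by rewrite -val_eqE /= [RHS]andbC; case: eqVneq => [->|] //=; rewrite ?andbF // eq_sym.
Qed.

(** The positions of the positive root vectors, in the order of [so7_pos]. *)
Definition pos_pairs : seq (nat * nat) :=
  [:: (0, 1); (0, 2); (1, 2); (0, 4); (0, 5); (1, 5); (0, 6); (1, 6); (2, 6)]%N.
Definition neg_pairs : seq (nat * nat) := [seq (p.2, p.1) | p <- pos_pairs].

Lemma B_in (W : {vspace M7}) (L : seq (nat * nat)) a b : (hso7 R <= W)%VS ->
  (forall p, p \in L -> B p.1 p.2 \in W) -> (a < 7)%N -> (b < 7)%N ->
  [|| a == b, a == barN b, (a, b) \in L | (barN b, barN a) \in L] -> B a b \in W.
Proof.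
move=> hW LW a7 b7 /or4P[/eqP <-|/eqP ->|/LW//|/LW /=].
- exact: (subvP hW _ (B_diag a7)).
- have -> : B (barN b) b = 0; last exact: mem0v.
  have b7' : (barN b < 7)%N by case: b b7 => [|[|[|[|[|[|[|]]]]]]].
  rewrite -(B_self b7'); congr B; by case: b b7 {b7'} => [|[|[|[|[|[|[|]]]]]]].
- by rewrite Bbar // rpredN.
Qed.

End SO7.

(** * The parabolic subalgebras of so(7) and of g2 *)
Lemma sumv_ind (K : fieldType) (vT : vectType K) (I : eqType) (s : seq I)
    (U : I -> {vspace vT}) (P : set vT) : subspace P ->
  (forall i u, i \in s -> u \in U i -> P u) -> forall x, x \in (\sum_(i <- s) U i)%VS -> P x.
Proof.
move=> sP; elim: s => [_ x|i s IH h x].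
  by rewrite big_nil memv0 => /eqP ->; exact: subspace0.
rewrite big_cons => /memv_addP[u ui [v vs ->]]; apply: (subspaceD sP).
  by apply: h ui; exact: mem_head.
by apply: IH vs => j w js; apply: h; rewrite inE js orbT.
Qed.

Lemma addv_ind (K : fieldType) (vT : vectType K) (U V : {vspace vT}) (P : set vT) : subspace P ->
  (forall u, u \in U -> P u) -> (forall u, u \in V -> P u) -> forall x, x \in (U + V)%VS -> P x.
Proof.
by move=> sP hU hV x /memv_addP[u /hU Pu [v /hV Pv ->]]; exact: (subspaceD sP).
Qed.

Lemma in_nat_span1 (K : fieldType) (n : nat) (h : {vspace 'M[K]_n}) (be al : dual h) H :
  in_nat_span [:: be] al -> ev be H = 0 -> ev al H = 0.
Proof. by move=> [c ->]; rewrite big_seq1 evMnl => ->; rewrite mul0rn. Qed.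

Lemma in_nat_span_self (K : fieldType) (n : nat) (h : {vspace 'M[K]_n}) (be : dual h) :
  in_nat_span [:: be] be.
Proof. by exists (fun _ => 1%N); rewrite big_seq1. Qed.

Lemma in_nth (T : eqType) (u : T) s k : (k < size s)%N -> nth u s k = u -> u \in s.
Proof. by move=> ks <-; exact: mem_nth. Qed.

Section SpanPair.
Context (K : fieldType) (vT : vectType K).
Implicit Types (a b d : vT) (W : {vspace vT}).
Lemma span_pair a b : a \in <<[:: a; b]>>%VS /\ b \in <<[:: a; b]>>%VS.
Proof. by split; apply: memv_span; rewrite !inE eqxx ?orbT. Qed.
Lemma span_pair_sub a b W : a \in W -> b \in W -> (<<[:: a; b]>> <= W)%VS.
Proof. by move=> aW bW; apply/span_subvP => u; rewrite !inE => /orP[] /eqP ->. Qed.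
Lemma eq_span_pair a b d (s t : K) : s != 0 -> d = s *: a + t *: b ->
  <<[:: a; b]>>%VS = <<[:: d; b]>>%VS.
Proof.
move=> s0 dE; have [a1 b1] := span_pair a b; have [d2 b2] := span_pair d b.
apply/eqP; rewrite eqEsubv; apply/andP; split; apply: span_pair_sub => //.
  have -> : a = s^-1 *: (d - t *: b) by rewrite dE addrK scalerA mulVf ?scale1r.
  by rewrite rpredZ ?rpredB ?rpredZ.
by rewrite dE rpredD ?rpredZ.
Qed.
End SpanPair.

Section Grading.
Context (R : realType).
Local Notation C := R[i].
Local Notation M7 := 'M[C]_7.

Definition nonneg : set M7 := [set x | forall a b : 'I_7, (degN a < degN b)%R -> x a b = 0].
Definition neg : set M7 := [set x | forall a b : 'I_7, (degN b <= degN a)%R -> x a b = 0].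

Lemma nonneg_sub : subspace nonneg.
Proof.
split=> [a b _|u v hu hv a b ab|k u hu a b ab]; rewrite !mxE //.
  by rewrite hu // hv // addr0.
by rewrite hu // mulr0.
Qed.
Lemma neg_sub : subspace neg.
Proof.
split=> [a b _|u v hu hv a b ab|k u hu a b ab]; rewrite !mxE //.
  by rewrite hu // hv // addr0.
by rewrite hu // mulr0.
Qed.

Lemma nonneg_lie x y : nonneg x -> nonneg y -> nonneg (lie x y).
Proof.
move=> hx hy a b ab; rewrite !mxE !big1 ?subrr // => c _.
  by case: (ltP (degN a) (degN c)) => ac; [rewrite hy ?mul0r // | rewrite hx ?mulr0 // (le_lt_trans ac)].
by case: (ltP (degN a) (degN c)) => ac; [rewrite hx ?mul0r // | rewrite hy ?mulr0 // (le_lt_trans ac)].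
Qed.
Lemma neg_lie x y : neg x -> neg y -> neg (lie x y).
Proof.
move=> hx hy a b ab; rewrite !mxE !big1 ?subrr // => c _.
  by case: (leP (degN c) (degN a)) => ac; [rewrite hy ?mul0r // | rewrite hx ?mulr0 // (le_trans ab) // ltW].
by case: (leP (degN c) (degN a)) => ac; [rewrite hx ?mul0r // | rewrite hy ?mulr0 // (le_trans ab) // ltW].
Qed.
Lemma neg_nonneg x : neg x -> nonneg x -> x = 0.
Proof.
move=> hx hy; apply/matrixP => a b; rewrite mxE.
by case: (leP (degN b) (degN a)) => ab; [exact: hx | exact: hy].
Qed.
Lemma degNE (a b : 'I_7) (c : int) u : lie (D0 R) u = c%:~R *: u -> degN a - degN b != c ->
  u a b = 0.
Proof. exact: (@entry_weight R 2 1 1). Qed.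
Lemma nonneg_wt (c : int) u : lie (D0 R) u = c%:~R *: u -> (0 <= c)%R -> nonneg u.
Proof.
move=> h c0 a b ab; apply: (degNE h); apply/eqP => E.
by move: c0; rewrite -E subr_ge0 leNgt ab.
Qed.
Lemma neg_wt (c : int) u : lie (D0 R) u = c%:~R *: u -> (c < 0)%R -> neg u.
Proof.
move=> h c0 a b ab; apply: (degNE h); apply/eqP => E.
by move: c0; rewrite -E subr_lt0 ltNge ab.
Qed.

Lemma hso7_nonneg H : H \in hso7 R -> nonneg H.
Proof.
by move=> /hso7E[x [y [z ->]]] a b ab; rewrite H3E; case: eqVneq ab => // ->; rewrite ltxx.
Qed.
Lemma hso7_comm H H' : H \in hso7 R -> H' \in hso7 R -> lie H H' = 0.
Proof.
move=> /hso7E[x [y [z ->]]] hH'; apply/matrixP => a b; rewrite lie_H3 mxE.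
case: (eqVneq a b) => [->|ab]; first by rewrite subrr mul0r.
by move: hH' => /hso7E[x' [y' [z' ->]]]; rewrite [H3 _ _ _ _ _]H3E (negPf ab) mulr0.
Qed.

Definition posr (i : nat) : dual (hso7 R) := nth 0 (so7_pos R) i.
(** The values of the positive roots on the diagonal (a, b, c), over any group:
    over the integers they can be compared by computation. *)
Definition posv (S : zmodType) (a b c : S) (i : nat) : S :=
  nth 0 [:: a - b; a - c; b - c; a + b; a + c; b + c; a; b; c] i.

Lemma ev_pos i a b c : (i < 9)%N -> ev (posr i) (H3 a b c) = posv a b c i.
Proof.
have [e1 e2 e3] := @ev_eps R a b c.
by case: i => [|[|[|[|[|[|[|[|[|//]]]]]]]]] _; rewrite /posr /= ?evDl ?evNl ?e1 ?e2 ?e3.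
Qed.
Lemma ev_posZ i (a b c : int) : (i < 9)%N ->
  ev (posr i) (H3 a%:~R b%:~R c%:~R) = (posv a b c i)%:~R.
Proof.
move=> i9; rewrite ev_pos //; case: i i9 => [|[|[|[|[|[|[|[|[|//]]]]]]]]] _ /=;
  by rewrite ?rmorphB ?rmorphD.
Qed.

Lemma levi_roots_so7 : levi_roots (so7_pos R) [:: posr 2] = [:: posr 2].
Proof.
rewrite /levi_roots; have -> : so7_pos R = [seq posr i | i <- iota 0 9] by [].
have F i : (i < 9)%N -> posv 2 1 1 i != 0 :> int -> `[< in_nat_span [:: posr 2] (posr i) >] = false.
  move=> i9 h; apply/asboolPn => /(in_nat_span1 (H := D0 R)).
  have e j : (j < 9)%N -> ev (posr j) (D0 R) = (posv 2 1 1 j : int)%:~R by exact: (@ev_posZ j 2 1 1).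
  rewrite !e // => /(_ (erefl _))/eqP; rewrite intr_eq0.
  by apply/negP.
have T : `[< in_nat_span [:: posr 2] (posr 2) >] by apply/asboolP; exact: in_nat_span_self.
by rewrite /= T !F.
Qed.

Context (X : dual (hso7 R) -> M7) (X_root : root_vectors X).

Lemma X_facts (s : bool) i : (i < 9)%N -> let ga := if s then - posr i else posr i in
  [/\ X ga != 0, X ga \in so7 R & forall H, H \in hso7 R -> lie H (X ga) = ev ga H *: X ga].
Proof.
move=> i9 ga; have : ga \in so7_pos R ++ [seq - be | be <- so7_pos R].
  rewrite mem_cat /ga; case: (s); last by rewrite mem_nth.
  by apply/orP; right; apply: map_f; apply: mem_nth.
by move=> /X_root[X0 /rootspaceP[Xg Xh]].
Qed.

Lemma Xpos_form i : (i < 9)%N -> exists2 x : C, x != 0 &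
  X (posr i) = x *: B R (nth (0, 0)%N pos_pairs i).1 (nth (0, 0)%N pos_pairs i).2.
Proof.
move=> i9; have [X0 Xs Xh] := @X_facts false i i9; set u := X _ in X0 Xs Xh *.
have hu : lie (Hst R) u = (posv 1 5 25 i : int)%:~R *: u.
  rewrite Xh ?H3_in //; congr (_ *: _); exact: (@ev_posZ i 1 5 25).
have iso : isolated (posv 1 5 25 i : int) (nth (0, 0)%N pos_pairs i).1 (nth (0, 0)%N pos_pairs i).2.
  by case: i i9 {u X0 Xs Xh hu} => [|[|[|[|[|[|[|[|[|//]]]]]]]]] _; vm_compute.
have E := weight_form Xs hu iso; exists (u (inord (nth (0, 0)%N pos_pairs i).1) (inord (nth (0, 0)%N pos_pairs i).2)) => //.
by apply: contra X0 => /eqP x0; rewrite E x0 scale0r.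
Qed.

Lemma Xneg_form i : (i < 9)%N -> exists2 x : C, x != 0 &
  X (- posr i) = x *: B R (nth (0, 0)%N pos_pairs i).2 (nth (0, 0)%N pos_pairs i).1.
Proof.
move=> i9; have [X0 Xs Xh] := @X_facts true i i9; set u := X _ in X0 Xs Xh *.
have hu : lie (Hst R) u = (- (posv 1 5 25 i : int))%:~R *: u.
  rewrite Xh ?H3_in //; congr (_ *: _); rewrite evNl rmorphN; congr (- _).
  exact: (@ev_posZ i 1 5 25).
have iso : isolated (- (posv 1 5 25 i : int)) (nth (0, 0)%N pos_pairs i).2 (nth (0, 0)%N pos_pairs i).1.
  by case: i i9 {u X0 Xs Xh hu} => [|[|[|[|[|[|[|[|[|//]]]]]]]]] _; vm_compute.
have E := weight_form Xs hu iso; exists (u (inord (nth (0, 0)%N pos_pairs i).2) (inord (nth (0, 0)%N pos_pairs i).1)) => //.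
by apply: contra X0 => /eqP x0; rewrite E x0 scale0r.
Qed.

Definition eX : M7 := B R 1 2.
Definition fX : M7 := B R 2 1.

Lemma BE p q : (p < 7)%N -> (q < 7)%N ->
  B R p q = delta_mx (inord p) (inord q) - delta_mx (inord (barN q)) (inord (barN p)).
Proof.
by move=> p7 q7; apply/matrixP => a b; rewrite !mxE -!val_eqE /= !inordK ?barN_lt.
Qed.

Lemma lie_ef : lie eX fX = Da R.
Proof.
rewrite /eX /fX !BE // /lie !mulmxBl !mulmxBr !mul_delta_mx_cond -!val_eqE /= !inordK //=.
rewrite !mulr1n !mulr0n !subr0 !sub0r !opprK.
rewrite /Da /H3 scale0r add0r scale1r scaleN1r /Hs /Eij /= !opprB.
by rewrite opprD [- _ - _]addrC addrACA.
Qed.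

Lemma Xroot_line (s : bool) i x p q : (i < 9)%N ->
  X (if s then - posr i else posr i) = x *: B R p q -> x != 0 ->
  isolated (if s then - (posv 1 5 25 i : int) else posv 1 5 25 i) p q ->
  rootspace (so7 R) (if s then - posr i else posr i) = <[B R p q]>%VS.
Proof.
move=> i9 XE x0 iso; set ga := if s then _ else _.
have [_ Xs Xh] := @X_facts s i i9; apply/eqP; rewrite eqEsubv; apply/andP; split.
  apply/subvP => u /rootspaceP[us uh]; apply/vlineP.
  exists (u (inord p) (inord q)); apply: weight_form iso => //.
  rewrite uh ?H3_in //; congr (_ *: _); rewrite /ga; case: (s); rewrite ?evNl ?rmorphN.
    by congr (- _); exact: (@ev_posZ i 1 5 25).
  exact: (@ev_posZ i 1 5 25).
rewrite -memvE; have -> : B R p q = x^-1 *: X ga by rewrite /ga XE scalerA mulVf // scale1r.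
by apply: memvZ; apply/rootspaceP.
Qed.

Lemma rootspace_e : rootspace (so7 R) (posr 2) = <[eX]>%VS.
Proof. by have [x x0 xE] := @Xpos_form 2 isT; exact: (@Xroot_line false 2 x 1 2). Qed.
Lemma rootspace_f : rootspace (so7 R) (- posr 2) = <[fX]>%VS.
Proof. by have [x x0 xE] := @Xneg_form 2 isT; exact: (@Xroot_line true 2 x 2 1). Qed.

Local Notation p := (parabolic (so7 R) (so7_pos R) [:: posr 2]).

Lemma hso7_so7 : (hso7 R <= so7 R)%VS.
Proof.
apply/subvP => H /hso7E[x [y [z ->]]]; apply/so7E => a b; rewrite !H3E.
rewrite (inj_eq (can_inj barK)) [b == a]eq_sym; case: eqVneq => [->|]; last by rewrite oppr0.
by rewrite barE; case: b => [[|[|[|[|[|[|[|//]]]]]]] ?] /=; rewrite ?opprK ?oppr0.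
Qed.

Lemma parabolic_so7_sub : (p <= so7 R)%VS.
Proof.
rewrite /parabolic !subv_add hso7_so7 /=; apply/andP; split.
  by apply: sumv_seq_sub => al _; exact: capvSl.
by apply: sumv_seq_sub => al _; exact: capvSl.
Qed.

Lemma rootspace_pos_p i : (i < 9)%N -> (rootspace (so7 R) (posr i) <= p)%VS.
Proof.
move=> i9; apply: subv_trans (addvSl _ _); apply: subv_trans (addvSr _ _).
by apply: (subv_sum_seq (fun al => rootspace (so7 R) al)); rewrite mem_nth.
Qed.

Lemma so7_hp : (hso7 R <= p)%VS.
Proof. by apply: subv_trans (addvSl _ _); exact: addvSl. Qed.
Lemma eX_p : eX \in p.
Proof. by apply: (subvP (rootspace_pos_p (i := 2) isT)); rewrite rootspace_e memv_line. Qed.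
Lemma fX_p : fX \in p.
Proof.
apply: (subvP (addvSr _ _)); rewrite levi_roots_so7 big_seq1 rootspace_f; exact: memv_line.
Qed.

Lemma B_pos_p i : (i < 9)%N -> B R (nth (0, 0)%N pos_pairs i).1 (nth (0, 0)%N pos_pairs i).2 \in p.
Proof.
move=> i9; have [x x0 xE] := Xpos_form i9; apply: (subvP (rootspace_pos_p i9)).
have -> : B R (nth (0, 0)%N pos_pairs i).1 (nth (0, 0)%N pos_pairs i).2 = x^-1 *: X (posr i).
  by rewrite xE scalerA mulVf // scale1r.
apply: memvZ; have [_ Xs Xh] := @X_facts false i i9; exact/rootspaceP.
Qed.

(** On D0 the positive roots take positive values, except for eps 2 - eps 3, which
    vanishes. As the nonnegative part of a grading, the parabolic subspace is closed
    under the bracket. *)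
Lemma parabolic_so7P x : x \in p <-> x \in so7 R /\ nonneg x.
Proof.
split=> [xp|[xs xn]].
  split; first exact: (subvP parabolic_so7_sub).
  have rs (ga : dual (hso7 R)) (c : int) u : ev ga (D0 R) = c%:~R -> 0 <= c ->
      u \in rootspace (so7 R) ga -> nonneg u.
    move=> gc c0 /rootspaceP[_ uh]; apply: nonneg_wt c0.
    by rewrite uh ?H3_in // gc.
  move: x xp; apply: (addv_ind nonneg_sub).
    apply: (addv_ind nonneg_sub); first exact: hso7_nonneg.
    apply: (sumv_ind nonneg_sub) => al u /(nthP 0)[i i9 <-].
    apply: (rs _ (posv 2 1 1 i)); first exact: (@ev_posZ i 2 1 1).
    by case: i i9 => [|[|[|[|[|[|[|[|[|//]]]]]]]]].
  apply: (sumv_ind nonneg_sub) => al u; rewrite levi_roots_so7 inE => /eqP ->.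
  by apply: (rs _ 0) => //; rewrite evNl (@ev_posZ 2 2 1 1) // oppr0.
rewrite (so7_dec xs); apply: memv_suml => a _; apply: memv_suml => b _.
case: (ltP (degN a) (degN b)) => ab; first by rewrite xn // mul0r scale0r mem0v.
apply: memvZ; apply: (B_in so7_hp (L := (2, 1)%N :: pos_pairs)) (ltn_ord a) (ltn_ord b) _.
  move=> pq; rewrite inE => /orP[/eqP -> |/(nthP (0, 0)%N)[i i9 <-]]; first exact: fX_p.
  exact: B_pos_p.
have chk : all (fun a => all (fun b => (degN b <= degN a) ==>
   [|| a == b, a == barN b, (a, b) \in (2, 1)%N :: pos_pairs | (barN b, barN a) \in (2, 1)%N :: pos_pairs])
   (iota 0 7)) (iota 0 7) by vm_compute.
have aI : (a : nat) \in iota 0 7 by rewrite mem_iota ltn_ord.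
have bI : (b : nat) \in iota 0 7 by rewrite mem_iota ltn_ord.
by have := allP (allP chk a aI) b bI; rewrite ab.
Qed.

Lemma parabolic_so7_lie : is_liealg p.
Proof.
move=> x y /parabolic_so7P[xs xn] /parabolic_so7P[ys yn]; apply/parabolic_so7P.
by split; [exact: so7_lie | exact: nonneg_lie].
Qed.

Lemma levi_so7E : levi (so7 R) (so7_pos R) [:: posr 2] = (hso7 R + <[eX]> + <[fX]>)%VS.
Proof. by rewrite /levi levi_roots_so7 big_seq1 rootspace_e rootspace_f addvA. Qed.

(** A basis of the opposite nilradical of so(7). The first five vectors span that of
    g2; the last three complete it. In this order a sorted monomial is a monomial
    of g2 applied to a monomial in the last three. *)
Definition y8 : 8.-tuple M7 := [tuple X (- eps R 1 - eps R 3); X (- eps R 1 - eps R 2);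
  X (- eps R 3) + X (eps R 2 - eps R 1); - X (- eps R 2) - X (eps R 3 - eps R 1);
  - X (- eps R 1) - X (- eps R 2 - eps R 3); X (- eps R 3); X (- eps R 2); X (- eps R 1)].
Definition y5 : 5.-tuple M7 := [tuple X (- eps R 1 - eps R 3); X (- eps R 1 - eps R 2);
  X (- eps R 3) + X (eps R 2 - eps R 1); - X (- eps R 2) - X (eps R 3 - eps R 1);
  - X (- eps R 1) - X (- eps R 2 - eps R 3)].
(** The i-th vector of [y8] lowers H0 by [dyN i] + 1; its weight for the coroot
    of alpha2 is [wyN i]. *)
Definition dyN (i : nat) : nat := nth 0%N [:: 2; 2; 0; 0; 1; 0; 0; 1]%N i.
Definition wyN (i : nat) : int := nth 0 [:: 1; -1; 1; -1; 0; 1; -1; 0] i.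
Local Notation Y i := (X (- posr i)).

Lemma y8E : tval y8 = [:: Y 4; Y 3; Y 8 + Y 0; - Y 7 - Y 1; - Y 6 - Y 5; Y 8; Y 7; Y 6].
Proof. by rewrite /posr /= !opprB !opprD. Qed.
Lemma y5E i : (i < 5)%N -> y5`_i = y8`_i.
Proof. by case: i => [|[|[|[|[|]]]]]. Qed.

Lemma y8_so7 (i : 'I_8) : y8`_i \in so7 R.
Proof.
have YS j : (j < 9)%N -> Y j \in so7 R by move=> j9; have [] := @X_facts true j j9.
by rewrite y8E; case: i => [[|[|[|[|[|[|[|[|//]]]]]]]] ?] /=; rewrite ?rpredB ?rpredD ?rpredN ?YS.
Qed.

Lemma y8_wt (x y z : int) (c : nat -> int) (i : 'I_8) :
  (forall i, (i < 8)%N -> c i = nth 0 [:: - (x + z); - (x + y); - z; - y; - x; - z; - y; - x] i) ->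
  x = y + z -> lie (H3 x%:~R y%:~R z%:~R) y8`_i = (c i)%:~R *: y8`_i.
Proof.
move=> cE xyz.
have YS j : (j < 9)%N -> lie (H3 x%:~R y%:~R z%:~R) (Y j) = (- (posv x y z j))%:~R *: Y j.
  move=> j9; have [_ _ Xh] := @X_facts true j j9; rewrite Xh ?H3_in //.
  by congr (_ *: _); rewrite evNl ev_posZ // rmorphN.
have LD (u v h : M7) : lie h (u + v) = lie h u + lie h v.
  by rewrite /lie mulmxDr mulmxDl opprD addrACA.
have LN (u h : M7) : lie h (- u) = - lie h u by rewrite /lie mulmxN mulNmx opprB opprK addrC.
rewrite cE // y8E xyz; rewrite xyz in YS.
case: i => [[|[|[|[|[|[|[|[|//]]]]]]]] ?]; rewrite [nth _ _ _]/= [(nth _ _ _)%:~R]/= ?LD ?LN ?YS //=.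
- by rewrite /posv /= scalerDr; congr (_%:~R *: _ + _%:~R *: _); ring.
- by rewrite /posv /= scalerDr !scalerN; congr (- (_%:~R *: _) - _%:~R *: _); ring.
- by rewrite /posv /= scalerDr !scalerN; congr (- (_%:~R *: _) - _%:~R *: _); ring.
Qed.

Lemma y8_H0 (i : 'I_8) : lie (D0 R) y8`_i = - (dyN i).+1%:R *: y8`_i.
Proof.
rewrite (@y8_wt 2 1 1 (fun i => - ((dyN i).+1 : int))) //; last by case=> [|[|[|[|[|[|[|[|]]]]]]]].
Qed.
Lemma y8_Ha (i : 'I_8) : lie (Da R) y8`_i = (wyN i)%:~R *: y8`_i.
Proof.
have -> : Da R = H3 0%:~R 1%:~R (-1)%:~R by rewrite /Da rmorphN.
by rewrite (@y8_wt 0 1 (-1) wyN) //; case=> [|[|[|[|[|[|[|[|]]]]]]]].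
Qed.

Lemma y8_neg u : u \in <<y8>>%VS -> neg u.
Proof.
apply: (span_ind neg_sub) => v /tnthP[i ->]; rewrite (tnth_nth 0).
apply: (@neg_wt (- ((dyN i).+1 : int))); last by rewrite oppr_lt0.
by rewrite y8_H0 rmorphN.
Qed.

Lemma y8_cap : (<<y8>> :&: p = 0)%VS.
Proof.
apply/eqP; rewrite -subv0; apply/subvP => u /memv_capP[/y8_neg un /parabolic_so7P[_ up]].
by rewrite memv0; apply/eqP; exact: neg_nonneg.
Qed.

Lemma y8_add : (<<y8>> + p = so7 R)%VS.
Proof.
apply/eqP; rewrite eqEsubv; apply/andP; split.
  rewrite subv_add parabolic_so7_sub andbT; apply/span_subvP => v /tnthP[i ->].
  by rewrite (tnth_nth 0); exact: y8_so7.
set W := (_ + _)%VS; have hW : (hso7 R <= W)%VS by apply: subv_trans so7_hp (addvSr _ _).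
have yW i : (i < 8)%N -> y8`_i \in W.
  by move=> i8; apply: (subvP (addvSl _ _)); apply: memv_span; rewrite mem_nth // size_tuple.
have y_ i u : (i < 8)%N -> u = y8`_i -> u \in W by move=> i8 ->; exact: yW.
have Y8 : Y 8 \in W by apply: (@y_ 5); rewrite // y8E.
have Y7 : Y 7 \in W by apply: (@y_ 6); rewrite // y8E.
have Y6 : Y 6 \in W by apply: (@y_ 7); rewrite // y8E.
have YW i : (i < 9)%N -> i != 2%N -> Y i \in W.
  case: i => [|[|[|[|[|[|[|[|[|//]]]]]]]]] // _ _.
  - by rewrite -(addKr (Y 8) (Y 0)) rpredD ?rpredN // (@y_ 2) // y8E.
  - by rewrite -[Y 1]opprK -(addKr (- Y 7) (- Y 1)) opprK rpredN rpredD // (@y_ 3) // y8E.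
  - by apply: (@y_ 1); rewrite // y8E.
  - by apply: (@y_ 0); rewrite // y8E.
  - by rewrite -[Y 5]opprK -(addKr (- Y 6) (- Y 5)) opprK rpredN rpredD // (@y_ 4) // y8E.
apply/subvP => x xs; rewrite (so7_dec xs); apply: memv_suml => a _; apply: memv_suml => b _.
apply: memvZ; apply: (B_in hW (L := pos_pairs ++ neg_pairs)) (ltn_ord a) (ltn_ord b) _.
  move=> pq; rewrite mem_cat => /orP[/(nthP (0, 0)%N)[i i9 <-]|/mapP[pq' /(nthP (0, 0)%N)[i i9 <-] ->]].
    by apply: (subvP (addvSr _ _)); exact: B_pos_p.
  case: (eqVneq i 2%N) => [->|i2]; first by apply: (subvP (addvSr _ _)); exact: fX_p.
  have [t t0 tE] := Xneg_form i9.
  suff -> : B R (nth (0, 0)%N pos_pairs i).2 (nth (0, 0)%N pos_pairs i).1 = t^-1 *: Y i.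
    by apply: memvZ; exact: YW.
  by rewrite tE scalerA mulVf // scale1r.
have chk : all (fun a => all (fun b =>
   [|| a == b, a == barN b, (a, b) \in pos_pairs ++ neg_pairs | (barN b, barN a) \in pos_pairs ++ neg_pairs])
   (iota 0 7)) (iota 0 7) by vm_compute.
have aI : (a : nat) \in iota 0 7 by rewrite mem_iota ltn_ord.
have bI : (b : nat) \in iota 0 7 by rewrite mem_iota ltn_ord.
exact: allP (allP chk a aI) b bI.
Qed.

(** The entries at (5, 0), (4, 0), (1, 0), (2, 0), (5, 1), (6, 2), (6, 1),
    (6, 0), read in this order, isolate the coefficients one after the other. *)
Lemma neg_indep (x0 x1 x3 x4 x5 x6 x7 x8 k0 k1 k2 k3 k4 k5 k6 k7 : C) :
  x0 != 0 -> x1 != 0 -> x3 != 0 -> x4 != 0 -> x5 != 0 -> x6 != 0 -> x7 != 0 -> x8 != 0 ->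
  k0 *: (x4 *: B R 5 0) + (k1 *: (x3 *: B R 4 0) + (k2 *: (x8 *: B R 6 2 + x0 *: B R 1 0) +
  (k3 *: (- (x7 *: B R 6 1) - x1 *: B R 2 0) + (k4 *: (- (x6 *: B R 6 0) - x5 *: B R 5 1) +
  (k5 *: (x8 *: B R 6 2) + (k6 *: (x7 *: B R 6 1) + k7 *: (x6 *: B R 6 0))))))) = 0 ->
  all (fun k => k == 0) [:: k0; k1; k2; k3; k4; k5; k6; k7].
Proof.
move=> x00 x10 x30 x40 x50 x60 x70 x80 h.
have E a b := congr1 (fun m : M7 => m (inord a) (inord b)) h.
have simp := (subrr, subr0, sub0r, mulr0, mulr1, addr0, add0r, oppr0).
have z0 : k0 = 0.
  by move: (E 5 0)%N; rewrite !mxE !inordK //= !simp => /eqP; rewrite mulf_eq0 (negPf x40) orbF => /eqP.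
have z1 : k1 = 0.
  by move: (E 4 0)%N; rewrite !mxE !inordK //= !simp => /eqP; rewrite mulf_eq0 (negPf x30) orbF => /eqP.
have z2 : k2 = 0.
  by move: (E 1 0)%N; rewrite !mxE !inordK //= !simp => /eqP; rewrite mulf_eq0 (negPf x00) orbF => /eqP.
have z3 : k3 = 0.
  by move: (E 2 0)%N; rewrite !mxE !inordK //= !simp => /eqP; rewrite mulf_eq0 oppr_eq0 (negPf x10) orbF => /eqP.
have z4 : k4 = 0.
  by move: (E 5 1)%N; rewrite !mxE !inordK //= !simp => /eqP; rewrite mulf_eq0 oppr_eq0 (negPf x50) orbF => /eqP.
have z5 : k5 = 0.
  by move: (E 6 2)%N; rewrite z2 !mxE !inordK //= ?mul0r !simp => /eqP; rewrite mulf_eq0 (negPf x80) orbF => /eqP.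
have z6 : k6 = 0.
  by move: (E 6 1)%N; rewrite z3 !mxE !inordK //= ?mul0r !simp => /eqP; rewrite mulf_eq0 (negPf x70) orbF => /eqP.
have z7 : k7 = 0.
  by move: (E 6 0)%N; rewrite z4 !mxE !inordK //= ?mul0r !simp => /eqP; rewrite mulf_eq0 (negPf x60) orbF => /eqP.
by rewrite z0 z1 z2 z3 z4 z5 z6 z7 /= !eqxx.
Qed.

Lemma y8_free : free y8.
Proof.
apply/freeP => k.
have [x0 x00 E0] := @Xneg_form 0 isT; have [x1 x10 E1] := @Xneg_form 1 isT.
have [x3 x30 E3] := @Xneg_form 3 isT; have [x4 x40 E4] := @Xneg_form 4 isT.
have [x5 x50 E5] := @Xneg_form 5 isT; have [x6 x60 E6] := @Xneg_form 6 isT.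
have [x7 x70 E7] := @Xneg_form 7 isT; have [x8 x80 E8] := @Xneg_form 8 isT.
pose kk j := k (inord j); have kE (i : 'I_8) : k i = kk i by rewrite /kk inord_val.
have -> : \sum_(i < 8) k i *: y8`_i = \sum_(0 <= i < 8) kk i *: y8`_i.
  by rewrite big_mkord; apply: eq_bigr => i _; rewrite kE.
rewrite unlock y8E /= addr0 E0 E1 E3 E4 E5 E6 E7 E8 /= => /(neg_indep x00 x10 x30 x40 x50 x60 x70 x80).
by move=> /= /and5P[/eqP z0 /eqP z1 /eqP z2 /eqP z3 /and5P[/eqP z4 /eqP z5 /eqP z6 /eqP z7 _]];
  case=> [[|[|[|[|[|[|[|[|//]]]]]]]] ?]; rewrite kE.
Qed.


(** ** The subalgebra g2 *)
Hypothesis g2L : is_liealg (g2 X).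
Local Notation gg := (g2 X).
Local Notation qq := (parabolic gg (g2_pos R) [:: alpha2 R]).

Lemma H3lin s t a b c a' b' c' :
  s *: H3 a b c + t *: H3 a' b' c' = H3 (s * a + t * a') (s * b + t * b') (s * c + t * c') :> M7.
Proof.
rewrite /H3; move: (Hs R 1) (Hs R 2) (Hs R 3) => h1 h2 h3.
rewrite !scalerDr !scalerA !scalerDl.
by rewrite addrACA; congr (_ + _); rewrite addrACA.
Qed.

Lemma H3_eq a b c a' b' c' : a = a' -> b = b' -> c = c' -> H3 a b c = H3 a' b' c' :> M7.
Proof. by move=> -> -> ->. Qed.

Lemma Ha2E : Ha2 R = Da R.
Proof. by rewrite /Ha2 /Da /H3 scale0r add0r scale1r scaleN1r. Qed.
Lemma H2a1a2E : H2a1a2 R = D0 R.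
Proof. by rewrite /H2a1a2 /D0 /H3 !scale1r. Qed.
Lemma Ha1E : Ha1 R = H3 1 (-1) 2.
Proof. by rewrite /Ha1 /H3 scale1r scaleN1r. Qed.

Lemma hg2_span : (hg2 R = <<[:: D0 R; Da R]>>)%VS.
Proof.
have e0 : D0 R = 2 *: Ha1 R + 3 *: Da R.
  by rewrite Ha1E /D0 /Da H3lin; apply: H3_eq; ring.
have n2 : (2 : C) != 0 by rewrite pnatr_eq0.
rewrite -(eq_span_pair n2 e0) -Ha2E; exact: erefl.
Qed.

Lemma D0_hg2 : D0 R \in hg2 R.
Proof. by rewrite hg2_span; exact: (span_pair _ _).1. Qed.
Lemma Da_hg2 : Da R \in hg2 R.
Proof. by rewrite hg2_span; exact: (span_pair _ _).2. Qed.
Lemma hg2_hso7 : (hg2 R <= hso7 R)%VS.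
Proof. by rewrite hg2_span; apply: span_pair_sub; exact: H3_in. Qed.

Definition posg (i : nat) : dual (hg2 R) := nth 0 (g2_pos R) i.
Definition dgN (i : nat) : int := nth 0 [:: 1; 0; 1; 2; 3; 3] i.
Definition wgN (i : nat) : int := nth 0 [:: -1; 2; 1; 0; -1; 1] i.

Lemma ev_al1 : ev (alpha1 R) (D0 R) = 1%:~R /\ ev (alpha1 R) (Da R) = (-1)%:~R.
Proof.
have [_ _ e3] := @ev_eps R 2 1 1; have [_ _ e3'] := @ev_eps R 0 1 (-1).
by rewrite /alpha1 (restrE _ D0_hg2) (restrE _ Da_hg2).
Qed.
Lemma ev_al2 : ev (alpha2 R) (D0 R) = 0%:~R /\ ev (alpha2 R) (Da R) = 2%:~R.
Proof.
have [_ e2 e3] := @ev_eps R 2 1 1; have [_ e2' e3'] := @ev_eps R 0 1 (-1).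
rewrite /alpha2 (restrE _ D0_hg2) (restrE _ Da_hg2) !evDl !evNl e2 e3 e2' e3' subrr opprK.
by split.
Qed.

Lemma ev_posg i : (i < 6)%N ->
  ev (posg i) (D0 R) = (dgN i)%:~R /\ ev (posg i) (Da R) = (wgN i)%:~R.
Proof.
have [e1 e1'] := ev_al1; have [e2 e2'] := ev_al2.
have e (j k : nat) : ev (alpha1 R *+ j + alpha2 R *+ k) (D0 R) = (1 *+ j + 0 *+ k : int)%:~R /\
    ev (alpha1 R *+ j + alpha2 R *+ k) (Da R) = (-1 *+ j + 2 *+ k : int)%:~R.
  have cE (a b : int) : (a *+ j + b *+ k)%:~R = a%:~R *+ j + b%:~R *+ k :> C.
    by rewrite rmorphD !rmorphMn.
  by split; apply: etrans _ (esym (cE _ _)); rewrite evDl !evMnl ?e1 ?e2 ?e1' ?e2'.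
case: i => [|[|[|[|[|[|//]]]]]] _.
- exact: (conj e1 e1').
- exact: (conj e2 e2').
- exact: (e 1%N 1%N).
- exact: (e 2%N 1%N).
- exact: (e 3%N 1%N).
- exact: (e 3%N 2%N).
Qed.

Lemma levi_roots_g2 : levi_roots (g2_pos R) [:: alpha2 R] = [:: alpha2 R].
Proof.
rewrite /levi_roots; have -> : g2_pos R = [seq posg i | i <- iota 0 6] by [].
have a2 : alpha2 R = posg 1 by [].
have F i : (i < 6)%N -> dgN i != 0 -> `[< in_nat_span [:: alpha2 R] (posg i) >] = false.
  move=> i9 h; apply/asboolPn => /(in_nat_span1 (H := D0 R)) /(_ ev_al2.1).
  by rewrite (ev_posg i9).1 => /eqP; rewrite intr_eq0 (negPf h).
have T : `[< in_nat_span [:: alpha2 R] (posg 1) >] by apply/asboolP; exact: in_nat_span_self.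
by rewrite /= T !F.
Qed.

Lemma nil_roots_g2 al : al \in nil_roots (g2_pos R) [:: alpha2 R] ->
  exists d : nat, ev al (D0 R) = d.+1%:R.
Proof.
rewrite mem_filter => /andP[nal /(nthP 0)[i i6 E]]; rewrite -E.
have e : ev (nth 0 (g2_pos R) i) (D0 R) = (dgN i)%:~R := (ev_posg i6).1.
rewrite e; case: i i6 E {e} => [|[|[|[|[|[|//]]]]]] _ E.
- by exists 0%N.
- move: nal; rewrite -E => /asboolPn[]; exact: in_nat_span_self.
- by exists 0%N.
- by exists 1%N.
- by exists 2%N.
- by exists 2%N.
Qed.

Lemma eigD (H u v : M7) c : lie H u = c *: u -> lie H v = c *: v -> lie H (u + v) = c *: (u + v).
Proof. by move=> hu hv; rewrite scalerDr -hu -hv /lie mulmxDr mulmxDl opprD addrACA. Qed.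
Lemma eigN (H u : M7) c : lie H u = c *: u -> lie H (- u) = c *: - u.
Proof. by move=> hu; rewrite scalerN -hu /lie mulmxN mulNmx opprB opprK addrC. Qed.

Lemma eigZ (H u : M7) x c : x != 0 -> lie H (x *: u) = c *: (x *: u) -> lie H u = c *: u.
Proof.
move=> x0 h; apply: (scalerI x0); rewrite scalerA mulrC -scalerA -h.
by rewrite /lie -scalemxAl -scalemxAr scalerBr.
Qed.

Lemma Xpos_wt i : (i < 9)%N ->
  lie (D0 R) (X (posr i)) = (posv 2 1 1 i : int)%:~R *: X (posr i) /\
  lie (Da R) (X (posr i)) = (posv 0 1 (-1) i : int)%:~R *: X (posr i).
Proof.
move=> i9; have [_ _ Xh] := @X_facts false i i9; rewrite !Xh ?H3_in //.
by split; congr (_ *: _); [exact: (@ev_posZ i 2 1 1) | exact: (@ev_posZ i 0 1 (-1))].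
Qed.
Lemma Xneg_wt i : (i < 9)%N ->
  lie (D0 R) (Y i) = (- (posv 2 1 1 i : int))%:~R *: Y i /\
  lie (Da R) (Y i) = (- (posv 0 1 (-1) i : int))%:~R *: Y i.
Proof.
move=> i9; have [_ _ Xh] := @X_facts true i i9; rewrite !Xh ?H3_in // !evNl !rmorphN.
by split; congr (- _ *: _); [exact: (@ev_posZ i 2 1 1) | exact: (@ev_posZ i 0 1 (-1))].
Qed.

Lemma g2_vecE : g2_root_vectors X = [:: X (posr 2); - X (posr 4); - X (posr 3);
  X (posr 8) + X (posr 0); X (posr 7) - X (posr 1); - X (posr 6) - X (posr 5);
  Y 2; Y 4; Y 3; Y 8 + Y 0; - Y 7 - Y 1; - Y 6 - Y 5].
Proof. by rewrite /posr /= !opprB !opprD. Qed.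

Lemma g2_so7 : (gg <= so7 R)%VS.
Proof.
rewrite subv_add (subv_trans hg2_hso7 hso7_so7) /=; apply/span_subvP => u.
have P i : (i < 9)%N -> X (posr i) \in so7 R by move=> i9; have [] := @X_facts false i i9.
have N i : (i < 9)%N -> Y i \in so7 R by move=> i9; have [] := @X_facts true i i9.
rewrite g2_vecE !inE => h.
by repeat (case/orP: h => [/eqP -> | h]); [..|move/eqP: h => ->]; rewrite ?rpredB ?rpredD ?rpredN ?P ?N.
Qed.

Lemma hg2_gg : (hg2 R <= gg)%VS. Proof. exact: addvSl. Qed.
Lemma vec_gg u : u \in g2_root_vectors X -> u \in gg.
Proof. by move=> h; apply: (subvP (addvSr _ _)); exact: memv_span. Qed.

Lemma rootspace_mem (be : dual (hg2 R)) (d w : int) u : ev be (D0 R) = d%:~R ->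
  ev be (Da R) = w%:~R -> u \in gg ->
  lie (D0 R) u = d%:~R *: u -> lie (Da R) u = w%:~R *: u -> u \in rootspace gg be.
Proof.
move=> bd bw ug hd hw; apply/rootspaceP; split=> // H Hh.
have {Hh} : H \in <<[:: D0 R; Da R]>>%VS by rewrite -hg2_span.
apply: (@span_ind _ _ _ [set H | lie H u = ev be H *: u]) => [|h].
  split=> [|a b ha hb|a b hb]; rewrite /mkset.
  - by rewrite ev0 scale0r /lie mul0mx mulmx0 subrr.
  - by rewrite evD scalerDl -ha -hb /lie mulmxDl mulmxDr opprD addrACA.
  - by rewrite evZ -scalerA -hb /lie -scalemxAl -scalemxAr scalerBr.
by rewrite !inE => /orP[] /eqP ->; rewrite /mkset ?bd ?bw.
Qed.

Lemma qq_gg : (qq <= gg)%VS.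
Proof.
rewrite /parabolic !subv_add hg2_gg /=; apply/andP; split.
  by apply: sumv_seq_sub => al _; exact: capvSl.
by apply: sumv_seq_sub => al _; exact: capvSl.
Qed.
Lemma hg2_qq : (hg2 R <= qq)%VS.
Proof. by apply: subv_trans (addvSl _ _); exact: addvSl. Qed.
Lemma rootspace_pos_qq i : (i < 6)%N -> (rootspace gg (posg i) <= qq)%VS.
Proof.
move=> i6; apply: subv_trans (addvSl _ _); apply: subv_trans (addvSr _ _).
by apply: (subv_sum_seq (fun al => rootspace gg al)); rewrite mem_nth.
Qed.
Lemma rootspace_neg_qq : (rootspace gg (- alpha2 R) <= qq)%VS.
Proof. by apply: subv_trans (addvSr _ _); rewrite levi_roots_g2 big_seq1. Qed.

Lemma qq_nonneg u : u \in qq -> nonneg u.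
Proof.
have rs (ga : dual (hg2 R)) (c : int) v : ev ga (D0 R) = c%:~R -> 0 <= c ->
    v \in rootspace gg ga -> nonneg v.
  by move=> gc c0 /rootspaceP[_ uh]; apply: nonneg_wt c0; rewrite uh ?D0_hg2 // gc.
move: u; apply: (addv_ind nonneg_sub).
  apply: (addv_ind nonneg_sub).
    by move=> v /(subvP hg2_hso7); exact: hso7_nonneg.
  apply: (sumv_ind nonneg_sub) => al v /(nthP 0)[i i6 <-].
  apply: (rs _ (dgN i)); first exact: (ev_posg i6).1.
  by case: i i6 => [|[|[|[|[|[|//]]]]]].
apply: (sumv_ind nonneg_sub) => al v; rewrite levi_roots_g2 inE => /eqP ->.
by apply: (rs _ 0) => //; rewrite evNl ev_al2.1 oppr0.
Qed.

Lemma rootspace_line (be : dual (hg2 R)) (w : int) p q : ev be (D0 R) = 0 ->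
  ev be (Da R) = w%:~R -> (p < 7)%N -> (q < 7)%N -> p != barN q ->
  all (fun a => all (fun b => (degN a - degN b == 0) ==> (haN a - haN b == w) ==>
    ((a == p) && (b == q) || (a == barN q) && (b == barN p))) (iota 0 7)) (iota 0 7) ->
  B R p q \in rootspace gg be -> rootspace gg be = <[B R p q]>%VS.
Proof.
move=> bd bw p7 q7 pq /allP chk Bin; apply/eqP; rewrite eqEsubv -memvE Bin andbT.
apply/subvP => u /rootspaceP[ug uh]; apply/vlineP.
exists (u (inord p) (inord q)); apply: B_form => //; first exact: (subvP g2_so7).
move=> a b h.
have aI : (a : nat) \in iota 0 7 by rewrite mem_iota ltn_ord.
have bI : (b : nat) \in iota 0 7 by rewrite mem_iota ltn_ord.
have := allP (chk a aI) b bI; rewrite (negPf h) implybF.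
case: (eqVneq (degN a - degN b) 0) => [_|ne _] /=.
  move=> ne; apply: (@entry_weight R 0 1 (-1) u w a b) => //.
  have -> : H3 0%:~R 1%:~R (-1)%:~R = Da R by rewrite /Da rmorphN.
  by rewrite uh ?Da_hg2 // bw.
by apply: (@degNE a b 0) => //; rewrite uh ?D0_hg2 // bd.
Qed.

Lemma X2_form : (exists2 x : C, x != 0 & X (posr 2) = x *: eX) /\
  (exists2 x : C, x != 0 & Y 2 = x *: fX).
Proof. by split; [exact: (@Xpos_form 2) | exact: (@Xneg_form 2)]. Qed.

Lemma eX_gg : eX \in gg.
Proof.
have [[x x0 xE] _] := X2_form; rewrite -[eX]scale1r -(mulVf x0) -scalerA -xE.
by apply: memvZ; apply: vec_gg; rewrite g2_vecE mem_head.
Qed.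
Lemma fX_gg : fX \in gg.
Proof.
have [_ [x x0 xE]] := X2_form; rewrite -[fX]scale1r -(mulVf x0) -scalerA -xE.
by apply: memvZ; apply: vec_gg; rewrite g2_vecE; exact: (@in_nth _ _ _ 6).
Qed.
Lemma eX_wt : lie (D0 R) eX = 0 /\ lie (Da R) eX = 2 *: eX.
Proof.
have [[x x0 xE] _] := X2_form; have [h0 h1] := @Xpos_wt 2 isT.
have [e0 e1] := (eigZ x0 (etrans (congr1 (lie _) (esym xE)) (etrans h0 (congr1 _ xE))),
  eigZ x0 (etrans (congr1 (lie _) (esym xE)) (etrans h1 (congr1 _ xE)))).
by rewrite e0 e1 scale0r.
Qed.
Lemma fX_wt : lie (D0 R) fX = 0 /\ lie (Da R) fX = - 2 *: fX.
Proof.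
have [_ [x x0 xE]] := X2_form; have [h0 h1] := @Xneg_wt 2 isT.
have [e0 e1] := (eigZ x0 (etrans (congr1 (lie _) (esym xE)) (etrans h0 (congr1 _ xE))),
  eigZ x0 (etrans (congr1 (lie _) (esym xE)) (etrans h1 (congr1 _ xE)))).
by rewrite e0 e1 scale0r.
Qed.

Lemma rootspace_g2_e : rootspace gg (alpha2 R) = <[eX]>%VS.
Proof.
have [d w] := ev_al2; apply: (rootspace_line (w := 2)) => //.
have [hd hw] := eX_wt; apply: (rootspace_mem (d := 0) (w := 2)) => //; first exact: eX_gg.
by rewrite hd scale0r.
Qed.
Lemma rootspace_g2_f : rootspace gg (- alpha2 R) = <[fX]>%VS.
Proof.
have [d w] := ev_al2; have [hd hw] := fX_wt.
have d' : ev (- alpha2 R) (D0 R) = 0 by rewrite evNl d oppr0.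
have w' : ev (- alpha2 R) (Da R) = (-2)%:~R by rewrite evNl w.
apply: (rootspace_line (w := -2)) => //.
apply: (rootspace_mem (d := 0) (w := -2)) => //; first exact: fX_gg.
by rewrite hd scale0r.
Qed.

Lemma levi_g2E : levi gg (g2_pos R) [:: alpha2 R] = (hg2 R + <[eX]> + <[fX]>)%VS.
Proof. by rewrite /levi levi_roots_g2 big_seq1 rootspace_g2_e rootspace_g2_f addvA. Qed.

Lemma eX_qq : eX \in qq.
Proof. by apply: (subvP (rootspace_pos_qq (i := 1) isT)); rewrite rootspace_g2_e memv_line. Qed.
Lemma fX_qq : fX \in qq.
Proof. by apply: (subvP rootspace_neg_qq); rewrite rootspace_g2_f memv_line. Qed.

Lemma y5_gg (i : 'I_5) : y5`_i \in gg.
Proof.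
apply: vec_gg; rewrite g2_vecE y5E // y8E.
case: i => [[|[|[|[|[|//]]]]] ?].
- exact: (@in_nth _ _ _ 7).
- exact: (@in_nth _ _ _ 8).
- exact: (@in_nth _ _ _ 9).
- exact: (@in_nth _ _ _ 10).
- exact: (@in_nth _ _ _ 11).
Qed.

Lemma gg_y5 : (gg <= <<y5>> + qq)%VS.
Proof.
rewrite subv_add (subv_trans hg2_qq (addvSr _ _)) /=; apply/span_subvP => u uv.
have ug := vec_gg uv; move: uv; rewrite g2_vecE.
have pq i v : (i < 6)%N -> v \in gg -> lie (D0 R) v = (dgN i)%:~R *: v ->
    lie (Da R) v = (wgN i)%:~R *: v -> v \in (<<y5>> + qq)%VS.
  move=> i6 vg h0 h1; apply: (subvP (addvSr _ _)); apply: (subvP (rootspace_pos_qq i6)).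
  have [e0 e1] := ev_posg i6; exact: (rootspace_mem e0 e1).
have ny i v : (i < 5)%N -> v = y5`_i -> v \in (<<y5>> + qq)%VS.
  by move=> i5 ->; apply: (subvP (addvSl _ _)); apply: memv_span; rewrite mem_nth // size_tuple.
have P := Xpos_wt.
rewrite !inE => h; repeat (case/orP: h => [/eqP E | h]); [..|move/eqP: h => E]; rewrite E in ug *.
- apply: (@pq 1) => //; [exact: (@P 2 isT).1 | exact: (@P 2 isT).2].
- apply: (@pq 4) => //; apply: eigN; [exact: (@P 4 isT).1 | exact: (@P 4 isT).2].
- apply: (@pq 5) => //; apply: eigN; [exact: (@P 3 isT).1 | exact: (@P 3 isT).2].
- apply: (@pq 0) => //; apply: eigD; [exact: (@P 8 isT).1 | exact: (@P 0 isT).1 | exact: (@P 8 isT).2 | exact: (@P 0 isT).2].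
- apply: (@pq 2) => //; apply: eigD; [exact: (@P 7 isT).1 | apply: eigN; exact: (@P 1 isT).1 | exact: (@P 7 isT).2 | apply: eigN; exact: (@P 1 isT).2].
- apply: (@pq 3) => //; apply: eigD; apply: eigN; [exact: (@P 6 isT).1 | exact: (@P 5 isT).1 | exact: (@P 6 isT).2 | exact: (@P 5 isT).2].
- apply: (subvP (addvSr _ _)); have [_ [x x0 ->]] := X2_form; apply: memvZ; exact: fX_qq.
- by apply: (@ny 0); rewrite // y5E // y8E.
- by apply: (@ny 1); rewrite // y5E // y8E.
- by apply: (@ny 2); rewrite // y5E // y8E.
- by apply: (@ny 3); rewrite // y5E // y8E.
- by apply: (@ny 4); rewrite // y5E // y8E.
Qed.

Lemma y5_neg u : u \in <<y5>>%VS -> neg u.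
Proof.
move=> uy; apply: y8_neg; apply: (subvP _ _ uy); apply/span_subvP => v /tnthP[i ->].
rewrite (tnth_nth 0) y5E //; apply: memv_span; apply: mem_nth; rewrite size_tuple.
exact: ltn_trans (ltn_ord i) _.
Qed.

(** The span is the negative part of g2, and degrees add up in brackets. *)
Lemma y5_lie : is_liealg <<y5>>%VS.
Proof.
have yg : (<<y5>> <= gg)%VS.
  by apply/span_subvP => v /tnthP[i ->]; rewrite (tnth_nth 0); exact: y5_gg.
move=> u v uy vy; have := subvP gg_y5 _ (g2L (subvP yg _ uy) (subvP yg _ vy)).
move=> /memv_addP[a ay [b bq E]]; rewrite E.
suff -> : b = 0 by rewrite addr0.
apply: neg_nonneg; last exact: qq_nonneg.
have -> : b = lie u v - a by rewrite E addrC addKr.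
apply: (subspaceB neg_sub); last exact: y5_neg.
by apply: neg_lie; exact: y5_neg.
Qed.

Definition us : seq M7 :=
  flatten [seq tval (vbasis (rootspace gg al)) | al <- nil_roots (g2_pos R) [:: alpha2 R]].

Lemma nil_us : (nilradical gg (g2_pos R) [:: alpha2 R] <= <<us>>)%VS.
Proof.
apply: sumv_seq_sub => al aln; apply/subvP => u ua.
rewrite (coord_vbasis ua); apply: memv_suml => i _; apply: memvZ; apply: memv_span.
apply/flattenP; exists (tval (vbasis (rootspace gg al))); first exact: (map_f (fun al => tval (vbasis (rootspace gg al)))).
by apply: mem_nth; rewrite size_tuple.
Qed.

Lemma us_wt u : u \in us -> u \in gg /\ exists d : nat, lie (D0 R) u = d.+1%:R *: u.
Proof.
move=> /flattenP[s /mapP[al /nil_roots_g2[d dE] ->] ub].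
have /rootspaceP[ug uh] := vbasis_mem ub; split=> //; exists d.
by rewrite uh ?D0_hg2 // dE.
Qed.

Lemma qq_span : (qq <= <<[:: D0 R; Da R; eX; fX]>> + nilradical gg (g2_pos R) [:: alpha2 R])%VS.
Proof.
set W := (_ + _)%VS.
have inW u : u \in [:: D0 R; Da R; eX; fX] -> u \in W.
  by move=> h; apply: (subvP (addvSl _ _)); exact: memv_span.
have hW : (hg2 R <= W)%VS.
  rewrite hg2_span; apply: span_pair_sub; apply: inW; first exact: (@in_nth _ _ _ 0).
  exact: (@in_nth _ _ _ 1).
have fW : fX \in W by apply: inW; exact: (@in_nth _ _ _ 3).
rewrite /parabolic !subv_add hW levi_roots_g2 big_seq1 rootspace_g2_f -memvE fW andbT /=.
apply: sumv_seq_sub => al alp; case: (boolP (`[< in_nat_span [:: alpha2 R] al >])) => ha.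
  have : al \in levi_roots (g2_pos R) [:: alpha2 R] by rewrite mem_filter ha.
  rewrite levi_roots_g2 inE => /eqP ->; rewrite rootspace_g2_e -memvE.
  by apply: inW; exact: (@in_nth _ _ _ 2).
apply: subv_trans (addvSr _ _); apply: (subv_sum_seq (fun al => rootspace gg al)).
by rewrite mem_filter ha.
Qed.

Lemma levi_span : (levi gg (g2_pos R) [:: alpha2 R] <= <<[:: D0 R; Da R; eX; fX]>>)%VS.
Proof.
have inW k : (k < 4)%N -> nth 0 [:: D0 R; Da R; eX; fX] k \in <<[:: D0 R; Da R; eX; fX]>>%VS.
  by move=> k4; apply: memv_span; exact: mem_nth.
rewrite levi_g2E !subv_add -!memvE (inW 2%N isT) (inW 3%N isT) !andbT hg2_span.
by apply: span_pair_sub; [exact: (inW 0%N isT) | exact: (inW 1%N isT)].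
Qed.

End Grading.

(** * Counting *)
Section Counting.
Local Open Scope nat_scope.

(** The monomials of degree c in the root vectors of -eps 3, -eps 2 and -eps 1, which
    raise the degree by 1, 1, 2: their exponents (a, b, j) satisfy a + b + 2 j = c and
    are recorded as (j, a). *)
Definition expos (c : nat) : seq (nat * nat) :=
  [seq (j, a) | j <- iota 0 (c./2).+1, a <- iota 0 (c - j.*2).+1].
Definition expo_wt (c : nat) (t : nat * nat) : int :=
  (t.2%:Z - (c - t.1.*2 - t.2)%:Z)%R.
Definition expo_num (c : nat) (z : int) : nat :=
  if (absz z <= c) && ~~ odd (c - absz z) then (c - absz z)./2.+1 else 0.

Lemma count_layer m (z : int) :
  count (fun a => (a%:Z - (m - a)%:Z == z)%R) (iota 0 m.+1) =
  ((absz z <= m) && ~~ odd (m - absz z)).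
Proof.
have one a0 (P : pred nat) : (forall a, a <= m -> P a = (a == a0)) -> a0 <= m ->
    count P (iota 0 m.+1) = 1.
  move=> h am; rewrite (@eq_in_count _ P (pred1 a0)) => [|a].
    by rewrite count_uniq_mem ?iota_uniq // mem_iota ltnS am.
  by rewrite mem_iota ltnS => /h ->.
have zero (P : pred nat) : (forall a, a <= m -> P a = false) -> count P (iota 0 m.+1) = 0.
  move=> h; rewrite (@eq_in_count _ P pred0) ?count_pred0 // => a.
  by rewrite mem_iota ltnS => /h ->.
case: (boolP (_ && _)) => [/andP[zm ev]|nev].
  apply: (one (if (0 <= z)%R then (m + absz z)./2 else (m - absz z)./2)); last by case: ifP; lia.
  by move=> a am; case: ifP; lia.
by apply: zero => a am; lia.
Qed.

Lemma sumn_ltn M N : sumn [seq (j < M : nat) | j <- iota 0 N] = minn M N.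
Proof.
elim: N => [|N IH]; first by rewrite minn0.
by rewrite -addn1 iotaD map_cat sumn_cat IH /=; lia.
Qed.

Lemma expos_count c z : count (fun t => expo_wt c t == z) (expos c) = expo_num c z.
Proof.
rewrite /expos count_flatten -map_comp.
rewrite (@eq_map _ _ _ (fun j => ((absz z <= c - j.*2) && ~~ odd (c - j.*2 - absz z) : nat))); last first.
  by move=> j; rewrite -count_layer; apply: etrans (count_map _ _ _) _; apply: eq_count.
rewrite /expo_num; case: ifP => [/andP[zc ev]|nev].
  have -> : ((c - absz z)./2).+1 = minn (c - absz z)./2.+1 (c./2).+1 by lia.
  rewrite -sumn_ltn; congr sumn; apply/eq_in_map => j; rewrite mem_iota => jc.
  by congr nat_of_bool; lia.
have -> : [seq ((absz z <= c - j.*2) && ~~ odd (c - j.*2 - absz z) : nat) | j <- iota 0 (c./2).+1] =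
    [seq 0 | j <- iota 0 (c./2).+1].
  by apply/eq_in_map => j; rewrite mem_iota => jc; apply/eqP; rewrite eqb0; lia.
by elim: (iota _ _).
Qed.

(** Along the n + 1 vectors of a string, the terms for the weights k and k + 2 agree
    up to a shift by one place, so that only the two extreme terms remain. *)
Lemma strings_expos (n c : nat) (k : int) :
  let D z := count (fun st => (n%:Z - 2 * (st.1)%:Z + expo_wt c st.2 == z)%R)
               [seq (s, t) | s <- iota 0 n.+1, t <- expos c] in
  D k + expo_num c (k + n%:Z + 2)%R = D (k + 2)%R + expo_num c (k - n%:Z)%R.
Proof.
pose E s := expo_num c (k - n%:Z + 2 * s%:Z)%R.
have DE (z : int) (i : nat) : z = (k + 2 * i%:Z)%R ->
    count (fun st => (n%:Z - 2 * (st.1)%:Z + expo_wt c st.2 == z)%R)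
               [seq (s, t) | s <- iota 0 n.+1, t <- expos c] = \sum_(s < n.+1) E (i + s).
  move=> zE; rewrite count_flatten -map_comp sumnE big_map -[iota 0 n.+1]/(index_iota 0 n.+1) big_mkord.
  apply: eq_bigr => s _; apply: etrans (count_map _ _ _) _; rewrite /E -expos_count; apply: eq_count => t /=.
  by rewrite zE; lia.
move=> D; rewrite /D (DE k 0) ?(DE (k + 2)%R 1) //; try by lia.
have -> : expo_num c (k + n%:Z + 2)%R = E n.+1 by rewrite /E; congr expo_num; lia.
have -> : expo_num c (k - n%:Z)%R = E 0 by rewrite /E; congr expo_num; lia.
rewrite addnC [RHS]addnC big_ord_recl [in RHS]big_ord_recr /= add1n.
have -> : \sum_(i < n) E (0 + bump 0 i) = \sum_(i < n) E (1 + i) by apply: eq_bigr.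
by rewrite add0n addnCA [X in _ + X]addnC.
Qed.

(** Here m is the number of strings of highest weight k in degree c; the natural
    numbers u and b are going to be the values of mu on the coroots of
    3 alpha1 + alpha2 and 3 alpha1 + 2 alpha2. *)
Lemma expo_num_diff (n c k m : nat) :
  m + expo_num c (k%:Z + n%:Z + 2)%R = expo_num c (k%:Z - n%:Z)%R ->
  forall u b, c = u + b -> k + b = n + u ->
    m.*2 + (maxn n k - minn n k) = 2 + minn c (n + k).
Proof. by move=> h u b cE kE; move: h; rewrite /expo_num; do 2 case: ifP; lia. Qed.

Lemma expo_num_zero (n c k m : nat) :
  m + expo_num c (k%:Z + n%:Z + 2)%R = expo_num c (k%:Z - n%:Z)%R -> 0 < m ->
  exists u b, c = u + b /\ k + b = n + u.
Proof.
rewrite {2}/expo_num; case: ifP => [/andP[h1 h2] _ _|_]; last by lia.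
exists ((c + k - n)./2), ((c + n - k)./2); lia.
Qed.

Definition expo_list (c : nat) (t : nat * nat) : seq nat :=
  nseq t.2 5 ++ nseq (c - t.1.*2 - t.2) 6 ++ nseq t.1 7.

Lemma expos_mem c t : (t \in expos c) = (t.1.*2 + t.2 <= c).
Proof.
apply/allpairsPdep/idP => [[j [a []]]|h].
  by rewrite !mem_iota => jc ac -> /=; lia.
case: t h => j a h; have {}h : j.*2 + a <= c := h; exists j, a; split.
- by rewrite mem_iota; lia.
- by rewrite mem_iota; lia.
- by [].
Qed.

Lemma expos_uniq c : uniq (expos c).
Proof.
apply: allpairs_uniq_dep; first exact: iota_uniq.
  by move=> j _; exact: iota_uniq.
by move=> [j a] [j' a'] _ _ /= [-> ->].
Qed.

Lemma expo_listP c t : t \in expos c ->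
  [/\ good 8 (expo_list c t), all (leq 5) (expo_list c t),
      count_mem 5 (expo_list c t) = t.2 & count_mem 7 (expo_list c t) = t.1].
Proof.
move=> tc; split.
- apply/andP; split; last by rewrite !all_cat !all_nseq /= !orbT.
  have sn (i k : nat) : sorted leq (nseq k i) by elim: k => [|[|k]] //= ->; rewrite leqnn.
  rewrite !sorted_pairwise; try exact: leq_trans.
  rewrite !pairwise_cat -!sorted_pairwise ?sn ?andbT /=; try exact: leq_trans.
  by apply/andP; split; apply/allrelP => x y; rewrite ?mem_cat !mem_nseq => /andP[_ /eqP ->];
    [move=> /orP[]|]; move=> /andP[_ /eqP ->].
- by rewrite !all_cat !all_nseq /= !orbT.
- by rewrite !count_cat !count_nseq /=; lia.
- by rewrite !count_cat !count_nseq /=; lia.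
Qed.

Lemma sorted_expo M : good 8 M -> all (leq 5) M -> exists c t, t \in expos c /\ M = expo_list c t.
Proof.
move=> /andP[sM aM] bM.
exists (count_mem 5 M + count_mem 6 M + (count_mem 7 M).*2), (count_mem 7 M, count_mem 5 M).
have tc : (count_mem 7 M, count_mem 5 M) \in expos (count_mem 5 M + count_mem 6 M + (count_mem 7 M).*2).
  by rewrite expos_mem /=; lia.
split=> //; apply: (sorted_eq leq_trans anti_leq) => //.
  by have [/andP[]] := expo_listP tc.
apply/allP => x _; apply/eqP; rewrite !count_cat !count_nseq /=.
case: (boolP (x \in M)) => [xM|xM].
  have := allP aM x xM; have := allP bM x xM.
  case: x xM => [|[|[|[|[|[|[|[|//]]]]]]]] // _ _ _; lia.
have -> : count_mem x M = 0 by apply/count_memPn.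
case: eqVneq => [E|_]; first by move: xM; rewrite -E => /count_memPn ->.
case: eqVneq => [E|_]; first by move: xM; rewrite -E => /count_memPn h6; rewrite h6; lia.
case: eqVneq => [E|_]; last by lia.
by move: xM; rewrite -E => /count_memPn h7; rewrite h7; lia.
Qed.

Lemma sorted_split (d : nat) M : sorted leq M ->
  M = [seq i <- M | i < d] ++ [seq i <- M | d <= i].
Proof.
elim: M => //= i M IH pM; have sM := path_sorted pM.
case: (ltnP i d) => id /=; first by rewrite -IH.
have -> : [seq i <- M | i < d] = [::].
  apply/eqP; rewrite -[_ == _]negbK -has_filter -all_predC; apply/allP => x xM /=.
  rewrite -leqNgt; apply: leq_trans id _.
  by have := order_path_min leq_trans pM => /allP/(_ x xM).
rewrite /= -[in LHS](_ : [seq i <- M | d <= i] = M) //; apply/all_filterP/allP => x xM.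
apply: leq_trans id _; by have := order_path_min leq_trans pM => /allP/(_ x xM).
Qed.

End Counting.

(** * Highest weight modules of a parabolic with Levi factor of type A1 *)
Lemma simple_hw_hw_module (K : numFieldType) (n : nat) (g h : {vspace 'M[K]_n})
    (Phip Pi : seq (dual h)) (H0 Ha e f : 'M[K]_n) (al : dual h) (l0 : K) (c k : nat)
    (lam : dual h) (F : vectType K) (aF : 'M[K]_n -> F -> F) :
  let p := parabolic g Phip Pi in
  (h <= p)%VS -> e \in p -> f \in p -> H0 \in h -> Ha \in h ->
  levi g Phip Pi = (h + <[e]> + <[f]>)%VS ->
  lie e f = Ha -> lie Ha e = 2 *: e -> lie Ha f = - 2 *: f -> lie H0 f = 0 ->
  (forall x, x \in h -> exists a, lie x f = a *: f) ->
  al \in levi_roots Phip Pi -> e \in rootspace g al ->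
  ev lam Ha = k%:R -> ev lam H0 = l0 - c%:R ->
  simple_hw_module g Phip Pi lam aF ->
  exists g0, hw_module p (nilradical g Phip Pi) H0 Ha e f l0 c k aF g0.
Proof.
move=> p hp ep fp H0h Hah lvE ef Hae Haf H0f hf all eal lk lc [rF nF sF [v0 [v00 wt0 ev0]]].
have e0 : aF e v0 = 0 by exact: ev0 all eal.
have [bas fin] := hw_basis hp ep fp Hah lvE ef Hae Haf hf rF sF v00 wt0 e0 lk.
have Hp := subvP hp _ H0h; exists v0; split=> //.
  by split=> //; rewrite wt0 // lk.
move=> v; have vS : v \in <<[seq iter s (aF f) v0 | s <- iota 0 k.+1]>>%VS.
  by rewrite (span_basis bas) memvf.
apply: (@span_ind _ _ _ [set v | aF H0 v = (l0 - c%:R) *: v] _ _ _ vS).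
  split=> [|a b ha hb|a b hb]; rewrite /mkset.
  - by rewrite (act0 rF) // scaler0.
  - by rewrite (actD rF) // ha hb scalerDr.
  - by rewrite (actZ rF) // hb !scalerA mulrC.
move=> u /mapP[s _ ->]; elim: s => [|s IH]; first by rewrite /mkset /= wt0 // lc.
by rewrite /mkset iterS (act_swap rF) // IH H0f (act0l rF) addr0 (actZ rF).
Qed.

(** * Free generators over the smaller algebra *)
Section Generators.
Context (K : numFieldType) (n : nat) (g : {vspace 'M[K]_n}).
Context (y : 8.-tuple 'M[K]_n) (y' : 5.-tuple 'M[K]_n).
Hypotheses (yg : forall i : 'I_8, y`_i \in g) (y'E : forall i, (i < 5)%N -> y'`_i = y`_i).
Context (V : lmodType K) (act : 'M[K]_n -> V -> V) (r : is_rep g act).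
Context (F : vectType K) (tl : F -> V).
Hypothesis tl_lin : forall a u v, tl (a *: u + v) = a *: tl u + tl v.
Hypothesis tspan : forall v, ysorted y act (range tl) v.
Hypothesis tfree : forall s (f : seq nat -> F), uniq s -> all (good 8) s ->
  \sum_(M <- s) ymon y act M (tl (f M)) = 0 -> forall M, M \in s -> f M = 0.
Context (N : nat) (fs : nat -> F).
Hypothesis fbasis : basis_of {:F} [seq fs s | s <- iota 0 N.+1].
Local Notation ym := (ymon y act).

(** The generators of degree c over the smaller algebra, with their Ha-weights:
    monomials in the last three vectors applied to a weight basis of F. *)
Definition gens (c : nat) : seq (V * int) :=
  [seq (ym (expo_list c st.2) (tl (fs st.1)), N%:Z - 2 * (st.1)%:Z + expo_wt c st.2)
    | st <- [seq (s, t) | s <- iota 0 N.+1, t <- expos c]].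

Lemma tl0 : tl 0 = 0.
Proof. by have := tl_lin (-1) 0 0; rewrite scaler0 addr0 scaleN1r addNr. Qed.
Lemma tlD u v : tl (u + v) = tl u + tl v.
Proof. by have := tl_lin 1 u v; rewrite !scale1r. Qed.
Lemma tlZ a u : tl (a *: u) = a *: tl u.
Proof. by have := tl_lin a u 0; rewrite tl0 !addr0. Qed.

Lemma ymZ M a u : good 8 M -> ym M (a *: u) = a *: ym M u.
Proof. by move=> gM; have := ymon_lin yg r a u 0 gM; rewrite (ymon0 yg r gM) !addr0. Qed.
Lemma ymD M u v : good 8 M -> ym M (u + v) = ym M u + ym M v.
Proof. by move=> gM; have := ymon_lin yg r 1 u v gM; rewrite !scale1r. Qed.
Lemma ym_sum M (I : Type) (s : seq I) (h : I -> V) : good 8 M ->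
  ym M (\sum_(i <- s) h i) = \sum_(i <- s) ym M (h i).
Proof.
by move=> gM; apply: (big_morph (ym M)) => [u v|]; [exact: ymD | exact: (ymon0 yg r gM)].
Qed.

Lemma gens_free c (a : nat -> K) :
  \sum_(i < size (gens c)) a i *: (nth (0, 0) (gens c) i).1 = 0 ->
  forall i, (i < size (gens c))%N -> a i = 0.
Proof.
pose I := [seq (s, t) | s <- iota 0 N.+1, t <- expos c].
have uI : uniq I.
  apply: allpairs_uniq; [exact: iota_uniq | exact: expos_uniq | by move=> [? ?] [? ?] _ _ [-> ->]].
have sI : size (gens c) = size I by rewrite size_map.
rewrite sI => Z.
pose b st := a (index st I).
pose dec (M : seq nat) : nat * nat := (count_mem 7%N M, count_mem 5%N M).
have decK t : t \in expos c -> dec (expo_list c t) = t.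
  by move=> /expo_listP[_ _ h5 h7]; rewrite /dec h5 h7; case: t {h5 h7}.
pose fM M := \sum_(s <- iota 0 N.+1) b (s, dec M) *: fs s.
have {}Z : \sum_(M <- [seq expo_list c t | t <- expos c]) ym M (tl (fM M)) = 0.
  rewrite -[RHS]Z big_map.
  have -> : \sum_(i < size I) a i *: (nth (0, 0) (gens c) i).1 =
      \sum_(st <- I) b st *: ym (expo_list c st.2) (tl (fs st.1)).
    rewrite (big_nth (0%N, (0%N, 0%N))) big_mkord; apply: eq_bigr => i _.
    by rewrite (nth_map (0%N, (0%N, 0%N))) // /b index_uniq.
  rewrite /I [RHS]big_allpairs_dep [RHS]exchange_big; apply: eq_big_seq => t tc /=.
  have [gM _ _ _] := expo_listP tc.
  have -> : tl (fM (expo_list c t)) = \sum_(s <- iota 0 N.+1) b (s, t) *: tl (fs s).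
    rewrite /fM decK // (big_morph tl tlD tl0); apply: eq_bigr => s _; exact: tlZ.
  by rewrite ym_sum //; apply: eq_bigr => s _; exact: ymZ.
have gs : all (good 8) [seq expo_list c t | t <- expos c].
  by apply/allP => M /mapP[t tc ->]; have [] := expo_listP tc.
have us : uniq [seq expo_list c t | t <- expos c].
  by rewrite map_inj_in_uniq ?expos_uniq // => t t' tc tc' E; rewrite -(decK _ tc) E decK.
have fM0 := tfree us gs Z.
move=> i iI; set st := nth (0%N, (0%N, 0%N)) I i.
have stI : st \in I by exact: mem_nth.
have -> : a i = b st by rewrite /b index_uniq.
have /allpairsP[[s t] [sN tc E]] := stI; have {}E : st = (s, t) := E; rewrite E.
have {}tc : t \in expos c := tc.
have sN' : (s < N.+1)%N by have : s \in iota 0 N.+1 := sN; rewrite mem_iota.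
have := fM0 _ (map_f _ tc); rewrite /fM decK // => S0.
have /freeP fr : free [tuple of [seq fs s | s <- iota 0 N.+1]] := basis_free fbasis.
apply: (fr (fun j => b (nat_of_ord j, t)) _ (Ordinal sN')); rewrite -[RHS]S0.
rewrite -[iota 0 N.+1]/(index_iota 0 N.+1) big_mkord; apply: eq_bigr => j _; congr (_ *: _).
by rewrite (nth_map 0%N) ?size_iota // nth_iota.
Qed.

Definition upper : set V :=
  lspan [set v | exists M x, [/\ good 8 M, all (leq 5) M & v = ym M (tl x)]].

Lemma gens_upper : gen_all gens = upper.
Proof.
apply/seteqP; split.
  apply: lspanS => _ [c [p [/mapP[st /allpairsP[[s t] /= [_ tc ->]] ->] ->]]] /=.
  by have [gM bM _ _] := expo_listP tc; exists (expo_list c t), (fs s).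
have sG : subspace (gen_all gens) by exact: lspan_subspace.
apply: lspan_sub => // _ [M [x [gM bM ->]]].
have xS : x \in <<[seq fs s | s <- iota 0 N.+1]>>%VS by rewrite (span_basis fbasis) memvf.
apply: (@span_ind _ _ _ [set x | gen_all gens (ym M (tl x))] _ _ _ xS).
  split=> [|u v hu hv|a u hu]; rewrite /mkset.
  - by rewrite tl0 (ymon0 yg r gM); exact: subspace0.
  - by rewrite tlD ymD //; exact: (subspaceD sG).
  - by rewrite tlZ ymZ //; exact: (subspaceZ _ sG).
move=> _ /mapP[s sN ->]; have [c [t [tc ->]]] := sorted_expo gM bM.
apply: sub_lspan; exists c, (ym (expo_list c t) (tl (fs s)), N%:Z - 2 * s%:Z + expo_wt c t); split=> //.
apply/mapP; exists (s, t) => //; apply/allpairsP; by exists (s, t).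
Qed.

Lemma ym_low b v : all (ltn^~ 5%N) b -> ymon y' act b v = ym b v.
Proof. by elim: b => //= i b IH /andP[i5 /IH ->]; rewrite y'E. Qed.

Lemma ym_cat b M v : ym (b ++ M) v = ym b (ym M v).
Proof. by rewrite /ymon foldr_cat. Qed.

(** In a sorted monomial the vectors of the smaller algebra come first. *)
Lemma gens_span v : ysorted y' act (gen_all gens) v.
Proof.
rewrite gens_upper; have := tspan v.
apply: lspan_sub; first exact: lspan_subspace.
move=> _ [M [_ [gM [x _ <-] ->]]]; have /andP[sM aM] := gM.
rewrite {1}(sorted_split 5 sM) ym_cat; apply: sub_lspan.
have b5 : all (ltn^~ 5%N) [seq i <- M | (i < 5)%N] by exact: filter_all.
exists [seq i <- M | (i < 5)%N], (ym [seq i <- M | (5 <= i)%N] (tl x)); split.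
- by apply/andP; split=> //; exact: sorted_filter leq_trans _ _ sM.
- apply: sub_lspan; exists [seq i <- M | (5 <= i)%N], x; split=> //; last exact: filter_all.
  apply/andP; split; first exact: sorted_filter leq_trans _ _ sM.
  by apply/allP => i; rewrite mem_filter => /andP[_ iM]; exact: (allP aM i iM).
- by rewrite ym_low.
Qed.

Let y3 : 3.-tuple 'M[K]_n := [tuple y`_5; y`_6; y`_7].

Lemma ym_shift M v : all (ltn^~ 3%N) M -> ymon y3 act M v = ym (map (addn 5) M) v.
Proof. by elim: M => //= i M IH /andP[i3 /IH ->]; case: i i3 => [|[|[|]]]. Qed.

Lemma good_shift M : good 3 M -> good 8 (map (addn 5) M).
Proof.
move=> /andP[sM aM]; apply/andP; split.
  by rewrite sorted_map; apply: sub_sorted sM => i j; rewrite /= leq_add2l.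
by rewrite all_map; apply: sub_all aM => i /=; rewrite -(ltn_add2l 5).
Qed.

Lemma upper_sum v : upper v -> exists s (f : seq nat -> F), [/\ uniq s, all (good 3) s &
  v = \sum_(M <- s) ym (map (addn 5) M) (tl (f M))].
Proof.
move=> uv; have sP : subspace (range tl).
  split=> [|_ _ [a _ <-] [b _ <-]|a _ [b _ <-]].
  - by exists 0 => //; exact: tl0.
  - by exists (a + b) => //; exact: tlD.
  - by exists (a *: b) => //; exact: tlZ.
have y3g (i : 'I_3) : y3`_i \in g.
  by case: i => [[|[|[|//]]] ?]; rewrite /=; [exact: (yg (@Ordinal 8 5 isT))
    |exact: (yg (@Ordinal 8 6 isT))|exact: (yg (@Ordinal 8 7 isT))].
have {uv} : ysorted y3 act (range tl) v.
  move: uv; apply: lspan_sub; first exact: lspan_subspace.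
  move=> _ [M [x [/andP[sM aM] bM ->]]]; apply: sub_lspan.
  have ME : M = map (addn 5) (map (subn^~ 5%N) M).
    rewrite -map_comp -[LHS]map_id; apply/eq_in_map => i iM /=.
    by rewrite subnKC //; exact: (allP bM i iM).
  have aM' : all (ltn^~ 3%N) (map (subn^~ 5%N) M).
    rewrite all_map; apply/allP => i iM /=; rewrite ltn_subLR; last exact: (allP bM i iM).
    exact: (allP aM i iM).
  exists (map (subn^~ 5%N) M), (tl x); split; last by rewrite ym_shift // -ME.
  - apply/andP; split=> //; rewrite sorted_map.
    by apply: sub_sorted sM => i j ij; rewrite /= leq_sub2r.
  - by exists x.
move=> /(ysortedP y3g r sP)[s [f [us gs Pf ->]]].
have fP M : exists x, f M = tl x by have [x _ <-] := Pf M; exists x.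
have [f' fE] := choice fP; exists s, f'; split=> //.
apply: eq_big_seq => M Ms; rewrite fE ym_shift //.
by have /andP[] := allP gs M Ms.
Qed.

(** A sorted monomial in the first five vectors followed by one in the last
    three is a sorted monomial in all eight, from which both can be recovered. *)
Lemma gens_indep s (h : seq nat -> V) : uniq s -> all (good 5) s ->
  (forall b, gen_all gens (h b)) -> \sum_(b <- s) ymon y' act b (h b) = 0 ->
  forall b, b \in s -> h b = 0.
Proof.
move=> us gs; rewrite gens_upper => hU Z.
have hP b : exists st : seq (seq nat) * (seq nat -> F), [/\ uniq st.1, all (good 3) st.1 &
    h b = \sum_(M <- st.1) ym (map (addn 5) M) (tl (st.2 M))].
  by have [t [f [ut gt E]]] := upper_sum (hU b); exists (t, f).
have [st stE] := choice hP.
have low b M : good 5 b -> [seq i <- b ++ map (addn 5) M | (i < 5)%N] = b /\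
    [seq i <- b ++ map (addn 5) M | (5 <= i)%N] = map (addn 5) M.
  move=> /andP[_ ab]; rewrite !filter_cat; split.
    have -> : [seq i <- map (addn 5) M | (i < 5)%N] = [::].
      by rewrite filter_map -[RHS]/(map (addn 5) [::]); congr map; elim: M.
    by rewrite cats0; apply/all_filterP.
  have -> : [seq i <- b | (5 <= i)%N] = [::].
    by elim: (b) ab => //= i b' IH /andP[i5 /IH ->]; rewrite leqNgt i5.
  by apply/all_filterP; rewrite all_map; apply/allP => i _ /=; rewrite leq_addr.
pose dec1 (L : seq nat) := [seq i <- L | (i < 5)%N].
pose dec2 (L : seq nat) := map (subn^~ 5%N) [seq i <- L | (5 <= i)%N].
have dec12 b M : good 5 b -> dec1 (b ++ map (addn 5) M) = b /\ dec2 (b ++ map (addn 5) M) = M.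
  move=> gb; have [e1 e2] := low b M gb; split=> //; rewrite /dec2 e2 -map_comp.
  by rewrite -[RHS]map_id; apply: eq_map => i /=; rewrite addKn.
pose S := [seq b ++ map (addn 5) M | b <- s, M <- (st b).1].
pose f L := (st (dec1 L)).2 (dec2 L).
have uS : uniq S.
  apply: allpairs_uniq_dep => // [b bs|[b M] [b' M']].
    by have [] := stE b.
  move=> /allpairsPdep[b1 [M1 [b1s _ [E1 E2]]]] /allpairsPdep[b2 [M2 [b2s _ [E3 E4]]]] /= E.
  have gb : good 5 b by rewrite E1; exact: (allP gs).
  have gb' : good 5 b' by rewrite E3; exact: (allP gs).
  have [d1 d2] := dec12 b M gb; have [d3 d4] := dec12 b' M' gb'.
  have eb : b = b' := etrans (esym d1) (etrans (congr1 dec1 E) d3).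
  have eM : M = M' := etrans (esym d2) (etrans (congr1 dec2 E) d4).
  by rewrite eb eM.
have gS : all (good 8) S.
  apply/allP => L /allpairsPdep[b [M [bs Mb ->]]].
  have /andP[sb ab] := allP gs b bs; have [_ gM _] := stE b.
  have /andP[sM aM] := good_shift (allP gM M Mb).
  apply/andP; split; last first.
    by rewrite all_cat aM andbT; apply: sub_all ab => i i5; exact: ltn_trans i5 _.
  rewrite sorted_pairwise; last exact: leq_trans.
  rewrite pairwise_cat -!sorted_pairwise ?sb ?sM ?andbT; try exact: leq_trans.
  apply/allrelP => i j ib /mapP[j' _ ->]; apply: leq_trans (leq_addr _ _).
  by apply: ltnW; exact: (allP ab).
have ZS : \sum_(L <- S) ym L (tl (f L)) = 0.
  rewrite -[RHS]Z big_allpairs_dep; apply: eq_big_seq => b bs.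
  have gb := allP gs b bs; have /andP[sb ab] := gb.
  have gb8 : good 8 b.
    by apply/andP; split=> //; apply: sub_all ab => i i5; exact: ltn_trans i5 _.
  have [_ _ hE] := stE b; rewrite ym_low // hE ym_sum //; apply: eq_bigr => M _.
  by have [d1 d2] := dec12 b M gb; rewrite ym_cat /f d1 d2.
have f0 := tfree uS gS ZS.
move=> b bs; have [_ gM ->] := stE b; apply: big1_seq => M /= Mb.
have gb := allP gs b bs; have [d1 d2] := dec12 b M gb.
have := f0 (b ++ map (addn 5) M); rewrite /f d1 d2 => -> //.
  by rewrite tl0; apply: (ymon0 yg r); exact: good_shift (allP gM M Mb).
by apply/allpairsPdep; exists b, M.
Qed.

End Generators.

(** * Sums over a countable index set *)
(** A finite subset of S is contained in one of the lists, and the terms are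
    nonnegative. *)
Lemma esum_lists (R : realType) (T : choiceType) (S : set T) (a : T -> \bar R)
    (L : nat -> seq T) :
  (forall N, uniq (L N)) -> (forall N x, x \in L N -> S x) ->
  (forall N N', (N <= N')%N -> {subset L N <= L N'}) ->
  (forall x, S x -> (0 <= a x)%E /\ exists N, x \in L N) ->
  (\esum_(x in S) a x = ereal_sup [set \sum_(x <- L N) a x | N in [set: nat]])%E.
Proof.
move=> uL LS Lmono SL; have finL N : finite_set [set` L N] by exact: finite_seq.
apply/eqP; rewrite eq_le; apply/andP; split; last first.
  apply: ge_ereal_sup => _ [N _ <-]; apply: esum_ge.
  exists [set` L N]; first by split=> //; exact: LS.
  by rewrite fsbig_seq.
apply: ge_ereal_sup => _ [A [/finite_seqP[t ->] tS] <-].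
have [N tN] : exists N, {subset t <= L N}.
  elim: t tS => [|x t IH] tS; first by exists 0%N.
  have [N tN] : exists N, {subset t <= L N}.
    by apply: IH => z zt; apply: tS; rewrite /= inE (_ : z \in t) ?orbT.
  have [_ [N' xN']] := SL x (tS x (mem_head x t)).
  exists (maxn N N') => z; rewrite inE => /orP[/eqP ->|/tN].
    exact: Lmono (leq_maxr _ _) _ xN'.
  exact: Lmono (leq_maxl _ _) _.
apply: (@le_trans _ _ (\sum_(x <- L N) a x)%E); last first.
  by apply: ereal_sup_ubound; exists N.
rewrite [X in (_ <= X)%E]fsbig_seq //; apply: lee_fsum_nneg_subset => //.
  by move=> x; rewrite !inE /=; exact: tN.
by move=> x; rewrite inE => /andP[_ /set_mem xN]; exact: (SL x (LS N x xN)).1.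
Qed.

Lemma sum_undup (R : realType) (T : eqType) (s : seq T) (h : T -> \bar R) :
  (\sum_(k <- s) h k = \sum_(k <- undup s) (count_mem k s)%:R%:E * h k)%E.
Proof.
rewrite -big_undup_iterop_count; apply: eq_bigr => k _; exact: esym (mule_natl _ _).
Qed.

Lemma ydeg_expo c t : t \in expos c -> ydeg dyN (expo_list c t) = c.
Proof.
rewrite expos_mem /ydeg /expo_list !map_cat !map_nseq !sumn_cat !sumn_nseq.
by case: t => j a; rewrite /dyN /=; lia.
Qed.

Lemma wt_expo c t : \sum_(i <- expo_list c t) wyN i = expo_wt c t.
Proof.
rewrite /expo_list !big_cat /= !big_nseq !iter_addr_0 /= /expo_wt.
by rewrite /wyN /= mul0rn addr0 mulNrn !natz.
Qed.

Lemma halves (K : numFieldType) (P Q : K) :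
  2^-1 * (P - Q) + 2^-1 * (P + Q) = P /\ 2^-1 * (P + Q) - 2^-1 * (P - Q) = Q.
Proof. by split; field. Qed.
Lemma half_sums (K : numFieldType) (u b : K) :
  2^-1 * (u + b - (b - u)) = u /\ 2^-1 * (u + b + (b - u)) = b.
Proof. by split; field. Qed.

(** * The branching rule *)
Section Main.
Context (R : realType).
Local Notation C := R[i].
Context (X : dual (hso7 R) -> 'M[C]_7) (X_root : root_vectors X) (g2_lie : is_liealg (g2 X)).
Context (lam : dual (hso7 R)) (N : nat) (lamN : ev lam (Hs R 2 - Hs R 3) = N%:R).
Context (F : vectType C) (aF : 'M[C]_7 -> F -> F).
Hypothesis F_lam : simple_hw_module (so7 R) (so7_pos R) [:: eps R 2 - eps R 3] lam aF.
Local Notation p := (parabolic (so7 R) (so7_pos R) [:: eps R 2 - eps R 3]).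
Local Notation gg := (g2 X).
Local Notation qq := (parabolic gg (g2_pos R) [:: alpha2 R]).
Local Notation nl := (nilradical gg (g2_pos R) [:: alpha2 R]).
Local Notation V := (gverma (so7 R) (so7_pos R) [:: eps R 2 - eps R 3] aF).
Local Notation M := (gverma_act (so7 R) (so7_pos R) [:: eps R 2 - eps R 3] aF).
Local Notation l0 := (ev lam (D0 R)).
Local Notation e := (eX R).
Local Notation f := (fX R).

Lemma lam_Da : ev lam (Da R) = N%:R.
Proof. by rewrite -Ha2E. Qed.

Lemma root_line_comm x : x \in hso7 R -> exists a, lie x f = a *: f.
Proof.
move=> xh; have /rootspaceP[_ h] : f \in rootspace (so7 R) (- posr R 2).
  by rewrite (rootspace_f X_root) memv_line.
by exists (ev (- posr R 2) x); exact: h.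
Qed.

Lemma F_hw : exists v0, hw_module p (nilradical (so7 R) (so7_pos R) [:: eps R 2 - eps R 3])
  (D0 R) (Da R) e f l0 0 N aF v0.
Proof.
have [e0 ea] := eX_wt X_root; have [f0 fa] := fX_wt X_root.
apply: (simple_hw_hw_module (al := posr R 2) _ _ _ _ _ _ _ _ _ _ _ _ _ _ _ F_lam) => //.
- exact: so7_hp.
- exact: eX_p X_root.
- exact: fX_p X_root.
- exact: H3_in.
- exact: H3_in.
- exact: levi_so7E X_root.
- exact: lie_ef.
- exact: root_line_comm.
- by rewrite (levi_roots_so7 R) mem_head.
- by rewrite (rootspace_e X_root) memv_line.
- exact: lam_Da.
- by rewrite subr0.
Qed.

Lemma V_rep : is_rep (so7 R) M. Proof. exact: induced_rep. Qed.
Lemma V_rep2 : is_rep gg M. Proof. exact: (sub_rep V_rep (g2_so7 X_root)). Qed.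

Local Notation tl := (tens (g := so7 R) p aF 1).

Lemma tl_lin a u v : tl (a *: u + v) = a *: tl u + tl v.
Proof. exact: tens1_linear. Qed.

Lemma V_act x v : x \in p -> M x (tl v) = tl (aF x v).
Proof. exact: tens1_act. Qed.

Lemma V_span v : ysorted (y8 X) M (range tl) v.
Proof.
have pg : (p <= so7 R)%VS by exact: parabolic_so7_sub.
have h : (so7 R <= <<y8 X>> + p)%VS by rewrite (y8_add X_root) subvv.
have -> : ysorted (y8 X) M (range tl) = setT; last by [].
apply: induced_gen; last by move=> x; apply: ysorted_sub; exists x.
apply: (pbw_span (@so7_lie R) pg (y8_so7 X_root) h V_rep) => x _ xp [w _ <-].
by exists (aF x w) => //; apply: esym; exact: tens1_act.
Qed.

Lemma V_indep s (h : seq nat -> F) : uniq s -> all (good 8) s ->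
  \sum_(b <- s) ymon (y8 X) M b (tl (h b)) = 0 -> forall b, b \in s -> h b = 0.
Proof.
have [rF _ _ _] := F_lam.
exact: (pbw_indep (@so7_lie R) (parabolic_so7_lie X_root) (parabolic_so7_sub R)
  (y8_free X_root) (y8_add X_root) (y8_cap X_root) rF).
Qed.

Section Generators.
Context (v0 : F).
Hypothesis hF : hw_module p (nilradical (so7 R) (so7_pos R) [:: eps R 2 - eps R 3])
  (D0 R) (Da R) e f l0 0 N aF v0.
Local Notation fs s := (iter s (aF f) v0).
Local Notation Ec := (gens (y8 X) M tl N (fun s => fs s)).

Lemma fs_basis : basis_of {:F} [seq fs s | s <- iota 0 N.+1].
Proof. by case: hF => _ []. Qed.

Lemma fs_wt s : aF (Da R) (fs s) = (N%:Z - 2 * s%:Z)%:~R *: fs s.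
Proof.
have [rF _ [_ h] _ _] := hF; have [f0 fa] := fX_wt X_root.
have Dap : Da R \in p by apply: (subvP (so7_hp R)); exact: H3_in.
have fp := fX_p X_root.
elim: s => [|s IH]; first by rewrite /= h mulr0 subr0.
rewrite iterS (act_swap rF) // IH fa (actZ rF) // (actZl rF) // -scalerDl; congr (_ *: _).
by rewrite !rmorphB !rmorphM /= -!pmulrn -natr1; ring.
Qed.

Lemma Ec_mem c q : q \in Ec c -> exists s t, [/\ t \in expos c,
  q.1 = ymon (y8 X) M (expo_list c t) (tl (fs s)) & q.2 = N%:Z - 2 * s%:Z + expo_wt c t].
Proof.
by move=> /mapP[st /allpairsP[[s t] [_ tc E]] ->]; exists s, t; rewrite E; split.
Qed.

Lemma Ec_H0 c q : q \in Ec c -> M (D0 R) q.1 = (l0 - c%:R) *: q.1.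
Proof.
move=> /Ec_mem[s [t [tc -> _]]]; have [/andP[_ a8] _ _ _] := expo_listP tc.
have [_ _ _ hH _] := hF.
have D0p : D0 R \in p by apply: (subvP (so7_hp R)); exact: H3_in.
have w0 : wdeg (D0 R) M l0 0 (tl (fs s)).
  rewrite /wdeg /mkset (V_act _ D0p) hH; exact: (tlZ tl_lin).
have := ymon_deg (parabolic_so7_sub R) (y8_so7 X_root) D0p (y8_H0 X_root) V_rep a8 w0.
by rewrite add0n (ydeg_expo tc).
Qed.

Lemma Ec_Ha c q : q \in Ec c -> M (Da R) q.1 = q.2%:~R *: q.1.
Proof.
move=> /Ec_mem[s [t [tc -> ->]]]; have [/andP[_ a8] _ _ _] := expo_listP tc.
have Dap : Da R \in p by apply: (subvP (so7_hp R)); exact: H3_in.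
have w0 : M (Da R) (tl (fs s)) = (N%:Z - 2 * s%:Z)%:~R *: tl (fs s).
  by rewrite (V_act _ Dap) fs_wt; exact: (tlZ tl_lin).
have := ymon_wt (parabolic_so7_sub R) (y8_so7 X_root) Dap (y8_Ha X_root) V_rep a8 w0.
by rewrite wt_expo.
Qed.

Local Notation y5X := (y5 X).

Lemma H0y5 (i : 'I_5) : lie (D0 R) y5X`_i = - (dyN i).+1%:R *: y5X`_i.
Proof. by rewrite y5E //; exact: (y8_H0 X_root (widen_ord (isT : (5 <= 8)%N) i)). Qed.
Lemma Hay5 (i : 'I_5) : lie (Da R) y5X`_i = (wyN i)%:~R *: y5X`_i.
Proof. by rewrite y5E //; exact: (y8_Ha X_root (widen_ord (isT : (5 <= 8)%N) i)). Qed.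
Lemma D0_qq : D0 R \in qq.
Proof. by apply: (subvP (hg2_qq X)); exact: D0_hg2. Qed.
Lemma Da_qq : Da R \in qq.
Proof. by apply: (subvP (hg2_qq X)); exact: Da_hg2. Qed.
Lemma y5E' i : (i < 5)%N -> y5X`_i = (y8 X)`_i.
Proof. exact: y5E. Qed.

Let Espan : forall v, ysorted y5X M (gen_all Ec) v :=
  gens_span (y8_so7 X_root) y5E' V_rep tl_lin V_span fs_basis.
Let Efree := gens_indep (y8_so7 X_root) y5E' V_rep tl_lin V_indep fs_basis.
Let Ecfree := gens_free (y8_so7 X_root) V_rep tl_lin V_indep fs_basis.

Lemma catO_Vlt c : in_catO gg (g2_pos R) [:: alpha2 R] M (Vlt y5X M Ec c).
Proof.
have [e0 ea] := eX_wt X_root; have [f0 fa] := fX_wt X_root.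
have D0D : lie (D0 R) (Da R) = 0 by apply: hso7_comm; exact: H3_in.
have sub := Vlt_submod g2_lie (qq_gg X) (y5_gg X) (gg_y5 X_root) (y5_lie X_root g2_lie)
  D0_qq Da_qq (eX_qq X_root) (fX_qq X_root) (nil_us X) (@us_wt R X) (qq_span X_root)
  e0 f0 H0y5 V_rep2 Ec_H0 Ec_Ha Espan c.
have gen := Vlt_gen g2_lie (qq_gg X) (y5_gg X) (gg_y5 X_root) (y5_lie X_root g2_lie)
  D0_qq Da_qq (eX_qq X_root) (fX_qq X_root) (nil_us X) (@us_wt R X) (qq_span X_root)
  e0 f0 H0y5 V_rep2 Ec_H0 Ec_Ha Espan c.
have lvE := levi_g2E X_root.
have el : e \in levi gg (g2_pos R) [:: alpha2 R].
  by rewrite lvE; apply: (subvP (addvSl _ _)); apply: (subvP (addvSr _ _)); exact: memv_line.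
have fl : f \in levi gg (g2_pos R) [:: alpha2 R].
  by rewrite lvE; apply: (subvP (addvSr _ _)); exact: memv_line.
have ss := Vlt_semisimple g2_lie (qq_gg X) (y5_gg X) (gg_y5 X_root) (y5_lie X_root g2_lie)
  D0_qq Da_qq (eX_qq X_root) (fX_qq X_root) (nil_us X) (@us_wt R X) (qq_span X_root)
  (lie_ef R) ea fa e0 f0 H0y5 Hay5 V_rep2 Ec_H0 Ec_Ha Espan (levi_span X_root) el fl c.
split; [exact: sub | by eexists; exact: gen | exact: ss | move=> v _].
exact: (nil_fin (qq_gg X) (y5_gg X) D0_qq (nil_us X) (@us_wt R X) H0y5 V_rep2 Ec_H0 Espan).
Qed.

Lemma catO_cover v : exists2 W, in_catO gg (g2_pos R) [:: alpha2 R] M W & W v.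
Proof.
have [c vc] := Vlt_exhaust (qq_gg X) (y5_gg X) D0_qq H0y5 V_rep2 Ec_H0 Espan v.
by exists (Vlt y5X M Ec c) => //; exact: catO_Vlt.
Qed.

(** On D0 and Da the root alpha1 takes the values 1, -1 and alpha2 the values 0, 2;
    hence the coefficients of the weight with the values l0 - c and k. *)
Definition hw (c k : nat) : dual (hg2 R) :=
  (l0 - c%:R) *: alpha1 R + ((k%:R + (l0 - c%:R)) / 2) *: alpha2 R.

Lemma ev_hw c k : ev (hw c k) (D0 R) = l0 - c%:R /\ ev (hw c k) (Da R) = k%:R.
Proof.
have [e1 e1'] := ev_al1 R; have [e2 e2'] := ev_al2 R.
rewrite /hw !evDl !evZl e1 e1' e2 e2' mulr1 mulr0 addr0; split=> //.
rewrite divfK ?pnatr_eq0 // mulrN1 addrC addrK //.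
Qed.

Lemma dual_hg2_eq (d d' : dual (hg2 R)) : ev d (D0 R) = ev d' (D0 R) ->
  ev d (Da R) = ev d' (Da R) -> d = d'.
Proof.
move=> h0 ha; apply/lfunP => H.
have E x : x \in hg2 R -> ev d x = ev d' x.
  move=> xh; have {xh} : x \in <<[:: D0 R; Da R]>>%VS by rewrite -hg2_span.
  apply: (@span_ind _ _ _ [set x | ev d x = ev d' x]) => [|u].
    split=> [|a b hx hy|a b hb]; rewrite /mkset.
    - by rewrite !ev0.
    - by rewrite !evD hx hy.
    - by rewrite !evZ hb.
  by rewrite !inE => /orP[] /eqP ->.
by have := E _ (subvsP H); rewrite /ev vsvalK.
Qed.

Context (G : dual (hg2 R) -> vectType C) (aG : forall del, 'M[C]_7 -> G del -> G del).
Hypothesis G_del : forall del, is_nat (ev del (Ha2 R)) ->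
  simple_hw_module gg (g2_pos R) [:: alpha2 R] del (@aG del).

Lemma G_hw c k : exists g0, hw_module qq nl (D0 R) (Da R) e f l0 c k (@aG (hw c k)) g0.
Proof.
have [h0 hk] := ev_hw c k.
have [e0 ea] := eX_wt X_root; have [f0 fa] := fX_wt X_root.
apply: (simple_hw_hw_module (al := alpha2 R) _ _ _ _ _ _ _ _ _ _ _ _ _ hk h0 _) => //.
- exact: hg2_qq.
- exact: eX_qq X_root.
- exact: fX_qq X_root.
- exact: D0_hg2.
- exact: Da_hg2.
- exact: levi_g2E X_root.
- exact: lie_ef.
- by move=> x /(subvP (hg2_hso7 R)); exact: root_line_comm.
- by rewrite (levi_roots_g2 R) mem_head.
- by rewrite (rootspace_g2_e X_root) memv_line.
- by apply: G_del; rewrite Ha2E hk; exists k.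
Qed.


(** ** The multiplicities *)
Context (L : lmodType C) (aL : 'M[C]_7 -> L -> L).
Hypotheses (rL : is_rep gg aL) (sL : simple_submod gg aL setT).
Local Notation mult d := (comp_mult R gg (gverma_act gg (g2_pos R) [:: alpha2 R] (@aG d)) aL).

Lemma mult_fin : comp_mult R gg M aL \is a fin_num.
Proof.
exact: (graded_fin (qq_gg X) (y5_gg X) D0_qq H0y5 V_rep2 Ec_H0 Espan R rL sL).
Qed.

Lemma mult_ge0 d : (0 <= mult d)%E.
Proof.
rewrite comp_multE; apply: cmult_ge0 => //.
by apply: submod0; exact: induced_rep.
Qed.

(** The number of strings comes from a difference of the numbers of generators
    of weights k and k + 2, which [strings_expos] evaluates. *)
Lemma mult_sup : exists s : nat -> seq nat,
  (forall c k : nat, (count_mem k (s c) + expo_num c (k%:Z + N%:Z + 2) =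
     expo_num c (k%:Z - N%:Z))%N) /\
  comp_mult R gg M aL =
    ereal_sup [set (\sum_(c < n) \sum_(k <- s c) mult (hw c k))%E | n in setT].
Proof.
have [e0 ea] := eX_wt X_root; have [f0 fa] := fX_wt X_root.
have D0D : lie (D0 R) (Da R) = 0 by apply: hso7_comm; exact: H3_in.
pose g0 c k := projT1 (cid (G_hw c k)).
have hg c k : hw_module qq nl (D0 R) (Da R) e f l0 c k (@aG (hw c k)) (g0 c k).
  exact: projT2 (cid (G_hw c k)).
have [s [sC sE]] := graded_comp_mult g2_lie (qq_gg X) (y5_gg X) (gg_y5 X_root)
  (y5_lie X_root g2_lie) D0_qq Da_qq (eX_qq X_root) (fX_qq X_root) (nil_us X) (@us_wt R X)
  (qq_span X_root) (lie_ef R) ea fa e0 f0 D0D H0y5 V_rep2 Ec_H0 Ec_Ha Espan Efree Ecfree R sL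
  (Gf := fun c k => G (hw c k)) (aGf := fun c k => @aG (hw c k)) hg.
exists s; split=> // c k.
have cE (z : int) : count (fun q => q.2 == z) (Ec c) =
    count (fun st => (N%:Z - 2 * (st.1)%:Z + expo_wt c st.2 == z)%R)
      [seq (s, t) | s <- iota 0 N.+1, t <- expos c].
  by rewrite count_map; apply: eq_count.
have h1 := sC c k; have h2 := strings_expos N c k%:Z; cbv beta zeta in h2.
rewrite !cE in h1; rewrite (_ : (k%:Z + 2)%R = k.+2%:Z) in h2; last by lia.
move: h1 h2; move: (count _ _) (count _ _) (count_mem _ _) (expo_num _ _) (expo_num _ _).
by clear=> a b d u v; lia.
Qed.


Lemma muE d H : H \in hg2 R -> ev (mu lam d) H = ev lam H - ev d H.
Proof. by move=> Hh; rewrite -(restrE lam Hh) -evNl -evDl. Qed.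
Lemma sigmaE d H : H \in hg2 R -> ev (sigma lam d) H = ev lam H + ev d H.
Proof. by move=> Hh; rewrite -(restrE lam Hh) -evDl. Qed.

Lemma ev_mu c k : [/\ ev (mu lam (hw c k)) (H2a1a2 R) = c%:R,
  ev (mu lam (hw c k)) (Ha2 R) = N%:R - k%:R & ev (sigma lam (hw c k)) (Ha2 R) = (N + k)%:R].
Proof.
have [h0 hk] := ev_hw c k.
rewrite H2a1a2E Ha2E (muE _ (D0_hg2 R)) (muE _ (Da_hg2 R)) (sigmaE _ (Da_hg2 R)) h0 hk lam_Da.
by rewrite natrD; split=> //; rewrite opprB addrC subrK.
Qed.

Lemma coef_hw c k n : (n.*2 + (maxn N k - minn N k) = 2 + minn c (N + k))%N ->
  coef lam (hw c k) = n%:R.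
Proof.
move=> E; have [e1 e2 e3] := ev_mu c k; rewrite /coef e1 e2 e3.
have -> : Num.min c%:R (N + k)%:R = (minn c (N + k))%:R :> C.
  by rewrite /Num.min /Order.min ltr_nat /minn; case: ifP.
have -> : `|N%:R - k%:R| = (maxn N k - minn N k)%:R :> C.
  rewrite /maxn /minn; case: ltnP => Nk.
    by rewrite distrC -natrB ?normr_nat // ltnW.
  by rewrite -natrB // normr_nat.
move/(congr1 (fun n : nat => n%:R : C)): E; rewrite -muln2 !natrD natrM => E.
have -> : (minn c (N + k))%:R = n%:R * 2 + (maxn N k - minn N k)%:R - 2 :> C.
  by rewrite E addrAC subrr add0r.
have -> : n%:R * 2 + (maxn N k - minn N k)%:R - 2 - (maxn N k - minn N k)%:R = (n%:R - 1) * 2 :> C.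
  by rewrite mulrBl mul1r addrAC addrK.
by rewrite mulfK ?pnatr_eq0 // addrC subrK.
Qed.

Lemma ev_H3 (d : dual (hg2 R)) :
  ev d (H3a1a2 R) = 2^-1 * (ev d (D0 R) - ev d (Da R)) /\
  ev d (H3a12a2 R) = 2^-1 * (ev d (D0 R) + ev d (Da R)).
Proof.
have -> : H3a1a2 R = 2^-1 *: (D0 R - Da R).
  have -> : D0 R - Da R = 2 *: H3a1a2 R; last by rewrite scalerA mulVf ?pnatr_eq0 ?scale1r.
  rewrite /D0 /Da /H3 /H3a1a2; move: (Hs R 1) (Hs R 2) (Hs R 3) => h1 h2 h3; clear.
  rewrite !scale1r scale0r add0r scaleN1r opprB [h3 - h2]addrC addrACA addrK.
  by rewrite scalerDr [2 *: h3]scaler_nat mulr2n.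
have -> : H3a12a2 R = 2^-1 *: (D0 R + Da R).
  have -> : D0 R + Da R = 2 *: H3a12a2 R; last by rewrite scalerA mulVf ?pnatr_eq0 ?scale1r.
  rewrite /D0 /Da /H3 /H3a12a2; move: (Hs R 1) (Hs R 2) (Hs R 3) => h1 h2 h3; clear.
  rewrite !scale1r scale0r add0r scaleN1r addrACA subrr addr0.
  by rewrite scalerDr [2 *: h2]scaler_nat mulr2n addrA.
by move: (D0 R) (Da R) => x y; rewrite evZ evD evN evZ evD.
Qed.

(** For the weight of degree c and highest weight k, mu takes the values c on D0 and
    N - k on Da; then u and b, its values on half the difference and half the sum of
    the two, satisfy u + b = c and b - u = N - k. *)
Lemma summation_setP d : summation_set lam d <->
  exists u b k : nat, (k + b = N + u)%N /\ d = hw (u + b) k.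
Proof.
split.
  move=> [[k dk] [u du] [b db]]; exists u, b, k.
  have [e1 e2] := ev_H3 (mu lam d); rewrite du in e1; rewrite db in e2.
  have [h0 h1] := halves (ev (mu lam d) (D0 R)) (ev (mu lam d) (Da R)).
  rewrite -e1 -e2 (muE _ (D0_hg2 R)) in h0; rewrite -e1 -e2 (muE _ (Da_hg2 R)) lam_Da in h1.
  rewrite Ha2E in dk; rewrite dk in h1; split.
    apply/eqP; rewrite -(eqr_nat C) !natrD; apply/eqP.
    by rewrite -[b%:R](subrK u%:R) h1 addrA [k%:R + _]addrC subrK.
  have [g0 g1] := ev_hw (u + b) k; apply: dual_hg2_eq; last by rewrite g1.
  by rewrite g0 natrD h0 opprB addrC subrK.
move=> [u [b [k [E ->]]]]; have [h0 ha _] := ev_mu (u + b) k.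
have [e1 e2] := ev_H3 (mu lam (hw (u + b) k)).
rewrite H2a1a2E in h0; rewrite Ha2E in ha; rewrite h0 ha in e1 e2.
have E' : N%:R - k%:R = b%:R - u%:R :> C.
  move/(congr1 (fun n : nat => n%:R : C)): E; rewrite !natrD => E.
  by rewrite -[N%:R](addrK u%:R) -E addrAC [k%:R + _]addrC addrK.
rewrite E' natrD in e1 e2.
have [g0 g1] := half_sums (u%:R : C) (b%:R : C).
split.
- by exists k; rewrite Ha2E; case: (ev_hw (u + b) k).
- by exists u; rewrite e1 g0.
- by exists b; rewrite e2 g1.
Qed.

(** The highest weights that occur in degrees below n form lists that exhaust
    the index set; the number of strings is the coefficient of the statement. *)
Theorem branching_mult : comp_mult R gg M aL =
  (\esum_(d in summation_set lam) ((complex.Re (coef lam d))%:E * mult d))%E.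
Proof.
have [s [sC ->]] := mult_sup.
pose Ls n := [seq hw c k | c <- iota 0 n, k <- undup (s c)].
have hw_inj c k c' k' : hw c k = hw c' k' -> c = c' /\ k = k'.
  move=> E; have [h0 hk] := ev_hw c k; have [h0' hk'] := ev_hw c' k'.
  rewrite E h0' in h0; rewrite E hk' in hk; split.
    by move/addrI/oppr_inj/eqP: h0; rewrite eqr_nat => /eqP.
  by move/eqP: hk; rewrite eqr_nat => /eqP.
have sum_mem c k : (0 < count_mem k (s c))%N -> exists u b, c = (u + b)%N /\ (k + b = N + u)%N.
  exact: expo_num_zero (sC c k).
have coefE c k : (0 < count_mem k (s c))%N ->
    complex.Re (coef lam (hw c k)) = (count_mem k (s c))%:R.
  move=> /sum_mem[u [b [cE kE]]].
  rewrite (coef_hw (expo_num_diff (sC c k) cE kE)).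
  by rewrite -(rmorph_nat (real_complex R)).
rewrite (esum_lists (L := Ls)).
- congr ereal_sup; apply: eq_imagel => n _.
  rewrite /Ls big_allpairs_dep (_ : iota 0 n = index_iota 0 n) ?big_mkord; last by rewrite /index_iota subn0.
  apply: eq_bigr => c _.
  rewrite sum_undup; apply: eq_big_seq => k; rewrite mem_undup => ks.
  by rewrite coefE // -has_count has_pred1.
- move=> n; apply: allpairs_uniq_dep; first exact: iota_uniq.
    by move=> c _; exact: undup_uniq.
  by move=> [c k] [c' k'] _ _ /= /hw_inj[-> ->].
- move=> n d /allpairsPdep[c [k [_ ks ->]]]; apply/summation_setP.
  rewrite mem_undup in ks.
  have [|u [b [-> kE]]] := sum_mem c k; first by rewrite -has_count has_pred1.
  by exists u, b, k.
- move=> n n' nn' d /allpairsPdep[c [k [cn ks ->]]]; apply/allpairsPdep; exists c, k; split=> //.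
  by move: cn; rewrite !mem_iota => /andP[_ cn]; exact: leq_trans cn nn'.
move=> d /summation_setP[u [b [k [kE ->]]]].
have pos : (0 < count_mem k (s (u + b)))%N.
  have := expo_num_diff (sC (u + b)%N k) (erefl _) kE.
  by move: kE; move: (count_mem _ _) => q; clear; lia.
split; first by apply: mule_ge0; [rewrite coefE // lee_fin ler0n | exact: mult_ge0].
exists (u + b).+1; apply/allpairsPdep; exists (u + b)%N, k; split=> //.
  by rewrite mem_iota leq0n add0n ltnS leqnn.
by rewrite mem_undup -has_pred1 has_count.
Qed.

End Generators.
End Main.

Theorem proposition4p5 (R : realType)
    (X : dual (hso7 R) -> 'M[R[i]]_7)
    (X_root : root_vectors X) (g2_lie : is_liealg (g2 X))
    (lam : dual (hso7 R))
    (lam_nat : is_nat (ev lam (Hs R 2 - Hs R 3)))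
    (F : vectType R[i]) (aF : 'M[R[i]]_7 -> F -> F)
    (F_lam : simple_hw_module (so7 R) (so7_pos R) [:: eps R 2 - eps R 3]
               lam aF)
    (G : dual (hg2 R) -> vectType R[i])
    (aG : forall del, 'M[R[i]]_7 -> G del -> G del)
    (G_del : forall del, is_nat (ev del (Ha2 R)) ->
       simple_hw_module (g2 X) (g2_pos R) [:: alpha2 R] del (aG del)) :
  let M := gverma_act (so7 R) (so7_pos R) [:: eps R 2 - eps R 3] aF in
  let Mg2 del := gverma_act (g2 X) (g2_pos R) [:: alpha2 R] (aG del) in
  (forall v, exists2 N,
     in_catO (g2 X) (g2_pos R) [:: alpha2 R] M N & N v) /\
  (forall (L : lmodType R[i]) (aL : 'M[R[i]]_7 -> L -> L),
     is_rep (g2 X) aL ->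
     in_catO (g2 X) (g2_pos R) [:: alpha2 R] aL setT ->
     simple_submod (g2 X) aL setT ->
     comp_mult R (g2 X) M aL \is a fin_num /\
     comp_mult R (g2 X) M aL =
       \esum_(del in summation_set lam)
          ((complex.Re (coef lam del))%:E * comp_mult R (g2 X) (Mg2 del) aL)%E).
Proof.
have [N lamN] := lam_nat; have [v0 hF] := F_hw X_root lamN F_lam.
split=> [v|L aL rL catL sL].
  exact: (catO_cover X_root g2_lie hF v).
split; first exact: (mult_fin X_root hF rL sL).
exact: (branching_mult X_root g2_lie lamN F_lam hF G_del sL).
Qed.
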